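(* Let $n\ge2$ and let $X=\mathbb{P}^n\subset\mathbb{P}^{n+2}=\operatorname{Proj}k[z_0,\dots,z_n,x,y]$ be the linear subspace with ideal $(x,y)$. The type I structures on $X$ of multiplicity four are, up to linear equivalence, those with the following ideals: (1) $(x^4,y)$ (2) $(x^2,y^2)$ (3) $(xy,\,x^2+y^2)$ (4) $(x^3,xy,y^2)$ (5) $(F_2y^2-F_3xy,\ F_1y^2-F_3x^2,\ F_1xy-F_2x^2,\ x^3,\ x^2y,\ xy^2,\ y^3)$ (6) $(x^3+Gy,\,xy,\,y^2)$ (7) $(x^2+z_0y,\,y^2)$ (8) $(x^2+xy+z_0y,\,y^2)$. Here (5) only occurs if $\dim X=2$, in which case $F_1,F_2,F_3\in k[z_0,z_1,z_2]_s$ are homogeneous of the same degree $s\ge1$ and satisfy $\bigcap_i V_+(F_i)=\emptyset$. In (6), $G$ is a homogeneous polynomial of degree $2$ in $k[z_0,\dots,z_n]$. The pair of structures (2), (3) and the pair of structures (7), (8) are each linearly equivalent if the characteristic of $k$ is different from two.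
   Context: $k$ is algebraically closed. A scheme is Cohen-Macaulay if all its local rings are. A multiple structure on $X$ is a closed subscheme $Y\subset\mathbb{P}^{n+2}$ with $Y_{\mathrm{red}}=X$; its multiplicity (= degree) is the length of its local ring at the generic point of $X$. Linear equivalence means equality up to a linear change of coordinates on $\mathbb{P}^{n+2}$; different choices of the undetermined polynomials ($F_i$, $G$) are not further distinguished, i.e. the list is a list of families. Type I: let $I=(x,y)$, let $X^{(i)}$ be the subscheme with ideal sheaf $\mathcal{I}_X^{i+1}$, and let $m$ be the unique integer with $Y\subset X^{(m)}$, $Y\not\subset X^{(m-1)}$. For $j\le m$ let $Y_j$ be obtained from $Y\cap X^{(j)}$ by removing the embedded components (its ideal is the $I$-primary component of $I_Y+I^{j+1}$). The chain $X=Y_0\subset\dots\subset Y_m\subset Y$ is the $S_1$-filtration of $Y$. $Y$ is of type I if $Y$ is Cohen-Macaulay and all the $Y_j$ are Cohen-Macaulay. *)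

(* Defs.v *)
From mathcomp Require Import all_boot all_order all_algebra.
From mathcomp Require Import mpoly.

Set Implicit Arguments.
Unset Strict Implicit.
Unset Printing Implicit Defensive.

Import GRing.Theory.
Local Open Scope ring_scope.

Definition incl (T : Type) (a b : T -> Prop) : Prop := forall f, a f -> b f.

Definition whole (T : Type) : T -> Prop := fun _ => True.

(* A commutative ring is presented as a subquotient A / J of an ambient ring
   K: A is a subring of K and J an ideal of A.  Ideals (prime ideals) of A / J
   are written as the ideals (prime ideals) of A that contain J, and an element
   of A / J as a representative in A. *)
Section Subquotient.
Variables (K : comNzRingType) (A : K -> Prop).

Definition ideal (b : K -> Prop) : Prop :=
  [/\ incl b A, b 0, (forall u v, b u -> b v -> b (u + v))
    & (forall u v, A u -> b v -> b (u * v))].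

Definition prime_ideal (p : K -> Prop) : Prop :=
  [/\ ideal p, ~ p 1
    & forall u v, A u -> A v -> p (u * v) -> p u \/ p v].

Definition strict_chain (Q : (K -> Prop) -> Prop) (l : nat) : Prop :=
  exists c : nat -> K -> Prop,
    (forall i, i <= l -> Q (c i))%N /\
    (forall i, (i < l)%N -> incl (c i) (c i.+1) /\ ~ incl (c i.+1) (c i)).

Definition greatest (Q : nat -> Prop) (d : nat) : Prop :=
  Q d /\ forall e, Q e -> (e <= d)%N.

Definition krull_dim (J : K -> Prop) (d : nat) : Prop :=
  greatest (strict_chain (fun p => prime_ideal p /\ incl J p)) d.

(* Length of A / J as a module over itself. *)
Definition ring_length (J : K -> Prop) (l : nat) : Prop :=
  greatest (strict_chain (fun b => ideal b /\ incl J b)) l.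

Definition adjoin (J : K -> Prop) (a : K) : K -> Prop :=
  fun f => exists b c, [/\ J b, A c & f = b + c * a].

(* s_i is not a zero divisor on (A / J) / (s_0, ..., s_{i-1}). *)
Fixpoint regular_seq (J : K -> Prop) (s : seq K) : Prop :=
  if s is a :: s' then
    (forall b, A b -> J (a * b) -> J b) /\ regular_seq (adjoin J a) s'
  else True.

(* Non-units of A / J; for a local ring this is its maximal ideal. *)
Definition nonunit (J : K -> Prop) (a : K) : Prop :=
  A a /\ ~ (exists b, A b /\ J (a * b - 1)).

(* Depth of A / J when this is a local ring: the maximal length of a regular
   sequence contained in the maximal ideal. *)
Definition depth (J : K -> Prop) (d : nat) : Prop :=
  greatest (fun e => exists s : seq K,
    [/\ size s = e, (forall a, a \in s -> nonunit J a) & regular_seq J s]) d.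

(* The local ring A / J is Cohen-Macaulay. *)
Definition CM_local_ring (J : K -> Prop) : Prop :=
  exists d, krull_dim J d /\ depth J d.

End Subquotient.

Section IdealOperations.
Variable S : comNzRingType.
Implicit Types a b p : S -> Prop.

Definition gen_ideal (s : seq S) : S -> Prop :=
  fun f => exists c : nat -> S, f = \sum_(i < size s) c i * s`_i.

Definition ideal_add a b : S -> Prop :=
  fun f => exists u v, [/\ a u, b v & f = u + v].

Definition ideal_mul a b : S -> Prop :=
  fun f => exists s : seq (S * S),
    (forall w, w \in s -> a w.1 /\ b w.2) /\ f = \sum_(w <- s) w.1 * w.2.

Fixpoint ideal_pow a (r : nat) : S -> Prop :=
  if r is r'.+1 then ideal_mul a (ideal_pow a r') else @whole S.

Definition radical a : S -> Prop := fun f => exists r : nat, a (f ^+ r).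

(* The p-primary component of a, for p a minimal prime of a: the preimage in S
   of the localization of a at p. *)
Definition primary_component p a : S -> Prop :=
  fun f => exists g, ~ p g /\ a (g * f).

End IdealOperations.

(* Projective space P^(N-1) over k, with homogeneous coordinate ring
   S = k[X_0, ..., X_(N-1)]. *)
Section Projective.
Variables (k : fieldType) (N : nat).
Local Notation S := {mpoly k[N]}.

Definition homogeneous (a : S -> Prop) : Prop :=
  forall f, a f -> forall d, a (pihomog mdeg d f).

Definition saturated (a : S -> Prop) : Prop :=
  forall f, (forall i : 'I_N, a ('X_i * f)) -> a f.

(* Closed subschemes are identified with their saturated homogeneous ideals;
   inclusion of subschemes is reversed inclusion of ideals. *)
Definition closed_subscheme (I : S -> Prop) : Prop :=
  [/\ ideal (@whole S) I, homogeneous I & saturated I].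

(* Points of Proj S, closed or not. *)
Definition proj_point (P : S -> Prop) : Prop :=
  [/\ prime_ideal (@whole S) P, homogeneous P & exists i : 'I_N, ~ P 'X_i].

Local Notation "f %:F" := (@FracField.tofrac S f).

(* The stalk at P of the structure sheaf of Proj (S / I) is A / J, where
   A = hlocal P is the degree-zero homogeneous localization of S at P, inside
   the fraction field of S, and J = hlocal_ideal P I is the ideal of A induced
   by I. *)
Definition hlocal (P : S -> Prop) : {fraction S} -> Prop :=
  fun u => exists (d : nat) (f g : S),
    [/\ f \is d.-homog, g \is d.-homog, ~ P g & u = f%:F / g%:F].

Definition hlocal_ideal (P I : S -> Prop) : {fraction S} -> Prop :=
  fun u => exists (d : nat) (f g : S),
    [/\ f \is d.-homog, g \is d.-homog, ~ P g, I f & u = f%:F / g%:F].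

(* Proj (S / I) is a Cohen-Macaulay scheme. *)
Definition CM_scheme (I : S -> Prop) : Prop :=
  forall P, proj_point P -> incl I P ->
    CM_local_ring (hlocal P) (hlocal_ideal P I).

Definition lin_equiv (I I' : S -> Prop) : Prop :=
  exists2 M : 'M[k]_N, M \in unitmx &
    forall f, I' f <->
      I (f \mPo [tuple \sum_(j < N) M i j *: 'X_j | i < N]).

End Projective.

(* The coordinates z_0, ..., z_n, x, y of P^(n+2) are the variables of index
   0, ..., n, n+1, n+2. *)
Section TypeI.
Variables (k : fieldType) (n : nat).
Local Notation S := {mpoly k[n.+3]}.

Definition z0 : S := 'X_(inord 0).
Definition x : S := 'X_(inord n.+1).
Definition y : S := 'X_(inord n.+2).

Definition in_z (F : {mpoly k[n.+1]}) : S := mwiden (mwiden F).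

Definition IX : S -> Prop := gen_ideal [:: x; y].

(* For a closed subscheme Y with ideal I, the second clause says Y_red = X. *)
Definition multiple_structure (I : S -> Prop) : Prop :=
  closed_subscheme I /\ (forall f, radical I f <-> IX f).

Definition multiplicity (I : S -> Prop) (mu : nat) : Prop :=
  ring_length (hlocal IX) (hlocal_ideal IX I) mu.

(* The j-th term Y_j of the S_1-filtration. *)
Definition filtration_ideal (I : S -> Prop) (j : nat) : S -> Prop :=
  primary_component IX (ideal_add I (ideal_pow IX j.+1)).

(* X^(j) has ideal IX^(j+1); in particular X^(-1) is empty. *)
Definition type_I (I : S -> Prop) : Prop :=
  [/\ multiple_structure I, CM_scheme I &
      exists m : nat,
        [/\ incl (ideal_pow IX m.+1) I, ~ incl (ideal_pow IX m) I &
            forall j, (j <= m)%N -> CM_scheme (filtration_ideal I j)]].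

Definition gens2 : seq S := [:: x ^+ 2; y ^+ 2].
Definition gens3 : seq S := [:: x * y; x ^+ 2 + y ^+ 2].
Definition gens7 : seq S := [:: x ^+ 2 + z0 * y; y ^+ 2].
Definition gens8 : seq S := [:: x ^+ 2 + x * y + z0 * y; y ^+ 2].

Inductive listed : seq S -> Prop :=
| Listed1 : listed [:: x ^+ 4; y]
| Listed2 : listed gens2
| Listed3 : listed gens3
| Listed4 : listed [:: x ^+ 3; x * y; y ^+ 2]
| Listed5 (s : nat) (F1 F2 F3 : {mpoly k[n.+1]}) :
    n = 2 -> (1 <= s)%N ->
    F1 \is s.-homog -> F2 \is s.-homog -> F3 \is s.-homog ->
    ~ (exists P, [/\ proj_point P, P F1, P F2 & P F3]) ->
    listed [:: in_z F2 * y ^+ 2 - in_z F3 * x * y;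
               in_z F1 * y ^+ 2 - in_z F3 * x ^+ 2;
               in_z F1 * x * y - in_z F2 * x ^+ 2;
               x ^+ 3; x ^+ 2 * y; x * y ^+ 2; y ^+ 3]
| Listed6 (G : {mpoly k[n.+1]}) :
    G \is 2.-homog ->
    listed [:: x ^+ 3 + in_z G * y; x * y; y ^+ 2]
| Listed7 : listed gens7
| Listed8 : listed gens8.

End TypeI.

(* Main.v *)
(* Write S = R[x, y] with R = k[z_0, ..., z_n], and let I_j be the ideal of Y_j.

   Every listed ideal is the common kernel of four R-linear functionals on S, each of which kills the
   multiples by x and y of the common kernel of the previous ones.  Where these functionals are
   locally onto, S / I is locally filtered by copies of the coordinate ring of X, so it is
   Cohen-Macaulay and has length four at the generic point.

   Conversely, let I be of type I.  Since S / I is Cohen-Macaulay, I is primary, hence I = I_m.  If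
   I_j / I_(j+1) has rank one and is generated over R by forms h_1, ..., h_r, then the relations
   between the h_i are those between coprime forms F_1, ..., F_r of R.  At a common zero of the F_i
   the depth of S / I_(j+1) would be at least two, and a regular pair there would put a unit into the
   ideal of the F_i; so the F_i have no common zero, and if r <= n, one of them is a nonzero constant.
   When I_1 contains a linear form, which may be taken to be y, each I_j / I_(j+1) has r = 2
   generators and is generically generated by x^(j+1), whence m = 3; following the choice of the
   constant F_i at each step gives (1), (6), (7) and (8).  Otherwise I_1 = (x, y)^2 and m = 2, and I
   is the kernel of one functional (F_1, F_2, F_3) on the quadrics in x and y: if it is constant, the
   classification of binary quadratic forms over k gives (2), (3) and (4), and if it is not, then
   n = 2 and the Koszul syzygies of F_1, F_2, F_3 give (5). *)

Require Import Defs.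
From HB Require Import structures.
From mathcomp Require Import all_boot all_order all_algebra.
From mathcomp Require Import mpoly.
From mathcomp.classical Require boolp classical_sets.
From mathcomp Require Import ring zify.
Set Implicit Arguments.
Unset Strict Implicit.
Unset Printing Implicit Defensive.

Import GRing.Theory.
Local Open Scope ring_scope.

(** * Prime ideals and depth *)

(** Neither the dimension nor the depth of a local ring is computed by general theory. A point of X
    is a prime in a polynomial ring in n variables, a chart. One induction on the variables yields e
    polynomials that are independent modulo this prime and a regular sequence of length n - e inside
    it. Each step of a chain of primes adds an independent element, and n + 1 polynomials in n
    variables are dependent, so no chain is longer than n - e. The two bounds meet, and both are
    carried from R to S / I along the flag of functionals.

    Conversely, Cohen-Macaulayness is used only to exchange an explicit chain of primes of length
    one or two for a regular sequence of that length. Minimal homogeneous primes and prime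
    factorization in R supply these chains.

    Localization at the generic point of X is mostly avoided: the ideals I_j are primary for (x, y),
    so multipliers outside (x, y), in particular nonzero elements of R, can be cancelled. The
    multiplicity is compared with explicit strict chains of ideals, which bounds m and the rank of
    the layers. *)

Lemma predext (T : Type) (p q : T -> Prop) : (forall t, p t <-> q t) -> p = q.
Proof.
by move=> pq; apply: boolp.funext => t; apply: boolp.propext.
Qed.

Definition is_subring (K : comNzRingType) (A : K -> Prop) : Prop :=
  [/\ A 1, forall u v, A u -> A v -> A (u - v)
    & forall u v, A u -> A v -> A (u * v)].

Lemma subring_whole (K : comNzRingType) : is_subring (@whole K).
Proof. by []. Qed.

Section Subring.
Variables (K : comNzRingType) (A : K -> Prop).
Hypothesis subA : is_subring A.

Lemma subring0 : A 0.
Proof. by case: subA => A1 AB _; rewrite -(subrr 1); apply: AB. Qed.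

Lemma subringN u : A u -> A (- u).
Proof.
by case: subA => _ AB _ Au; rewrite -(sub0r u); apply: AB => //; apply: subring0.
Qed.

Lemma subringD u v : A u -> A v -> A (u + v).
Proof.
case: (subA) => _ AB _ Au Av; rewrite -(opprK v).
by apply: AB => //; apply: subringN.
Qed.

Lemma subringX u r : A u -> A (u ^+ r).
Proof.
case: subA => A1 _ AM Au; elim: r => [|r IH]; rewrite ?expr0 // exprS.
exact: AM.
Qed.

Implicit Types (J b p : K -> Prop).

Lemma idealN b u : ideal A b -> b u -> b (- u).
Proof.
case=> _ _ _ bM bu; rewrite -mulN1r; apply: bM => //.
by apply: subringN; case: subA.
Qed.

Lemma idealB b u v : ideal A b -> b u -> b v -> b (u - v).
Proof. by move=> ib bu bv; case: (ib) => _ _ bD _; apply: bD => //; apply: idealN. Qed.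

Lemma ideal_adjoin b a : ideal A b -> A a -> ideal A (adjoin A b a).
Proof.
move=> [bA b0 bD bM] Aa; have [A1 AB AM] := subA; split.
- move=> _ [u [v [bu Av ->]]]; apply: subringD.
    by apply: bA.
  by apply: AM.
- by exists 0, 0; rewrite mul0r addr0; split=> //; apply: subring0.
- move=> _ _ [u [v [bu Av ->]]] [u' [v' [bu' Av' ->]]].
  exists (u + u'), (v + v'); split; [exact: bD | exact: subringD | by ring].
- move=> w _ Aw [u [v [bu Av ->]]]; exists (w * u), (w * v).
  by split; [apply: bM | apply: AM | ring].
Qed.

Lemma incl_adjoin b a : incl b (adjoin A b a).
Proof.
by move=> u bu; exists u, 0; rewrite mul0r addr0; split=> //; apply: subring0.
Qed.

Lemma adjoin_self b a : ideal A b -> adjoin A b a a.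
Proof.
by case=> _ b0 _ _; exists 0, 1; rewrite mul1r add0r; case: subA.
Qed.

Lemma adjoin_sub b p a : ideal A p -> incl b p -> p a -> incl (adjoin A b a) p.
Proof.
by move=> [_ _ pD pM] bp pa _ [u [v [bu Av ->]]]; apply: pD; [apply: bp | apply: pM].
Qed.

Lemma primeX p u r : prime_ideal A p -> A u -> p (u ^+ r) -> p u.
Proof.
move=> [_ p1 pP] Au; elim: r => [|r IH]; first by rewrite expr0 => /p1.
by rewrite exprS => /pP[] //; apply: subringX.
Qed.

(* Zorn's lemma is applied to the sets X such that J and X together form an ideal
   avoiding W, so that the empty chain is not a special case. *)
Lemma exists_prime J (W : K -> Prop) :
  ideal A J -> incl W A -> W 1 -> (forall u v, W u -> W v -> W (u * v)) ->
  (forall u, J u -> ~ W u) ->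
  exists p, [/\ prime_ideal A p, incl J p & forall u, p u -> ~ W u].
Proof.
move=> iJ WA W1 WM JW; have [JA J0 JD JM] := iJ; have [A1 AB AM] := subA.
pose good b := ideal A b /\ forall u, b u -> ~ W u.
pose U (X : K -> Prop) := fun u => J u \/ X u.
have [|X [gX mX]] := @classical_sets.Zorn_bigcup K (fun X => good (U X)).
  move=> F FP Ftot; split.
    split.
    - move=> u [/JA //|[X FX Xu]]; have [[UA _ _ _] _] := FP _ FX.
      by apply: UA; right.
    - by left.
    - move=> u v [Ju|[X FX Xu]] [Jv|[Y FY Yv]].
      + by left; apply: JD.
      + have [[_ _ UD _] _] := FP _ FY.
        case: (UD u v) => [||/=|]; [by left | by right | by left |].
        by right; exists Y.
      + have [[_ _ UD _] _] := FP _ FX.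
        case: (UD u v) => [||/=|]; [by right | by left | by left |].
        by right; exists X.
      + case: (Ftot _ _ FX FY) => XY.
          have [[_ _ UD _] _] := FP _ FY.
          case: (UD u v) => [||/=|]; [by right; apply: XY | by right | by left |].
          by right; exists Y.
        have [[_ _ UD _] _] := FP _ FX.
        case: (UD u v) => [||/=|]; [by right | by right; apply: XY | by left |].
        by right; exists X.
    - move=> u v Au [Jv|[X FX Xv]]; first by left; apply: JM.
      have [[_ _ _ UM] _] := FP _ FX.
      by case: (UM u v) => [||/=|]; [|right|left|right; exists X].
  move=> u [Ju|[X FX Xu]]; first exact: JW.
  by have [_ UW] := FP _ FX; apply: UW; right.
set p := U X in gX.
have max b : ideal A b -> incl p b -> (forall u, b u -> ~ W u) -> incl b p.
  move=> ib pb bW u bu; apply: boolp.contrapT => pu.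
  apply: (mX b).
    split; first by move=> v Xv; apply: pb; right.
    by move=> bX; apply: pu; right; apply: bX.
  have -> : U b = b by apply: predext => v; split; [case=> // Jv; apply: pb; left | right].
  by split.
have [ip pW] := gX; exists p; split => //; last by left.
have [pA p0 pD pM] := ip.
split => // [p1|u v Au Av puv]; first exact: (pW _ p1).
have key w : A w -> ~ p w -> exists c d, [/\ W c, A d & p (c - d * w)].
  move=> Aw pw; apply: boolp.contrapT => H; apply: pw.
  apply: (max (adjoin A p w)); last exact: adjoin_self.
  - exact: ideal_adjoin.
  - exact: incl_adjoin.
  - move=> _ [c [d [pc Ad ->]]] Wcd; apply: H; exists (c + d * w), d.
    by split=> //; rewrite addrK.
have [|pu] := boolp.EM (p u); first by left.
have [|pv] := boolp.EM (p v); first by right.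
have [c [d [Wc Ad pcd]]] := key _ Au pu.
have [c' [d' [Wc' Ad' pcd']]] := key _ Av pv.
exfalso; apply: (pW (c * c')); last exact: WM.
have -> : c * c' = c' * (c - d * u) + (d * u) * (c' - d' * v) + (d * d') * (u * v) by ring.
apply: (pD); last by apply: (pM) => //; apply: AM.
by apply: (pD); apply: (pM) => //; [apply: WA | apply: AM].
Qed.

(* The primes are found from the top down: a regular element a lies in no prime minimal over J. *)
Lemma regular_seq_chain J m s :
  ideal A J -> prime_ideal A m -> incl J m -> (forall a, a \in s -> m a) ->
  regular_seq A J s ->
  strict_chain (fun p => prime_ideal A p /\ incl J p) (size s).
Proof.
move=> + pm; have [im _ _] := pm; have [mA _ _ _] := im.
have [A1 AB AM] := subA.
elim: s J => [|a s IH] J iJ Jm sm /=.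
  by move=> _; exists (fun=> m); split => // i; rewrite ltn0.
move=> [areg sreg]; have ma : m a by apply: sm; rewrite mem_head.
have Aa := mA _ ma.
have [|||c [cP cI]] := IH (adjoin A J a) _ _ _ sreg.
- exact: ideal_adjoin.
- exact: adjoin_sub.
- by move=> b bs; apply: sm; rewrite in_cons bs orbT.
have [p0 Jp0] := cP 0 isT.
have [[c0A _ _ c0M] c01 c0P] := p0.
have c0a : c 0 a by apply: Jp0; apply: adjoin_self.
(* [W] avoids [J] because [a] is no zero divisor modulo [J]. A prime avoiding [W] lies in [c 0] and
   misses [a], so it prolongs the chain downwards. *)
pose W u := exists t r, [/\ A t, ~ c 0 t & u = t * a ^+ r].
have [|||||p [pp Jp pW]] := @exists_prime J W.
- by [].
- by move=> _ [t [r [At _ ->]]]; apply: AM => //; apply: subringX.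
- by exists 1, 0; rewrite expr0 mulr1; split.
- move=> _ _ [t [r [At ct ->]]] [t' [r' [At' ct' ->]]].
  exists (t * t'), (r + r'); split; [exact: AM | by case/c0P |].
  by rewrite exprD; ring.
- move=> u Ju [t [r [At ct uE]]]; apply: ct; apply: Jp0; apply: incl_adjoin.
  rewrite uE in Ju; elim: r Ju {uE} => [|r IHr]; first by rewrite expr0 mulr1.
  rewrite exprS mulrCA => Ju; apply/IHr/areg => //.
  by apply: AM => //; apply: subringX.
exists (fun i => if i is i'.+1 then c i' else p); split.
  move=> [|i] le_i //; have [pi Ji] := cP i le_i.
  by split => // u Ju; apply/Ji/incl_adjoin.
move=> [|i] lt_i; last exact: cI.
have [[pA _ _ _] _ _] := pp.
split; last first.
  move=> /(_ a c0a) pa; apply: (pW a) => //; exists 1, 1; rewrite mul1r expr1; split=> //.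
move=> u pu; apply: boolp.contrapT => cu; apply: (pW u) => //.
by exists u, 0; rewrite expr0 mulr1; split => //; apply: pA.
Qed.

(* Counting, for each ideal c of a chain, the steps at which it meets b i.+1 outside b i. *)
Lemma ring_length_bound J l (b : nat -> K -> Prop) (e : nat -> K) m :
  (forall i, (i <= l)%N -> ideal A (b i)) -> b 0%N = J -> b l = A ->
  (forall i, (i < l)%N -> incl (b i) (b i.+1)) ->
  (forall i f, (i < l)%N -> b i.+1 f -> exists2 a, A a & b i (f - a * e i)) ->
  (forall i a, (i < l)%N -> m a -> b i (a * e i)) ->
  (forall a, A a -> ~ m a -> exists2 a', A a' & m (1 - a * a')) ->
  forall r, strict_chain (fun c => ideal A c /\ incl J c) r -> (r <= l)%N.
Proof.
move=> ib b0 bl bS bgen mb minv r [c [cP cI]].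
pose t i j : bool := boolp.asbool (exists f, [/\ c j f, b i.+1 f & ~ b i f]).
pose lam j := (\sum_(i < l) t i j)%N.
have lam_le j : (lam j <= l)%N.
  rewrite /lam -[X in (_ <= X)%N]card_ord -sum1_card leq_sum // => i _.
  by case: (t i j).
have t_mono i j : (j < r)%N -> t i j -> t i j.+1.
  move=> lt_j /boolp.asboolP[f [cf bf nbf]]; apply/boolp.asboolP; exists f; split=> //.
  by have [H _] := cI _ lt_j; apply: H.
have lam_lt j : (j < r)%N -> (lam j < lam j.+1)%N.
  move=> lt_j; have le_lam : (lam j <= lam j.+1)%N.
    apply: leq_sum => i _; move: (t_mono i j lt_j).
    by case: (t i j) => // ->.
  rewrite ltn_neqAle le_lam andbT; apply/eqP => eq_lam.
  have eq_t i : (i < l)%N -> t i j.+1 -> t i j.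
    move=> lt_i; apply: contraTT => nt; apply/negP => ti; move/eqP: eq_lam.
    apply/negP; rewrite ltn_eqF // /lam (bigD1 (Ordinal lt_i)) //=.
    rewrite [X in (_ < X)%N](bigD1 (Ordinal lt_i)) //= ti (negbTE nt) add0n add1n ltnS.
    by apply: leq_sum => h _; move: (t_mono h j lt_j); case: (t h j) => // ->.
  have [cc' ncc'] := cI _ lt_j; apply: ncc'.
  have [[cA c0 cD cM] Jc] := cP _ (ltnW lt_j).
  have [ic' Jc'] := cP _ lt_j; have [c'A _ _ c'M] := ic'.
  (* Where the counts agree, [c j] contains some [g] whose coefficient [a] at step [i] is invertible
     modulo [m]; subtracting a multiple of [g] lowers [f] into [b i]. *)
  have main i : (i <= l)%N -> forall f, c j.+1 f -> b i f -> c j f.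
    elim: i => [|i IHi] lt_i f cf bf; first by apply: Jc; rewrite -b0.
    have [bif|nbif] := boolp.EM (b i f); first exact: (IHi (ltnW lt_i)).
    have /boolp.asboolP[g [cg bg nbg]] : t i j.
      by apply: eq_t => //; apply/boolp.asboolP; exists f.
    have [bi _ _ _] := ib _ (ltnW lt_i).
    have ibi := ib _ (ltnW lt_i); have [_ _ biD biM] := ibi.
    have [a Aa ba] := bgen _ _ lt_i bg.
    have nma : ~ m a.
      move=> /(mb _ _ lt_i) bae; apply: nbg; rewrite -(subrK (a * e i) g).
      exact: biD.
    have [a' Aa' ma'] := minv _ Aa nma.
    have [d Ad bd] := bgen _ _ lt_i bf.
    have [_ _ AM] := subA.
    have cdg : c j (d * a' * g) by apply: cM => //; apply: AM.
    rewrite -(subrK (d * a' * g) f); apply: cD => //; apply: (IHi (ltnW lt_i)).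
      by apply: idealB => //; apply: cc'.
    have -> : f - d * a' * g = (f - d * e i) + d * ((1 - a * a') * e i)
                               - (d * a') * (g - a * e i) by ring.
    apply: idealB => //; last by apply: biM => //; apply: AM.
    by apply: biD => //; apply: biM => //; apply: mb.
  by move=> f cf; apply: (main l) => //; rewrite bl; apply: c'A.
have lam_ge j : (j <= r)%N -> (j <= lam j)%N.
  elim: j => [//|j IHj] lt_j; exact: leq_ltn_trans (IHj (ltnW lt_j)) (lam_lt _ lt_j).
exact: leq_trans (lam_ge r (leqnn r)) (lam_le r).
Qed.

End Subring.

(** * Linear and algebraic dependence by counting *)

Definition span_of (k : fieldType) (V : lmodType k) (J : finType) (w : J -> V) (v : V) : Prop :=
  exists c : J -> k, v = \sum_j c j *: w j.

Section Span.
Variables (k : fieldType) (V : lmodType k) (J : finType) (w : J -> V).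

Lemma span_of0 : span_of w 0.
Proof. by exists (fun=> 0); rewrite big1 // => j _; rewrite scale0r. Qed.

Lemma span_ofD u v : span_of w u -> span_of w v -> span_of w (u + v).
Proof.
move=> [c ->] [d ->]; exists (fun j => c j + d j); rewrite -big_split /=.
by apply: eq_bigr => j _; rewrite scalerDl.
Qed.

Lemma span_ofZ a v : span_of w v -> span_of w (a *: v).
Proof.
move=> [c ->]; exists (fun j => a * c j); rewrite scaler_sumr.
by apply: eq_bigr => j _; rewrite scalerA.
Qed.

Lemma span_of_sum (T : Type) (r : seq T) (P : pred T) (F : T -> V) :
  (forall i, P i -> span_of w (F i)) -> span_of w (\sum_(i <- r | P i) F i).
Proof. by move=> H; apply: big_ind => //; [exact: span_of0 | exact: span_ofD]. Qed.

Lemma span_of_mem j : span_of w (w j).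
Proof.
exists (fun i => (i == j)%:R); rewrite (bigD1 j) //= eqxx scale1r big1 ?addr0 //.
by move=> i /negbTE ->; rewrite scale0r.
Qed.

Lemma lin_dep (I : finType) (u : I -> V) :
  (forall i, span_of w (u i)) -> (#|J| < #|I|)%N ->
  exists2 c : I -> k, (exists i, c i != 0) & \sum_i c i *: u i = 0.
Proof.
move=> /boolp.choice[C uE] ltJI.
pose M := \matrix_(i < #|I|, j < #|J|) C (enum_val i) (enum_val j).
have /rowV0Pn[v /sub_kermxP vM v0] : kermx M != 0.
  rewrite kermx_eq0 /row_free neq_ltn; apply/orP; left.
  exact: leq_ltn_trans (rank_leq_col M) ltJI.
exists (fun i => v 0 (enum_rank i)).
  have [i vi] := rV0Pn _ v0; exists (enum_val i); by rewrite enum_valK.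
under eq_bigr => i _ do rewrite uE scaler_sumr.
rewrite exchange_big big1 //= => j _.
under eq_bigr => i _ do rewrite scalerA.
rewrite -scaler_suml.
suff -> : \sum_i v 0 (enum_rank i) * C i j = 0 by rewrite scale0r.
move/matrixP: vM => /(_ 0 (enum_rank j)); rewrite !mxE => vM; apply: etrans vM.
rewrite (reindex (enum_val : 'I_#|I| -> I)) /=; last first.
  by exists enum_rank => i _; [exact: enum_valK | exact: enum_rankK].
by apply: eq_bigr => i _; rewrite enum_valK !mxE enum_rankK.
Qed.

End Span.

Section PolyDependence.
Variables (k : fieldType).

Lemma msize_mulS n (p q : {mpoly k[n]}) d e :
  (msize p <= d.+1)%N -> (msize q <= e.+1)%N -> (msize (p * q) <= (d + e).+1)%N.
Proof.
move=> hp hq; rewrite msizeE; apply/bigmax_leqP_seq => m /msuppM_le.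
case/allpairsP=> -[m1 m2] /= [h1 h2 ->] _; rewrite mdegD ltnS leq_add //.
  by rewrite -ltnS; apply: leq_trans (msize_mdeg_lt h1) hp.
by rewrite -ltnS; apply: leq_trans (msize_mdeg_lt h2) hq.
Qed.

Lemma msize_expS n (p : {mpoly k[n]}) d r :
  (msize p <= d.+1)%N -> (msize (p ^+ r) <= (r * d).+1)%N.
Proof.
move=> hp; elim: r => [|r IH]; first by rewrite expr0 msize1.
by rewrite exprS mulSn; apply: msize_mulS.
Qed.

Lemma msize_prodS n (I : finType) (F : I -> {mpoly k[n]}) (d : I -> nat) :
  (forall i, msize (F i) <= (d i).+1)%N -> (msize (\prod_i F i) <= (\sum_i d i).+1)%N.
Proof.
move=> hF; apply: (big_rec2 (fun p e => (msize p <= e.+1)%N)); first by rewrite msize1.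
by move=> i p e _ hp; apply: msize_mulS.
Qed.

(** Monomials in a box rather than of bounded degree: they are indexed by a finite type whose
    cardinal is the plain power D^n. *)
Definition bmon n D (b : {ffun 'I_n -> 'I_D}) : 'X_{1..n} := [multinom (b i : nat) | i < n].

Lemma leq_expn2 a b e : (a <= b)%N -> (a ^ e <= b ^ e)%N.
Proof. by case: e => // e ab; rewrite leq_exp2r. Qed.

Lemma bmon_inj n D : injective (@bmon n D).
Proof.
move=> a b /mnmP ab; apply/ffunP => i; apply/val_inj.
by have := ab i; rewrite !mnmE.
Qed.

Lemma bmon_onto n D (m : 'X_{1..n}) : (forall i, m i < D)%N -> exists b : {ffun 'I_n -> 'I_D}, bmon b = m.
Proof.
move=> mD; exists ([ffun i => Ordinal (mD i)] : {ffun 'I_n -> 'I_D}).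
by apply/mnmP => i; rewrite mnmE ffunE.
Qed.

Lemma span_bmon n D (p : {mpoly k[n]}) :
  (msize p <= D)%N -> span_of (fun b : {ffun 'I_n -> 'I_D} => 'X_[bmon b] : {mpoly k[n]}) p.
Proof.
move=> hp; rewrite [p]mpolyE big_seq; apply: span_of_sum => m mp; apply: span_ofZ.
have [|b <-] := @bmon_onto n D m; last exact: (span_of_mem (fun b => 'X_[bmon b])).
move=> i; apply: leq_trans (leq_trans (msize_mdeg_lt mp) hp).
by rewrite ltnS mdegE (bigD1 i) //= leq_addr.
Qed.

Lemma bmon_free n D (c : {ffun 'I_n -> 'I_D} -> k) b :
  (\sum_a c a *: 'X_[bmon a] : {mpoly k[n]})@_(bmon b) = c b.
Proof.
rewrite raddf_sum (bigD1 b) //= mcoeffZ mcoeffX eqxx mulr1 big1 ?addr0 // => a ab.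
by rewrite mcoeffZ mcoeffX (inj_eq (@bmon_inj _ _)) (negbTE ab) mulr0.
Qed.

(** The products of powers of the g_i with exponents below B number B^(n+1). Their degrees grow only
    linearly in B, so they lie in a space whose dimension grows like B^n. *)
Lemma alg_dependent n (g : 'I_n.+1 -> {mpoly k[n]}) :
  exists2 Q : {mpoly k[n.+1]}, Q != 0 & mmap (@mpolyC n k) g Q = 0.
Proof.
pose c := (\sum_i msize (g i))%N.
have gc i : (msize (g i) <= c.+1)%N by rewrite /c (bigD1 i) //= -addnS leq_addr.
(* D + 1 = (n + 1) c B + 1 is at most ((n + 1) c + 1) B, so (D + 1)^n is at most ((n + 1) c + 1)^n
   B^n, which this B makes smaller than B^(n+1). *)
pose B := ((n.+1 * c + 1) ^ n).+1.
pose D := (\sum_(i < n.+1) B * c)%N.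
pose u (a : {ffun 'I_n.+1 -> 'I_B}) := \prod_i g i ^+ a i.
have [a||d [b db] dE] := lin_dep (u := u) (w := fun b : {ffun 'I_n -> 'I_D.+1} => 'X_[bmon b] : {mpoly k[n]}).
- apply: span_bmon; apply: msize_prodS => i.
  apply: leq_trans (msize_expS _ (gc i)) _.
  by rewrite ltnS leq_mul2r ltnW ?orbT.
- rewrite !card_ffun !card_ord.
  have -> : D.+1 = (n.+1 * c * B + 1)%N by rewrite /D sum_nat_const card_ord; lia.
  rewrite expnS; apply: (@leq_ltn_trans (((n.+1 * c + 1) * B) ^ n)).
    by apply: leq_expn2 => //; rewrite mulnDl leq_add2l mul1n.
  by rewrite expnMn ltn_pmul2r ?expn_gt0.
exists (\sum_a d a *: 'X_[bmon a]).
  by apply/eqP => /(congr1 (mcoeff (bmon b))); rewrite bmon_free mcoeff0; apply/eqP.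
rewrite raddf_sum -[RHS]dE; apply: eq_bigr => a _ /=.
rewrite mmapZ mmapX mul_mpolyC /mmap1; congr (_ *: _).
by apply: eq_bigr => i _; rewrite mnmE.
Qed.

Lemma alg_dependent_eq n m (g : 'I_m -> {mpoly k[n]}) : m = n.+1 ->
  exists2 Q : {mpoly k[m]}, Q != 0 & mmap (@mpolyC n k) g Q = 0.
Proof. by move=> mE; subst m; apply: alg_dependent. Qed.

End PolyDependence.

(** * Factorial rings *)

Section Factorial.
Variable (D : comNzRingType).

Definition divides (a b : D) : Prop := exists c, b = c * a.

Definition invertible (u : D) : Prop := exists v, u * v = 1.

Definition prime_elt (p : D) : Prop :=
  [/\ p != 0, ~ invertible p
    & forall a b, divides p (a * b) -> divides p a \/ divides p b].

Definition factors_as (f : D) (s : seq D) : Prop :=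
  (forall p, p \in s -> prime_elt p) /\ exists2 u, invertible u & f = u * \prod_(p <- s) p.

(** Only existence of factorizations is asked for: the factors are prime and not merely irreducible,
    so uniqueness is automatic in a domain. *)
Definition factorial : Prop := forall f, f != 0 -> exists s, factors_as f s.

Lemma divides_trans a b c : divides a b -> divides b c -> divides a c.
Proof. by move=> [d ->] [e ->]; exists (e * d); rewrite mulrA. Qed.

Lemma dividesMr a b c : divides a b -> divides a (b * c).
Proof. by move=> [d ->]; exists (d * c); ring. Qed.

Lemma divides_refl a : divides a a.
Proof. by exists 1; rewrite mul1r. Qed.

Lemma dividesD a b c : divides a b -> divides a c -> divides a (b + c).
Proof. by move=> [d ->] [e ->]; exists (d + e); rewrite mulrDl. Qed.

Lemma dividesB a b c : divides a b -> divides a c -> divides a (b - c).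
Proof. by move=> [d ->] [e ->]; exists (d - e); rewrite mulrBl. Qed.

Lemma invertibleM u v : invertible u -> invertible v -> invertible (u * v).
Proof.
by move=> [a ua] [b vb]; exists (a * b); rewrite mulrACA ua vb mulr1.
Qed.

Lemma factors_asM f g s t : factors_as f s -> factors_as g t -> factors_as (f * g) (s ++ t).
Proof.
move=> [sP [u uU ->]] [tP [v vU ->]]; split.
  by move=> p; rewrite mem_cat => /orP[/sP|/tP].
by exists (u * v); [exact: invertibleM | rewrite big_cat mulrACA].
Qed.

Lemma prime_divides_prod p (s : seq D) :
  prime_elt p -> divides p (\prod_(q <- s) q) -> exists2 q, q \in s & divides p q.
Proof.
move=> [_ pU pP]; elim: s => [|q s IH].
  rewrite big_nil => -[c c1]; case: pU; exists c; by rewrite mulrC.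
rewrite big_cons => /pP[pq|/IH[r rs pr]]; first by exists q; rewrite ?mem_head.
by exists r; rewrite ?in_cons ?rs ?orbT.
Qed.

End Factorial.

Section FactorialPoly.
Variable (D : idomainType).
Implicit Types (f g h a b c : {poly D}) (p d e : D).

Lemma dividesC d f : (forall i, divides d f`_i) -> divides d%:P f.
Proof.
move=> /boolp.choice[q fq]; exists (\poly_(i < size f) q i).
apply/polyP => i; rewrite coefMC coef_poly; case: ltnP => [_|le_i]; first exact: fq.
by rewrite nth_default ?mul0r.
Qed.

Lemma divides_coef d f i : divides d%:P f -> divides d f`_i.
Proof. by move=> [q ->]; exists q`_i; rewrite coefMC. Qed.

Lemma min_coef p f : ~ divides p%:P f ->
  exists2 i, ~ divides p f`_i & forall j, (j < i)%N -> divides p f`_j.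
Proof.
move=> pf; have ex : exists i, boolp.asbool (~ divides p f`_i).
  apply: boolp.contrapT => H; apply: pf; apply: dividesC => i.
  by apply: boolp.contrapT => pi; apply: H; exists i; apply/boolp.asboolP.
case: (ex_minnP ex) => i /boolp.asboolP pi imin.
exists i => // j lt_ji; apply: boolp.contrapT => /boolp.asboolP/imin.
by rewrite leqNgt lt_ji.
Qed.

(** Gauss's lemma: the first coefficients of [a] and of [b] not divisible by [p] multiply to a
    coefficient of [a * b], modulo [p]. *)
Lemma prime_eltC p : prime_elt p -> prime_elt p%:P.
Proof.
move=> [p0 pU pP]; split; first by rewrite polyC_eq0.
  move=> [v /polyP/(_ 0)]; rewrite coefCM coef1 => pv; by apply: pU; exists v`_0.
move=> a b pab; have [|pa] := boolp.EM (divides p%:P a); first by left.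
have [|pb] := boolp.EM (divides p%:P b); first by right.
have [i pi imin] := min_coef pa; have [j pj jmin] := min_coef pb.
have /pP[/pi|/pj] // : divides p (a`_i * b`_j).
have := divides_coef (i + j) pab; rewrite coefM.
have lt_i : (i < (i + j).+1)%N by lia.
rewrite (bigD1 (Ordinal lt_i)) //= addKn => H; rewrite -[X in divides _ X](addrK (\sum_(l < (i + j).+1 | l != Ordinal lt_i) a`_l * b`_(i + j - l))).
apply: dividesB => //; apply: big_ind => [|x y|l li]; first by exists 0; rewrite mul0r.
  exact: dividesD.
have [lt_li|lt_il|eq_li] := ltngtP l i.
- by apply: dividesMr; apply: imin.
- by rewrite mulrC; apply: dividesMr; apply: jmin; have := ltn_ord l; lia.
- by move/eqP: li; case; apply: val_inj.
Qed.

(** Content one, expressed through prime constants so that no gcd in [D] is needed. *)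
Definition primitive f : Prop := forall p, prime_elt p -> ~ divides p%:P f.

Hypothesis factD : factorial D.

(** A prime constant dividing [f] divides its leading coefficient; cancelling it removes one prime
    factor there, and the number of these factors bounds the induction. *)
Lemma primitive_part f : f != 0 -> exists d g, [/\ d != 0, primitive g & f = d%:P * g].
Proof.
move=> f0; have lf0 : lead_coef f != 0 by rewrite lead_coef_eq0.
have [s] := factD lf0; clear lf0.
elim: {s}_.+1 {-2}s (ltnSn (size s)) f f0 => // N IH s; rewrite ltnS => sN f f0 fs.
have [[p pp [g fg]]|nP] := boolp.EM (exists2 p, prime_elt p & divides p%:P f); last first.
  by exists 1, f; rewrite oner_neq0 mul1r; split=> // p pp pf; apply: nP; exists p.
have [p0 pU pP] := pp.
have g0 : g != 0 by apply: contraNneq f0 => g0; rewrite fg g0 mul0r.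
have lf : lead_coef f = lead_coef g * p by rewrite fg lead_coefM lead_coefC.
have [sP [u uU lfE]] := fs.
have pu : ~ divides p u.
  move=> [v uE]; case: uU => w uw; apply: pU; exists (w * v).
  by rewrite -uw uE; ring.
have [] := pP u (\prod_(q <- s) q); [by rewrite -lfE lf; exists (lead_coef g) | by [] |].
move=> /(prime_divides_prod pp)[q qs [c qc]].
have [q0 qU qP] := sP _ qs.
have cU : invertible c.
  case: (qP c p); first by rewrite -qc; apply: divides_refl.
    move=> [v cE]; case: pU; exists v; apply: (mulfI q0).
    by rewrite mulr1 {2}qc cE; ring.
  move=> [v pE]; exists v; apply: (mulfI p0); rewrite mulr1 {2}pE qc; ring.
have [||e [h [e0 hP gh]]] := IH (rem q s) _ g g0.
- by rewrite size_rem // prednK // lt0n size_eq0; apply: contraTneq qs => ->.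
- split; first by move=> r /mem_rem/sP.
  exists (u * c); first exact: invertibleM.
  by apply: (mulIf p0); rewrite -lf lfE (perm_big _ (perm_to_rem qs)) big_cons /= {1}qc; ring.
exists (e * p), h; rewrite mulf_neq0 //; split=> //.
by rewrite fg gh rmorphM /=; ring.
Qed.

Lemma primitive_cancel e h c : e != 0 -> primitive h -> divides e%:P (h * c) -> divides e%:P c.
Proof.
move=> /factD[s [sP [u [v uv] ->]]] hP; elim: s sP c => [|p s IH] sP c.
  rewrite big_nil mulr1 => _; exists (v%:P * c).
  by rewrite mulrAC -rmorphM /= mulrC mulrC [v * u]mulrC uv mul1r.
rewrite big_cons => ehc.
have pp : prime_elt p by apply: sP; rewrite mem_head.
have [p0 _ _] := pp; have [_ _ pP] := prime_eltC pp.
have : divides p%:P (h * c).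
  by case: ehc => q ->; exists (q * (u * \prod_(j <- s) j)%:P); rewrite !rmorphM /=; ring.
move=> /pP[/(hP _ pp)//|[c' cE]].
have [||q c'E] := IH _ c'.
- by move=> r rs; apply: sP; rewrite in_cons rs orbT.
- case: ehc => q hcE; exists q; apply: (mulIf (_ : p%:P != 0)); first by rewrite polyC_eq0.
  transitivity (h * c); first by rewrite cE mulrA.
  by rewrite hcE !rmorphM /=; ring.
by exists q; rewrite cE c'E !rmorphM /=; ring.
Qed.

Lemma primitive_dvd f g : primitive f -> divides g f -> primitive g.
Proof. by move=> fP gf p pp pg; apply: (fP p pp); apply: divides_trans gf. Qed.

Lemma primitive_const d : d != 0 -> primitive d%:P -> invertible d.
Proof.
move=> /factD[[|p s] [sP [u uU dE]]] dP; first by rewrite dE big_nil mulr1.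
case: (dP p); first by apply: sP; rewrite mem_head.
by exists (u * \prod_(j <- s) j)%:P; rewrite dE big_cons -rmorphM; congr (_%:P); ring.
Qed.

(** A gcd without fractions: [g] is the primitive part of a nonzero element of least size in the
    ideal of [f] and [a]. Pseudo-division by that element leaves remainder zero, and
    [primitive_cancel] removes the pseudo-division multiplier. *)
Lemma common_divisor f a : f != 0 -> primitive f -> exists u v g,
  [/\ g != 0, primitive g, divides g f, divides g a & exists2 d, d != 0 & d%:P * g = u * f + v * a].
Proof.
move=> f0 fP.
pose Q m := boolp.asbool (exists u v, u * f + v * a != 0 /\ size (u * f + v * a)%R = m).
have ex : exists m, Q m.
  by exists (size f); apply/boolp.asboolP; exists 1, 0; rewrite mul1r mul0r addr0.
case: (ex_minnP ex) => m /boolp.asboolP[u [v [g0 gm]]] mmin.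
set g := u * f + v * a in g0 gm.
have [d [g' [d0 g'P gE]]] := primitive_part g0.
have g'0 : g' != 0 by apply: contraNneq g0 => g'0; rewrite gE g'0 mulr0.
have dvd b : (exists r s, b = r * f + s * a) -> divides g' b.
  move=> [r [s bE]]; have E := Pdiv.Idomain.divp_eq b g.
  set e := lead_coef g ^+ _ in E.
  have e0 : e != 0 by rewrite expf_neq0 // lead_coef_eq0.
  have r0 : modp b g = 0.
    apply/eqP/negPn/negP => r0; have := Pdiv.Idomain.ltn_modp b g; rewrite g0 => lt.
    have := mmin (size (modp b g)); rewrite leqNgt -gm lt => H.
    apply/notF/H/boolp.asboolP; exists (e%:P * r - divp b g * u), (e%:P * s - divp b g * v).
    suff -> : (e%:P * r - divp b g * u) * f + (e%:P * s - divp b g * v) * a = modp b g by [].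
    have -> : modp b g = e *: b - divp b g * g by rewrite E addrAC subrr add0r.
    by rewrite -mul_polyC /g bE; ring.
  have {}E : e%:P * b = divp b g * d%:P * g' by rewrite mul_polyC E r0 addr0 {2}gE mulrA.
  have [|q qE] := @primitive_cancel e g' (divp b g * d%:P) e0 g'P.
    by exists b; rewrite [RHS]mulrC E; ring.
  exists q; apply: (mulfI (_ : e%:P != 0)); first by rewrite polyC_eq0.
  by rewrite E qE; ring.
exists u, v, g'; split=> //.
- by apply: dvd; exists 1, 0; ring.
- by apply: dvd; exists 0, 1; ring.
- by exists d.
Qed.

(** A primitive polynomial that is not a product of two of positive degree is prime. If it divides
    [a * b], its common divisor with [a] is either associated to it, or constant; in the latter case
    Bezout's identity and [primitive_cancel] make it divide [b]. *)
Lemma factorial_poly : factorial {poly D}.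
Proof.
move=> f f0; have [d [g [d0 gP fE]]] := primitive_part f0.
have g0 : g != 0 by apply: contraNneq f0 => g0; rewrite fE g0 mulr0.
suff [s gs] : exists s, factors_as g s.
  have [t [tP [u [v uv] dE]]] := factD d0.
  exists ([seq p%:P | p <- t] ++ s); rewrite fE; apply: factors_asM => //; split.
    by move=> _ /mapP[p /tP pp ->]; apply: prime_eltC.
  exists u%:P; first by exists v%:P; rewrite -rmorphM /= uv.
  by rewrite dE rmorphM /= rmorph_prod big_map.
elim: {f d f0 d0 fE}_.+1 {-2}g (ltnSn (size g)) g0 gP => // N IH {}g; rewrite ltnS => gN g0 gP.
have [/size1_polyC gE|size_g] := leqP (size g) 1.
  exists [::]; split=> //; exists g; last by rewrite big_nil mulr1.
  rewrite gE in gP g0; rewrite polyC_eq0 in g0; have [v uv] := primitive_const g0 gP.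
  by exists v%:P; rewrite gE -rmorphM /= uv.
have [[a [b [gE sa sb]]]|irr] := boolp.EM (exists a b, [/\ g = a * b, (1 < size a)%N & (1 < size b)%N]).
  have a0 : a != 0 by apply: contraNneq g0 => a0; rewrite gE a0 mul0r.
  have b0 : b != 0 by apply: contraNneq g0 => b0; rewrite gE b0 mulr0.
  have sg := size_mul a0 b0; rewrite -gE in sg.
  have [||s sE] := IH a _ a0; first by lia.
    by apply: primitive_dvd gP _; exists b; rewrite mulrC.
  have [||t tE] := IH b _ b0; first by lia.
    by apply: primitive_dvd gP _; exists a.
  by exists (s ++ t); rewrite gE; apply: factors_asM.
exists [:: g]; split; last by exists 1; [exists 1; rewrite mulr1 | rewrite big_seq1 mul1r].
move=> _ /[!inE]/eqP->; split=> // [[v gv]|a b [w abE]].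
  have v0 : v != 0 by apply: contra_eqN gv => /eqP ->; rewrite mulr0 eq_sym oner_neq0.
  move: (size_mul g0 v0) (v0) size_g; rewrite gv size_poly1 -size_poly_gt0.
  by case: (size g) => [|[|m]] //; case: (size v) => // m'; rewrite addnS.
have [u [v [h [h0 hP [q gE] ha [e e0 eE]]]]] := common_divisor a g0 gP.
have q0 : q != 0 by apply: contraNneq g0 => q0; rewrite gE q0 mul0r.
have [sh|sh] := leqP (size h) 1.
  right; rewrite (size1_polyC sh) -rmorphM /= in eE.
  have h00 : h`_0 != 0 by rewrite -polyC_eq0 -size1_polyC.
  have [||r bE] := @primitive_cancel (e * h`_0) g (u * b + v * w) _ gP.
  - by rewrite mulf_neq0.
  - by exists b; transitivity (u * g * b + v * (a * b)); [rewrite abE; ring | rewrite eE; ring].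
  exists r; apply: (mulfI (_ : (e * h`_0)%:P != 0)); first by rewrite polyC_eq0 mulf_neq0.
  transitivity (g * (u * b + v * w)); last by rewrite bE; ring.
  by rewrite eE mulrDl -[v * a * b]mulrA abE; ring.
have sq : (size q <= 1)%N by rewrite leqNgt; apply/negP => sq; apply: irr; exists q, h.
left; apply: divides_trans ha.
have /primitive_const : q`_0 != 0 by rewrite -polyC_eq0 -size1_polyC.
rewrite -size1_polyC // => /(_ (primitive_dvd gP _))[|v' qv].
  by exists h; rewrite mulrC.
by exists v'%:P; rewrite gE (size1_polyC sq) mulrA -rmorphM /= mulrC [v' * _]mulrC qv mulr1.
Qed.

End FactorialPoly.

(** * Polynomial rings as iterated polynomial rings *)

Section Tower.
Variables (k : idomainType).

Lemma mpoly_rmorph_ext n (L : nzRingType) (f g : {rmorphism {mpoly k[n]} -> L}) :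
  (forall c, f c%:MP = g c%:MP) -> (forall i, f 'X_i = g 'X_i) -> f =1 g.
Proof.
move=> eqC eqX p; rewrite [p]mpolyE !rmorph_sum; apply: eq_bigr => m _ /=.
rewrite -mul_mpolyC !rmorphM eqC mpolyXE_id !rmorph_prod; congr (_ * _).
by apply: eq_bigr => i _; rewrite !rmorphXn eqX.
Qed.

Lemma mwidenXi n i : mwiden ('X_i : {mpoly k[n]}) = 'X_(widen_ord (leqnSn n) i).
Proof. by rewrite mwidenX mnmwiden1. Qed.

Lemma muniX n (m : 'X_{1..n.+1}) :
  muni ('X_[m] : {mpoly k[n.+1]}) = ('X_[[multinom (m (widen_ord (leqnSn n) i)) | i < n]])%:P * 'X^(m ord_max).
Proof. by rewrite muniE msuppX big_seq1 mcoeffX eqxx scale1r mul_polyC. Qed.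

Lemma muni_max n : muni ('X_ord_max : {mpoly k[n.+1]}) = 'X.
Proof.
rewrite muniX mnm1E eqxx expr1 [X in 'X_[X]](_ : _ = 0%MM) ?mpolyX0 ?mul1r //.
by apply/mnmP => i; rewrite mnmE mnm1E mnm0E -val_eqE /= gtn_eqF.
Qed.

Lemma muni_widen n (p : {mpoly k[n]}) : muni (mwiden p) = p%:P.
Proof.
pose f : {rmorphism _ -> _} := @muni n k \o @mwiden n k.
pose g : {rmorphism _ -> _} := @polyC {mpoly k[n]}.
apply: (@mpoly_rmorph_ext n _ f g) => [c|i] /=; first by rewrite mwidenC muniC.
rewrite mwidenXi muniX mnm1E -val_eqE /= ltn_eqF // expr0 mulr1; congr (_%:P).
congr 'X_[_]; apply/mnmP => j; rewrite mnmE !mnm1E.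
by rewrite -val_eqE.
Qed.

Lemma mmultiE n (p : {poly {mpoly k[n]}}) :
  mmulti p = (map_poly (@mwiden n k) p).['X_ord_max].
Proof.
rewrite (horner_coef_wide _ (size_poly _ _)) /mmulti.
by apply: eq_bigr => i _; rewrite coef_map.
Qed.

Lemma mmultiK n : cancel (@mmulti n k) (@muni n k).
Proof.
move=> p; rewrite /mmulti rmorph_sum -[RHS]coefK poly_def; apply: eq_bigr => i _ /=.
by rewrite rmorphM rmorphXn /= muni_max muni_widen mul_polyC.
Qed.

Lemma muniK n : cancel (@muni n k) (@mmulti n k).
Proof.
move=> p; rewrite mmultiE.
pose f : {rmorphism _ -> _} := horner_eval ('X_ord_max : {mpoly k[n.+1]}) \o map_poly (@mwiden n k) \o @muni n k.
apply: (@mpoly_rmorph_ext n.+1 _ f idfun) => [c|i] /=.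
  by rewrite muniC map_polyC /= mwidenC /horner_eval hornerC.
have [->|] := eqVneq i ord_max.
  by rewrite muni_max map_polyX /horner_eval hornerX.
rewrite eq_sym => /unlift_some[j iE _].
have -> : i = widen_ord (leqnSn n) j by apply/val_inj; rewrite iE /= /bump leqNgt ltn_ord.
by rewrite -mwidenXi muni_widen map_polyC /horner_eval hornerC.
Qed.

Lemma muni_inj n : injective (@muni n k).
Proof. exact: can_inj (@muniK n). Qed.

End Tower.

Section FactorialMpoly.

Lemma factorial_iso (D E : comNzRingType) (f : {rmorphism D -> E}) (g : E -> D) :
  cancel f g -> cancel g f -> factorial E -> factorial D.
Proof.
move=> fK gK factE a a0; have [|s [sP [u [v uv] aE]]] := factE (f a).
  by rewrite -(rmorph0 f) (can_eq fK).
have g1 : g 1 = 1 by rewrite -(rmorph1 f) fK.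
have gM x y : g (x * y) = g x * g y by rewrite -[RHS]fK rmorphM /= !gK.
exists (map g s); split; last first.
  exists (g u); first by exists (g v); rewrite -gM uv.
  rewrite -[LHS]fK aE gM; congr (_ * _); rewrite big_map.
  by elim: (s) => [|p t IH]; rewrite ?big_nil ?big_cons ?gM ?IH.
move=> _ /mapP[p /sP[p0 pU pP] ->]; split.
- by apply: contraNneq p0 => /(congr1 f); rewrite gK rmorph0 => ->.
- by move=> [w gw]; apply: pU; exists (f w); rewrite -(rmorph1 f) -gw rmorphM /= gK.
- move=> x y [c xy]; have [] := pP (f x) (f y).
  + by exists (f c); rewrite -rmorphM xy rmorphM /= gK.
  + by move=> [d dE]; left; exists (g d); rewrite -gM -dE fK.
  + by move=> [d dE]; right; exists (g d); rewrite -gM -dE fK.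
Qed.

Lemma factorial_mpoly (k : fieldType) n : factorial {mpoly k[n]}.
Proof.
elim: n => [f f0|n /factorial_poly]; last exact: factorial_iso (@muniK _ _) (@mmultiK _ _).
exists [::]; split=> //; exists f; last by rewrite big_nil mulr1.
have fE := nvar0_mpolyC f; exists ((f@_0%MM)^-1)%:MP; rewrite {1}fE -mpolyCM mulfV ?mpolyC1 //.
by apply: contraNneq f0 => fc; rewrite fE fc.
Qed.

End FactorialMpoly.

(** * Homogeneous components *)

Section Homogeneous.
Variables (k : fieldType) (n : nat).
Local Notation R := {mpoly k[n]}.
Local Notation hc := (pihomog mdeg).
Implicit Types (f g : R) (d e : nat) (a P : R -> Prop).

Lemma pihomog_mulr d e f g : g \is e.-homog -> hc (d + e) (f * g) = hc d f * g.
Proof.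
move=> ge; pose N := msize f.
rewrite {1}(pihomog_partitionE (leqnn N)) mulr_suml linear_sum /=.
rewrite [in RHS](pihomog_partitionE (leqnn N)) linear_sum /= mulr_suml.
apply: eq_bigr => i _; have [<-|di] := eqVneq (i : nat) d.
  by rewrite pihomog_id pihomog_dE //; apply: dhomogM => //; exact: pihomogP.
have hi : hc i f * g \is (i + e).-homog by apply: dhomogM => //; exact: pihomogP.
by rewrite (pihomog_ne0 di (pihomogP _ _ _)) mul0r (pihomog_ne0 _ hi) // eqn_add2r.
Qed.

Lemma pihomog_mulr_lt d e f g : g \is e.-homog -> (d < e)%N -> hc d (f * g) = 0.
Proof.
move=> ge lt_de; rewrite (pihomog_partitionE (leqnn (msize f))) mulr_suml linear_sum big1 //= => i _.
have hi : hc i f * g \is (i + e).-homog by apply: dhomogM => //; exact: pihomogP.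
by rewrite (pihomog_ne0 _ hi) // gtn_eqF // ltn_addl.
Qed.

Lemma pihomog_gt d f : (msize f <= d)%N -> hc d f = 0.
Proof.
move=> hf; rewrite (pihomog_partitionE hf) linear_sum big1 //= => i _.
by rewrite (pihomog_ne0 _ (pihomogP _ _ _)) // ltn_eqF.
Qed.

Lemma pihomogM d f g : hc d (f * g) = \sum_(i < d.+1) hc i f * hc (d - i) g.
Proof.
pose N := maxn (msize g) d.+1.
have gN : (msize g <= N)%N by apply: leq_maxl.
have dN : (d.+1 <= N)%N by apply: leq_maxr.
rewrite {1}(pihomog_partitionE gN) mulr_sumr linear_sum /=.
rewrite (bigID (fun j : 'I_N => (j < d.+1)%N)) /= [X in _ + X]big1 ?addr0; last first.
  by move=> j; rewrite -leqNgt => dj; apply: pihomog_mulr_lt (pihomogP _ _ _) _.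
transitivity (\sum_(0 <= j < d.+1) hc d (f * hc j g)).
  by rewrite (big_nat_widen _ _ N) // big_mkord.
rewrite big_mkord (reindex_inj rev_ord_inj) /=.
apply: eq_bigr => i _; rewrite subSS.
have {1}-> : d = (i + (d - i))%N by have := ltn_ord i; lia.
by rewrite (pihomog_mulr _ _ (pihomogP _ _ _)).
Qed.

(** [a] is only a set closed under sums and multiples, so that the same statement serves for a prime
    ideal and for zero. *)
Lemma pihomogM_lead a d e f g : a 0 -> (forall u v, a u -> a v -> a (u + v)) ->
  (forall u v, a v -> a (u * v)) ->
  (forall i, (i <= d + e)%N -> i <> d -> a (hc i f) \/ a (hc (d + e - i) g)) ->
  a (hc (d + e) (f * g) - hc d f * hc e g).
Proof.
move=> a0 aD aM H; rewrite pihomogM.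
have lt_d : (d < (d + e).+1)%N by lia.
rewrite (bigD1 (Ordinal lt_d)) //= addKn addrAC subrr add0r.
apply: big_ind => // i id; case: (H i) => [||af|ag]; last exact: aM.
- by rewrite -ltnS.
- by move=> iE; case/eqP: id; apply: val_inj.
- by rewrite mulrC; apply: aM.
Qed.

Lemma pihomog_sum_eq f : f = \sum_(d < msize f) hc d f.
Proof. exact: pihomog_partitionE. Qed.

Lemma hom_mem a f : ideal (@whole R) a -> (forall d, a (hc d f)) -> a f.
Proof. by move=> [_ a0 aD _] H; rewrite [f]pihomog_sum_eq; apply: big_ind. Qed.

Lemma min_component (Q : R -> Prop) f : (exists d, ~ Q (hc d f)) ->
  exists2 d, ~ Q (hc d f) & forall i, (i < d)%N -> Q (hc i f).
Proof.
move=> [d Qd]; have ex : exists i, boolp.asbool (~ Q (hc i f)) by exists d; apply/boolp.asboolP.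
case: (ex_minnP ex) => i /boolp.asboolP Qi imin; exists i => // j lt_j.
by apply: boolp.contrapT => /boolp.asboolP/imin; rewrite leqNgt lt_j.
Qed.

Lemma max_component f : f != 0 ->
  exists2 d, hc d f != 0 & forall i, (d < i)%N -> hc i f = 0.
Proof.
move=> f0; have ex : exists i, hc i f != 0.
  apply: boolp.contrapT => H; case/eqP: f0; rewrite [f]pihomog_sum_eq big1 // => i _.
  by apply/eqP; apply: boolp.contrapT => /negP Hi; apply: H; exists i.
case: (@ex_maxnP _ (msize f) ex) => [i|i fi imax].
  by apply: contraR; rewrite -ltnNge => /ltnW/pihomog_gt ->.
exists i => // j lt_j; apply/eqP; apply: contraTT lt_j => /imax.
by rewrite -leqNgt.
Qed.

(** The largest homogeneous ideal inside a prime is prime: the lowest components of f and g outside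
    P multiply, modulo P, to a component of f g. *)
Lemma core_prime P : prime_ideal (@whole R) P ->
  prime_ideal (@whole R) (fun f => forall d, P (hc d f)) /\
  homogeneous (fun f => forall d, P (hc d f)).
Proof.
move=> pP; have [[_ P0 PD PM] P1 PP] := pP.
pose C f := forall d, P (hc d f).
have sub f : C f -> P f by apply: hom_mem; split.
have iC : ideal (@whole R) C.
  split=> // [d|f g Cf Cg d|f g _ Cg d]; first by rewrite linear0.
    by rewrite linearD; apply: PD; [apply: Cf | apply: Cg].
  by rewrite pihomogM; apply: big_ind => // i _; apply: PM => //; apply: Cg.
split; last first.
  move=> f Cf d e; have [<-|de] := eqVneq d e; first by rewrite pihomog_id.
  by rewrite (pihomog_ne0 de (pihomogP _ _ _)).
split=> // [/sub/P1 //|f g _ _ Cfg].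
apply: boolp.contrapT => /boolp.not_orP[nf ng].
have /min_component[d Pd dmin] : exists d, ~ P (hc d f) by apply/boolp.existsNP.
have /min_component[e Pe emin] : exists d, ~ P (hc d g) by apply/boolp.existsNP.
suff /PP[] : P (hc d f * hc e g) by [].
have -> : hc d f * hc e g = hc (d + e) (f * g) - (hc (d + e) (f * g) - hc d f * hc e g) by ring.
have iP : ideal (@whole R) P by case: pP.
apply: (idealB (@subring_whole R) iP); first exact: Cfg.
apply: pihomogM_lead => // [u v|i le_i ne_i]; first exact: PM.
have [lt_i|le_di] := ltnP i d; first by left; apply: dmin.
by right; apply: emin; move/eqP: ne_i; lia.
Qed.

(** In a domain the lowest components of the two factors have a nonzero product, and so have the
    highest ones. Both products sit in degree d, which leaves no gap between lowest and highest. *)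
Lemma homog_factor d f g : f * g != 0 -> f * g \is d.-homog -> exists e, f \is e.-homog.
Proof.
move=> fg0 fgd; have f0 : f != 0 by apply: contraNneq fg0 => ->; rewrite mul0r.
have g0 : g != 0 by apply: contraNneq fg0 => ->; rewrite mulr0.
have exm (h : R) : h != 0 -> exists2 i, hc i h != 0 & forall j, (j < i)%N -> hc j h = 0.
  move=> h0; have [i hi _] := max_component h0.
  have [|j hj jmin] := @min_component (fun u => u = 0) h; first by exists i; apply/eqP.
  by exists j => //; apply/eqP.
have [d1 d1P d1min] := exm f f0; have [e1 e1P e1min] := exm g g0.
have [d2 d2P d2max] := max_component f0; have [e2 e2P e2max] := max_component g0.
have z0 : forall u v : R, u = 0 -> v = 0 -> u + v = 0 by move=> u v -> ->; rewrite addr0.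
have zM : forall u v : R, v = 0 -> u * v = 0 by move=> u v ->; rewrite mulr0.
have /eqP E1 : hc (d1 + e1) (f * g) - hc d1 f * hc e1 g = 0.
  apply: (@pihomogM_lead (fun u => u = 0)) => // i le_i ne_i.
  have [lt_i|le_di] := ltnP i d1; first by left; apply: d1min.
  by right; apply: e1min; move/eqP: ne_i; lia.
have /eqP E2 : hc (d2 + e2) (f * g) - hc d2 f * hc e2 g = 0.
  apply: (@pihomogM_lead (fun u => u = 0)) => // i le_i ne_i.
  have [lt_i|le_di] := ltnP d2 i; first by left; apply: d2max.
  by right; apply: e2max; move/eqP: ne_i; lia.
have degE i j : hc (i + j) (f * g) - hc i f * hc j g == 0 -> hc i f != 0 -> hc j g != 0 -> (i + j = d)%N.
  rewrite subr_eq0 => /eqP E fi gj; apply/eqP; apply: contraTT (mulf_neq0 fi gj) => ne.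
  by rewrite -E negbK; apply/eqP; apply: pihomog_ne0 fgd; rewrite eq_sym.
have dE1 := degE _ _ E1 d1P e1P; have dE2 := degE _ _ E2 d2P e2P.
have le_d : (d1 <= d2)%N by rewrite leqNgt; apply: contraNN d1P => /d2max ->.
have le_e : (e1 <= e2)%N by rewrite leqNgt; apply: contraNN e1P => /e2max ->.
exists d1; rewrite homog_piE {2}[f]pihomog_sum_eq.
have [lt_d|] := ltnP d1 (msize f); last by move/pihomog_gt => E; rewrite E eqxx in d1P.
rewrite (bigD1 (Ordinal lt_d)) //= big1 ?addr0 // => i ne_i.
have ne_i' : (i : nat) != d1 by apply: contra ne_i => /eqP iE; apply/eqP/val_inj.
have [lt_i|lt_i|eq_i] := ltngtP (i : nat) d1; [exact: d1min | | by rewrite eq_i eqxx in ne_i'].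
by apply: d2max; lia.
Qed.

End Homogeneous.

(** * Homogeneous prime ideals and common zeros of forms *)

Section HomogeneousPrimes.
Variables (k : fieldType) (n : nat).
Local Notation R := {mpoly k[n]}.
Local Notation hc := (pihomog mdeg).
Implicit Types (f g u w : R) (d e : nat) (a P W : R -> Prop).

Lemma core_homog P u d : P 0 -> u \is d.-homog -> P u <-> (forall e, P (hc e u)).
Proof.
move=> P0 ud; split => [Pu e|/(_ d)]; last by rewrite pihomog_dE.
have [<-|ne] := eqVneq d e; first by rewrite pihomog_dE.
by rewrite (pihomog_ne0 ne ud).
Qed.

(* Minimality of P is obtained by maximizing its complement instead. *)
Lemma minimal_hom_prime a z e :
  ideal (@whole R) a -> homogeneous a -> z \is e.-homog -> (forall N, ~ a (z ^+ N)) ->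
  exists P, [/\ prime_ideal (@whole R) P, homogeneous P, incl a P, ~ P z &
    forall u d, u \is d.-homog -> P u ->
      exists N w d', [/\ w \is d'.-homog, ~ P w & a (w * u ^+ N)]].
Proof.
move=> ia ha ze az.
(* A [good] set consists of homogeneous elements, is multiplicative and avoids [a]. The powers of
   [z] are put into every [U X], so that the empty chain is bounded too. *)
pose good W := [/\ forall u, W u -> exists d, u \is d.-homog,
  forall u v, W u -> W v -> W (u * v), W 1 & forall u, W u -> ~ a u].
pose U X : R -> Prop := fun u => (exists N, u = z ^+ N) \/ X u.
have zgood : good (U classical_sets.set0).
  split=> [u [[N ->]|//]|u v [[N ->]|//] [[N' ->]|//]||u [[N ->]|//]] //.
  - by exists (e * N)%N; apply: dhomogMn.
  - by left; exists (N + N')%N; rewrite exprD.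
  - by left; exists 0.
have [|X [gX mX]] := @classical_sets.Zorn_bigcup R (fun X => good (U X)).
  move=> F FP Ftot; have [[X0 FX0]|Fe] := boolp.EM (exists X, F X); last first.
    rewrite (_ : classical_sets.bigcup F (fun X => X) = classical_sets.set0) //.
    by apply: predext => u; split=> // -[X FX]; case: Fe; exists X.
  have lift X u : F X -> U X u -> U (classical_sets.bigcup F (fun X => X)) u.
    by move=> FX [zu|Xu]; [left | right; exists X].
  have low u : U (classical_sets.bigcup F (fun X => X)) u -> exists2 X, F X & U X u.
    by move=> [zu|[X FX Xu]]; [exists X0 => //; left | exists X => //; right].
  have mono X Y u : classical_sets.subset X Y -> U X u -> U Y u.
    by move=> XY [zu|Xu]; [left | right; apply: XY].
  split.
  - by move=> u /low[X /FP[H _ _ _]]; apply: H.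
  - move=> u v /low[X FX Xu] /low[Y FY Yv].
    case: (Ftot _ _ FX FY) => XY.
      apply: (lift Y) => //; have [_ H _ _] := FP _ FY.
      by apply: H => //; apply: mono XY Xu.
    apply: (lift X) => //; have [_ H _ _] := FP _ FX.
    by apply: H => //; apply: mono XY Yv.
  - by apply: (lift X0) => //; have [_ _ H _] := FP _ FX0.
  - by move=> u /low[X /FP[_ _ _ H]]; apply: H.
set W := U X in gX; have [Wh WM W1 Wa] := gX.
have max V : good V -> incl W V -> incl V W.
  move=> gV WV u Vu; apply: boolp.contrapT => Wu; apply: (mX V).
    split; first by move=> v Xv; apply: WV; right.
    by move=> VX; apply: Wu; right; apply: VX.
  rewrite (_ : U V = V) //; apply: predext => v; split; last by right.
  by move=> [zv|//]; apply: WV; left.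
have [|||||P' [pP' aP' P'W]] := @exists_prime _ _ (@subring_whole R) a W => //.
  by move=> u au Wu; apply: (Wa u).
have [pP hP] := core_prime pP'; set P := (fun f => _) in pP hP.
have [[_ P'0 P'D P'M] P'1 P'P] := pP'.
have PE u d : u \is d.-homog -> P u <-> P' u.
  by move=> ud; apply: iff_sym; apply: core_homog ud.
exists P; split => //.
- by move=> f af d; apply: aP'; apply: ha.
- by move=> /(PE _ _ ze) /P'W; apply; left; exists 1; rewrite expr1.
have WE u d : u \is d.-homog -> ~ P' u -> W u.
  move=> ud Pu; apply: (max (fun u => (exists d, u \is d.-homog) /\ ~ P' u)); last by split; first exists d.
    split.
    - by move=> v [].
    - move=> v v' [[i vi] Pv] [[i' vi'] Pv']; split; last by case/P'P.
      by exists (i + i')%N; apply: dhomogM.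
    - by split=> //; exists 0%N; apply: dhomog1.
    - by move=> v [_ Pv] av; apply: Pv; apply: aP'.
  by move=> v Wv; split; [apply: Wh | move=> /P'W].
move=> u d ud /(PE _ _ ud) Pu; apply: boolp.contrapT => H.
have Wu : ~ W u by apply: P'W.
(* If no [w * u ^ N] were in [a], the multiplicative set generated by [W] and [u] would be good,
   against maximality. *)
apply: Wu; apply: (max (fun f => exists w N, W w /\ f = w * u ^+ N)); last first.
- by exists 1, 1; rewrite mul1r expr1.
- by move=> w Ww; exists w, 0; rewrite expr0 mulr1.
split.
- move=> _ [w [N [/Wh[i wi] ->]]]; exists (i + d * N)%N.
  by apply: dhomogM => //; apply: dhomogMn.
- move=> _ _ [w [N [Ww ->]]] [w' [N' [Ww' ->]]]; exists (w * w'), (N + N')%N.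
  by split; [apply: WM | rewrite exprD; ring].
- by exists 1, 0; rewrite expr0 mulr1.
- move=> _ [w [N [Ww ->]]] aw; apply: H; exists N, w; have [i wi] := Wh _ Ww.
  by exists i; split=> //; move=> /(PE _ _ wi)/P'W.
Qed.

End HomogeneousPrimes.

Lemma span_of_mul (k : fieldType) (V : algType k) (J J' : finType)
    (w : J -> V) (w' : J' -> V) a v :
  (forall j, span_of w' (a * w j)) -> span_of w v -> span_of w' (a * v).
Proof.
move=> H [c ->]; rewrite mulr_sumr; apply: span_of_sum => j _.
by rewrite -scalerAr; apply: span_ofZ.
Qed.

Lemma homog_msize_le (k : fieldType) n (f : {mpoly k[n]}) d :
  f \is d.-homog -> (msize f <= d.+1)%N.
Proof.
move=> /dhomogP fd; rewrite msizeE; apply/bigmax_leqP_seq => m mf _.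
by rewrite (fd _ mf).
Qed.

Lemma large_monomials (k : fieldType) n (a : {mpoly k[n.+1]} -> Prop) N :
  ideal (@whole {mpoly k[n.+1]}) a -> (forall j, a ('X_j ^+ N.+1)) ->
  forall m, (n.+1 * N.+1 <= mdeg m)%N -> a 'X_[m].
Proof.
move=> [_ _ _ aM] aX m Mm.
have [j Nj] : exists j, (N < m j)%N.
  apply: boolp.contrapT => H; move: Mm; rewrite leqNgt => /negP; apply.
  rewrite mdegE; apply: (@leq_trans (\sum_(i < n.+1) N).+1).
    rewrite ltnS; apply: leq_sum => i _; rewrite leqNgt; apply/negP => lt_i.
    by apply: H; exists i.
  by rewrite sum_nat_const card_ord ltn_mul2l /=.
have -> : m = (m - (U_(j) *+ N.+1) + U_(j) *+ N.+1)%MM.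
  rewrite submK //; apply/mnm_lepP => i; rewrite mulmnE mnm1E.
  by case: eqVneq => [<-|_]; rewrite ?mul1n.
by rewrite mpolyXD -mpolyXn; apply: aM.
Qed.

Section CommonZero.
Variables (k : fieldType) (n r : nat).
Local Notation R := {mpoly k[n.+1]}.
Local Notation hc := (pihomog mdeg).
Variables (F : 'I_r -> R) (d : 'I_r -> nat).
Hypothesis Fd : forall i, F i \is (d i).-homog.

Definition forms_ideal : R -> Prop := fun f => exists g : 'I_r -> R, f = \sum_i g i * F i.

Lemma forms_ideal_ideal : ideal (@whole R) forms_ideal.
Proof.
split=> //.
- by exists (fun=> 0); rewrite big1 // => i _; rewrite mul0r.
- move=> _ _ [g ->] [h ->]; exists (fun i => g i + h i); rewrite -big_split /=.
  by apply: eq_bigr => i _; rewrite mulrDl.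
- move=> u _ _ [g ->]; exists (fun i => u * g i); rewrite mulr_sumr.
  by apply: eq_bigr => i _; rewrite mulrA.
Qed.

Lemma forms_ideal_mem i : forms_ideal (F i).
Proof.
exists (fun j => (j == i)%:R); rewrite (bigD1 i) //= eqxx mul1r big1 ?addr0 //.
by move=> j /negbTE ->; rewrite mul0r.
Qed.

Lemma forms_ideal_comp D f : forms_ideal f ->
  exists2 g : 'I_r -> R, hc D f = \sum_i g i * F i &
    forall i, g i = 0 \/ (d i <= D)%N /\ g i \is (D - d i).-homog.
Proof.
move=> [g ->]; exists (fun i => if (d i <= D)%N then hc (D - d i) (g i) else 0).
  rewrite linear_sum; apply: eq_bigr => i _ /=; case: leqP => dD.
    by rewrite -(pihomog_mulr _ _ (Fd i)) subnK.
  by rewrite (pihomog_mulr_lt _ (Fd i)) // mul0r.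
by move=> i; case: leqP => dD; [right; split => //; apply: pihomogP | left].
Qed.

Lemma forms_ideal_hom : homogeneous forms_ideal.
Proof. by move=> f ff e; have [g -> _] := forms_ideal_comp e ff; exists g. Qed.

(** The projective Nullstellensatz in a form valid over any field, since points need not be closed:
    if no power of X_j is in the ideal, a homogeneous prime containing it and missing X_j is a
    common zero. *)
Lemma no_zero_power : ~ (exists P, proj_point P /\ forall i, P (F i)) ->
  forall j, exists N, forms_ideal ('X_j ^+ N).
Proof.
move=> noP j; apply: boolp.contrapT => H; apply: noP.
have X1 : ('X_j : R) \is 1.-homog by rewrite dhomogX; apply/eqP; apply: mdeg1.
have [|P [pP hP aP Pj _]] := minimal_hom_prime forms_ideal_ideal forms_ideal_hom X1.
  by move=> N aN; apply: H; exists N.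
exists P; split; last by move=> i; apply/aP/forms_ideal_mem.
by split=> //; exists j.
Qed.

Hypotheses (rn : (r <= n)%N) (d0 : forall i, (0 < d i)%N).

(* If the forms had no common zero, all monomials of large degree would lie in their ideal
   and k[z_0..z_n] would be a finite module over k[F_1..F_r]; as r < n + 1 the numbers of
   monomials of bounded degree contradict this. *)
Lemma common_zero : exists P, proj_point P /\ forall i, P (F i).
Proof.
apply: boolp.contrapT => noP.
have pow := no_zero_power noP.
have [N0 N0P] := boolp.choice pow.
pose N := (\sum_j N0 j).+1; pose M := (n.+1 * N)%N.
have powN j : forms_ideal ('X_j ^+ N).
  have leN : (N0 j <= N)%N by rewrite /N (bigD1 j) //= -addnS leq_addr.
  have [_ _ _ aM] := forms_ideal_ideal.
  by rewrite -(subnK leN) exprD; apply: aM.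
have mon m : (M <= mdeg m)%N -> forms_ideal 'X_[m] := large_monomials forms_ideal_ideal powN (m := m).
(* Monomials of degree below M times monomials in the F_i. They span all polynomials of degree at
   most D, because a monomial of degree at least M is a combination of the F_i with coefficients of
   smaller degree. *)
pose w D (b : 'X_{1..n.+1 < M} * {ffun 'I_r -> 'I_D.+1}) : R := 'X_[b.1] * \prod_i F i ^+ b.2 i.
have low D m : (mdeg m < M)%N -> span_of (w D) 'X_[m].
  move=> lt_m; have -> : 'X_[m] = w D (BMultinom lt_m, [ffun=> ord0]).
    by rewrite /w big1 ?mulr1 // => i _; rewrite ffunE expr0.
  exact: span_of_mem.
have spn D f : (msize f <= D.+1)%N -> span_of (w D) f.
  elim: D f => [|D IH] f fD; rewrite [f]mpolyE big_seq; apply: span_of_sum => m mf; apply: span_ofZ;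
    have := leq_trans (msize_mdeg_lt mf) fD; rewrite ltnS => mD.
    by apply: low; move: mD; rewrite leqn0 => /eqP ->.
  have [|le_m] := ltnP (mdeg m) M; first exact: low.
  have Xm : ('X_[m] : R) \is (mdeg m).-homog by rewrite dhomogX; apply/eqP.
  have [g] := forms_ideal_comp (mdeg m) (mon _ le_m); rewrite pihomog_dE // => -> gP.
  apply: span_of_sum => i _; have [->|[di gi]] := gP i; first by rewrite mul0r; apply: span_of0.
  have {}gi : span_of (w D) (g i).
    apply: IH; apply: leq_trans (homog_msize_le gi) _.
    by have := d0 i; lia.
  rewrite mulrC; apply: span_of_mul gi => -[b al] /=.
  have ltal j : (al j + (j == i) < D.+2)%N.
    by have := ltn_ord (al j); case: (j == i); lia.
  have -> : F i * w D (b, al) = w D.+1 (b, [ffun j => Ordinal (ltal j)]).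
    rewrite /w /= mulrCA; congr (_ * _); rewrite (bigD1 i) //= [RHS](bigD1 i) //=.
    rewrite !ffunE /= eqxx addn1 exprS mulrA; congr (_ * _); apply: eq_bigr => j ij.
    by rewrite ffunE /= (negbTE ij) addn0.
  exact: span_of_mem.
pose C := #|{: 'X_{1..n.+1 < M}}|.
(* The (E + 1)^(n+1) monomials with exponents at most E have degree at most D. The spanning elements
   number C (D + 1)^r, at most C (n + 1)^n (E + 1)^n = E (E + 1)^n, which is too few. *)
pose E := (C * n.+1 ^ n)%N; pose D := (n.+1 * E)%N.
have [b||c [b cb]] := lin_dep (u := fun b : {ffun 'I_n.+1 -> 'I_E.+1} => 'X_[bmon b] : R) (w := w D).
- apply: spn; rewrite msizeX ltnS mdegE.
  apply: (@leq_trans (\sum_(i < n.+1) E)).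
    by apply: leq_sum => i _; rewrite mnmE -ltnS.
  by rewrite sum_nat_const card_ord.
- rewrite card_prod !card_ffun !card_ord -/C.
  have leD : (D.+1 <= n.+1 * E.+1)%N by rewrite /D mulnS; lia.
  apply: (@leq_ltn_trans (C * (n.+1 * E.+1) ^ n)).
    rewrite leq_mul2l; apply/orP; right; apply: leq_trans (leq_expn2 _ leD) _.
    by rewrite leq_pexp2l.
  by rewrite expnMn mulnA -/E expnS ltn_pmul2r ?expn_gt0.
- move=> /(congr1 (mcoeff (bmon b))); rewrite bmon_free mcoeff0 => cb0.
  by rewrite cb0 eqxx in cb.
Qed.

End CommonZero.

(** * Regular sequences in polynomial rings *)

Section WeakRegularity.
Variables (D : comNzRingType).
Implicit Types (a p : D -> Prop) (s : seq D).

(** The preimage of the localization of [a] at [p]. It expresses regularity in the local ring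
    without building that ring. *)
Definition loc p a : D -> Prop := fun b => exists2 t, ~ p t & a (t * b).

Definition adjoins a s : D -> Prop := foldl (fun b f => adjoin (@whole D) b f) a s.

Fixpoint loc_regular p a s : Prop :=
  if s is f :: s' then
    (forall b, loc p a (f * b) -> loc p a b) /\ loc_regular p (adjoin (@whole D) a f) s'
  else True.

Lemma loc_regular_rcons p a s f :
  loc_regular p a s -> (forall b, loc p (adjoins a s) (f * b) -> loc p (adjoins a s) b) ->
  loc_regular p a (rcons s f).
Proof. by elim: s a => [|g s IH] a //= [H1 /IH H2] /H2. Qed.

Lemma ideal_adjoin_whole a f : ideal (@whole D) a -> ideal (@whole D) (adjoin (@whole D) a f).
Proof. by move=> ia; apply: ideal_adjoin. Qed.

Lemma common_multiplier p a N (h : nat -> D) :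
  prime_ideal (@whole D) p -> ideal (@whole D) a ->
  (forall i, (i < N)%N -> loc p a (h i)) ->
  exists2 t, ~ p t & forall i, (i < N)%N -> a (t * h i).
Proof.
move=> pp ia; have [_ p1 pP] := pp; have [_ _ _ aM] := ia.
elim: N => [|N IH] H; first by exists 1.
have [i lt_i|t pt tH] := IH; first by apply: H; apply: ltnW.
have [t' pt' t'H] := H N (ltnSn N).
exists (t * t'); first by case/pP.
move=> i; rewrite ltnS leq_eqVlt => /orP[/eqP ->|lt_i]; first by rewrite -mulrA; apply: aM.
by rewrite mulrAC mulrC; apply: aM => //; apply: tH.
Qed.

End WeakRegularity.

Lemma loc_regular_iso (D E : comNzRingType) (f : {rmorphism D -> E}) (g : E -> D) p a s :
  cancel f g -> cancel g f -> loc_regular p a s -> loc_regular (p \o f) (a \o f) (map g s).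
Proof.
move=> fK gK; elim: s a => [|u s IH] a //= [H1 H2]; split.
  move=> b [t pt at_]; have [|t' pt' at'] := H1 (f b).
    by exists (f t) => //; move: at_; rewrite /= !rmorphM gK.
  by exists (g t'); rewrite /= ?gK // rmorphM gK.
rewrite (_ : adjoin _ (a \o f) _ = adjoin (@whole E) a u \o f); first exact: IH.
apply: predext => v /=; split=> [[b [c [ab _ ->]]]|[b [c [ab _ vE]]]].
  by exists (f b), (f c); rewrite rmorphD rmorphM gK.
exists (g b), (g c); split=> //; first by rewrite /= gK.
by rewrite -[v]fK vE -[RHS]fK rmorphD rmorphM !gK.
Qed.

Section PolyRegularity.
Variables (D : comNzRingType) (P : {poly D} -> Prop).
Hypothesis pP : prime_ideal (@whole {poly D}) P.
Implicit Types (a : D -> Prop) (f g h : {poly D}).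

Let p : D -> Prop := fun c => P c%:P.

Definition coefs_in a : {poly D} -> Prop := fun f => forall i, a f`_i.

Lemma prime_contraction : prime_ideal (@whole D) p.
Proof.
have [[_ P0 PD PM] P1 PP] := pP; split; [split=> //|by []|].
- by move=> u v pu pv; rewrite /p rmorphD; apply: PD.
- by move=> u v _ pv; rewrite /p rmorphM; apply: PM.
- by move=> u v _ _; rewrite /p rmorphM => /PP; apply.
Qed.

Lemma coefs_in_ideal a : ideal (@whole D) a -> ideal (@whole {poly D}) (coefs_in a).
Proof.
move=> [_ a0 aD aM]; split=> //.
- by move=> i; rewrite coef0.
- by move=> u v au av i; rewrite coefD; apply: aD.
- by move=> u v _ av i; rewrite coefM; apply: big_ind => // j _; apply: aM.
Qed.

Lemma coefs_in_sub f : coefs_in p f -> P f.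
Proof.
have [[_ P0 PD PM] _ _] := pP => pf; rewrite -[f]coefK poly_def.
by apply: big_ind => // i _; rewrite -mul_polyC mulrC; apply: PM => //; apply: pf.
Qed.

Lemma coefs_in_adjoin a d : ideal (@whole D) a ->
  adjoin (@whole {poly D}) (coefs_in a) d%:P = coefs_in (adjoin (@whole D) a d).
Proof.
move=> [_ a0 _ _]; apply: predext => f; split.
  by move=> [b [c [ab _ ->]]] i; exists b`_i, c`_i; rewrite coefD coefMC.
move=> af; have /boolp.choice[c cP] : forall i, exists c, a (f`_i - c * d).
  by move=> i; have [b [c [ab _ ->]]] := af i; exists c; rewrite addrK.
pose q := \poly_(i < size f) c i.
exists (f - q * d%:P), q; split=> //; last by rewrite subrK.
move=> i; rewrite coefB coefMC coef_poly; case: ltnP => // le_i.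
by rewrite nth_default // mul0r subr0.
Qed.

Lemma coefs_in_regular a d : ideal (@whole D) a ->
  (forall b, loc p a (d * b) -> loc p a b) ->
  forall f, loc P (coefs_in a) (d%:P * f) -> loc P (coefs_in a) f.
Proof.
move=> ia reg f [t Pt at_]; have [_ p1 _] := prime_contraction.
have [i lt_i|u pu uH] := @common_multiplier D p a (size (t * f)) (nth 0 (t * f)) prime_contraction ia.
  by apply: reg; exists 1 => //; rewrite mul1r -coefCM mulrCA.
have [_ _ PP] := pP; exists (u%:P * t); first by case/PP.
move=> i; rewrite -mulrA coefCM; have [lt_i|le_i] := ltnP i (size (t * f)); first exact: uH.
by rewrite nth_default // mulr0; case: ia.
Qed.

Lemma coefs_in_loc_regular a s : ideal (@whole D) a ->
  loc_regular p a s -> loc_regular P (coefs_in a) [seq d%:P | d <- s].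
Proof.
elim: s a => [|d s IH] a ia //= [reg /IH H]; split; first exact: coefs_in_regular.
by rewrite coefs_in_adjoin //; apply/H/ideal_adjoin_whole.
Qed.

Lemma coefs_in_adjoins a s : ideal (@whole D) a ->
  adjoins (coefs_in a) [seq d%:P | d <- s] = coefs_in (adjoins a s).
Proof.
elim: s a => [|d s IH] a ia //=; rewrite -IH /adjoins /= ?coefs_in_adjoin //.
exact: ideal_adjoin_whole.
Qed.

(* The argument of McCoy's theorem, applied to the leading coefficient. *)
Lemma lead_coef_regular a g : ideal (@whole D) a -> ~ p (lead_coef g) ->
  forall f, loc P (coefs_in a) (g * f) -> loc P (coefs_in a) f.
Proof.
move=> ia pg f [t Pt at_]; have [_ a0 aD aM] := ia.
have [_ p1 pPr] := prime_contraction; have [_ _ PP] := pP.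
suff [u pu uH] : exists2 u, ~ p u & forall i, a (u * (t * f)`_i).
  by exists (u%:P * t); [case/PP | move=> i; rewrite -mulrA coefCM].
have : coefs_in a (g * (t * f)) by rewrite mulrCA.
elim: {f t Pt at_}_.+1 {-2}(t * f) (ltnSn (size (t * f))) => // N IH h; rewrite ltnS => hN gh.
have [->|h0] := eqVneq h 0; first by exists 1 => // i; rewrite coef0 mulr0.
have hs : (0 < size h)%N by rewrite size_poly_gt0.
have alh : a (lead_coef g * lead_coef h).
  by have := gh (size g + size h).-2; rewrite -mul_lead_coef.
set c := lead_coef g in pg alh *.
(* Modulo [a] the polynomial [c%:P * h] loses its top term, because [c * lead_coef h] is the top
   coefficient of [g * h]. Hence the induction on the size. *)
pose h' := \poly_(i < (size h).-1) (c * h`_i).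
have hE : c%:P * h = h' + (c * lead_coef h)%:P * 'X^((size h).-1).
  apply/polyP => i; rewrite coefCM coefD coef_poly coefCM coefXn.
  have [lt_i|lt_i|->] := ltngtP i (size h).-1; rewrite ?mulr0 ?addr0 ?mulr1 ?add0r //.
  by rewrite nth_default ?mulr0 // -(prednK hs).
have ich := coefs_in_ideal ia.
have [||u pu uH] := IH h'.
- by apply: leq_ltn_trans (size_poly _ _) _; rewrite prednK.
- have -> : g * h' = c%:P * (g * h) - (g * 'X^((size h).-1)) * (c * lead_coef h)%:P.
    by rewrite mulrCA hE; ring.
  have [_ _ _ iM] := ich; apply: (idealB (@subring_whole _) ich); first exact: iM.
  by apply: iM => // i; rewrite coefC; case: eqP.
exists (u * c); first by case/pPr.
move=> i; rewrite -mulrA -coefCM hE coefD mulrDr; apply: aD; first exact: uH.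
by rewrite coefCM; apply: (aM) => //; rewrite mulrC; apply: (aM).
Qed.

Lemma loc_regular_extend a s g : ideal (@whole D) a -> loc_regular p a s ->
  ~ p (lead_coef g) -> loc_regular P (coefs_in a) (rcons [seq d%:P | d <- s] g).
Proof.
move=> ia sreg pg; apply: loc_regular_rcons; first exact: coefs_in_loc_regular.
rewrite coefs_in_adjoins //; apply: lead_coef_regular => //.
by rewrite /adjoins; elim: s a ia {sreg} => [|d t IHt] a ia //=; apply/IHt/ideal_adjoin_whole.
Qed.

End PolyRegularity.

Section AlgebraicIndependence.
Variables (k : fieldType) (L : comNzRingType) (c : {rmorphism k -> L}) (A : L -> Prop).
Implicit Types (p : L -> Prop).

Definition alg_indep p m (w : 'I_m -> L) : Prop :=
  forall Q : {mpoly k[m]}, p (mmap c w Q) -> Q = 0.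

Definition snoc m (w : 'I_m -> L) (u : L) : 'I_m.+1 -> L :=
  fun i => oapp w u (unlift ord_max i).

Lemma mmap_snoc m (w : 'I_m -> L) u Q :
  mmap c (snoc w u) Q = (map_poly (mmap c w) (muni Q)).[u].
Proof.
pose f : {rmorphism _ -> _} := mmap c (snoc w u).
pose g : {rmorphism _ -> _} := horner_eval u \o map_poly (mmap c w) \o @muni m k.
apply: (@mpoly_rmorph_ext k m.+1 _ f g) => [d|i] /=.
  by rewrite mmapC muniC map_polyC /= mmapC /horner_eval hornerC.
rewrite mmapX mmap1U /snoc; case: unliftP => [j iE|iE] /=; rewrite iE; last first.
  by rewrite muni_max map_polyX /horner_eval hornerX.
have -> : lift ord_max j = widen_ord (leqnSn m) j.
  by apply/val_inj; rewrite /= /bump leqNgt ltn_ord.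
by rewrite -mwidenXi muni_widen map_polyC /horner_eval hornerC /= mmapX mmap1U.
Qed.

Hypotheses (subA : is_subring A) (cA : forall d, A (c d)).

Lemma mmap_subring m (w : 'I_m -> L) Q : (forall i, A (w i)) -> A (mmap c w Q).
Proof.
move=> Aw; have [A1 _ AM] := subA; rewrite /mmap.
apply: big_ind => [|u v|m' _]; [exact: subring0 | exact: subringD|].
apply: (AM) => //; rewrite /mmap1; apply: big_ind => // i _.
exact: subringX.
Qed.

(** In a relation modulo [p], the part free of [u] is in [q], hence zero; what remains is a multiple
    of [u], which cancels because [u] is outside [p]. A strict inclusion of primes thus gains one
    independent element. *)
Lemma alg_indep_snoc p q m (w : 'I_m -> L) u :
  prime_ideal A p -> ideal A q -> incl p q -> q u -> ~ p u -> (forall i, A (w i)) ->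
  alg_indep q w -> alg_indep p (snoc w u).
Proof.
move=> [[pA p0 pD pM] p1 pP] iq pq qu pu Aw wq Q; have [qA _ _ qM] := iq.
rewrite mmap_snoc => H; apply: (@muni_inj k m); rewrite rmorph0.
have Ah (r : {poly {mpoly k[m]}}) : A (map_poly (mmap c w) r).[u].
  elim/poly_ind: r => [|r d IH]; first by rewrite rmorph0 horner0; apply: subring0.
  rewrite rmorphD rmorphM /= map_polyX map_polyC hornerMXaddC.
  by have [_ _ AM] := subA; apply: subringD => //; [apply: AM => //; apply: qA | apply: mmap_subring].
elim/poly_ind: (muni Q) H => [//|r d IH].
rewrite rmorphD rmorphM /= map_polyX map_polyC hornerMXaddC => H.
have d0 : d = 0.
  apply: wq; have -> : mmap c w d = ((map_poly (mmap c w) r).[u] * u + mmap c w d)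
    - (map_poly (mmap c w) r).[u] * u by rewrite addrC addKr.
  by apply: (idealB subA iq); [exact: pq | apply: qM].
have {}H : p ((map_poly (mmap c w) r).[u] * u) by move: H; rewrite d0 raddf0 addr0.
rewrite d0 addr0; have [|/IH ->|//] := pP _ _ (Ah r) _ H; last by rewrite mul0r.
exact: qA.
Qed.

End AlgebraicIndependence.

(* A maximal regular sequence in the prime p, together with elements lifting a transcendence
   basis modulo p: p contains a polynomial with leading coefficient outside p in the variables
   that are algebraic over the previous ones modulo p, and no condition for the others. *)
Lemma regular_sequence_mpoly (k : fieldType) n (p : {mpoly k[n]} -> Prop) :
  prime_ideal (@whole {mpoly k[n]}) p ->
  exists e (w : 'I_e -> {mpoly k[n]}) (s : seq {mpoly k[n]}),
    [/\ (e + size s)%N = n, forall f, f \in s -> p f, loc_regular p (fun f => f = 0) s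
      & alg_indep (mpolyC n (R := k)) p w].
Proof.
elim: n p => [|n IH] p pp.
  exists 0, (fun=> 0), [::]; split=> // Q pQ; rewrite (nvar0_mpolyC Q) in pQ *.
  rewrite mmapC in pQ; have [[_ _ _ pM] p1 _] := pp.
  have [->|c0] := eqVneq (Q@_0%MM) 0; first by rewrite mpolyC0.
  case: p1; have -> : 1 = (Q@_0%MM)^-1%:MP * (Q@_0%MM)%:MP_[0] :> {mpoly k[0]}.
    by rewrite -mpolyCM mulVf.
  exact: pM.
pose P f := p (mmulti f).
have mmD (f g : {poly {mpoly k[n]}}) : mmulti (f + g) = mmulti f + mmulti g.
  by apply: (@muni_inj k n); rewrite muniD !mmultiK.
have mmM (f g : {poly {mpoly k[n]}}) : mmulti (f * g) = mmulti f * mmulti g.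
  by apply: (@muni_inj k n); rewrite muniM !mmultiK.
have pP : prime_ideal (@whole {poly {mpoly k[n]}}) P.
  have [[_ p0 pD pM] p1 pPr] := pp; split; [split=> //| |].
  - by rewrite /P (_ : mmulti 0 = 0) //; apply: (@muni_inj k n); rewrite rmorph0 mmultiK.
  - by move=> u v; rewrite /P mmD; apply: pD.
  - by move=> u v _; rewrite /P mmM => Pv; apply: pM.
  - by rewrite /P (_ : mmulti 1 = 1) //; apply: (@muni_inj k n); rewrite rmorph1 mmultiK.
  - by move=> u v _ _; rewrite /P mmM; apply: pPr I I.
have mmC (f : {mpoly k[n]}) : mmulti f%:P = mwiden f.
  by apply: (@muni_inj k n); rewrite mmultiK muni_widen.
have [e [w [s [es sp sreg wind]]]] := IH _ (prime_contraction pP).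
have PE f : P (muni f) <-> p f by rewrite /P muniK.
have zE : (fun f : {poly {mpoly k[n]}} => f = 0) = coefs_in (fun f => f = 0).
  by apply: predext => f; split=> [-> i|H]; [rewrite coef0 | apply/polyP => i; rewrite coef0].
have iz : ideal (@whole {mpoly k[n]}) (fun f => f = 0).
  by split=> // [u v -> ->|u v _ ->]; rewrite ?addr0 ?mulr0.
have transport t : loc_regular P (fun f => f = 0) t ->
    loc_regular p (fun f => f = 0) [seq mmulti f | f <- t].
  move/(loc_regular_iso (f := @muni n k) (@muniK _ _) (@mmultiK _ _)).
  rewrite (_ : P \o _ = p); last by apply: predext => f; apply: PE.
  rewrite (_ : _ \o _ = (fun f => f = 0)) //.
  apply: predext => f /=; split=> [f0|->]; last exact: rmorph0.
  by apply: (@muni_inj k n); rewrite rmorph0.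
have PregS : loc_regular P (fun f => f = 0) [seq d%:P | d <- s].
  by rewrite zE; apply: coefs_in_loc_regular.
have wE (Q : {mpoly k[e]}) : mmap (mpolyC n.+1 (R := k)) (@mwiden n k \o w) Q
    = mwiden (mmap (mpolyC n (R := k)) w Q).
  pose f : {rmorphism _ -> _} := mmap (mpolyC n.+1 (R := k)) (@mwiden n k \o w).
  pose g : {rmorphism _ -> _} := @mwiden n k \o mmap (mpolyC n (R := k)) w.
  apply: (@mpoly_rmorph_ext k e _ f g) => [c|i] /=; first by rewrite !mmapC mwidenC.
  by rewrite !mmapX !mmap1U.
(* If some polynomial in [P] has a coefficient outside the contracted prime, it leads to one more
   regular element; if none has, the last variable stays independent modulo [p]. *)
have [[f Pf nf]|alg] := boolp.EM (exists2 f, P f & ~ coefs_in (P \o polyC) f); last first.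
  exists e.+1, (snoc (@mwiden n k \o w) 'X_ord_max), [seq mmulti f | f <- [seq d%:P | d <- s]].
  split; [by rewrite !size_map addSn es | | exact: transport |].
    by move=> _ /mapP[_ /mapP[d /sp pd ->] ->]; move: pd; rewrite /= /P.
  move=> Q pQ; apply: (@muni_inj k e); rewrite rmorph0; apply/polyP => i; rewrite coef0; apply: wind.
  have QE : muni (mmap (mpolyC n.+1 (R := k)) (snoc (@mwiden n k \o w) 'X_ord_max) Q)
      = map_poly (mmap (mpolyC n (R := k)) w) (muni Q).
    pose f : {rmorphism _ -> _} := @muni n k \o mmap (mpolyC n.+1 (R := k)) (snoc (@mwiden n k \o w) 'X_ord_max).
    pose g : {rmorphism _ -> _} := map_poly (mmap (mpolyC n (R := k)) w) \o @muni e k.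
    apply: (@mpoly_rmorph_ext k e.+1 _ f g) => [c|j] /=.
      by rewrite mmapC !muniC map_polyC /= mmapC.
    rewrite mmapX mmap1U /snoc; case: unliftP => [j' jE|jE] /=; rewrite jE; last first.
      by rewrite !muni_max map_polyX.
    have -> : lift ord_max j' = widen_ord (leqnSn e) j'.
      by apply/val_inj; rewrite /= /bump leqNgt ltn_ord.
    by rewrite muni_widen -mwidenXi muni_widen map_polyC /= mmapX mmap1U.
  rewrite -coef_map /= -QE; apply: boolp.contrapT => nQ; apply: alg.
  by eexists; [apply/PE; exact: pQ | move=> /(_ i)].
have [p0 _ _] := prime_contraction pP; have [_ q0 qD qM] := p0.
have coefP := coefs_in_sub pP.
have ex : exists i, boolp.asbool (~ P (f`_i)%:P).
  by have [i ni] := (boolp.existsNP _).2 nf; exists i; apply/boolp.asboolP.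
have bnd i : boolp.asbool (~ P (f`_i)%:P) -> (i <= size f)%N.
  move=> /boolp.asboolP nfi; rewrite leqNgt; apply/negP => /ltnW le_i; apply: nfi.
  by rewrite nth_default.
case: (ex_maxnP ex bnd) => i /boolp.asboolP nfi imax.
(* Cutting [f] above its last coefficient outside the contracted prime changes it by an element of
   [P] and puts the leading coefficient of [g] outside, as [loc_regular_extend] requires. *)
pose g := take_poly i.+1 f.
have lg : lead_coef g = f`_i.
  have fi0 : f`_i != 0 by apply/eqP => fi0; apply: nfi; rewrite fi0.
  have gi : g`_i = f`_i by rewrite coef_take_poly ltnSn.
  rewrite /lead_coef; suff -> : size g = i.+1 by [].
  apply/eqP; rewrite eqn_leq size_take_poly ltnNge; apply/negP => le_g.
  by move: fi0; rewrite -gi nth_default ?eqxx.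
have Pg : P g.
  have [iP _ _] := pP.
  have -> : g = f - (f - g) by ring.
  apply: (idealB (@subring_whole _) iP Pf); apply: coefP => j /=.
  rewrite coefB coef_take_poly; case: ltnP => [_|lt_j]; first by rewrite subrr.
  rewrite subr0; apply: boolp.contrapT => /boolp.asboolP/imax.
  by rewrite leqNgt lt_j.
exists e, (@mwiden n k \o w), [seq mmulti f | f <- rcons [seq d%:P | d <- s] g].
split.
- by rewrite size_map size_rcons size_map addnS es.
- move=> u /mapP[h]; rewrite mem_rcons in_cons => /orP[/eqP hg|/mapP[d /sp pd hd]] uE.
    by rewrite uE hg.
  by rewrite uE hd.
- apply: transport; have := loc_regular_extend pP iz sreg (g := g); rewrite -zE.
  by apply; rewrite lg.
- by move=> Q; rewrite wE -mmC => /wind.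
Qed.

(** * Homogeneous localization *)

(* Proved in an abstract field, since computing in the fraction field of a polynomial ring is slow. *)
Section FieldIdentities.
Variables (F : fieldType).
Implicit Types (b f g h : F).

Lemma frac_sub f g f' g' : g != 0 -> g' != 0 ->
  f / g - f' / g' = (f * g' - f' * g) / (g * g').
Proof. by move=> g0 g0'; field; rewrite g0 g0'. Qed.

Lemma frac_add f g f' g' : g != 0 -> g' != 0 ->
  f / g + f' / g' = (g' * f + g * f') / (g * g').
Proof. by move=> g0 g0'; field; rewrite g0 g0'. Qed.

Lemma frac_simpl s f g : s != 0 -> (s * f) / (s * g) = f / g.
Proof. by move=> s0; rewrite -mulf_div divff ?mul1r. Qed.

Lemma frac_adjoin b h c h' f g : h != 0 -> h' != 0 -> g != 0 ->
  b / h + c / h' * (f / g) = (b * (h' * g) + h * (c * f)) / (h * (h' * g)).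
Proof. by move=> h0 h0' g0; field; rewrite h0 h0' g0. Qed.

Lemma frac_split b c f g h : h != 0 -> g != 0 ->
  (b + c * f) / h = b / h + c * g / h * (f / g).
Proof. by move=> h0 g0; field; rewrite h0 g0. Qed.

Lemma frac_sub1 f g f' g' : g != 0 -> g' != 0 ->
  f / g * (f' / g') - 1 = (f * f' - g * g') / (g * g').
Proof. by move=> g0 g0'; field; rewrite g0 g0'. Qed.

Lemma frac_change f g h : g != 0 -> f / h = g / h * (f / g).
Proof. by move=> g0; rewrite [RHS]mulrC -mulrA mulKf. Qed.

Lemma frac_reduce f g s t z e : g != 0 -> s != 0 -> z != 0 ->
  f / g - t * z / (s * g) * (e / z) = (s * f - t * e) / (s * g).
Proof. by move=> g0 s0 z0; field; rewrite g0 s0 z0. Qed.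

End FieldIdentities.

Section HomogeneousLocalization.
Variables (k : fieldType) (n : nat).
Local Notation S := {mpoly k[n]}.
Local Notation hc := (pihomog mdeg).
Local Notation "f %:F" := (@FracField.tofrac S f).
Implicit Types (f g b s : S) (a p P I : S -> Prop) (u v : {fraction S}).

Lemma tofrac_neq0 P g : P 0 -> ~ P g -> g%:F != 0.
Proof. by move=> P0 Pg; rewrite tofrac_eq0; apply/eqP => g0; apply: Pg; rewrite g0. Qed.

Definition hloc P a : S -> Prop :=
  fun b => exists s d, [/\ s \is d.-homog, ~ P s & a (s * b)].

(** Regularity is tested on homogeneous elements and up to a multiplier outside [P]: degree-zero
    fractions see no more than that. *)
Fixpoint hom_regular P a (t : seq S) : Prop :=
  if t is f :: t' then
    (forall b d, b \is d.-homog -> loc P a (f * b) -> loc P a b) /\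
    hom_regular P (adjoin (@whole S) a f) t'
  else True.

Section At.
Variables (P : S -> Prop).
Hypotheses (pP : prime_ideal (@whole S) P) (hP : homogeneous P).

Let P0 : P 0. Proof. by case: pP => -[]. Qed.
Let P1 : ~ P 1. Proof. by case: pP. Qed.
Let PM f g : ~ P f -> ~ P g -> ~ P (f * g).
Proof. by case: pP => _ _ PP Pf Pg /PP[]. Qed.

Lemma not_prime0 g : ~ P g -> g%:F != 0.
Proof. exact: tofrac_neq0. Qed.

Lemma hlocal_subring : is_subring (hlocal P).
Proof.
split.
- by exists 0, 1, 1; rewrite divr1 tofrac1; split=> //; apply: dhomog1.
- move=> _ _ [d [f [g [fd gd Pg ->]]]] [e [f' [g' [fe ge Pg' ->]]]].
  exists (d + e)%N, (f * g' - f' * g), (g * g'); split.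
  + by apply: rpredB; [apply: dhomogM | rewrite addnC; apply: dhomogM].
  + exact: dhomogM.
  + exact: PM.
  + have g0 := not_prime0 Pg; have g0' := not_prime0 Pg'.
    by rewrite (frac_sub _ _ g0 g0') tofracB !tofracM.
- move=> _ _ [d [f [g [fd gd Pg ->]]]] [e [f' [g' [fe ge Pg' ->]]]].
  exists (d + e)%N, (f * f'), (g * g'); split; [exact: dhomogM | exact: dhomogM | exact: PM |].
  by rewrite mulf_div !tofracM.
Qed.

Lemma hlocal_ideal_ideal a : ideal (@whole S) a -> ideal (hlocal P) (hlocal_ideal P a).
Proof.
move=> [_ a0 aD aM]; split.
- by move=> _ [d [f [g [fd gd Pg _ ->]]]]; exists d, f, g.
- by exists 0, 0, 1; rewrite tofrac0 mul0r; split=> //; [apply: dhomog0 | apply: dhomog1].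
- move=> _ _ [d [f [g [fd gd Pg af ->]]]] [e [f' [g' [fe ge Pg' af' ->]]]].
  exists (d + e)%N, (g' * f + g * f'), (g * g'); split.
  + by apply: rpredD; [rewrite addnC; apply: dhomogM | apply: dhomogM].
  + exact: dhomogM.
  + exact: PM.
  + by apply: aD; apply: aM.
  + have g0 := not_prime0 Pg; have g0' := not_prime0 Pg'.
    by rewrite (frac_add _ _ g0 g0') tofracD !tofracM.
- move=> _ _ [d [f [g [fd gd Pg ->]]]] [e [f' [g' [fe ge Pg' af' ->]]]].
  exists (d + e)%N, (f * f'), (g * g').
  split; [exact: dhomogM | exact: dhomogM | exact: PM | exact: aM |].
  by rewrite mulf_div !tofracM.
Qed.

Lemma hlocal_ideal_frac a f g d : ideal (@whole S) a ->
  f \is d.-homog -> g \is d.-homog -> ~ P g ->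
  hlocal_ideal P a (f%:F / g%:F) <-> hloc P a f.
Proof.
move=> [_ a0 aD aM] fd gd Pg; have g0 := not_prime0 Pg; split.
  move=> [e [f' [g' [fe ge Pg' af' /eqP]]]]; have g0' := not_prime0 Pg'.
  rewrite (eqr_div _ _ g0 g0') -!tofracM tofrac_eq => /eqP E.
  by exists g', e; split=> //; rewrite mulrC E mulrC; apply: aM.
move=> [s [e [se Ps asf]]]; exists (e + d)%N, (s * f), (s * g).
split; [exact: dhomogM | exact: dhomogM | exact: PM | by [] |].
by rewrite !tofracM (frac_simpl _ _ (not_prime0 Ps)).
Qed.

Lemma hloc_ideal a : ideal (@whole S) a -> ideal (@whole S) (hloc P a).
Proof.
move=> [_ a0 aD aM]; split=> //.
- by exists 1, 0; rewrite mulr0; split=> //; apply: dhomog1.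
- move=> f g [s [d [sd Ps af]]] [t [e [te Pt ag]]]; exists (s * t), (d + e)%N.
  split; [exact: dhomogM | exact: PM |].
  rewrite (_ : _ * _ = t * (s * f) + s * (t * g)); last by ring.
  by apply: aD; apply: aM.
- move=> f g _ [s [d [sd Ps ag]]]; exists s, d; split=> //.
  by rewrite mulrCA; apply: aM.
Qed.

Lemma hloc_incl a : incl a (hloc P a).
Proof. by move=> f af; exists 1, 0; rewrite mul1r; split=> //; apply: dhomog1. Qed.

Lemma hloc_prime p f : prime_ideal (@whole S) p -> incl p P -> hloc P p f -> p f.
Proof. by move=> [_ _ pp] pP' [s [d [_ Ps /pp[]]]] // /pP'. Qed.

Lemma loc_hloc a f d : homogeneous a -> f \is d.-homog -> loc P a f -> hloc P a f.
Proof.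
move=> ha fd [t Pt atf].
have [e Pe] : exists e, ~ P (hc e t).
  apply/boolp.existsNP => H; apply: Pt; apply: hom_mem => //.
  by case: pP.
exists (hc e t), e; split=> //; first exact: pihomogP.
by rewrite -(pihomog_mulr _ _ fd); apply: ha.
Qed.

Lemma homogeneous_adjoin a f d : homogeneous a -> f \is d.-homog ->
  ideal (@whole S) a -> homogeneous (adjoin (@whole S) a f).
Proof.
move=> ha fd [_ a0 _ _] _ [b [c [ab _ ->]]] e; rewrite linearD /=.
have [le_d|lt_e] := leqP d e.
  rewrite -{2}(subnK le_d) (pihomog_mulr _ _ fd).
  by exists (hc e b), (hc (e - d) c); split=> //; apply: ha.
rewrite (pihomog_mulr_lt _ fd) // addr0.
by exists (hc e b), 0; rewrite mul0r addr0; split=> //; apply: ha.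
Qed.

Lemma hlocal_ideal_adjoin a f g d : ideal (@whole S) a -> homogeneous a ->
  f \is d.-homog -> g \is d.-homog -> ~ P g ->
  adjoin (hlocal P) (hlocal_ideal P a) (f%:F / g%:F) = hlocal_ideal P (adjoin (@whole S) a f).
Proof.
move=> ia ha fd gd Pg; have [_ a0 aD aM] := ia; have g0 := not_prime0 Pg.
apply: predext => u; split.
  move=> [_ [_ [[i [b [h [bi hi Ph ab ->]]]] [j [c [h' [cj hj Ph' ->]]]] ->]]].
  have h0 := not_prime0 Ph; have h0' := not_prime0 Ph'.
  exists (i + (j + d))%N, (b * (h' * g) + h * (c * f)), (h * (h' * g)).
  split.
  - by apply: rpredD; do 2?[apply: dhomogM => //].
  - by do 2?[apply: dhomogM => //].
  - by do 2?[apply: PM => //].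
  - by exists (b * (h' * g)), (h * c); split; [rewrite mulrC; apply: aM | by [] | rewrite -[h * c * f]mulrA].
  - by rewrite (frac_adjoin _ _ _ h0 h0' g0) tofracD !tofracM.
move=> [e [f' [h [be he Ph [b [c [ab _ fE]]] ->]]]]; rewrite {}fE in be *; have h0 := not_prime0 Ph.
have bE : b + c * f = hc e b + (if (d <= e)%N then hc (e - d) c else 0) * f.
  rewrite -[LHS](pihomog_dE be) linearD /=; congr (_ + _).
  case: leqP => de; last by rewrite (pihomog_mulr_lt _ fd) // mul0r.
  by rewrite -(pihomog_mulr _ _ fd) subnK.
rewrite bE; set c' := if _ then _ else _.
exists ((hc e b)%:F / h%:F), ((c' * g)%:F / h%:F); split.
- by exists e, (hc e b), h; split=> //; [apply: pihomogP | apply: ha].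
- exists e, (c' * g), h; split=> //; rewrite /c'; case: leqP => de.
    by rewrite -(subnK de); apply: dhomogM => //; rewrite subnK //; apply: pihomogP.
  by rewrite mul0r; apply: dhomog0.
- by rewrite tofracD !tofracM; exact: (frac_split _ _ _ h0 g0).
Qed.

Lemma hom_regular_frac a (s : seq (S * S)) : ideal (@whole S) a -> homogeneous a ->
  (forall w, w \in s -> exists d, [/\ w.1 \is d.-homog, w.2 \is d.-homog & ~ P w.2]) ->
  hom_regular P a [seq w.1 | w <- s] ->
  regular_seq (hlocal P) (hlocal_ideal P a) [seq w.1%:F / w.2%:F | w <- s].
Proof.
elim: s a => [|[f g] s IH] a ia ha //= sP [reg sreg].
have [d [/= fd gd Pg]] := sP _ (mem_head _ _); split; last first.
  rewrite (hlocal_ideal_adjoin ia ha fd gd Pg); apply: IH => //.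
  - exact: ideal_adjoin_whole.
  - exact: homogeneous_adjoin fd ia.
  - by move=> w ws; apply: sP; rewrite in_cons ws orbT.
move=> _ [e [b [h [be he Ph ->]]]]; have h0 := not_prime0 Ph; have g0 := not_prime0 Pg.
rewrite (hlocal_ideal_frac ia be he Ph) mulf_div -!tofracM.
rewrite (hlocal_ideal_frac ia (dhomogM fd be) (dhomogM gd he) (PM Pg Ph)).
move=> [t [i [_ Pt afb]]]; apply: (loc_hloc ha be); apply: (reg _ _ be).
by exists t.
Qed.

Variable (i0 : 'I_n).
Hypothesis Pi0 : ~ P 'X_i0.

Lemma Xexp_homog d : ('X_i0 : S) ^+ d \is d.-homog.
Proof. by rewrite -{2}[d]mul1n; apply: dhomogMn; rewrite dhomogX; apply/eqP; apply: mdeg1. Qed.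

Lemma not_prime_Xexp d : ~ P ('X_i0 ^+ d).
Proof.
elim: d => [|d IH]; rewrite ?expr0 // exprS.
exact: PM.
Qed.

(** The element b need not be homogeneous: each of its components becomes a degree-zero fraction
    after division by a power of X_i0, which is outside P. *)
Lemma frac_regular_hloc a f g d : ideal (@whole S) a -> homogeneous a ->
  f \is d.-homog -> g \is d.-homog -> ~ P g ->
  (forall u, hlocal P u -> hlocal_ideal P a (f%:F / g%:F * u) -> hlocal_ideal P a u) ->
  forall b, hloc P a (f * b) -> hloc P a b.
Proof.
move=> ia ha fd gd Pg reg b [s [e [se Ps asfb]]].
apply: (hom_mem (hloc_ideal ia)) => i.
have bi : hc i b \is i.-homog by apply: pihomogP.
have zi := Xexp_homog i; have Pz := @not_prime_Xexp i.
apply/(hlocal_ideal_frac ia bi zi Pz)/reg.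
  by exists i, (hc i b), ('X_i0 ^+ i).
rewrite mulf_div -!tofracM (hlocal_ideal_frac ia (dhomogM fd bi) (dhomogM gd zi) (PM Pg Pz)).
exists s, e; split=> //; rewrite mulrA mulrC -(pihomog_mulr _ _ (dhomogM se fd)).
by apply: ha; rewrite mulrC -mulrA.
Qed.

Lemma hlocal_ideal_prime p : prime_ideal (@whole S) p -> incl p P ->
  prime_ideal (hlocal P) (hlocal_ideal P p).
Proof.
move=> pp pP'; have [ip p1 pM] := pp; split; first exact: hlocal_ideal_ideal.
  rewrite -[1](@divr1 _ 1) -tofrac1 (hlocal_ideal_frac ip (dhomog1 _ _) (dhomog1 _ _) P1).
  by move/(hloc_prime pp pP').
move=> _ _ [d [f [g [fd gd Pg ->]]]] [e [f' [g' [fe ge Pg' ->]]]].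
rewrite mulf_div -!tofracM (hlocal_ideal_frac ip (dhomogM fd fe) (dhomogM gd ge) (PM Pg Pg')).
rewrite (hlocal_ideal_frac ip fd gd Pg) (hlocal_ideal_frac ip fe ge Pg').
by move=> /(hloc_prime pp pP')/pM[]// pf; [left | right]; apply: hloc_incl.
Qed.

Lemma hlocal_ideal_mono a a' : incl a a' -> incl (hlocal_ideal P a) (hlocal_ideal P a').
Proof. by move=> aa' _ [d [f [g [fd gd Pg /aa' af ->]]]]; exists d, f, g. Qed.

Lemma hlocal_ideal_proper a a' f d : ideal (@whole S) a ->
  f \is d.-homog -> a' f -> ~ hloc P a f -> ~ incl (hlocal_ideal P a') (hlocal_ideal P a).
Proof.
move=> ia fd af naf H; apply: naf.
apply/(hlocal_ideal_frac ia fd (Xexp_homog d) (@not_prime_Xexp d)); apply: H.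
by exists d, f, ('X_i0 ^+ d); split=> //; [apply: Xexp_homog | apply: not_prime_Xexp].
Qed.

Lemma nonunit_hlocal I f g d : ideal (@whole S) I -> incl I P ->
  f \is d.-homog -> g \is d.-homog -> ~ P g ->
  nonunit (hlocal P) (hlocal_ideal P I) (f%:F / g%:F) <-> P f.
Proof.
move=> ii IP fd gd Pg; have [_ I0 _ _] := ii; have g0 := not_prime0 Pg; split.
  move=> [_ H]; apply: boolp.contrapT => Pf; have f0 := not_prime0 Pf; apply: H.
  exists (g%:F / f%:F); split; first by exists d, g, f.
  rewrite (frac_sub1 _ _ g0 f0) mulrC [g%:F * _]mulrC subrr mulr0.
  by case: (hlocal_ideal_ideal ii).
move=> Pf; split; first by exists d, f, g.
move=> [_ [[e [f' [g' [fe ge Pg' ->]]]]]]; have g0' := not_prime0 Pg'.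
rewrite (_ : _ - 1 = (f * f' - g * g')%:F / (g * g')%:F); last first.
  by rewrite (frac_sub1 _ _ g0 g0') tofracB !tofracM.
have ffd : f * f' - g * g' \is (d + e).-homog by apply: rpredB; apply: dhomogM.
rewrite (hlocal_ideal_frac ii ffd (dhomogM gd ge) (PM Pg Pg')).
move=> [s [i [_ Ps /IP]]]; have [[_ _ PD PMl] _ PP] := pP.
move/PP=> [] // PE; apply: (PM Pg Pg').
rewrite (_ : g * g' = f' * f - (f * f' - g * g')); last by ring.
have [iP _ _] := pP.
by apply: (idealB (@subring_whole S) iP) => //; apply: PMl.
Qed.

(** The way in which Cohen-Macaulayness is used as a hypothesis: dimension equals depth, so a chain
    of primes is matched by a regular sequence at least as long. *)
Lemma CM_regular I l : ideal (@whole S) I ->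
  CM_local_ring (hlocal P) (hlocal_ideal P I) ->
  strict_chain (fun q => prime_ideal (hlocal P) q /\ incl (hlocal_ideal P I) q) l ->
  exists t, [/\ (l <= size t)%N,
    forall u, u \in t -> nonunit (hlocal P) (hlocal_ideal P I) u
    & regular_seq (hlocal P) (hlocal_ideal P I) t].
Proof.
move=> ii [d [[_ dmax] [[s [sd sm sreg]] _]]] /dmax le_l.
by exists s; rewrite sd.
Qed.

End At.

End HomogeneousLocalization.

(** * Expansion in powers of x and y *)

Section Coefficients.
Variables (k : fieldType).

Lemma mpoly_gen_ind n (Q : {mpoly k[n]} -> Prop) :
  (forall c, Q c%:MP) -> (forall i, Q 'X_i) -> (forall f g, Q f -> Q g -> Q (f + g)) ->
  (forall f g, Q f -> Q g -> Q (f * g)) -> forall f, Q f.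
Proof.
move=> QC QX QD QM f; rewrite [f]mpolyE; apply: big_ind => [|//|m _].
  by rewrite -mpolyC0.
rewrite -mul_mpolyC; apply: (QM) => //; rewrite mpolyXE_id.
apply: big_ind => [|//|i _]; first by rewrite -mpolyC1.
by elim: (m i) => [|e IH]; rewrite ?expr0 -?mpolyC1 // exprS; apply: QM.
Qed.

Lemma mcoeff_muni n (f : {mpoly k[n.+1]}) i m :
  ((muni f)`_i)@_m = f@_(mnmwiden m + U_(ord_max) *+ i)%MM.
Proof.
rewrite [f]mpolyE !raddf_sum /= coef_sum !raddf_sum; apply: eq_bigr => u _.
rewrite muniZ coefZ /= mcoeffCM mcoeffZ; congr (_ * _).
rewrite muniX coefCM coefXn mcoeffX.
have -> : (u == mnmwiden m + U_(ord_max) *+ i)%MM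
    = ([multinom (u (widen_ord (leqnSn n) j)) | j < n] == m) && (i == u ord_max).
  apply/eqP/andP => [->|[/eqP <- /eqP ->]].
    split; last by rewrite mnmDE mnmwiden_ordmax mulmnE mnm1E eqxx mul1n.
    apply/eqP/mnmP => j; rewrite mnmE mnmDE mnmwiden_widen mulmnE mnm1E.
    by rewrite -val_eqE /= gtn_eqF // mul0n addn0.
  apply/mnmP => j; rewrite mnmDE mulmnE mnm1E.
  case: (unliftP ord_max j) => [j' ->|->]; last by rewrite mnmwiden_ordmax eqxx mul1n.
  have -> : lift ord_max j' = widen_ord (leqnSn n) j'.
    by apply/val_inj; rewrite /= /bump leqNgt ltn_ord.
  by rewrite mnmwiden_widen mnmE -val_eqE /= gtn_eqF // mul0n addn0.
by case: eqP => _; rewrite ?mulr1 ?mulr0 ?mcoeff0 ?mcoeffX ?andbT ?andbF.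
Qed.

Lemma mdeg_mnmwiden n (m : 'X_{1..n}) : mdeg (mnmwiden m) = mdeg m.
Proof.
rewrite !mdegE big_ord_recr /= mnmwiden_ordmax addn0.
by apply: eq_bigr => i _; rewrite mnmwiden_widen.
Qed.

Lemma muni_coef_homog n (f : {mpoly k[n.+1]}) i d :
  f \is d.-homog -> ((i <= d)%N -> (muni f)`_i \is (d - i).-homog) /\
  ((d < i)%N -> (muni f)`_i = 0).
Proof.
move=> /dhomogP fd.
have deg m : ((muni f)`_i)@_m != 0 -> (mdeg m + i)%N = d.
  rewrite mcoeff_muni -mcoeff_msupp => /fd.
  by rewrite /= mdegD mdegMn mdeg1 mdeg_mnmwiden mul1n.
split=> di; first by apply/dhomogP => m; rewrite mcoeff_msupp => /deg /= <-; rewrite addnK.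
apply/mpolyP => m; rewrite mcoeff0; apply/eqP; apply: contraTT di => /deg <-.
by rewrite -leqNgt leq_addl.
Qed.

Lemma mwiden_homog n (f : {mpoly k[n]}) d : f \is d.-homog -> mwiden f \is d.-homog.
Proof.
move=> /dhomogP fd; rewrite (mwidenE (leqnn _)).
apply: rpred_sum => m _; have [|nm] := boolP ((m : 'X_{1..n}) \in msupp f).
  move=> /fd /= dm; apply: rpredZ; rewrite dhomogX /= mdeg_mnmwiden; exact/eqP.
by rewrite (memN_msupp_eq0 nm) scale0r; apply: dhomog0.
Qed.

Variable (n : nat).
Local Notation R := {mpoly k[n.+1]}.
Local Notation S := {mpoly k[n.+3]}.
Local Notation x := (x k n).
Local Notation y := (y k n).
Local Notation iz := (@in_z k n).
Local Notation IX := (@IX k n).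

(** The coefficient in R of x^a y^b: the outer [muni] of [f] expands in y, the last variable, and
    the next one in x. *)
Definition cf (a b : nat) (f : S) : R := (muni ((muni f)`_b))`_a.

Lemma yE : y = 'X_ord_max.
Proof. by rewrite /Defs.y; congr 'X_(_); apply/val_inj; rewrite /= inordK. Qed.

Lemma xE : x = mwiden 'X_ord_max.
Proof.
rewrite mwidenXi /Defs.x; congr 'X_(_); apply/val_inj; rewrite /= inordK //.
Qed.

HB.instance Definition _ := GRing.RMorphism.copy iz (@mwiden n.+2 k \o @mwiden n.+1 k).

Lemma iz_inj : injective iz.
Proof. by move=> f g /inj_mwiden/inj_mwiden. Qed.

Lemma iz_homog f d : f \is d.-homog -> iz f \is d.-homog.
Proof. by move=> fd; apply/mwiden_homog/mwiden_homog. Qed.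

Lemma cfD a b f g : cf a b (f + g) = cf a b f + cf a b g.
Proof. by rewrite /cf muniD coefD muniD coefD. Qed.

Lemma cf0 a b : cf a b 0 = 0.
Proof. by rewrite /cf muni0 coef0 muni0 coef0. Qed.

Lemma cfN a b f : cf a b (- f) = - cf a b f.
Proof. by rewrite /cf muniN coefN muniN coefN. Qed.

Lemma cfB a b f g : cf a b (f - g) = cf a b f - cf a b g.
Proof. by rewrite cfD cfN. Qed.

Lemma cfM a b r f : cf a b (iz r * f) = r * cf a b f.
Proof. by rewrite /cf muniM muni_widen coefCM muniM muni_widen coefCM. Qed.

Lemma cf_sum a b (I : Type) (s : seq I) P (F : I -> S) :
  cf a b (\sum_(i <- s | P i) F i) = \sum_(i <- s | P i) cf a b (F i).
Proof. by apply: (big_morph (cf a b) (cfD a b)); apply: cf0. Qed.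

Lemma cfx a b f : cf a b (x * f) = if a is a'.+1 then cf a' b f else 0.
Proof.
rewrite /cf xE muniM muni_widen coefCM muniM muni_max mulrC coefMX.
by case: a.
Qed.

Lemma cfy a b f : cf a b (y * f) = if b is b'.+1 then cf a b' f else 0.
Proof.
rewrite /cf yE muniM muni_max mulrC coefMX.
by case: b => //; rewrite muni0 coef0.
Qed.

Lemma cfz a b r : cf a b (iz r) = if (a == 0%N) && (b == 0%N) then r else 0.
Proof.
rewrite /cf muni_widen coefC andbC; case: eqP => _ /=; last by rewrite muni0 coef0.
by rewrite muni_widen coefC.
Qed.

Lemma cf1 a b : cf a b 1 = if (a == 0%N) && (b == 0%N) then 1 else 0.
Proof. by rewrite -(rmorph1 iz) cfz. Qed.

Lemma cf_homog a b f d : f \is d.-homog ->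
  ((a + b <= d)%N -> cf a b f \is (d - (a + b)).-homog) /\ ((d < a + b)%N -> cf a b f = 0).
Proof.
move=> fd; rewrite /cf; have [H1 H2] := muni_coef_homog b fd.
have [bd|db] := leqP b d; last first.
  by rewrite H2 // muni0 coef0; split=> // _; apply: dhomog0.
have [G1 G2] := muni_coef_homog a (H1 bd); split=> ab.
  by rewrite addnC subnDA; apply: G1; lia.
by apply: G2; lia.
Qed.

(* The quotients f1 and f2 are normalized by choosing f1 free of y. *)
Lemma cf_split f : exists f1 f2, [/\ f = iz (cf 0 0 f) + x * f1 + y * f2,
  forall a b, cf a b f1 = if b is 0 then cf a.+1 0 f else 0
  & forall a b, cf a b f2 = cf a b.+1 f].
Proof.
have spl m (g : {mpoly k[m.+1]}) : exists g', g = mwiden (muni g)`_0 + 'X_ord_max * g' /\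
    forall i, (muni g')`_i = (muni g)`_i.+1.
  exists (mmulti (drop_poly 1 (muni g))); split; last first.
    by move=> i; rewrite mmultiK coef_drop_poly addn1.
  apply: (@muni_inj k m); rewrite muniD muniM muni_widen muni_max mmultiK.
  apply/polyP => i; rewrite coefD coefC mulrC coefMX coef_drop_poly.
  by case: i => [|i]; rewrite ?addr0 // add0r addn1.
have [f2 [fE f2E]] := spl _ f; have [g1 [gE g1E]] := spl _ (muni f)`_0.
exists (mwiden g1), f2; split.
- by rewrite {1}fE {1}gE mwidenD mwidenM -xE -yE.
- move=> a b; rewrite {1}/cf (muni_widen g1) coefC.
  by case: b => [|b] /=; [exact: g1E | rewrite muni0 coef0].
- by move=> a b; rewrite /cf; congr ((muni _)`_a); exact: f2E.
Qed.

Lemma gen_idealP (s : seq S) : ideal (@whole S) (gen_ideal s).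
Proof.
split=> //.
- by exists (fun=> 0); rewrite big1 // => i _; rewrite mul0r.
- move=> _ _ [c ->] [d ->]; exists (fun i => c i + d i); rewrite -big_split.
  by apply: eq_bigr => i _; rewrite mulrDl.
- move=> u _ _ [c ->]; exists (fun i => u * c i); rewrite mulr_sumr.
  by apply: eq_bigr => i _; rewrite mulrA.
Qed.

Lemma gen_ideal_mem (s : seq S) f : f \in s -> gen_ideal s f.
Proof.
move=> fs; exists (fun i => (i == index f s)%:R).
have lt_i : (index f s < size s)%N by rewrite index_mem.
rewrite (bigD1 (Ordinal lt_i)) //= eqxx mul1r nth_index // big1 ?addr0 // => i ni.
rewrite (_ : (i : nat) == _ = false) ?mul0r //; apply/negbTE.
by apply: contra ni => /eqP iE; apply/eqP/val_inj.
Qed.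

Lemma gen_ideal_sub (s : seq S) (a : S -> Prop) : ideal (@whole S) a ->
  (forall f, f \in s -> a f) -> incl (gen_ideal s) a.
Proof.
move=> [_ a0 aD aM] sa _ [c ->]; apply: big_ind => // i _; apply: aM => //.
by apply: sa; apply: mem_nth.
Qed.

Lemma IX_P f : IX f <-> cf 0 0 f = 0.
Proof.
split.
  move=> [c ->]; rewrite big_ord_recl big_ord1 /= mulrC [c 1%N * _]mulrC.
  by rewrite cfD cfx cfy addr0.
move=> f0; have [f1 [f2 [-> _ _]]] := cf_split f; rewrite f0 rmorph0 add0r.
by exists (nth 0 [:: f1; f2]); rewrite big_ord_recl big_ord1 /= mulrC [f2 * _]mulrC.
Qed.

Lemma cf00M f g : cf 0 0 (f * g) = cf 0 0 f * cf 0 0 g.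
Proof. by rewrite /cf muniM coef0M muniM coef0M. Qed.

Lemma cf00X f r : cf 0 0 (f ^+ r) = cf 0 0 f ^+ r.
Proof.
elim: r => [|r IH]; first by rewrite !expr0 cf1.
by rewrite !exprS cf00M IH.
Qed.

Lemma IX_prime : prime_ideal (@whole S) IX.
Proof.
split; first exact: gen_idealP.
  by move/IX_P; rewrite cf1 /=; apply/eqP/oner_neq0.
move=> f g _ _ /IX_P/eqP; rewrite cf00M mulf_eq0 => /orP[]/eqP fg.
  by left; apply/IX_P.
by right; apply/IX_P.
Qed.

Lemma cf_pihomog a b d f : cf a b (pihomog mdeg (d + (a + b)) f) = pihomog mdeg d (cf a b f).
Proof.
have -> : cf a b f = \sum_(i < msize f) cf a b (pihomog mdeg i f).
  by rewrite {1}(pihomog_sum_eq f) cf_sum.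
rewrite raddf_sum /=.
have hc i : pihomog mdeg d (cf a b (pihomog mdeg i f)) =
    if i == (d + (a + b))%N then cf a b (pihomog mdeg i f) else 0.
  have [H1 H2] := cf_homog a b (pihomogP mdeg i f).
  have [ab|ab] := leqP (a + b) i; last first.
    by rewrite H2 // linear0; case: eqP.
  case: eqP => [iE|iE].
    by apply: pihomog_dE; move: (H1 ab); rewrite iE addnK.
  by apply: pihomog_ne0 (H1 ab); apply/eqP; lia.
under eq_bigr => i _ do rewrite hc.
have [lt|ge] := ltnP (d + (a + b)) (msize f).
  rewrite (bigD1 (Ordinal lt)) //= eqxx big1 ?addr0 // => i ni.
  case: eqP => // iE; case/eqP: ni; exact: val_inj.
rewrite (pihomog_gt ge) cf0 big1 // => i _; case: eqP => // iE.
by have := ltn_ord i; rewrite iE ltnNge ge.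
Qed.

Lemma IX_hom : homogeneous IX.
Proof.
move=> f /IX_P f0 d; apply/IX_P.
by rewrite -[d]addn0 -[X in (_ + X)%N]/(0 + 0)%N cf_pihomog f0 linear0.
Qed.

Definition ord_ge (j : nat) (f : S) : Prop := forall a b, (a + b < j)%N -> cf a b f = 0.

Lemma var_cases (i : 'I_n.+3) : [\/ 'X_i = y, 'X_i = x | exists j : 'I_n.+1, 'X_i = iz 'X_j].
Proof.
case: (unliftP ord_max i) => [j ->|->]; last by constructor 1; rewrite yE.
have -> : lift ord_max j = widen_ord (leqnSn n.+2) j.
  by apply/val_inj; rewrite /= /bump leqNgt ltn_ord.
rewrite -mwidenXi; case: (unliftP ord_max j) => [l ->|->]; last by constructor 2; rewrite xE.
have -> : lift ord_max l = widen_ord (leqnSn n.+1) l.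
  by apply/val_inj; rewrite /= /bump leqNgt ltn_ord.
by constructor 3; exists l; rewrite /in_z -mwidenXi.
Qed.

Lemma S_ind (Q : S -> Prop) : (forall r, Q (iz r)) -> Q x -> Q y ->
  (forall f g, Q f -> Q g -> Q (f + g)) -> (forall f g, Q f -> Q g -> Q (f * g)) ->
  forall f, Q f.
Proof.
move=> Qz Qx Qy QD QM; apply: mpoly_gen_ind => // [c|i].
  by rewrite (_ : c%:MP = iz c%:MP) // /in_z !mwidenC.
by case: (var_cases i) => [->|->|[j ->]].
Qed.

Lemma stable_ideal (a : S -> Prop) : a 0 -> (forall f g, a f -> a g -> a (f + g)) ->
  (forall r f, a f -> a (iz r * f)) -> (forall f, a f -> a (x * f)) ->
  (forall f, a f -> a (y * f)) -> ideal (@whole S) a.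
Proof.
move=> a0 aD az ax ay; split=> // u v _; elim/S_ind: u v => //.
- by move=> f g Hf Hg v av; rewrite mulrDl; apply: aD; [apply: Hf | apply: Hg].
- by move=> f g Hf Hg v av; rewrite -mulrA; apply: Hf; apply: Hg.
Qed.

Lemma ord_ge_ideal j : ideal (@whole S) (ord_ge j).
Proof.
apply: stable_ideal => [a b _|f g Hf Hg a b ab|r f Hf a b ab|f Hf [|a] b ab|f Hf a [|b] ab].
- exact: cf0.
- by rewrite cfD Hf ?Hg ?addr0.
- by rewrite cfM Hf ?mulr0.
- by rewrite cfx.
- by rewrite cfx Hf //; lia.
- by rewrite cfy.
- by rewrite cfy Hf //; lia.
Qed.

Lemma ideal_powP j f : ideal_pow IX j f <-> ord_ge j f.
Proof.
elim: j f => [|j IH] f; first by split.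
split.
  move=> [s [sP ->]]; have [_ o0 oD _] := ord_ge_ideal j.+1.
  rewrite big_seq; apply: (big_ind (ord_ge j.+1) o0 oD) => w ws; have [IXw /IH ow] := sP _ ws.
  have [w1 [w2 [-> _ _]]] := cf_split w.1; move/IX_P: IXw => ->.
  rewrite rmorph0 add0r mulrDl -!mulrA; have [_ _ _ oM] := ord_ge_ideal j.
  apply: (oD (x * _) (y * _)) => a b ab.
    by rewrite cfx; case: a ab => // a ab; apply: oM => //; lia.
  by rewrite cfy; case: b ab => // b ab; apply: oM => //; lia.
move=> of_; have [f1 [f2 [fE f1E f2E]]] := cf_split f.
have IXx : IX x by apply/IX_P; rewrite -[x]mulr1 cfx.
have IXy : IX y by apply/IX_P; rewrite -[y]mulr1 cfy.
exists [:: (x, f1); (y, f2)]; split.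
  move=> w; rewrite !inE => /orP[]/eqP -> /=; split=> //; apply/IH => a b ab.
    by rewrite f1E; case: b ab => // ab; apply: of_; lia.
  by rewrite f2E; apply: of_; lia.
have of0 : cf 0 0 f = 0 by apply: of_.
by rewrite big_cons big_seq1 /= [LHS]fE of0 rmorph0 add0r.
Qed.

End Coefficients.

(** * Affine charts of X and the primes of S above them *)

Section Chart.
Variables (k : fieldType) (n : nat).
Local Notation R := {mpoly k[n.+1]}.
Local Notation S := {mpoly k[n.+3]}.
Local Notation T := {mpoly k[n]}.
Local Notation x := (x k n).
Local Notation y := (y k n).
Local Notation iz := (@in_z k n).
Local Notation IX := (@IX k n).
Local Notation "f %:F" := (@FracField.tofrac S f).
Variable (j0 : 'I_n.+1).

(** Dehomogenization at z_j0 = 1, with the other variables renumbered. *)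
Definition chart : {rmorphism R -> T} :=
  mmap (@mpolyC n k) (fun j => if unlift j0 j is Some i then 'X_i else 1).

Lemma chartX_lift i : chart 'X_(lift j0 i) = 'X_i.
Proof. by rewrite /chart /= mmapX mmap1U liftK. Qed.

Lemma chartX_self : chart 'X_j0 = 1.
Proof. by rewrite /chart /= mmapX mmap1U unlift_none. Qed.

Lemma chart_Xexp d : chart ('X_j0 ^+ d) = 1.
Proof. by rewrite rmorphXn chartX_self expr1n. Qed.

Let X1 j : ('X_j : R) \is 1.-homog.
Proof. by rewrite dhomogX; apply/eqP; apply: mdeg1. Qed.

Let Xd j d : ('X_j : R) ^+ d \is d.-homog.
Proof. by rewrite -{2}[d]mul1n; apply: dhomogMn. Qed.

(** A form lifting [phi] is provided in every large degree, so that several lifts can be brought to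
    matching degrees. *)
Lemma chart_lift (phi : T) :
  exists M0, forall M, (M0 <= M)%N -> exists2 f, f \is M.-homog & chart f = phi.
Proof.
elim/mpoly_gen_ind: phi => [c|i|f g [M0 fP] [N0 gP]|f g [M0 fP] [N0 gP]].
- exists 0%N => M _; exists (c%:MP * 'X_j0 ^+ M).
    by rewrite mul_mpolyC; apply: rpredZ; apply: Xd.
  by rewrite rmorphM chart_Xexp mulr1 /chart /= mmapC.
- exists 1%N => -[//|M] _; exists ('X_(lift j0 i) * 'X_j0 ^+ M).
    by rewrite -[M.+1]add1n; apply: dhomogM; [apply: X1 | apply: Xd].
  by rewrite rmorphM chart_Xexp mulr1 chartX_lift.
- exists (maxn M0 N0) => M; rewrite geq_max => /andP[/fP[f' fh <-] /gP[g' gh <-]].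
  by exists (f' + g'); [apply: rpredD | rewrite rmorphD].
- exists (M0 + N0)%N => M le_M.
  have [|f' fh <-] := fP (M - N0)%N; first by lia.
  have [|g' gh <-] := gP N0; first by [].
  exists (f' * g'); last by rewrite rmorphM.
  by rewrite (_ : M = M - N0 + N0)%N; [apply: dhomogM | lia].
Qed.

Lemma chart_inj f M : f \is M.-homog -> chart f = 0 -> f = 0.
Proof.
move=> /dhomogP fM; rewrite /chart /= /mmap => f0; apply/mpolyP => m; rewrite mcoeff0.
have [mf|/memN_msupp_eq0 //] := boolP (m \in msupp f).
pose r (u : 'X_{1..n.+1}) : 'X_{1..n} := [multinom u (lift j0 i) | i < n].
have rX u : mmap1 (fun j => if unlift j0 j is Some i then 'X_i else 1) u = 'X_[r u] :> T.
  rewrite /mmap1 (bigD1_ord j0) //= unlift_none expr1n mul1r mpolyXE_id.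
  by apply: eq_bigr => i _; rewrite liftK mnmE.
have r_inj u v : mdeg u = mdeg v -> r u = r v -> u = v.
  move=> + /mnmP ruv; rewrite !mdegE !(bigD1_ord j0) //= => uv.
  have E i : u (lift j0 i) = v (lift j0 i) by have := ruv i; rewrite !mnmE.
  move: uv; under eq_bigr => i _ do rewrite E.
  move/addIn => uv; apply/mnmP => j; case: (unliftP j0 j) => [i ->|->] //.
move/(congr1 (mcoeff (r m))): f0; rewrite mcoeff0 raddf_sum /= => f0.
rewrite -[RHS]f0 (bigD1_seq m) ?msupp_uniq //= rX mcoeffCM mcoeffX eqxx mulr1.
rewrite big_seq_cond big1 ?addr0 // => u /andP[uf um]; rewrite rX mcoeffCM mcoeffX.
case: eqP => [ruv|_]; last by rewrite mulr0.
case/eqP: um; apply: r_inj ruv; have := fM _ uf; have := fM _ mf.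
by move=> /= -> ->.
Qed.

(** The coordinate ring of the chart inside the degree-zero fractions: coordinates become quotients
    by z_j0. *)
Definition chart_eval : {rmorphism T -> {fraction S}} :=
  mmap (@FracField.tofrac S \o @mpolyC n.+3 k) (fun i => (iz 'X_(lift j0 i))%:F / (iz 'X_j0)%:F).

Lemma iz_neq0 f : f != 0 -> (iz f)%:F != 0.
Proof.
move=> f0; rewrite tofrac_eq0; apply: contraNneq f0 => fz.
by apply/eqP; apply: iz_inj; rewrite fz rmorph0.
Qed.

Lemma iz_X0 : (iz 'X_j0)%:F != 0.
Proof. by apply: iz_neq0; rewrite -msize_poly_eq0 msizeX. Qed.

Lemma chart_evalE f M : f \is M.-homog -> chart_eval (chart f) = (iz f)%:F / (iz 'X_j0)%:F ^+ M.
Proof.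
move=> /dhomogP fM.
have mono m c : chart_eval (chart (c *: 'X_[m])) = (iz (c *: 'X_[m]))%:F / (iz 'X_j0)%:F ^+ mdeg m.
  rewrite -!mul_mpolyC !(rmorphM, tofracM) -mulrA; congr (_ * _).
    by rewrite /chart_eval /chart /= !mmapC /= /in_z !mwidenC.
  rewrite mdegE mpolyXE_id !rmorph_prod -prodrXr -prodf_div.
  apply: eq_bigr => j _; rewrite !rmorphXn -expr_div_n; congr (_ ^+ _).
  case: (unliftP j0 j) => [i ->|->].
    by rewrite chartX_lift /chart_eval /= mmapX mmap1U.
  by rewrite chartX_self rmorph1 divff // iz_X0.
transitivity (\sum_(m <- msupp f) chart_eval (chart (f@_m *: 'X_[m]))).
  by rewrite -!raddf_sum -mpolyE.
transitivity (\sum_(m <- msupp f) (iz (f@_m *: 'X_[m]))%:F / (iz 'X_j0)%:F ^+ M).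
  by rewrite !big_seq; apply: eq_bigr => m mf; rewrite mono (fM _ mf).
by rewrite -mulr_suml -!raddf_sum -mpolyE.
Qed.

End Chart.

Section Point.
Variables (k : fieldType) (n : nat).
Local Notation R := {mpoly k[n.+1]}.
Local Notation S := {mpoly k[n.+3]}.
Local Notation T := {mpoly k[n]}.
Local Notation x := (x k n).
Local Notation y := (y k n).
Local Notation iz := (@in_z k n).
Local Notation IX := (@IX k n).
Local Notation hc := (pihomog mdeg).
Local Notation "f %:F" := (@FracField.tofrac S f).

Lemma iz_pihomog d r : hc d (iz r) = iz (hc d r).
Proof.
have -> : hc d (iz r) = \sum_(i < msize r) hc d (iz (hc i r)).
  by rewrite -!raddf_sum -pihomog_sum_eq.
have E i : hc d (iz (hc i r)) = if i == d then iz (hc i r) else 0.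
  have ih := iz_homog (pihomogP mdeg i r).
  case: eqP => [iE|/eqP ne]; first by rewrite -iE pihomog_dE.
  exact: pihomog_ne0 ih.
under eq_bigr => i _ do rewrite E.
have [lt|ge] := ltnP d (msize r).
  rewrite (bigD1 (Ordinal lt)) //= eqxx big1 ?addr0 // => i ni.
  by case: eqP => // iE; case/eqP: ni; apply: val_inj.
rewrite big1 => [|i _]; first by rewrite (pihomog_gt ge) rmorph0.
by case: eqP => // iE; have := ltn_ord i; rewrite iE ltnNge ge.
Qed.

Lemma iz_X (j : 'I_n.+1) : exists i : 'I_n.+3, iz 'X_j = 'X_i.
Proof.
by exists (widen_ord (leqnSn n.+2) (widen_ord (leqnSn n.+1) j)); rewrite /in_z !mwidenXi.
Qed.

Section AtPoint.
Variables (P : S -> Prop) (j0 : 'I_n.+1).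
Hypotheses (pP : prime_ideal (@whole S) P) (hP : homogeneous P) (XP : incl IX P).
Hypothesis Pj0 : ~ P (iz 'X_j0).

Definition trace : R -> Prop := fun r => P (iz r).

Lemma trace_prime : prime_ideal (@whole R) trace.
Proof.
have [[_ P0 PD PM] P1 PP] := pP; split; [split; [by move=> ? _ | by rewrite /trace rmorph0 | |] | by rewrite /trace rmorph1 |].
- by move=> u v; rewrite /trace rmorphD; apply: PD.
- by move=> u v _; rewrite /trace rmorphM; apply: PM.
- by move=> u v _ _; rewrite /trace rmorphM; apply: PP.
Qed.

Lemma trace_hom : homogeneous trace.
Proof. by move=> r pr d; rewrite /trace -iz_pihomog; apply: hP. Qed.

Lemma IX_split f : exists2 h, IX h & f = iz (cf 0 0 f) + h.
Proof.
exists (f - iz (cf 0 0 f)); last by rewrite addrC subrK.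
by apply/IX_P; rewrite cfB cfz subrr.
Qed.

Lemma trace_cf f : P f <-> trace (cf 0 0 f).
Proof.
have [h Xh fE] := IX_split f; have [iP _ _] := pP; have [_ _ PD _] := iP.
rewrite /trace; split=> [Pf|Pz]; last by rewrite fE; apply: PD => //; apply: XP.
rewrite (_ : iz _ = f - h); last by rewrite [X in _ = X - h]fE addrK.
by apply: (idealB (@subring_whole S) iP) => //; apply: XP.
Qed.

Let A := hlocal P.
Let mA := hlocal_ideal P P.
Let iP : ideal (@whole S) P. Proof. by case: pP. Qed.
Let z_exp M : ~ P (iz 'X_j0 ^+ M).
Proof. by have [i iE] := iz_X j0; move: Pj0; rewrite iE => Pi; apply: not_prime_Xexp. Qed.
Let z_homog M : iz 'X_j0 ^+ M \is M.-homog.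
Proof. by have [i ->] := iz_X j0; apply: Xexp_homog. Qed.

Lemma subringA : is_subring A. Proof. exact: hlocal_subring. Qed.

Lemma primeA : prime_ideal A mA.
Proof. by apply: hlocal_ideal_prime. Qed.

Lemma chart_eval_frac f M : f \is M.-homog ->
  chart_eval k j0 (chart k j0 f) = (iz f)%:F / (iz 'X_j0 ^+ M)%:F.
Proof. by move=> fM; rewrite (chart_evalE _ fM) tofracXn. Qed.

Lemma chart_eval_local phi : A (chart_eval k j0 phi).
Proof.
have [M0 /(_ _ (leqnn _))[f fM <-]] := chart_lift j0 phi.
by rewrite (chart_eval_frac fM); exists M0, (iz f), (iz 'X_j0 ^+ M0); split=> //; apply: iz_homog.
Qed.

Definition chart_prime : T -> Prop := fun phi => mA (chart_eval k j0 phi).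

Lemma chart_prime_prime : prime_ideal (@whole T) chart_prime.
Proof.
have [[_ P0 PD PM] P1 PP] := primeA; rewrite /chart_prime; split; [split=> //|by rewrite rmorph1|].
- by rewrite rmorph0.
- by move=> u v; rewrite rmorphD; apply: PD.
- by move=> u v _; rewrite rmorphM; apply: PM; apply: chart_eval_local.
- by move=> u v _ _; rewrite rmorphM; apply: PP; apply: chart_eval_local.
Qed.

Lemma chart_primeE f M : f \is M.-homog -> chart_prime (chart k j0 f) <-> trace f.
Proof.
move=> fM; rewrite /chart_prime (chart_eval_frac fM) /mA.
rewrite (hlocal_ideal_frac pP iP (iz_homog fM) (z_homog M) (@z_exp M)).
by split; [apply: (hloc_prime pP) | move=> tf; apply: (hloc_incl pP tf)].
Qed.

Lemma adjoins_ideal (D : comNzRingType) (a : D -> Prop) s :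
  ideal (@whole D) a -> ideal (@whole D) (adjoins a s).
Proof. by elim: s a => [|f s IH] a ia //=; apply/IH/ideal_adjoin_whole. Qed.

Lemma zero_ideal (D : comNzRingType) : ideal (@whole D) (fun f => f = 0).
Proof. by split=> // [u v -> ->|u v _ ->]; rewrite ?addr0 ?mulr0. Qed.

Lemma zero_hom m : homogeneous (fun f : {mpoly k[m]} => f = 0).
Proof. by move=> f -> d; rewrite linear0. Qed.

Lemma adjoins_rcons (D : comNzRingType) (a : D -> Prop) s f :
  adjoins a (rcons s f) = adjoin (@whole D) (adjoins a s) f.
Proof. by rewrite /adjoins foldl_rcons. Qed.

Lemma adjoins_hom m (a : {mpoly k[m]} -> Prop) s :
  ideal (@whole {mpoly k[m]}) a -> homogeneous a -> (forall f, f \in s -> exists d, f \is d.-homog) ->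
  homogeneous (adjoins a s).
Proof.
elim: s a => [|f s IH] a ia ha sh //=; have [d fd] := sh f (mem_head _ _).
apply: IH; [exact: ideal_adjoin_whole | exact: homogeneous_adjoin fd ia |].
by move=> g gs; apply: sh; rewrite in_cons gs orbT.
Qed.

Lemma adjoins_chart s f : adjoins (fun f => f = 0) s f ->
  adjoins (fun f => f = 0) (map (chart k j0) s) (chart k j0 f).
Proof.
elim/last_ind: s f => [|s g IH] f; first by move=> ->; rewrite /= rmorph0.
rewrite map_rcons !adjoins_rcons => -[b [c [/IH ab _ ->]]].
by exists (chart k j0 b), (chart k j0 c); rewrite rmorphD rmorphM.
Qed.

(** Dehomogenization loses only powers of z_j0: lifted coefficients are padded by such powers until
    the degrees agree, and [chart_inj] turns the equation in the chart into an equation of forms. *)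
Lemma adjoins_chart_inv s f M : (forall g, g \in s -> exists d, g \is d.-homog) ->
  f \is M.-homog -> adjoins (fun f => f = 0) (map (chart k j0) s) (chart k j0 f) ->
  exists N, adjoins (fun f => f = 0) s ('X_j0 ^+ N * f).
Proof.
elim/last_ind: s f M => [|s g IH] f M sh fM.
  by move=> /(chart_inj fM) ->; exists 0%N; rewrite mulr0.
rewrite map_rcons !adjoins_rcons => -[b [c [ab _ fE]]].
have [d gd] : exists d, g \is d.-homog by apply: sh; rewrite mem_rcons mem_head.
have [B /(_ (B + M)%N (leq_addr _ _))[b' bB bE]] := chart_lift j0 b.
have [C /(_ (C + M)%N (leq_addr _ _))[c' cC cE]] := chart_lift j0 c.
have [N aN] : exists N, adjoins (fun f => f = 0) s ('X_j0 ^+ N * b').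
  by apply: IH bB _; [move=> h hs; apply: sh; rewrite mem_rcons in_cons hs orbT | rewrite bE].
have Xh e : ('X_j0 : R) ^+ e \is e.-homog by apply: Xexp_homog.
have E : 'X_j0 ^+ (B + C + d) * f = 'X_j0 ^+ (C + d) * b' + 'X_j0 ^+ B * c' * g.
  apply/eqP; rewrite -subr_eq0; apply/eqP.
  apply: (@chart_inj _ _ j0 _ (B + C + d + M)).
    apply: rpredB; first exact: dhomogM.
    apply: rpredD; first by rewrite (_ : _ + M = C + d + (B + M))%N; [apply: dhomogM | lia].
    rewrite (_ : _ + M = B + (C + M) + d)%N; last by lia.
    by do 2!apply: dhomogM => //.
  by rewrite rmorphB rmorphD !rmorphM !chart_Xexp !mul1r bE cE -fE subrr.
exists (N + (B + C + d))%N; rewrite exprD -mulrA E mulrDr.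
have [_ _ aD aM] := adjoins_ideal s (zero_ideal R).
exists ('X_j0 ^+ N * ('X_j0 ^+ (C + d) * b')), ('X_j0 ^+ N * ('X_j0 ^+ B * c')).
by split=> //; [rewrite mulrCA; apply: aM | rewrite !mulrA].
Qed.

(** [t] collects the elements already adjoined, so that the ideals on both sides stay generated by
    forms while the induction runs over [s]. *)
Lemma hom_regular_chart t s : (forall g, g \in t ++ s -> exists d, g \is d.-homog) ->
  loc_regular chart_prime (adjoins (fun f => f = 0) (map (chart k j0) t)) (map (chart k j0) s) ->
  hom_regular trace (adjoins (fun f => f = 0) t) s.
Proof.
elim: s t => [|f s IH] t //= tsh [reg sreg]; split; last first.
  rewrite -adjoins_rcons; apply: IH; first by rewrite cat_rcons.
  by rewrite map_rcons adjoins_rcons.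
move=> b d bd lfb; have [e fe] : exists d, f \is d.-homog.
  by apply: tsh; rewrite mem_cat mem_head orbT.
have th g : g \in t -> exists d, g \is d.-homog by move=> gt; apply: tsh; rewrite mem_cat gt.
have at_hom := adjoins_hom (zero_ideal R) (@zero_hom _) th.
have [u [i [ui pu afb]]] := loc_hloc trace_prime at_hom (dhomogM fe bd) lfb.
have [|v pv avb] := reg (chart k j0 b).
  exists (chart k j0 u); first by move/(chart_primeE ui).
  by rewrite -!rmorphM; apply: adjoins_chart.
have [M /(_ _ (leqnn M))[v' vM vE]] := chart_lift j0 v.
have [|N aN] := adjoins_chart_inv th (dhomogM vM bd) _; first by rewrite rmorphM vE.
exists ('X_j0 ^+ N * v'); last by rewrite -mulrA.
have [_ _ PP] := trace_prime => /(PP _ _ Logic.I Logic.I)[|/(chart_primeE vM)]; last by rewrite vE.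
by rewrite /trace rmorphXn => /z_exp.
Qed.

Lemma chart_eval_mmap m (w : 'I_m -> T) Q :
  mmap (@FracField.tofrac S \o @mpolyC n.+3 k) (chart_eval k j0 \o w) Q
  = chart_eval k j0 (mmap (@mpolyC n k) w Q).
Proof.
pose f : {rmorphism _ -> _} := mmap (@FracField.tofrac S \o @mpolyC n.+3 k) (chart_eval k j0 \o w).
pose g : {rmorphism _ -> _} := chart_eval k j0 \o mmap (@mpolyC n k) w.
apply: (@mpoly_rmorph_ext k m _ f g) => [c|i] /=; first by rewrite !mmapC.
by rewrite !mmapX !mmap1U.
Qed.

Lemma prime_sub_maximal c : prime_ideal A c -> incl c mA.
Proof.
move=> [[cA _ _ cM] c1 _] u cu; have [d [f [g [fd gd Pg uE]]]] := cA _ cu.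
rewrite uE /mA (hlocal_ideal_frac pP iP fd gd Pg); apply: (hloc_incl pP).
apply: boolp.contrapT => Pf; apply: c1.
rewrite (_ : 1 = g%:F / f%:F * u); first by apply: cM => //; exists d, g, f.
rewrite uE; have g0 := not_prime0 pP Pg; have f0 := not_prime0 pP Pf.
by rewrite mulrA (mulfVK f0) (divff g0).
Qed.

(* Adjoining one element of c (i.+1) outside c i for each step of the chain keeps the
   given algebraically independent elements independent, so the chain is short. *)
Lemma chain_bound (W : S -> Prop) N e (w : 'I_e -> T) l :
  ideal (@whole S) W -> (forall h, IX h -> W (h ^+ N)) ->
  (e <= n)%N -> alg_indep (@mpolyC n k) chart_prime w ->
  strict_chain (fun c => prime_ideal A c /\ incl (hlocal_ideal P W) c) l -> (l + e <= n)%N.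
Proof.
move=> iW nilW le_e wind [c [cP cI]]; rewrite leqNgt; apply/negP => lt_n.
(* If l + e exceeded n, walking down from [c d] to [c 0] would produce d + e = n + 1 independent
   polynomials in n variables. *)
have [d dE] : exists d, (d + e)%N = n.+1.
  by exists (n.+1 - e)%N; rewrite subnK // ltnW.
have le_d : (d <= l)%N by lia.
pose ik : {rmorphism k -> {fraction S}} := @FracField.tofrac S \o @mpolyC n.+3 k.
have ikA a : A (ik a).
  exists 0%N, a%:MP, 1; rewrite /ik /= tofrac1 divr1; split=> //; last by case: pP.
    by rewrite -alg_mpolyC; apply: rpredZ; apply: dhomog1.
  exact: dhomog1.
suff H i : (i <= d)%N -> exists w' : 'I_(i + e) -> T,
    alg_indep ik (c (d - i)%N) (chart_eval k j0 \o w').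
  have [w' w'ind] := H d (leqnn d); rewrite subnn in w'ind.
  have [Q Q0 QE] := alg_dependent_eq w' dE.
  case/eqP: Q0; apply: w'ind; rewrite chart_eval_mmap QE rmorph0.
  by have [[[_ c0 _ _] _ _] _] := cP 0%N isT.
elim: i => [|i IH] lt_i.
  exists w => Q; rewrite chart_eval_mmap subn0 => cQ; apply: wind.
  by have [cp _] := cP _ le_d; apply: prime_sub_maximal cQ.
have [w' w'ind] := IH (ltnW lt_i).
have jE : (d - i)%N = (d - i.+1).+1 by lia.
rewrite jE in w'ind; set j := (d - i.+1)%N in w'ind *.
have lt_j : (j < l)%N by rewrite /j; lia.
have [p0 W0] := cP j (ltnW lt_j); have [p1 W1] := cP j.+1 lt_j.
have [cc' ncc'] := cI j lt_j.
have [u c1u nc0u] : exists2 u, c j.+1 u & ~ c j u.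
  by apply: boolp.contrapT => H; apply: ncc' => u c1u; apply: boolp.contrapT => nc0u; apply: H; exists u.
have [[cA1 _ _ cM1] _ _] := p1; have [ij0 _ cP0] := p0; have [cA0 z0 _ cM0] := ij0.
have ij1 : ideal A (c j.+1) by case: p1.
have [m [f [g [fa ga Pg uE]]]] := cA1 _ c1u.
have g0 := not_prime0 pP Pg.
have f0h : cf 0 0 f \is m.-homog.
  by have [H _] := cf_homog 0 0 fa; move: (H isT); rewrite subn0.
(* The part of [u] coming from [IX] is nilpotent modulo [W], hence in every prime of the chain. So
   [u] may be replaced by [v], which up to a unit comes from the chart. *)
pose v := (iz (cf 0 0 f))%:F / g%:F.
have vA : A v by exists m, (iz (cf 0 0 f)), g; split=> //; apply: iz_homog.
have cuv : c j (u - v).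
  have [h Xh fE] := IX_split f.
  have hE : u - v = h%:F / g%:F by rewrite uE /v -mulrBl -tofracB [X in X - _]fE addrC addKr.
  have hh : h \is m.-homog.
    by rewrite (_ : h = f - iz (cf 0 0 f)); [apply: rpredB => //; apply: iz_homog | rewrite [X in X - _]fE addrC addKr].
  rewrite hE; apply: (primeX subringA (r := N) p0); first by exists m, h, g.
  apply: W0; exists (m * N)%N, (h ^+ N), (g ^+ N); split.
  - exact: dhomogMn.
  - exact: dhomogMn.
  - have [_ _ PP] := pP; move=> PgN; apply: Pg; apply: (primeX (@subring_whole S) pP) PgN => //.
  - exact: nilW.
  - by rewrite expr_div_n !tofracXn.
pose psi := chart k j0 (cf 0 0 f).
have psiE : chart_eval k j0 psi = (iz (cf 0 0 f))%:F / (iz 'X_j0 ^+ m)%:F := chart_eval_frac f0h.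
have z0a := not_prime0 pP (@z_exp m).
have q1 : A (g%:F / (iz 'X_j0 ^+ m)%:F) by exists m, g, (iz 'X_j0 ^+ m).
have q2 : A ((iz 'X_j0 ^+ m)%:F / g%:F) by exists m, (iz 'X_j0 ^+ m), g.
have c1psi : c j.+1 (chart_eval k j0 psi).
  rewrite psiE (_ : _ / _ = g%:F / (iz 'X_j0 ^+ m)%:F * v).
    apply: cM1 => //; rewrite (_ : v = u - (u - v)).
      by apply: (idealB subringA ij1) => //; apply: cc'.
    by rewrite opprB addrC subrK.
  exact: frac_change g0.
have c0psi : ~ c j (chart_eval k j0 psi).
  move=> H; apply: nc0u; rewrite (_ : u = (u - v) + (iz 'X_j0 ^+ m)%:F / g%:F * chart_eval k j0 psi).
    by have [_ _ cD0 _] := ij0; apply: cD0 => //; apply: cM0.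
  by rewrite psiE -(frac_change _ _ z0a) subrK.
exists (snoc w' psi) => Q cQ.
apply: (alg_indep_snoc subringA ikA p0 ij1 cc' c1psi c0psi (w := chart_eval k j0 \o w')) => //.
  by move=> i0; apply: chart_eval_local.
rewrite (_ : snoc _ _ = chart_eval k j0 \o snoc w' psi) //.
by apply: boolp.funext => i0; rewrite /snoc /=; case: unliftP.
Qed.

End AtPoint.
End Point.

(** * Kernels of flags of functionals *)

Section Flag.
Variables (k : fieldType) (n : nat).
Local Notation R := {mpoly k[n.+1]}.
Local Notation S := {mpoly k[n.+3]}.
Local Notation x := (x k n).
Local Notation y := (y k n).
Local Notation iz := (@in_z k n).
Local Notation IX := (@IX k n).
Local Notation hc := (pihomog mdeg).
Local Notation "f %:F" := (@FracField.tofrac S f).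

(* R-linear functionals c 0, ..., c (r-1) on S whose successive common kernels form a chain
   of ideals, each killed by (x, y) modulo the next one: over R, the quotient of S by the last
   kernel is built up from r ideals of R. *)
Record is_flag (r : nat) (c : nat -> S -> R) : Prop := IsFlag {
  flagD : forall i f g, c i (f + g) = c i f + c i g;
  flagM : forall i u f, c i (iz u * f) = u * c i f;
  flag_homog : forall i, exists p q, forall f d, f \is d.-homog ->
    ((q <= d + p)%N -> c i f \is (d + p - q).-homog) /\ ((d + p < q)%N -> c i f = 0);
  flag_first : forall f, c 0 f = cf 0 0 f;
  flag_x : forall j f, (j < r)%N -> (forall i, (i < j)%N -> c i f = 0) -> c j (x * f) = 0;
  flag_y : forall j f, (j < r)%N -> (forall i, (i < j)%N -> c i f = 0) -> c j (y * f) = 0 }.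

Definition flag_ker (c : nat -> S -> R) (j : nat) : S -> Prop :=
  fun f => forall i, (i < j)%N -> c i f = 0.

(** On the common kernel of the previous functionals, each functional takes a value that is a unit
    at P: the layers of the quotient are free of rank one at every point of X. *)
Definition flag_locally_onto (r : nat) (c : nat -> S -> R) : Prop :=
  forall P, prime_ideal (@whole S) P -> homogeneous P -> incl IX P ->
    (exists j0, ~ P (iz 'X_j0)) -> forall j, (j < r)%N ->
  exists e d, [/\ e \is d.-homog, flag_ker c j e & ~ P (iz (c j e))].

Variables (r : nat) (c : nat -> S -> R).
Hypotheses (fc : is_flag r c) (r0 : (0 < r)%N).
Local Notation ker := (flag_ker c).

Lemma flag0 i : c i 0 = 0.
Proof. by rewrite -(mul0r (0 : S)) -(rmorph0 iz) (flagM fc) mul0r. Qed.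

Lemma flagN i f : c i (- f) = - c i f.
Proof. by apply/eqP; rewrite -addr_eq0 -(flagD fc) addNr flag0. Qed.

Lemma flag_sub i f g : c i (f - g) = c i f - c i g.
Proof. by rewrite (flagD fc) flagN. Qed.

Lemma flag_ker_mono i j f : (i <= j)%N -> ker j f -> ker i f.
Proof. by move=> ij kf l li; apply: kf; apply: leq_trans ij. Qed.

Lemma flag_ker_ideal j : (j <= r)%N -> ideal (@whole S) (ker j).
Proof.
move=> jr; apply: stable_ideal => [i _|f g Hf Hg i ij|u f Hf i ij|f Hf i ij|f Hf i ij].
- exact: flag0.
- by rewrite (flagD fc) Hf ?Hg ?addr0.
- by rewrite (flagM fc) Hf ?mulr0.
- apply: (flag_x fc); first exact: leq_trans ij jr.
  by move=> l li; apply: Hf; apply: ltn_trans li ij.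
- apply: (flag_y fc); first exact: leq_trans ij jr.
  by move=> l li; apply: Hf; apply: ltn_trans li ij.
Qed.

Lemma flag_ker_IX j h f : (j < r)%N -> IX h -> ker j f -> ker j.+1 (h * f).
Proof.
move=> jr /IX_P h0 kf; have [h1 [h2 [-> _ _]]] := cf_split h.
rewrite h0 rmorph0 add0r mulrDl -!mulrA.
have [_ _ _ kM] := flag_ker_ideal (ltnW jr).
move=> i; rewrite ltnS => ij; rewrite (flagD fc).
have ir : (i < r)%N := leq_ltn_trans ij jr.
rewrite (flag_x fc ir) ?(flag_y fc ir) ?addr0 //;
  by apply: (flag_ker_mono ij); apply: kM.
Qed.

Lemma flag_ker_pow j : (j <= r)%N -> incl (ideal_pow IX j) (ker j).
Proof.
elim: j => [|j IH] jr; first by move=> f _ i.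
have [_ k0 kD _] := flag_ker_ideal jr.
move=> _ [s [sP ->]]; rewrite big_seq; apply: (big_ind (ker j.+1) k0 kD) => w /sP[IXw pw].
by apply: flag_ker_IX => //; apply: IH => //; apply: ltnW.
Qed.

Lemma flag_ker_exp j h : (j <= r)%N -> IX h -> ker j (h ^+ j).
Proof.
move=> + Xh; elim: j => [|j IH] jr; first by move=> i.
by rewrite exprS; apply: flag_ker_IX => //; apply: IH; apply: ltnW.
Qed.

Lemma flag_ker_sub_IX f : ker r f -> IX f.
Proof. by move=> kf; apply/IX_P; rewrite -(flag_first fc); apply: kf. Qed.

(** A functional shifts all degrees by the same amount, so its values on distinct components cannot
    cancel. *)
Lemma flag_pihomog i f d : c i f = 0 -> c i (hc d f) = 0.
Proof.
move=> cf0; have [p [q H]] := flag_homog fc i.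
have [H1 H2] := H _ _ (pihomogP mdeg d f).
have [qd|/H2 //] := leqP q (d + p).
have csum (I : Type) (s : seq I) (Q : pred I) (F : I -> S) :
    c i (\sum_(l <- s | Q l) F l) = \sum_(l <- s | Q l) c i (F l).
  by apply: (big_morph (c i) (flagD fc i)); apply: flag0.
rewrite -(pihomog_dE (H1 qd)).
have [lt|ge] := ltnP d (msize f); last by rewrite (pihomog_gt ge) flag0 linear0.
have : hc (d + p - q) (c i (\sum_(l < msize f) hc l f)) = 0.
  by rewrite -pihomog_sum_eq cf0 linear0.
rewrite csum raddf_sum /= (bigD1 (Ordinal lt)) //= big1 ?addr0 // => l ne_l.
have [G1 G2] := H _ _ (pihomogP mdeg l f).
have [ql|/G2 ->] := leqP q (l + p); last by rewrite linear0.
apply: pihomog_ne0 (G1 ql); apply: contra ne_l => /eqP E; apply/eqP/val_inj => /=; lia.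
Qed.

Lemma flag_ker_hom j : homogeneous (ker j).
Proof. by move=> f kf d i ij; apply/flag_pihomog/kf. Qed.

(** A multiplier outside IX acts on each layer as its nonzero constant coefficient, and the layers
    embed into the domain R. *)
Lemma flag_ker_primary j g f : (j <= r)%N -> ~ IX g -> ker j (g * f) -> ker j f.
Proof.
move=> jr Xg; elim: j jr => [|j IH] jr kgf; first by move=> i.
have kf : ker j f by apply: IH; [apply: ltnW | apply: flag_ker_mono kgf].
have [h Xh gE] := IX_split g.
move=> i; rewrite ltnS leq_eqVlt => /orP[/eqP ->|]; last exact: kf.
have := kgf j (ltnSn j); rewrite gE mulrDl (flagD fc) (flagM fc).
rewrite (flag_ker_IX jr Xh kf) // addr0 => /eqP; rewrite mulf_eq0 => /orP[/eqP g0|/eqP //].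
by case: Xg; apply/IX_P.
Qed.

Lemma X0_notin_IX : ~ IX (iz 'X_ord0).
Proof.
move/IX_P; rewrite cfz /= => /eqP; apply/negP.
by rewrite -msize_poly_eq0 msizeX.
Qed.

Lemma flag_multiple_structure : multiple_structure (ker r).
Proof.
have ik := flag_ker_ideal (leqnn r).
split; last first.
  move=> f; split=> [[e /flag_ker_sub_IX/IX_P]|Xf]; last by exists r; apply: flag_ker_exp.
  by rewrite cf00X => /eqP; rewrite expf_eq0 => /andP[_ /eqP/IX_P].
split=> //; first exact: flag_ker_hom.
move=> f kf; have [i iE] := @iz_X k n ord0.
apply: (@flag_ker_primary r 'X_i) => //; rewrite -iE; exact: X0_notin_IX.
Qed.

Hypothesis onto : flag_locally_onto r c.

(** At P, S modulo the kernel is an iterated extension of copies of R, so regularity over R passes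
    to it. The ideals [a] and [B] are tied together by three inclusions that survive adjoining the
    next element to both. *)
Lemma flag_hom_regular P a B s : prime_ideal (@whole S) P -> homogeneous P -> incl IX P ->
  (exists j0, ~ P (iz 'X_j0)) -> ideal (@whole R) a -> ideal (@whole S) B ->
  (forall u l, (l < r)%N -> B u -> a (c l u)) -> (forall v, a v -> B (iz v)) -> incl (ker r) B ->
  hom_regular (trace P) a s -> hom_regular P B (map iz s).
Proof.
move=> pP hP XP Pj0; have [_ P1 PP] := pP; have pT := trace_prime pP; have [_ _ PT] := pT.
elim: s a B => [|f s IH] a B ia iB Ba aB kB //= [reg sreg]; split; last first.
  apply: IH sreg.
  - exact: ideal_adjoin_whole.
  - exact: ideal_adjoin_whole.
  - move=> _ l lr [b [b' [Bb _ ->]]]; exists (c l b), (c l b'); split=> //; first exact: Ba.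
    by rewrite (flagD fc) [b' * _]mulrC (flagM fc) mulrC.
  - by move=> _ [b [b' [ab _ ->]]]; exists (iz b), (iz b'); rewrite rmorphD rmorphM; split=> //; apply: aB.
  - by move=> u /kB Bu; exists u, 0; rewrite mul0r addr0.
have [_ a0 aD aM] := ia; have [_ B0 BD BM] := iB.
move=> b d bd [t Pt Btfb].
have lc l : (l < r)%N -> loc (trace P) a (c l b).
  move=> lr; have [d' cd] : exists d', c l b \is d'.-homog.
    have [p [q H]] := flag_homog fc l; have [H1 H2] := H _ _ bd.
    have [/H1 ?|/H2 ->] := leqP q (d + p); first by exists (d + p - q)%N.
    by exists 0%N; apply: dhomog0.
  apply: (reg _ d') => //; have [h Xh tE] := IX_split t.
  have t0 : ~ trace P (cf 0 0 t) by move=> /(trace_cf pP XP t).2.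
  exists (cf 0 0 t ^+ r).
    by move=> H; apply: t0; apply: (primeX (@subring_whole R) pT) H.
  rewrite -!(flagM fc); apply: Ba => //.
  (* The multiplier t is traded for its constant coefficient: their difference h is in IX, so the
     r-th power of h lies in [ker r]. *)
  have [q qE] : exists q, iz (cf 0 0 t ^+ r) = t * q + (- h) ^+ r.
    have -> : iz (cf 0 0 t ^+ r) = (t - h) ^+ r by rewrite rmorphXn; congr (_ ^+ _); rewrite [X in X - _]tE addrK.
    elim: (r) => [|e [q qE]]; first by exists 0; rewrite mulr0 add0r.
    by exists (q * (t - h) + (- h) ^+ e); rewrite exprSr qE exprSr; ring.
  rewrite qE mulrDl; apply: BD; first by rewrite mulrAC mulrC; apply: BM.
  rewrite mulrC; apply: BM => //; apply: kB; apply: flag_ker_exp => //.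
  by have [iX _ _] := @IX_prime k n; apply: (idealN (@subring_whole S) iX).
(* Descent through the layers: subtracting a multiple of [e], whose l-th value is a unit at P, kills
   the l-th value, while all values stay in [a] up to multipliers. *)
have main j : (j <= r)%N -> forall b, ker (r - j) b -> (forall l, (l < r)%N -> loc (trace P) a (c l b)) ->
    loc P B b.
  elim: j => [|j IHj] jr b1 kb lc1.
    by exists 1 => //; rewrite mul1r; apply: kB; rewrite subn0 in kb.
  set l := (r - j.+1)%N in kb *; have lr : (l < r)%N by rewrite /l; lia.
  have [e [de [ed ke Pe]]] := onto pP hP XP Pj0 lr.
  have [t' Pt' atb] := lc1 _ lr.
  pose b' := iz (t' * c l e) * b1 - iz (t' * c l b1) * e.
  have cb' i : c i b' = t' * c l e * c i b1 - t' * c l b1 * c i e by rewrite flag_sub !(flagM fc).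
  have [||s' Ps' Bs'] := IHj (ltnW jr) b'.
  - move=> i il; rewrite cb'; have [->|ne_il] := eqVneq i l; first by ring.
    have lt_il : (i < l)%N by move/eqP: ne_il; rewrite /l in il *; lia.
    by rewrite (kb _ lt_il) (ke _ lt_il); ring.
  - move=> i ir; have [v Pv av] := lc1 _ ir; exists v => //; rewrite cb'.
    rewrite (_ : v * _ = (t' * c l e) * (v * c i b1) + (- v * c i e) * (t' * c l b1)); last by ring.
    by apply: aD; apply: aM.
  exists (s' * iz (t' * c l e)).
    by rewrite (rmorphM iz) => /(PP _ _ Logic.I Logic.I)[//|/(PP _ _ Logic.I Logic.I)[]].
  rewrite (_ : _ * b1 = s' * b' + s' * e * iz (t' * c l b1)); last by rewrite /b'; ring.
  by apply: BD => //; apply: BM => //; apply: aB.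
by apply: (main r) => // i; rewrite subnn.
Qed.

(** One application of [regular_sequence_mpoly] in the chart gives both bounds: [s], lifted to
    forms, is regular on S modulo the kernel, and [w] limits the chains of primes to the length of
    [s]. *)
Lemma flag_CM : CM_scheme (ker r).
Proof.
have ik := flag_ker_ideal (leqnn r).
move=> P [pP hP [i0 Pi0]] kP.
have XP : incl IX P.
  by move=> h Xh; apply: (primeX (@subring_whole S) (r := r) pP) => //; apply/kP/flag_ker_exp.
have [j0 Pj0] : exists j0, ~ P (iz 'X_j0).
  case: (var_cases k i0) => [yE|xE|[j jE]]; last by exists j; rewrite -jE.
    by case: Pi0; rewrite yE; apply/XP/IX_P; rewrite -[Defs.y _ _]mulr1 cfy.
  by case: Pi0; rewrite xE; apply/XP/IX_P; rewrite -[Defs.x _ _]mulr1 cfx.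
have iP : ideal (@whole S) P by case: pP.
have [e [w [s [es sP sreg wind]]]] := regular_sequence_mpoly (chart_prime_prime pP Pj0).
have [fs [fsE fsh fsP]] : exists fs : seq (R * nat),
    [/\ map (chart k j0 \o fst) fs = s, forall w, w \in fs -> w.1 \is (w.2).-homog &
        forall w, w \in fs -> trace P w.1].
  elim: {sreg es} s sP => [|phi s IH] sP; first by exists [::].
  have [fs [fsE fsh fsP]] : exists fs : seq (R * nat),
    [/\ map (chart k j0 \o fst) fs = s, forall w, w \in fs -> w.1 \is (w.2).-homog &
        forall w, w \in fs -> trace P w.1].
    by apply: IH => f fs; apply: sP; rewrite in_cons fs orbT.
  have [M /(_ _ (leqnn M))[f fM fE]] := chart_lift j0 phi.
  exists ((f, M) :: fs); split; first by rewrite /= fE fsE.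
    by move=> v; rewrite in_cons => /orP[/eqP ->|/fsh].
  move=> v; rewrite in_cons => /orP[/eqP ->|/fsP] //=.
  by apply/(chart_primeE pP Pj0 fM); rewrite fE; apply: sP; rewrite mem_head.
have Rreg : hom_regular (trace P) (fun f => f = 0) (map fst fs).
  apply: (@hom_regular_chart _ _ P j0 pP Pj0 [::]).
    by move=> g /mapP[v /fsh vd ->]; exists v.2.
  by rewrite -map_comp fsE.
have Sreg : hom_regular P (ker r) (map iz (map fst fs)).
  apply: (flag_hom_regular pP hP XP _ _ ik _ _ _ Rreg) => //.
  - by exists j0.
  - exact: zero_ideal.
  - by move=> u l lr ku; apply: ku.
  - by move=> v ->; rewrite rmorph0; case: ik.
have [iz0 izE] := iz_X k j0; have Piz : ~ P 'X_iz0 by rewrite -izE.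
pose J := hlocal_ideal P (ker r); pose A := hlocal P.
pose q (v : S * nat) := (v.1, 'X_iz0 ^+ v.2 : S).
pose us := [seq v.1%:F / v.2%:F | v <- [seq q (iz v.1, v.2) | v <- fs]].
have usreg : regular_seq A J us.
  apply: hom_regular_frac => //.
  - exact: flag_ker_hom.
  - move=> v /mapP[u /fsh ud ->] /=; exists u.2; split; first exact: iz_homog.
      exact: Xexp_homog.
    exact: not_prime_Xexp.
  - suff -> : [seq w.1 | w <- [seq q (iz v.1, v.2) | v <- fs]] = map iz (map fst fs) by [].
    by rewrite -!map_comp.
have subA : is_subring A := hlocal_subring pP.
have mA : prime_ideal A (hlocal_ideal P P) := hlocal_ideal_prime pP pP (fun f Pf => Pf).
have JA : ideal A J := hlocal_ideal_ideal pP ik.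
have JmA : incl J (hlocal_ideal P P) := hlocal_ideal_mono kP.
have nonP u : nonunit A J u -> hlocal_ideal P P u.
  move=> nu; have [[d [f [g [fd gd Pg uE]]]] _] := nu; rewrite uE in nu *.
  apply/(hlocal_ideal_frac pP iP fd gd Pg)/(hloc_incl pP).
  exact/(nonunit_hlocal pP ik kP fd gd Pg).
have usP u : u \in us -> nonunit A J u.
  move=> /mapP[_ /mapP[v vs ->] ->].
  by apply: (nonunit_hlocal pP ik kP (iz_homog (fsh _ vs)) (Xexp_homog k iz0 _) (not_prime_Xexp pP Piz (d := v.2))).2; apply: fsP.
have bound l : strict_chain (fun p => prime_ideal A p /\ incl J p) l -> (l <= size us)%N.
  move=> /(chain_bound pP Pj0 ik (N := r)) H.
  have : (l + e <= n)%N by apply: H wind; [move=> h Xh; apply: flag_ker_exp | rewrite -es leq_addr].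
  by rewrite /us !size_map -(size_map (chart k j0 \o fst)) fsE -[X in (_ <= X)%N -> _]es addnC leq_add2l.
have chain t : (forall u, u \in t -> nonunit A J u) -> regular_seq A J t ->
    strict_chain (fun p => prime_ideal A p /\ incl J p) (size t).
  by move=> tP; apply: (regular_seq_chain subA JA mA JmA) => u /tP/nonP.
exists (size us); split; split; first exact: chain.
- exact: bound.
- by exists us.
- by move=> _ [t [<- tP treg]]; apply/bound/chain.
Qed.

(** At the generic point nonzero elements of R become units, so the kernels form a composition
    series; [b] lists them from the smallest upwards, whence the index r - i. *)
Lemma flag_multiplicity : multiplicity (ker r) r.
Proof.
have deg_swap p q d e : (q <= d + p -> q <= e + p -> e + p - q + d = d + p - q + e)%N by lia.
have ik := flag_ker_ideal (leqnn r); have pX := @IX_prime k n; have hX := @IX_hom k n.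
have iX : ideal (@whole S) IX by case: pX.
have Xj0 : exists j0, ~ IX (iz 'X_j0) by exists ord0; apply: X0_notin_IX.
have [i0 i0E] := iz_X k (ord0 : 'I_n.+1).
have Xi0 : ~ IX 'X_i0 by rewrite -i0E; apply: X0_notin_IX.
have subA : is_subring (hlocal IX) := hlocal_subring pX.
have /boolp.choice[ed edP] : forall j, exists ed : S * nat, (j < r)%N ->
    [/\ ed.1 \is (ed.2).-homog, ker j ed.1 & ~ IX (iz (c j ed.1))].
  move=> j; have [jr|rj] := ltnP j r; last by exists (0, 0%N).
  by have [e [d H]] := onto pX hX (fun f => id) Xj0 jr; exists (e, d).
pose b i := hlocal_ideal IX (ker (r - i)).
pose u i : {fraction S} := (ed (r - i.+1)%N).1%:F / ('X_i0 ^+ (ed (r - i.+1)%N).2)%:F.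
have ib i : ideal (hlocal IX) (b i) by apply: hlocal_ideal_ideal => //; apply: flag_ker_ideal; apply: leq_subr.
have b0 : b 0%N = hlocal_ideal IX (ker r) by rewrite /b subn0.
have br : b r = hlocal IX.
  rewrite /b subnn; apply: predext => v; split=> [[d [f [g [fd gd Pg _ ->]]]]|[d [f [g [fd gd Pg ->]]]]].
    by exists d, f, g.
  by exists d, f, g; split.
have bS i : (i < r)%N -> incl (b i) (b i.+1).
  move=> ir; apply: hlocal_ideal_mono => f; apply: flag_ker_mono.
  exact: leq_sub2l.
have jE i : (i < r)%N -> (r - i)%N = (r - i.+1).+1 by lia.
split.
  exists b; split.
    move=> i ir; split=> //; rewrite -b0; elim: i ir => [_ //|i IH] ir v bv.
    by apply: (bS i ir v); apply: (IH (ltnW ir)).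
  move=> i ir; split; first exact: bS.
  have lr : (r - i.+1 < r)%N by lia.
  have [edh ke Xe] := edP _ lr.
  have ikj : ideal (@whole S) (ker (r - i)) by apply: flag_ker_ideal; apply: leq_subr.
  apply: (hlocal_ideal_proper pX Xi0 ikj edh ke) => -[s [d [sd Xs ks]]].
  have := flag_ker_primary (leq_subr _ _) Xs ks; rewrite (jE _ ir) => /(_ _ (ltnSn _)) H.
  by apply: Xe; rewrite H rmorph0; case: iX.
apply: (ring_length_bound subA (b := b) (e := u) (m := hlocal_ideal IX IX)) => //.
- move=> i v ir [d [f [g [fd gd Xg kf vE]]]].
  have lr : (r - i.+1 < r)%N by lia.
  have [edh ke Xe] := edP _ lr.
  set j := (r - i.+1)%N in kf lr edh ke Xe *; set e := (ed j).1 in edh ke Xe *; set de := (ed j).2 in edh.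
  have z0 := not_prime0 pX (not_prime_Xexp pX Xi0 (d := de)).
  have g0 := not_prime0 pX Xg; have s0 := not_prime0 pX Xe.
  have [tau0|tau0] := eqVneq (c j f) 0.
    exists 0; first exact: (subring0 subA).
    rewrite mul0r subr0 vE; exists d, f, g; split=> //; rewrite (jE _ ir) => l.
    by rewrite ltnS leq_eqVlt => /orP[/eqP ->|/kf].
  have [p [q H]] := flag_homog fc j.
  have [F1 F2] := H _ _ fd; have [E1 E2] := H _ _ edh.
  have qd : (q <= d + p)%N by rewrite leqNgt; apply: contraNN tau0 => /F2 ->.
  have qe : (q <= de + p)%N.
    by rewrite leqNgt; apply/negP => /E2 ce; apply: Xe; rewrite ce rmorph0; case: iX.
  pose s := iz (c j e); pose t := iz (c j f).
  have sd : s \is (de + p - q).-homog by apply: iz_homog; apply: E1.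
  have td : t \is (d + p - q).-homog by apply: iz_homog; apply: F1.
  have [_ _ XX] := pX; have Xsg : ~ IX (s * g) by case/XX.
  have degE := deg_swap _ _ _ _ qd qe.
  exists ((t * 'X_i0 ^+ de)%:F / (s * g)%:F).
    exists (de + p - q + d)%N, (t * 'X_i0 ^+ de), (s * g); split=> //; last exact: dhomogM.
    by rewrite degE; apply: dhomogM => //; apply: Xexp_homog.
  exists (de + p - q + d)%N, (s * f - t * e), (s * g); split=> //.
  + apply: rpredB; first exact: dhomogM.
    by rewrite degE; apply: dhomogM.
  + exact: dhomogM.
  + rewrite (jE _ ir) => l; rewrite ltnS leq_eqVlt flag_sub !(flagM fc) => /orP[/eqP ->|ll].
      by rewrite mulrC subrr.
    by rewrite (kf _ ll) (ke _ ll) !mulr0 subrr.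
  + rewrite vE /u -/j -/e -/de tofracB !tofracM.
    exact: (frac_reduce _ _ _ g0 s0 z0).
- move=> i _ ir [d [h [g [hd gd Xg Xh ->]]]].
  have lr : (r - i.+1 < r)%N by lia.
  have [edh ke Xe] := edP _ lr; have [_ _ XX] := pX.
  rewrite /u mulf_div -!tofracM; exists (d + (ed (r - i.+1)%N).2)%N, (h * (ed (r - i.+1)%N).1), (g * 'X_i0 ^+ (ed (r - i.+1)%N).2).
  split=> //; first exact: dhomogM.
  + by apply: dhomogM => //; apply: Xexp_homog.
  + by case/XX => //; apply: not_prime_Xexp.
  + by rewrite (jE _ ir); apply: flag_ker_IX.
- move=> _ [d [f [g [fd gd Xg ->]]]] H.
  have g0 := not_prime0 pX Xg.
  have Xf : ~ IX f by move=> Xf; apply: H; exists d, f, g.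
  exists (g%:F / f%:F); first by exists d, g, f.
  rewrite mulf_div [g%:F * _]mulrC divff ?subrr; first by case: (hlocal_ideal_ideal pX iX).
  exact: mulf_neq0 (not_prime0 pX Xf) g0.
Qed.

End Flag.

(** * Syzygies of forms without common zero *)

Section Coprime.
Variables (D : idomainType).

Definition coprime_elts (f g : D) : Prop := forall p, prime_elt p -> divides p f -> ~ divides p g.

Lemma divides_cancel (f g h : D) : factorial D -> f != 0 -> coprime_elts f g ->
  divides f (g * h) -> divides f h.
Proof.
move=> fD f0 cop; have [s [sP [u [v uv] fE]]] := fD f f0.
have sg p : p \in s -> ~ divides p g.
  move=> ps; apply: cop; first exact: sP.
  by exists (u * \prod_(q <- rem p s) q); rewrite fE (perm_big _ (perm_to_rem ps)) big_cons /=; ring.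
rewrite fE; elim: s sP sg h {fE} => [|p s IH] sP sg h.
  by rewrite big_nil mulr1 => _; exists (v * h); rewrite -mulrA [h * u]mulrC mulrA [v * u]mulrC uv mul1r.
have ps : p \in p :: s := mem_head _ _.
have [p0 _ pP] := sP _ ps; rewrite big_cons => -[q qE].
have /pP[/(sg _ ps)//|[h' hE]] : divides p (g * h).
  by exists (q * (u * \prod_(j <- s) j)); rewrite qE; ring.
have [|||r rE] := IH _ _ h'.
- by move=> j js; apply: sP; rewrite in_cons js orbT.
- by move=> j js; apply: sg; rewrite in_cons js orbT.
- by exists q; apply: (mulIf p0); rewrite -mulrA -hE qE; ring.
by exists r; rewrite hE rE; ring.
Qed.

End Coprime.

Section Syzygies.
Variables (k : fieldType).

Lemma mpoly_var_sum n (i j : 'I_n) (f : {mpoly k[n]}) :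
  (forall m, m \in msupp f -> (m i != 0%N) || (m j != 0%N)) ->
  exists g h, f = 'X_i * g + 'X_j * h.
Proof.
move=> H; rewrite [f]mpolyE big_seq.
apply: (big_ind (fun f => exists g h, f = 'X_i * g + 'X_j * h)) => [|_ _ [g [h ->]] [g' [h' ->]]|m mf].
- by exists 0, 0; rewrite !mulr0 addr0.
- by exists (g + g'), (h + h'); ring.
have ml l : m l != 0%N -> 'X_[m] = 'X_l * 'X_[m - U_(l)] :> {mpoly k[n]}.
  by move=> ml; rewrite -mpolyXD addmC submK // lep1mP.
case/orP: (H _ mf) => ml0; rewrite (ml _ ml0).
  by exists (f@_m *: 'X_[m - U_(i)]), 0; rewrite mulr0 addr0 scalerAr.
by exists 0, (f@_m *: 'X_[m - U_(j)]); rewrite mulr0 add0r scalerAr.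
Qed.

Lemma mcoeff_varM n (i : 'I_n) (f : {mpoly k[n]}) m :
  ('X_i * f)@_m = if m i != 0%N then f@_(m - U_(i)) else 0.
Proof.
rewrite mulrC; case: ifP => mi.
  have {1}-> : m = (U_(i) + (m - U_(i)))%MM by rewrite addmC submK // lep1mP.
  by rewrite mcoeffMX.
rewrite mcoeffMr big1 // => -[u v] /= /eqP mE; rewrite mcoeffX.
case: eqP => [vE|_]; last by rewrite mulr0.
by move/mnmP/(_ i): mE mi; rewrite -vE mnmDE mnm1E eqxx => ->; rewrite addn_eq0 /= ?andbF.
Qed.

Lemma var_cross n (i j : 'I_n) (f g : {mpoly k[n]}) : i != j ->
  'X_j * f = 'X_i * g -> exists h, f = 'X_i * h.
Proof.
move=> ij E; have [m|a [b ->]] := @mpoly_var_sum n i i f; last by exists (a + b); ring.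
rewrite mcoeff_msupp orbb; apply: contraNneq => mi.
have := congr1 (mcoeff (m + U_(j))) E; rewrite !mcoeff_varM !mnmDE !mnm1E eqxx addn1 /= addmK.
by rewrite mi [j == i]eq_sym (negbTE ij) => ->.
Qed.

(** X_i, X_j, X_l is a regular sequence: a monomial of f free of X_i and X_j would survive
    multiplication by X_l. *)
Lemma var_cross2 n (i j l : 'I_n) (f g h : {mpoly k[n]}) : l != i -> l != j ->
  'X_l * f = 'X_i * g + 'X_j * h -> exists g' h', f = 'X_i * g' + 'X_j * h'.
Proof.
move=> li lj E; apply: mpoly_var_sum => m; rewrite mcoeff_msupp; apply: contraNT.
rewrite negb_or !negbK => /andP[/eqP mi /eqP mj].
have := congr1 (mcoeff (m + U_(l))) E.
rewrite mcoeffD !mcoeff_varM !mnmDE !mnm1E eqxx addn1 /= addmK => ->.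
by rewrite mi mj (negbTE li) (negbTE lj) addr0.
Qed.

(* The depth of k[X_0..X_n] / (f, g) is positive when n >= 2. *)
Lemma coprime_saturated n (i j l : 'I_n) (f g h : {mpoly k[n]}) :
  i != j -> l != i -> l != j -> f != 0 -> coprime_elts f g ->
  (forall v, exists a b, 'X_v * h = a * f + b * g) -> exists a b, h = a * f + b * g.
Proof.
move=> ij li lj f0 cop hI; have facR := @factorial_mpoly k n.
have [ai [bi Ei]] := hI i; have [aj [bj Ej]] := hI j; have [al [bl El]] := hI l.
(* Two expressions of X_u X_v h by f and g differ by a syzygy, which is a multiple c of the trivial
   one because f and g are coprime. *)
have rel u v au bu av bv : 'X_u * h = au * f + bu * g -> 'X_v * h = av * f + bv * g ->
    exists c, 'X_v * au - 'X_u * av = - c * g /\ 'X_v * bu - 'X_u * bv = c * f.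
  move=> Eu Ev; have E : ('X_v * bu - 'X_u * bv) * g = - ('X_v * au - 'X_u * av) * f.
    apply/eqP; rewrite -subr_eq0 (_ : _ - _ = 'X_v * (au * f + bu * g) - 'X_u * (av * f + bv * g)); last by ring.
    by rewrite -Eu -Ev mulrCA subrr.
  have [|c cE] := @divides_cancel _ f g ('X_v * bu - 'X_u * bv) facR f0 cop.
    by exists (- ('X_v * au - 'X_u * av)); rewrite mulrC.
  exists c; split=> //; apply: (mulIf f0); apply: oppr_inj; rewrite -mulNr -E cE; ring.
have [c [ca cb]] := rel i j _ _ _ _ Ei Ej.
have [c1 [c1a c1b]] := rel i l _ _ _ _ Ei El.
have [c2 [c2a c2b]] := rel j l _ _ _ _ Ej El.
(* The relation among the three syzygy multipliers puts [c] into the ideal of X_i and X_j; its two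
   parts correct the coefficients of X_i h until X_i divides them. *)
have E : 'X_l * c = 'X_j * c1 + 'X_i * (- c2).
  apply: (mulIf f0); rewrite -mulrA -cb mulrDl -!mulrA mulNr -c1b -c2b; ring.
have [d1 [d0 cE]] := var_cross2 lj li E.
have [|e aE] := @var_cross n i j (ai + d1 * g) (aj - d0 * g) ij.
  have -> : 'X_j * (ai + d1 * g) = ('X_j * ai - 'X_i * aj) + 'X_i * aj + 'X_j * d1 * g by ring.
  by rewrite ca cE; ring.
have [|e' bE] := @var_cross n i j (bi - d1 * f) (bj + d0 * f) ij.
  have -> : 'X_j * (bi - d1 * f) = ('X_j * bi - 'X_i * bj) + 'X_i * bj - 'X_j * d1 * f by ring.
  by rewrite cb cE; ring.
exists e, e'; apply: (mulfI (_ : 'X_i != 0)); first by rewrite -msize_poly_eq0 msizeX.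
rewrite Ei (_ : _ * (_ + _) = ('X_i * e) * f + ('X_i * e') * g); last by ring.
by rewrite -aE -bE; ring.
Qed.

Lemma prime_not_const n (p : {mpoly k[n]}) : prime_elt p -> ~ p \is 0.-homog.
Proof.
move=> [p0 pU _] /homog_msize_le/msize1_polyC pE; apply: pU.
have c0 : p@_0%MM != 0 by apply: contraNneq p0 => c0; rewrite pE c0.
by exists ((p@_0%MM)^-1)%:MP; rewrite {1}pE -mpolyCM mulfV // mpolyC1.
Qed.

Lemma divides_homog n (p f : {mpoly k[n]}) d : f != 0 -> f \is d.-homog -> divides p f ->
  exists e, p \is e.-homog.
Proof.
move=> f0 fd [q fE]; rewrite fE mulrC in f0 fd.
exact: homog_factor f0 fd.
Qed.

Let R := {mpoly k[3]}.

(* Forms without a common zero in the projective plane are a regular sequence. *)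
Lemma koszul_syzygies s (F1 F2 F3 a b c : R) :
  (0 < s)%N -> F1 \is s.-homog -> F2 \is s.-homog -> F3 \is s.-homog ->
  ~ (exists P, [/\ proj_point P, P F1, P F2 & P F3]) ->
  a * F1 + b * F2 + c * F3 = 0 ->
  exists u v w, [/\ a = u * F2 + v * F3, b = w * F3 - u * F1 & c = - v * F1 - w * F2].
Proof.
move=> s0 h1 h2 h3 noP E; have facR := @factorial_mpoly k 3.
(* In three variables two forms of positive degree have a common zero. Hence F1 is nonzero, and F1,
   F2 are coprime: a common prime factor and F3 would vanish together. *)
have zero2 e (f : R) g : (0 < e)%N -> f \is e.-homog -> g \is s.-homog -> exists P, [/\ proj_point P, P f & P g].
  move=> e0 fe gs; pose F := fun i : 'I_2 => if i == 0 then f else g.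
  pose d := fun i : 'I_2 => if i == 0 then e else s.
  have [|//|i|P [pP PF]] := @common_zero k 2 2 F d.
  - by move=> i; rewrite /F /d; case: ifP.
  - by rewrite /d; case: ifP.
  - by exists P; split; [| exact: (PF 0) | exact: (PF 1)].
have P0 (P : R -> Prop) : proj_point P -> P 0 by case=> -[[]].
have F1n0 : F1 != 0.
  apply/eqP => F10; apply: noP; have [P [pP PF PG]] := zero2 _ _ _ s0 h2 h3.
  by exists P; split=> //; rewrite F10; apply: P0.
have cop : coprime_elts F1 F2.
  move=> p pp p1 p2; apply: noP; have [e pe] := divides_homog F1n0 h1 p1.
  have e0 : (0 < e)%N by rewrite lt0n; apply/eqP => e0; rewrite e0 in pe; exact: (prime_not_const pp pe).
  have [P [pP PF PG]] := zero2 _ _ _ e0 pe h3.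
  have [[[_ _ _ PM] _ _] _ _] := pP.
  by exists P; split=> //; [case: p1 => q -> | case: p2 => q ->]; apply: PM.
pose F := fun i : 'I_3 => if i == 0 then F1 else if i == 1 then F2 else F3.
have Fs i : F i \is s.-homog by rewrite /F; case: ifP => // _; case: ifP.
have [|N0 N0P] := boolp.choice (no_zero_power Fs _).
  by move=> [P [pP PF]]; apply: noP; exists P; split=> //; [exact: (PF 0) | exact: (PF 1) | exact: (PF ord_max)].
pose I h := exists a b, h = a * F1 + b * F2.
have iI : ideal (@whole R) I.
  split=> //; first by exists 0, 0; rewrite !mul0r addr0.
    by move=> _ _ [a1 [b1 ->]] [a2 [b2 ->]]; exists (a1 + a2), (b1 + b2); ring.
  by move=> u _ _ [a1 [b1 ->]]; exists (u * a1), (u * b1); ring.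
have [_ I0 ID IM] := iI.
have FI f : forms_ideal F f -> I (c * f).
  move=> [g ->]; rewrite !big_ord_recl big_ord0 /F /= addr0.
  exists (c * g ord0 - g (lift ord0 (lift ord0 ord0)) * a), (c * g (lift ord0 ord0) - g (lift ord0 (lift ord0 ord0)) * b).
  apply/eqP; rewrite -subr_eq0; apply/eqP.
  transitivity (g (lift ord0 (lift ord0 ord0)) * (a * F1 + b * F2 + c * F3)); first by ring.
  by rewrite E mulr0.
pose N := (\sum_j N0 j)%N.
have powN j : I (c * 'X_j ^+ N.+1).
  have leN : (N0 j <= N.+1)%N by rewrite /N (bigD1 j) //= -addnS leq_addr.
  by rewrite -(subnK leN) exprD mulrCA; apply: IM => //; apply: FI.
(* By the relation, c times each F_i is in (F1, F2), hence so is c times every monomial of large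
   degree. As (F1, F2) is saturated, the bound on the degree descends to zero. *)
have [u [v cE]] : I c.
  have large := @large_monomials k 2 (fun f => I (c * f)) N _ powN.
  have {large} : forall m : 'X_{1..3}, (3 * N.+1 <= mdeg m)%N -> I (c * 'X_[m]).
    apply: large; split=> // [|f g|f g _]; first by rewrite mulr0.
      by rewrite mulrDr; apply: ID.
    by rewrite mulrCA; apply: IM.
  suff H M : (forall m : 'X_{1..3}, (M <= mdeg m)%N -> I (c * 'X_[m])) -> I c by apply: H.
  elim: M => [|M IH] H; first by rewrite -[c]mulr1 -mpolyX0; apply: H.
  apply: IH => m Mm; apply: (@coprime_saturated 3 0 1 ord_max F1 F2) => // v.
  have [|p [q pq]] := H (U_(v) + m)%MM; first by rewrite mdegD mdeg1 add1n.
  by exists p, q; rewrite -pq mpolyXD; ring.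
have E' : (a + u * F3) * F1 = - (b + v * F3) * F2.
  apply/eqP; rewrite -subr_eq0 (_ : _ - _ = a * F1 + b * F2 + (u * F1 + v * F2) * F3); last by ring.
  by rewrite -cE E.
have [|w wE] := @divides_cancel _ F1 F2 (- (b + v * F3)) facR F1n0 cop.
  by exists (a + u * F3); rewrite E' mulrC.
exists w, (- u), (- v); split.
- have : a + u * F3 = w * F2 by apply: (mulIf F1n0); rewrite E' wE; ring.
  by move=> aE; rewrite -[a](addrK (u * F3)) aE; ring.
- by rewrite -[b](addrK (v * F3)) -[b + v * F3]opprK wE; ring.
- by rewrite cE; ring.
Qed.

End Syzygies.

(** * The listed ideals *)

(* Stated for abstract ring elements: ring is slow at comparing coefficients of polynomials. *)
Lemma expand_identity (A : comNzRingType) (x y c00 c10 c20 c30 a c01 c11 b c02 c d : A) :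
  c00 + x * (c10 + x * (c20 + x * (c30 + x * a))) + y * (c01 + x * (c11 + x * b) + y * (c02 + x * c + y * d))
  = c00 + c10 * x + c20 * x ^+ 2 + c30 * x ^+ 3 + x ^+ 4 * a + c01 * y + c11 * x * y + x ^+ 2 * y * b
    + c02 * y ^+ 2 + x * y ^+ 2 * c + y ^+ 3 * d.
Proof. by ring. Qed.

(* ring would unfold the coefficient maps. *)
Ltac cf_ring := repeat match goal with
  | |- context [@cf ?k ?n ?a ?b ?f] => move: (@cf k n a b f) => ?
  | |- context [@in_z ?k ?n ?r] => move: (@in_z k n r) => ?
  end; ring.

Section Expansion.
Variables (k : fieldType) (n : nat).
Local Notation R := {mpoly k[n.+1]}.
Local Notation S := {mpoly k[n.+3]}.
Local Notation x := (x k n).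
Local Notation y := (y k n).
Local Notation iz := (@in_z k n).
Local Notation IX := (@IX k n).

Lemma cf_inj (f : S) : (forall a b, cf a b f = 0) -> f = 0.
Proof.
move=> H; apply: (@muni_inj k n.+2); rewrite muni0; apply/polyP => b; rewrite coef0.
apply: (@muni_inj k n.+1); rewrite muni0; apply/polyP => a; rewrite coef0.
exact: H.
Qed.

Lemma cf_split_x (f : S) : (forall a b, cf a b.+1 f = 0) ->
  exists f1, [/\ f = iz (cf 0 0 f) + x * f1, forall a b, cf a b.+1 f1 = 0
    & forall a, cf a 0 f1 = cf a.+1 0 f].
Proof.
move=> fy; have [f1 [f2 [fE f1E f2E]]] := cf_split f.
have f20 : f2 = 0 by apply: cf_inj => a b; rewrite f2E fy.
exists f1; split=> [|a b|a]; last by rewrite f1E.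
  by rewrite {1}fE f20 mulr0 addr0.
by rewrite f1E.
Qed.

(** The remainders, multiples of x^4, x^2 y, x y^2 and y^3, lie in every listed ideal; the seven
    coefficients are those which the flags below read. *)
Lemma cf_expand (f : S) : exists A B C D, f = iz (cf 0 0 f) + iz (cf 1 0 f) * x + iz (cf 2 0 f) * x ^+ 2
  + iz (cf 3 0 f) * x ^+ 3 + x ^+ 4 * A + iz (cf 0 1 f) * y + iz (cf 1 1 f) * x * y + x ^+ 2 * y * B
  + iz (cf 0 2 f) * y ^+ 2 + x * y ^+ 2 * C + y ^+ 3 * D.
Proof.
have [f1 [f2 [fE f1E f2E]]] := cf_split f.
have [|h1 [h1E h1y h1c]] := @cf_split_x f1; first by move=> a b; rewrite f1E.
have [//|h2 [h2E h2y h2c]] := @cf_split_x h1.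
have [//|A [h3E _ _]] := @cf_split_x h2.
have [g1 [g2 [gE g1E g2E]]] := cf_split f2.
have [|B [g1B _ _]] := @cf_split_x g1; first by move=> a b; rewrite g1E.
have [C [D [g2E' _ _]]] := cf_split g2.
rewrite g1E f2E in g1B; rewrite g2E f2E in g2E'; rewrite f2E in gE.
rewrite h2c h1c f1E in h3E; rewrite h1c f1E in h2E; rewrite f1E in h1E.
by exists A, B, C, D; rewrite [LHS]fE h1E h2E h3E gE g1B g2E'; apply: expand_identity.
Qed.

Lemma cf_mono a b i j : cf a b (x ^+ i * y ^+ j) = ((a == i) && (b == j))%:R.
Proof.
elim: i a => [|i IH] a; last first.
  by rewrite exprS -mulrA cfx; case: a => // a; rewrite IH.
rewrite expr0 mul1r; elim: j b => [|j IH] b; first by rewrite expr0 cf1; case: (_ && _).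
by rewrite exprS cfy; case: b => [|b]; rewrite ?andbF // IH.
Qed.

Lemma row_homog a b p q e (w : R) : w \is e.-homog -> (e + q = p + (a + b))%N ->
  forall f d, f \is d.-homog -> ((q <= d + p)%N -> w * cf a b f \is (d + p - q).-homog) /\
    ((d + p < q)%N -> w * cf a b f = 0).
Proof.
move=> we E f d fd; have [H1 H2] := cf_homog a b fd; split=> le.
  have [ab|ab] := leqP (a + b) d; last by rewrite H2 // mulr0; apply: dhomog0.
  by rewrite (_ : _ - q = e + (d - (a + b)))%N; [apply: dhomogM => //; apply: H1 | lia].
by rewrite H2 ?mulr0 //; lia.
Qed.

Lemma row_homogD (c1 c2 : S -> R) p q :
  (forall f d, f \is d.-homog -> ((q <= d + p)%N -> c1 f \is (d + p - q).-homog) /\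
    ((d + p < q)%N -> c1 f = 0)) ->
  (forall f d, f \is d.-homog -> ((q <= d + p)%N -> c2 f \is (d + p - q).-homog) /\
    ((d + p < q)%N -> c2 f = 0)) ->
  forall f d, f \is d.-homog -> ((q <= d + p)%N -> c1 f + c2 f \is (d + p - q).-homog) /\
    ((d + p < q)%N -> c1 f + c2 f = 0).
Proof.
move=> H1 H2 f d fd; have [A1 A2] := H1 _ _ fd; have [B1 B2] := H2 _ _ fd.
by split=> le; [apply: rpredD; [exact: A1 | exact: B1] | rewrite A2 // B2 // addr0].
Qed.

(** Coordinates in the quotient: with respect to 1, x, x^2, x^3 for (1), where (al, be) = (0, 1),
    and to 1, x, x^2, y for (6), where x^3 = - G y and (al, be) = (1, - G). *)
Definition flagA (al be : R) (i : nat) (f : S) : R :=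
  match i with
  | 0 => cf 0 0 f | 1 => cf 1 0 f | 2 => cf 2 0 f | _ => al * cf 0 1 f + be * cf 3 0 f
  end.

(** For (2) to (5): the last row is the functional on quadrics with values F1, F2, F3 on x^2, x y,
    y^2. *)
Definition flagB (F1 F2 F3 : R) (i : nat) (f : S) : R :=
  match i with
  | 0 => cf 0 0 f | 1 => cf 1 0 f | 2 => cf 0 1 f
  | _ => F1 * cf 2 0 f + F2 * cf 1 1 f + F3 * cf 0 2 f
  end.

(** Coordinates with respect to 1, x, y, x y modulo x^2 + a x y + l y and y^2, where x^3 = - l x y.
    The linear form [l] and the scalar [a] are normalized to z_0 and to 0 or 1 only after the
    classification. *)
Definition flagC (l : R) (a : k) (i : nat) (f : S) : R :=
  match i with
  | 0 => cf 0 0 f | 1 => cf 1 0 f | 2 => cf 0 1 f - l * cf 2 0 f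
  | _ => cf 1 1 f - a%:MP * cf 2 0 f - l * cf 3 0 f
  end.

Lemma cf_row_homog a b : exists p q, forall (f : S) d, f \is d.-homog ->
  ((q <= d + p)%N -> cf a b f \is (d + p - q).-homog) /\ ((d + p < q)%N -> cf a b f = 0).
Proof.
exists 0%N, (a + b)%N => f d fd; rewrite -[cf a b f]mul1r.
exact: (row_homog (dhomog1 _ _) _ fd).
Qed.

Lemma var_homog m (i : 'I_m) : ('X_i : {mpoly k[m]}) \is 1.-homog.
Proof. by rewrite dhomogX; apply/eqP; apply: mdeg1. Qed.

Lemma const_homog m (a : k) : (a%:MP : {mpoly k[m]}) \is 0.-homog.
Proof. by rewrite -alg_mpolyC; apply: rpredZ; apply: dhomog1. Qed.

Lemma flagA_flag al be : (al = 0 /\ be = 1) \/ (al = 1 /\ be \is 2.-homog) ->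
  is_flag 4 (flagA al be).
Proof.
move=> alP; split=> [[|[|[|i]]] f g|[|[|[|i]]] u f|[|[|[|i]]]|f|[|[|[|[|//]]]] f _ H|[|[|[|[|//]]]] f _ H] /=;
  rewrite ?cfD ?cfM ?cfx ?cfy ?(H 0%N) ?(H 1%N) ?(H 2%N) ?mulr0 ?addr0 //.
- by cf_ring.
- by cf_ring.
- exact: cf_row_homog.
- exact: cf_row_homog.
- exact: cf_row_homog.
- case: alP => -[alE bE].
    exists 0%N, 3; apply: row_homogD; last by apply: (@row_homog _ _ _ _ 0); rewrite ?bE ?dhomog1.
    by move=> f d _; rewrite alE mul0r; split=> // _; apply: dhomog0.
  exists 0%N, 1%N; apply: row_homogD; last exact: (@row_homog _ _ _ _ 2).
  by apply: (@row_homog _ _ _ _ 0); rewrite ?alE ?dhomog1.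
- exact: (H 0%N).
- exact: (H 1%N).
- by have /= -> := H 2%N isT; rewrite mulr0 addr0.
- by have /= -> := H 0%N isT; rewrite mulr0.
Qed.

Lemma flagB_flag s F1 F2 F3 : F1 \is s.-homog -> F2 \is s.-homog -> F3 \is s.-homog ->
  is_flag 4 (flagB F1 F2 F3).
Proof.
move=> h1 h2 h3; split=> [[|[|[|i]]] f g|[|[|[|i]]] u f|[|[|[|i]]]|f|[|[|[|[|//]]]] f _ H|[|[|[|[|//]]]] f _ H] /=;
  rewrite ?cfD ?cfM ?cfx ?cfy ?mulr0 ?addr0 ?add0r //.
- by cf_ring.
- by cf_ring.
- exact: cf_row_homog.
- exact: cf_row_homog.
- exact: cf_row_homog.
- exists s, 2%N; do 2?apply: row_homogD; exact: (@row_homog _ _ _ _ s).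
- exact: (H 0%N).
- by have /= -> := H 1%N isT; have /= -> := H 2%N isT; rewrite !mulr0 addr0.
- exact: (H 0%N).
- by have /= -> := H 1%N isT; have /= -> := H 2%N isT; rewrite !mulr0 addr0.
Qed.

Lemma flagC_flag l a : l \is 1.-homog -> is_flag 4 (flagC l a).
Proof.
move=> l1; split=> [[|[|[|i]]] f g|[|[|[|i]]] u f|[|[|[|i]]]|f|[|[|[|[|//]]]] f _ H|[|[|[|[|//]]]] f _ H] /=;
  rewrite ?cfD ?cfM ?cfx ?cfy ?mulr0 ?subr0 ?sub0r //.
- by cf_ring.
- by cf_ring.
- by cf_ring.
- by cf_ring.
- exact: cf_row_homog.
- exact: cf_row_homog.
- exists 0%N, 1%N => f d fd; rewrite -mulNr -[cf 0 1 f]mul1r; move: f d fd.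
  apply: row_homogD; first by apply: (@row_homog _ _ _ _ 0); rewrite ?dhomog1.
  by apply: (@row_homog _ _ _ _ 1); rewrite ?rpredN.
- exists 0%N, 2%N => f d fd; rewrite -!mulNr -[cf 1 1 f]mul1r; move: f d fd.
  do 2?apply: row_homogD; first by apply: (@row_homog _ _ _ _ 0); rewrite ?dhomog1.
    by apply: (@row_homog _ _ _ _ 0); rewrite ?rpredN ?const_homog.
  by apply: (@row_homog _ _ _ _ 1); rewrite ?rpredN.
- exact: (H 0%N).
- by have /= -> := H 1%N isT; rewrite mulr0 oppr0.
- have /= H2 := H 2%N isT; have /= H1 := H 1%N isT.
  by rewrite H1 mulr0 subr0.
- exact: (H 0%N).
- exact: (H 1%N).
Qed.

Lemma is_flag_le r r' (c : nat -> S -> R) : (r' <= r)%N -> is_flag r c -> is_flag r' c.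
Proof.
move=> le [fD fM fh f0 fx fy]; split=> // j f jr.
  exact: fx (leq_trans jr le).
exact: fy (leq_trans jr le).
Qed.

Lemma onto_le r r' (c : nat -> S -> R) : (r' <= r)%N -> flag_locally_onto r c -> flag_locally_onto r' c.
Proof. by move=> le H P pP hP XP Pj j jr; apply: H => //; apply: leq_trans le. Qed.

Lemma onto_witness (P : S -> Prop) (c : nat -> S -> R) i e d : prime_ideal (@whole S) P ->
  e \is d.-homog -> (forall l, (l < i)%N -> c l e = 0) -> c i e = 1 ->
  exists e d, [/\ e \is d.-homog, flag_ker c i e & ~ P (iz (c i e))].
Proof.
by move=> [_ P1 _] ed ce ci; exists e, d; split=> //; rewrite ci rmorph1.
Qed.

Lemma xy_homog i j : (x ^+ i * y ^+ j : S) \is (i + j).-homog.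
Proof.
apply: dhomogM; first by rewrite -[X in X.-homog]mul1n; apply: dhomogMn; apply: var_homog.
by rewrite -[X in X.-homog]mul1n; apply: dhomogMn; apply: var_homog.
Qed.

Lemma flagA_onto al be : (al = 0 /\ be = 1) \/ (al = 1 /\ be \is 2.-homog) ->
  flag_locally_onto 4 (flagA al be).
Proof.
move=> alP P pP _ _ _ [|[|[|[|//]]]] _.
- by apply: (onto_witness (i := 0) pP (xy_homog 0 0)) => //=; rewrite cf_mono.
- by apply: (onto_witness (i := 1) pP (xy_homog 1 0)) => [[|]//|] /=; rewrite cf_mono.
- by apply: (onto_witness (i := 2) pP (xy_homog 2 0)) => [[|[|]]//|] /=; rewrite cf_mono.
- case: alP => -[-> bE].
    by apply: (onto_witness (i := 3) pP (xy_homog 3 0)) => [[|[|[|]]]//|] /=; rewrite ?cf_mono ?bE //= mulr0 add0r mulr1.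
  by apply: (onto_witness (i := 3) pP (xy_homog 0 1)) => [[|[|[|]]]//|] /=; rewrite ?cf_mono //= mulr0 addr0 mulr1.
Qed.

Lemma flagC_onto l a : flag_locally_onto 4 (flagC l a).
Proof.
move=> P pP _ _ _ [|[|[|[|//]]]] _.
- by apply: (onto_witness (i := 0) pP (xy_homog 0 0)) => //=; rewrite cf_mono.
- by apply: (onto_witness (i := 1) pP (xy_homog 1 0)) => [[|]//|] /=; rewrite cf_mono.
- apply: (onto_witness (i := 2) pP (xy_homog 0 1)) => [[|[|]]//|] /=; rewrite ?cf_mono //=.
  by rewrite mulr0 subr0.
- apply: (onto_witness (i := 3) pP (xy_homog 1 1)) => [[|[|[|]]]//|] /=; rewrite ?cf_mono //=.
    by rewrite mulr0 subr0.
  by rewrite !mulr0 !subr0.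
Qed.

Lemma flagB_onto F1 F2 F3 : (forall P, prime_ideal (@whole S) P -> homogeneous P -> incl IX P ->
    (exists j0, ~ P (iz 'X_j0)) -> ~ [/\ P (iz F1), P (iz F2) & P (iz F3)]) ->
  flag_locally_onto 4 (flagB F1 F2 F3).
Proof.
move=> noF P pP hP XP Pj0 [|[|[|[|//]]]] _.
- by apply: (onto_witness (i := 0) pP (xy_homog 0 0)) => //=; rewrite cf_mono.
- by apply: (onto_witness (i := 1) pP (xy_homog 1 0)) => [[|]//|] /=; rewrite cf_mono.
- by apply: (onto_witness (i := 2) pP (xy_homog 0 1)) => [[|[|]]//|] /=; rewrite ?cf_mono.
have [PF1|PF1] := boolp.EM (P (iz F1)); last first.
  exists (x ^+ 2 * y ^+ 0), (2 + 0)%N; split; first exact: xy_homog.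
    by case=> [|[|[|//]]] _ /=; rewrite cf_mono.
  by rewrite /= !cf_mono /= !mulr0 !addr0 mulr1.
have [PF2|PF2] := boolp.EM (P (iz F2)); last first.
  exists (x ^+ 1 * y ^+ 1), (1 + 1)%N; split; first exact: xy_homog.
    by case=> [|[|[|//]]] _ /=; rewrite cf_mono.
  by rewrite /= !cf_mono /= !mulr0 addr0 add0r mulr1.
have PF3 : ~ P (iz F3) by move=> PF3; apply: (noF P).
exists (x ^+ 0 * y ^+ 2), (0 + 2)%N; split; first exact: xy_homog.
  by case=> [|[|[|//]]] _ /=; rewrite cf_mono.
by rewrite /= !cf_mono /= !mulr0 !add0r mulr1.
Qed.

End Expansion.

Section Monomials.
Variables (k : fieldType) (n : nat).
Local Notation x := (x k n).
Local Notation y := (y k n).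

Lemma cf_x i a b : cf a b (x ^+ i) = ((a == i) && (b == 0%N))%:R.
Proof. by rewrite -[x ^+ i]mulr1 -(expr0 y) cf_mono. Qed.

Lemma cf_y i a b : cf a b (y ^+ i) = ((a == 0%N) && (b == i))%:R.
Proof. by rewrite -[y ^+ i]mul1r -(expr0 x) cf_mono. Qed.

Lemma cf_xy a b i : cf a b (x * y ^+ i) = ((a == 1%N) && (b == i))%:R.
Proof. by rewrite -[x in x * _]expr1 cf_mono. Qed.

Lemma cf_x1 a b : cf a b x = ((a == 1%N) && (b == 0%N))%:R.
Proof. by rewrite -[x]expr1 cf_x. Qed.

Lemma cf_y1 a b : cf a b y = ((a == 0%N) && (b == 1%N))%:R.
Proof. by rewrite -[y]expr1 cf_y. Qed.

Lemma cf_x1y1 a b : cf a b (x * y) = ((a == 1%N) && (b == 1%N))%:R.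
Proof. by rewrite -[y]expr1 cf_xy. Qed.

End Monomials.

Ltac row_simp := rewrite ?(@cfD, @cfB, @cfM, @cf_x, @cf_y, @cf_x1, @cf_y1, @cf_x1y1, @cf_mono) /=
  ?(mulr0, mul0r, mulr1, mul1r, addr0, add0r, subr0, sub0r, oppr0, subrr, addNr).

Section Listed.
Variables (k : fieldType) (n : nat).
Local Notation R := {mpoly k[n.+1]}.
Local Notation S := {mpoly k[n.+3]}.
Local Notation x := (x k n).
Local Notation y := (y k n).
Local Notation z0 := (z0 k n).
Local Notation iz := (@in_z k n).
Local Notation IX := (@IX k n).

Lemma gen_ideal2 (g1 g2 u1 u2 : S) : gen_ideal [:: g1; g2] (u1 * g1 + u2 * g2).
Proof. by exists (nth 0 [:: u1; u2]); rewrite !big_ord_recl big_ord0 /= addr0. Qed.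

Lemma gen_ideal3 (g1 g2 g3 u1 u2 u3 : S) :
  gen_ideal [:: g1; g2; g3] (u1 * g1 + u2 * g2 + u3 * g3).
Proof. by exists (nth 0 [:: u1; u2; u3]); rewrite !big_ord_recl big_ord0 /= addr0 !addrA. Qed.

Lemma gen_ideal7 (g1 g2 g3 g4 g5 g6 g7 u1 u2 u3 u4 u5 u6 u7 : S) :
  gen_ideal [:: g1; g2; g3; g4; g5; g6; g7]
    (u1 * g1 + u2 * g2 + u3 * g3 + u4 * g4 + u5 * g5 + u6 * g6 + u7 * g7).
Proof.
exists (nth 0 [:: u1; u2; u3; u4; u5; u6; u7]).
by rewrite !big_ord_recl big_ord0 /= addr0 !addrA.
Qed.

Lemma z0E : z0 = iz 'X_ord0.
Proof.
rewrite /Defs.z0 /in_z !mwidenXi; congr 'X_(_); apply/val_inj; rewrite /= inordK //.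
Qed.

Lemma pow_mem m i j h : (m <= i + j)%N -> ideal_pow IX m (x ^+ i * y ^+ j * h).
Proof.
move=> le; apply/ideal_powP; rewrite mulrC; have [_ _ _ oM] := ord_ge_ideal k n m.
by apply: oM => // a b ab; rewrite cf_mono; case: eqP => [aE|//]; case: eqP => [bE|//]; lia.
Qed.

Lemma ideal_add_ideal (a b : S -> Prop) : ideal (@whole S) a -> ideal (@whole S) b ->
  ideal (@whole S) (ideal_add a b).
Proof.
move=> [_ a0 aD aM] [_ b0 bD bM]; split=> //.
- by exists 0, 0; rewrite addr0.
- move=> _ _ [u [v [au bv ->]]] [u' [v' [au' bv' ->]]]; exists (u + u'), (v + v').
  by split; [apply: aD | apply: bD | rewrite addrACA].
- move=> w _ _ [u [v [au bv ->]]]; exists (w * u), (w * v).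
  by split; [apply: aM | apply: bM | rewrite mulrDr].
Qed.

Lemma ideal_add_l (a b : S -> Prop) : b 0 -> incl a (ideal_add a b).
Proof. by move=> b0 f af; exists f, 0; rewrite addr0. Qed.

Lemma ideal_pow_ideal m : ideal (@whole S) (ideal_pow IX m).
Proof.
have -> : ideal_pow IX m = @ord_ge k n m by apply: predext => f; apply: ideal_powP.
exact: ord_ge_ideal.
Qed.

(** One inclusion holds because the kernel is primary; for the other it is enough that a single
    multiplier [g] outside IX carries the kernel into I + IX^(j+1). *)
Lemma filtration_flag r (c : nat -> S -> R) (I : S -> Prop) j r' g :
  is_flag r c -> (r' <= r)%N -> incl I (flag_ker c r') ->
  incl (ideal_pow IX j.+1) (flag_ker c r') -> ~ IX g ->
  (forall f, flag_ker c r' f -> ideal_add I (ideal_pow IX j.+1) (g * f)) ->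
  filtration_ideal I j = flag_ker c r'.
Proof.
move=> fc le Ik pk Xg H; apply: predext => f; split; last by move/H; exists g.
move=> [h [Xh [u [v [/Ik ku /pk kv E]]]]]; have ik := flag_ker_ideal fc le.
by apply: (flag_ker_primary fc le Xh); rewrite E; case: ik => _ _ kD _; apply: kD.
Qed.

(** [phi j] is the number of functionals cutting out the j-th term of the filtration; it is j + 1
    when every layer has rank one. *)
Lemma flag_listed (gens : seq S) c m (phi : nat -> nat) :
  is_flag 4 c -> flag_locally_onto 4 c -> gen_ideal gens = flag_ker c 4 ->
  incl (ideal_pow IX m.+1) (flag_ker c 4) -> ~ incl (ideal_pow IX m) (flag_ker c 4) ->
  (forall j, (j <= m)%N -> (0 < phi j <= 4)%N /\
     filtration_ideal (flag_ker c 4) j = flag_ker c (phi j)) ->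
  type_I (gen_ideal gens) /\ multiplicity (gen_ideal gens) 4.
Proof.
move=> fc oc -> pm npm H; split; last exact: flag_multiplicity.
split; [exact: flag_multiple_structure | exact: flag_CM |].
exists m; split=> // j /H[/andP[p0 p4] ->].
by apply: flag_CM p0 (onto_le p4 oc); apply: is_flag_le fc.
Qed.

Lemma iz_mem (a : S -> Prop) f g : ideal (@whole S) a -> a g -> a (f * g).
Proof. by case=> _ _ _ aM ag; apply: aM. Qed.

Lemma flag_pow_incl r (c : nat -> S -> R) j : is_flag r c -> (j <= r)%N ->
  incl (ideal_pow IX j) (flag_ker c j).
Proof. by move=> fc jr; apply: flag_ker_pow fc _ jr. Qed.

Lemma not_IX_const (u : R) : u != 0 -> ~ IX (iz u).
Proof. by move=> u0 /IX_P; rewrite cfz /=; apply/eqP. Qed.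

Lemma x_tail j (f : S) : (j <= 2)%N -> (forall a, (a <= j)%N -> cf a 0 f = 0) ->
  exists p q, f = y * p + x ^+ j.+1 * q.
Proof.
move=> j2 f0; have [A [B [C [D fE]]]] := cf_expand f.
exists (iz (cf 0 1 f) + iz (cf 1 1 f) * x + x ^+ 2 * B + iz (cf 0 2 f) * y + x * y * C + y ^+ 2 * D).
case: j j2 f0 => [|[|[|//]]] _ f0; rewrite {1}fE.
- exists (iz (cf 1 0 f) + iz (cf 2 0 f) * x + iz (cf 3 0 f) * x ^+ 2 + x ^+ 3 * A).
  by rewrite (f0 0%N isT) (rmorph0 iz); cf_ring.
- exists (iz (cf 2 0 f) + iz (cf 3 0 f) * x + x ^+ 2 * A).
  by rewrite (f0 0%N isT) (f0 1%N isT) (rmorph0 iz); cf_ring.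
- exists (iz (cf 3 0 f) + x * A).
  by rewrite (f0 0%N isT) (f0 1%N isT) (f0 2%N isT) (rmorph0 iz); cf_ring.
Qed.

Lemma kernel1 : gen_ideal [:: x ^+ 4; y] = flag_ker (flagA (0 : R) 1) 4.
Proof.
have fA : is_flag 4 (flagA (0 : R) 1) by apply: flagA_flag; left.
have ik := flag_ker_ideal fA (leqnn 4).
apply: predext => f; split.
  apply: (gen_ideal_sub ik) => g; rewrite !inE => /orP[]/eqP -> [|[|[|[|//]]]] _ /=;
    by row_simp.
move=> kf; have [A [B [C [D ->]]]] := cf_expand f.
have k0 : cf 0 0 f = 0 := kf 0 isT; have k1 : cf 1 0 f = 0 := kf 1 isT.
have k2 : cf 2 0 f = 0 := kf 2 isT; have /= k3 := kf 3 isT; rewrite mul0r add0r mul1r in k3.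
rewrite k0 k1 k2 k3 (rmorph0 iz).
suff -> : forall c01 c11 c02 : S, 0 + 0 * x + 0 * x ^+ 2 + 0 * x ^+ 3 + x ^+ 4 * A + c01 * y + c11 * x * y
   + x ^+ 2 * y * B + c02 * y ^+ 2 + x * y ^+ 2 * C + y ^+ 3 * D =
   A * x ^+ 4 + (c01 + c11 * x + x ^+ 2 * B + c02 * y + x * y * C + y ^+ 2 * D) * y.
  exact: gen_ideal2.
by move=> c01 c11 c02; ring.
Qed.

Lemma kernel6 (G : R) : G \is 2.-homog ->
  gen_ideal [:: x ^+ 3 + iz G * y; x * y; y ^+ 2] = flag_ker (flagA 1 (- G)) 4.
Proof.
move=> G2; have fA : is_flag 4 (flagA 1 (- G)) by apply: flagA_flag; right; rewrite rpredN.
have ik := flag_ker_ideal fA (leqnn 4).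
apply: predext => f; split.
  apply: (gen_ideal_sub ik) => g; rewrite !inE => /or3P[]/eqP -> [|[|[|[|//]]]] _ /=;
    by row_simp.
move=> kf; have [A [B [C [D ->]]]] := cf_expand f.
have k0 : cf 0 0 f = 0 := kf 0 isT; have k1 : cf 1 0 f = 0 := kf 1 isT.
have k2 : cf 2 0 f = 0 := kf 2 isT; have /= k3 := kf 3 isT.
have {}k3 : cf 0 1 f = G * cf 3 0 f by apply: subr0_eq; rewrite -[RHS]k3 mul1r mulNr.
rewrite k0 k1 k2 k3 (rmorph0 iz) (rmorphM iz).
suff -> : forall c30 c11 c02 g : S, 0 + 0 * x + 0 * x ^+ 2 + c30 * x ^+ 3 + x ^+ 4 * A + g * c30 * y + c11 * x * y
   + x ^+ 2 * y * B + c02 * y ^+ 2 + x * y ^+ 2 * C + y ^+ 3 * D =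
   (c30 + x * A) * (x ^+ 3 + g * y) + (c11 + x * B + y * C - g * A) * (x * y) + (c02 + y * D) * y ^+ 2.
  exact: gen_ideal3.
by move=> c30 c11 c02 g; ring.
Qed.

Lemma kernelC (l : R) (a : k) : l \is 1.-homog ->
  gen_ideal [:: x ^+ 2 + iz a%:MP * (x * y) + iz l * y; y ^+ 2] = flag_ker (flagC l a) 4.
Proof.
move=> l1; have fC := flagC_flag a l1; have ik := flag_ker_ideal fC (leqnn 4).
apply: predext => f; split.
  apply: (gen_ideal_sub ik) => g; rewrite !inE => /orP[]/eqP -> [|[|[|[|//]]]] _ /=;
    by row_simp.
move=> kf; have [A [B [C [D ->]]]] := cf_expand f.
have k0 : cf 0 0 f = 0 := kf 0 isT; have k1 : cf 1 0 f = 0 := kf 1 isT.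
have /= k2 := kf 2 isT; have /= k3 := kf 3 isT.
have {}k2 : cf 0 1 f = l * cf 2 0 f by apply/eqP; rewrite -subr_eq0 k2.
have {}k3 : cf 1 1 f = a%:MP * cf 2 0 f + l * cf 3 0 f.
  by apply/eqP; rewrite -subr_eq0 opprD addrA k3.
rewrite k0 k1 k2 k3 (rmorph0 iz) (rmorphD iz) !(rmorphM iz).
(* The cofactors come from dividing x^2, x^3, x^4 and x^2 y by the first generator; the terms in y
   and x y cancel, and a multiple of y^2 is left. *)
suff -> : forall c20 c30 c02 b z : S, 0 + 0 * x + c20 * x ^+ 2 + c30 * x ^+ 3 + x ^+ 4 * A + z * c20 * y
   + (b * c20 + z * c30) * x * y + x ^+ 2 * y * B + c02 * y ^+ 2 + x * y ^+ 2 * C + y ^+ 3 * D =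
   (c20 + c30 * (x - b * y) + A * (x * (x - b * y) - z * y) + B * y) * (x ^+ 2 + b * (x * y) + z * y)
   + (c30 * b * (b * x + z) + A * (b * x * (b * x + z) + z * (b * x + z)) - B * (b * x + z) + c02 + x * C + y * D) * y ^+ 2.
  exact: gen_ideal2.
by move=> c20 c30 c02 b z; ring.
Qed.

Lemma flagB_kernel_expand s (F1 F2 F3 : R) f :
  F1 \is s.-homog -> F2 \is s.-homog -> F3 \is s.-homog -> flag_ker (flagB F1 F2 F3) 4 f ->
  exists A B C D, f = iz (cf 2 0 f) * x ^+ 2 + iz (cf 1 1 f) * (x * y) + iz (cf 0 2 f) * y ^+ 2
    + x ^+ 3 * A + x ^+ 2 * y * B + x * y ^+ 2 * C + y ^+ 3 * D.
Proof.
move=> h1 h2 h3 kf; have [A [B [C [D fE]]]] := cf_expand f.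
exists (iz (cf 3 0 f) + x * A), B, C, D.
have k0 : cf 0 0 f = 0 := kf 0 isT; have k1 : cf 1 0 f = 0 := kf 1 isT.
have k2 : cf 0 1 f = 0 := kf 2 isT.
rewrite {1}fE k0 k1 k2 (rmorph0 iz); by cf_ring.
Qed.

Lemma cubic_in_flagB s (F1 F2 F3 : R) :
  F1 \is s.-homog -> F2 \is s.-homog -> F3 \is s.-homog ->
  incl (ideal_pow IX 3) (flag_ker (flagB F1 F2 F3) 4).
Proof.
by move=> h1 h2 h3 f /ideal_powP o [|[|[|[|//]]]] _ /=; rewrite !o // !mulr0 !addr0.
Qed.

Lemma kernel2 : gen_ideal [:: x ^+ 2; y ^+ 2] = flag_ker (flagB (0 : R) 1 0) 4.
Proof.
have h0 := @dhomog0 n.+1 k mdeg 0; have h1 := @dhomog1 n.+1 k mdeg.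
have fB := flagB_flag h0 h1 h0; have ik := flag_ker_ideal fB (leqnn 4).
apply: predext => f; split.
  apply: (gen_ideal_sub ik) => g; rewrite !inE => /orP[]/eqP -> [|[|[|[|//]]]] _ /=;
    by row_simp.
move=> kf; have [A [B [C [D ->]]]] := flagB_kernel_expand h0 h1 h0 kf.
have /= k3 := kf 3 isT; rewrite !mul0r mul1r add0r addr0 in k3; rewrite k3 (rmorph0 iz).
suff -> : forall c20 c02 : S, c20 * x ^+ 2 + 0 * (x * y) + c02 * y ^+ 2 + x ^+ 3 * A + x ^+ 2 * y * B
   + x * y ^+ 2 * C + y ^+ 3 * D = (c20 + x * A + y * B) * x ^+ 2 + (c02 + x * C + y * D) * y ^+ 2.
  exact: gen_ideal2.
by move=> c20 c02; ring.
Qed.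

Lemma kernel3 : gen_ideal [:: x * y; x ^+ 2 + y ^+ 2] = flag_ker (flagB (1 : R) 0 (- 1)) 4.
Proof.
have h0 := @dhomog0 n.+1 k mdeg 0; have h1 := @dhomog1 n.+1 k mdeg.
have hN : (- 1 : R) \is 0.-homog by rewrite rpredN.
have fB := flagB_flag h1 h0 hN; have ik := flag_ker_ideal fB (leqnn 4).
apply: predext => f; split.
  apply: (gen_ideal_sub ik) => g; rewrite !inE => /orP[]/eqP -> [|[|[|[|//]]]] _ /=;
    by row_simp.
move=> kf; have [A [B [C [D ->]]]] := flagB_kernel_expand h1 h0 hN kf.
have /= k3 := kf 3 isT; rewrite mul1r mul0r addr0 mulN1r in k3.
rewrite (subr0_eq k3).
suff -> : forall c11 c02 : S, c02 * x ^+ 2 + c11 * (x * y) + c02 * y ^+ 2 + x ^+ 3 * A + x ^+ 2 * y * B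
   + x * y ^+ 2 * C + y ^+ 3 * D = (c11 - y * A + x * B + y * C - x * D) * (x * y) + (c02 + x * A + y * D) * (x ^+ 2 + y ^+ 2).
  exact: gen_ideal2.
by move=> c11 c02; ring.
Qed.

Lemma kernel4 : gen_ideal [:: x ^+ 3; x * y; y ^+ 2] = flag_ker (flagB (1 : R) 0 0) 4.
Proof.
have h0 := @dhomog0 n.+1 k mdeg 0; have h1 := @dhomog1 n.+1 k mdeg.
have fB := flagB_flag h1 h0 h0; have ik := flag_ker_ideal fB (leqnn 4).
apply: predext => f; split.
  apply: (gen_ideal_sub ik) => g; rewrite !inE => /or3P[]/eqP -> [|[|[|[|//]]]] _ /=;
    by row_simp.
move=> kf; have [A [B [C [D ->]]]] := flagB_kernel_expand h1 h0 h0 kf.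
have /= k3 := kf 3 isT; rewrite mul1r !mul0r !addr0 in k3; rewrite k3 (rmorph0 iz).
suff -> : forall c11 c02 : S, 0 * x ^+ 2 + c11 * (x * y) + c02 * y ^+ 2 + x ^+ 3 * A + x ^+ 2 * y * B
   + x * y ^+ 2 * C + y ^+ 3 * D = A * x ^+ 3 + (c11 + x * B + y * C) * (x * y) + (c02 + y * D) * y ^+ 2.
  exact: gen_ideal3.
by move=> c11 c02; ring.
Qed.

Lemma filtration0 r (c : nat -> S -> R) (I : S -> Prop) : is_flag r c -> (0 < r)%N -> incl I IX ->
  I 0 -> filtration_ideal I 0 = flag_ker c 1.
Proof.
move=> fc r0 IXI I0; have k1 f : flag_ker c 1 f <-> cf 0 0 f = 0.
  split=> [/(_ 0%N isT)|f0 [|//] _]; by rewrite (flag_first fc).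
have Xg : ~ IX (iz 1) by apply: not_IX_const; apply: oner_neq0.
apply: (filtration_flag fc r0 _ _ Xg) => [f /IXI/IX_P/k1 //|f /ideal_powP o|f /k1 f0].
  by apply/k1; apply: o.
rewrite rmorph1 mul1r; exists 0, f; rewrite add0r; split=> //.
by apply/ideal_powP => a b; rewrite ltnS leqn0 addn_eq0 => /andP[/eqP -> /eqP ->].
Qed.

(** For j up to 2 the multiplier [g] shows y to be generically in the ideal of Y_j. As [be] is
    nonzero, x^3 is not in I, whence m = 3. *)
Lemma type_I_flagA (gens : seq S) (al be g : R) :
  (al = 0 /\ be = 1) \/ (al = 1 /\ be \is 2.-homog) -> be != 0 -> g != 0 ->
  gen_ideal gens = flag_ker (flagA al be) 4 ->
  (forall j, (j <= 2)%N -> ideal_add (gen_ideal gens) (ideal_pow IX j.+1) (iz g * y)) ->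
  type_I (gen_ideal gens) /\ multiplicity (gen_ideal gens) 4.
Proof.
move=> alP be0 g0 E gy; have fA := @flagA_flag k n _ _ alP.
have kX : incl (flag_ker (flagA al be) 4) IX by move=> f /(_ 0%N isT) /= /IX_P.
have ik := flag_ker_ideal fA (leqnn 4).
apply: (@flag_listed _ _ 3 succn fA _ E); [exact: flagA_onto | exact: flag_pow_incl fA _| |].
  move=> /(_ (x ^+ 3 * y ^+ 0 * 1)) H.
  have /= := H (@pow_mem 3 3 0 1 isT) 3%N isT; rewrite mulr1 !cf_mono /= mulr0 add0r mulr1.
  exact/eqP.
move=> j j3; split=> //; case: j j3 => [_|j].
  by apply: (filtration0 fA) => //; case: ik.
rewrite leq_eqVlt => /orP[/eqP[->]|lt_j].
  have Xg : ~ IX (iz 1) by apply: not_IX_const; apply: oner_neq0.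
  apply: (filtration_flag fA (leqnn 4) (fun f => id) (flag_pow_incl fA (leqnn 4)) Xg) => f kf.
  by rewrite rmorph1 mul1r; apply: ideal_add_l => //; have [] := ideal_pow_ideal 4.
have lt4 : (j.+2 <= 4)%N by lia.
apply: (filtration_flag fA lt4 _ _ (not_IX_const g0)).
- by move=> f; apply: flag_ker_mono.
- exact: flag_pow_incl fA lt4.
move=> f kf; have j2 : (j.+1 <= 2)%N by lia.
have [a|p [q ->]] := @x_tail j.+1 f j2.
  move=> aj; have := kf a aj; move: aj j2; case: a => [|[|[|a]]] //= aj; lia.
have ia := ideal_add_ideal ik (ideal_pow_ideal j.+2); have [_ _ aD aM] := ia.
rewrite mulrDr; apply: aD.
  by rewrite mulrA mulrC; apply: aM => //; rewrite -E; apply: gy.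
exists 0, (iz g * (x ^+ j.+2 * q)); rewrite add0r; split=> //; first by case: ik.
rewrite (_ : _ * _ = x ^+ j.+2 * y ^+ 0 * (q * iz g)); last by rewrite expr0; cf_ring.
by apply: pow_mem; rewrite addn0.
Qed.

Lemma type_I_1 : type_I (gen_ideal [:: x ^+ 4; y]) /\ multiplicity (gen_ideal [:: x ^+ 4; y]) 4.
Proof.
apply: (type_I_flagA (g := 1) _ _ _ kernel1); rewrite ?oner_neq0 //; first by left.
move=> j _; apply: ideal_add_l; first by case: (ideal_pow_ideal j.+1).
by apply: iz_mem; [exact: gen_idealP | apply: gen_ideal_mem; rewrite !inE eqxx orbT].
Qed.

Lemma type_I_6 (G : R) : G \is 2.-homog -> G != 0 ->
  type_I (gen_ideal [:: x ^+ 3 + iz G * y; x * y; y ^+ 2]) /\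
  multiplicity (gen_ideal [:: x ^+ 3 + iz G * y; x * y; y ^+ 2]) 4.
Proof.
move=> G2 G0; apply: (type_I_flagA (g := G) _ _ G0 (kernel6 G2)); rewrite ?oppr_eq0 //.
  by right; rewrite rpredN.
move=> j j2; exists (x ^+ 3 + iz G * y), (x ^+ 3 * y ^+ 0 * (- 1)); split.
- by apply: gen_ideal_mem; rewrite mem_head.
- by apply: pow_mem.
- by rewrite expr0; cf_ring.
Qed.

(** Modulo I, l y is congruent to - x^2 - a x y, so the multiplier [l], a unit at the generic point,
    carries y into I + IX^2. *)
Lemma type_I_C (l : R) (a : k) (gens : seq S) : l \is 1.-homog -> l != 0 ->
  gen_ideal gens = flag_ker (flagC l a) 4 ->
  type_I (gen_ideal gens) /\ multiplicity (gen_ideal gens) 4.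
Proof.
move=> l1 z00 E; have fC := flagC_flag a l1.
have kX : incl (flag_ker (flagC l a) 4) IX by move=> f /(_ 0%N isT) /= /IX_P.
have ik := flag_ker_ideal fC (leqnn 4).
have Pk : flag_ker (flagC l a) 4 (x ^+ 2 + iz a%:MP * (x * y) + iz l * y).
  by rewrite -kernelC //; apply: gen_ideal_mem; rewrite mem_head.
have yk : flag_ker (flagC l a) 4 (y ^+ 2).
  by rewrite -kernelC //; apply: gen_ideal_mem; rewrite !inE eqxx orbT.
apply: (@flag_listed _ _ 3 succn fC _ E); [exact: flagC_onto | exact: flag_pow_incl fC _| |].
  move=> /(_ (x ^+ 3 * y ^+ 0 * 1)) H.
  have /= := H (@pow_mem 3 3 0 1 isT) 3%N isT; rewrite mulr1 !cf_mono /= mulr0 subr0 sub0r mulr1.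
  by move/eqP; rewrite oppr_eq0 (negbTE z00).
move=> j j3; split=> //; case: j j3 => [_|[_|[_|[_|//]]]].
- have [_ k0 _ _] := ik.
  exact: (filtration0 fC isT kX k0).
- have le2 : (2 <= 4)%N by []. apply: (filtration_flag fC le2 _ _ (not_IX_const z00)).
  + by move=> f; apply: flag_ker_mono.
  + exact: flag_pow_incl fC _.
  move=> f kf; have [|p [q ->]] := @x_tail 1 f isT.
    by case=> [|[|//]] _; [apply: (kf 0 isT) | apply: (kf 1 isT)].
  exists (p * (x ^+ 2 + iz a%:MP * (x * y) + iz l * y)).
  exists (x ^+ 2 * y ^+ 0 * (iz l * q - p) + x ^+ 1 * y ^+ 1 * (- iz a%:MP * p)); split.
  + exact: (iz_mem _ ik Pk).
  + by have [_ _ pD _] := ideal_pow_ideal 2; apply: pD; apply: pow_mem.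
  + by rewrite expr0 expr1; cf_ring.
- apply: (filtration_flag fC (_ : 3 <= 4)%N _ _ (not_IX_const z00)) => //.
  + by move=> f; apply: flag_ker_mono.
  + exact: flag_pow_incl fC _.
  move=> f kf; have [A [B [C [D ->]]]] := cf_expand f.
  have k0 : cf 0 0 f = 0 := kf 0 isT; have k1 : cf 1 0 f = 0 := kf 1 isT.
  have /= k2 := kf 2 isT.
  have {}k2 : cf 0 1 f = l * cf 2 0 f by apply/eqP; rewrite -subr_eq0 k2.
  rewrite k0 k1 k2 (rmorph0 iz) (rmorphM iz).
  exists ((iz (cf 2 0 f) * (iz l - iz a%:MP * x) + iz (cf 1 1 f) * x)
      * (x ^+ 2 + iz a%:MP * (x * y) + iz l * y)
    + iz l * (iz (cf 0 2 f) + x * C + y * D) * y ^+ 2).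
  exists (x ^+ 3 * y ^+ 0 * (iz l * (iz (cf 3 0 f) + x * A) + iz (cf 2 0 f) * iz a%:MP - iz (cf 1 1 f))
    + x ^+ 2 * y ^+ 1 * (iz l * B + iz (cf 2 0 f) * iz a%:MP * iz a%:MP - iz (cf 1 1 f) * iz a%:MP)); split.
  + by have [_ _ iD _] := ik; apply: iD; [exact: (iz_mem _ ik Pk) | exact: (iz_mem _ ik yk)].
  + by have [_ _ pD _] := ideal_pow_ideal 3; apply: pD; apply: pow_mem.
  + by rewrite expr0 expr1 /=; cf_ring.
- have Xg : ~ IX (iz 1) by apply: not_IX_const; apply: oner_neq0.
  apply: (filtration_flag fC (leqnn 4) (fun f => id) (flag_pow_incl fC (leqnn 4)) Xg) => f kf.
  by rewrite rmorph1 mul1r; apply: ideal_add_l => //; have [] := ideal_pow_ideal 4.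
Qed.

Lemma type_I_B s (F1 F2 F3 : R) (gens : seq S) :
  F1 \is s.-homog -> F2 \is s.-homog -> F3 \is s.-homog ->
  flag_locally_onto 4 (flagB F1 F2 F3) -> gen_ideal gens = flag_ker (flagB F1 F2 F3) 4 ->
  type_I (gen_ideal gens) /\ multiplicity (gen_ideal gens) 4.
Proof.
move=> h1 h2 h3 oB E; have fB := flagB_flag h1 h2 h3.
have kX : incl (flag_ker (flagB F1 F2 F3) 4) IX by move=> f /(_ 0%N isT) /= /IX_P.
have ik := flag_ker_ideal fB (leqnn 4); have cub := cubic_in_flagB h1 h2 h3.
have Xg : ~ IX (iz 1) by apply: not_IX_const; apply: oner_neq0.
(* The middle layer has rank two, x and y entering together: the terms of the filtration are cut out
   by one, three and four functionals, and m = 2. *)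
apply: (@flag_listed _ _ 2 (nth 0%N [:: 1; 3; 4]) fB oB E) => //.
  move=> H; have [e [d [_ ke]]] := oB _ (@IX_prime k n) (@IX_hom k n) (fun f => id)
    (ex_intro _ ord0 (@X0_notin_IX k n)) 3 isT; apply.
  rewrite (_ : flagB _ _ _ _ _ = 0); first by rewrite rmorph0; case: (@IX_prime k n) => -[].
  apply: H => //; apply/ideal_powP => a b; case: a b => [|[|a]] [|[|b]] //= _.
  - exact: (ke 0%N isT).
  - exact: (ke 2%N isT).
  - exact: (ke 1%N isT).
move=> [_|[_|[_|//]]]; split=> //=.
- have [_ k0 _ _] := ik.
  exact: (filtration0 fB isT kX k0).
- apply: (filtration_flag fB (_ : 3 <= 4)%N _ _ Xg) => //.
  + by move=> f; apply: flag_ker_mono.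
  + by move=> f /ideal_powP o [|[|[|//]]] _ /=; apply: o.
  move=> f kf; rewrite rmorph1 mul1r; exists 0, f; rewrite add0r; split=> //; first by case: ik.
  apply/ideal_powP => -[|[|a]] [|[|b]] //= _.
  + exact: (kf 0%N isT).
  + exact: (kf 2%N isT).
  + exact: (kf 1%N isT).
- apply: (filtration_flag fB (leqnn 4) (fun f => id) cub Xg) => f kf.
  by rewrite rmorph1 mul1r; apply: ideal_add_l => //; case: (ideal_pow_ideal 3).
Qed.

End Listed.

(** The coefficients of a quadric in the kernel form a syzygy of F1, F2, F3, and the first three
    generators are the Koszul syzygies up to sign. *)
Lemma kernel5 (k : fieldType) s (F1 F2 F3 : {mpoly k[3]}) : (0 < s)%N ->
  F1 \is s.-homog -> F2 \is s.-homog -> F3 \is s.-homog ->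
  ~ (exists P, [/\ proj_point P, P F1, P F2 & P F3]) ->
  gen_ideal [:: in_z F2 * y k 2 ^+ 2 - in_z F3 * x k 2 * y k 2;
                in_z F1 * y k 2 ^+ 2 - in_z F3 * x k 2 ^+ 2;
                in_z F1 * x k 2 * y k 2 - in_z F2 * x k 2 ^+ 2;
                x k 2 ^+ 3; x k 2 ^+ 2 * y k 2; x k 2 * y k 2 ^+ 2; y k 2 ^+ 3]
  = flag_ker (flagB F1 F2 F3) 4.
Proof.
move=> s0 h1 h2 h3 noP; have fB := flagB_flag h1 h2 h3; have ik := flag_ker_ideal fB (leqnn 4).
have cub := cubic_in_flagB h1 h2 h3.
have cubm i j : (3 <= i + j)%N -> flag_ker (flagB F1 F2 F3) 4 (x k 2 ^+ i * y k 2 ^+ j).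
  by move=> ij; apply: cub; rewrite -[X in ideal_pow _ _ X]mulr1; apply: pow_mem.
apply: predext => f; split.
  apply: (gen_ideal_sub ik) => g; rewrite !inE => /or4P[/eqP->|/eqP->|/eqP->|/or4P[/eqP->|/eqP->|/eqP->|/eqP->]].
  - move=> [|[|[|[|//]]]] _ /=; rewrite -?mulrA !(cfB, cfM) ?cf_y ?cf_x1y1 /= ?mulr0 ?subrr //.
    by ring.
  - move=> [|[|[|[|//]]]] _ /=; rewrite !(cfB, cfM) ?cf_y ?cf_x /= ?mulr0 ?subrr //.
    by ring.
  - move=> [|[|[|[|//]]]] _ /=; rewrite -?mulrA !(cfB, cfM) ?cf_x ?cf_x1y1 /= ?mulr0 ?subrr //.
    by ring.
  - by have := cubm 3 0%N isT; rewrite expr0 mulr1.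
  - exact: (cubm 2 1%N isT).
  - exact: (cubm 1%N 2 isT).
  - by have := cubm 0%N 3 isT; rewrite expr0 mul1r.
move=> kf; have [A [B [C [D ->]]]] := flagB_kernel_expand h1 h2 h3 kf.
have /= k3 := kf 3 isT.
have [|u [v [w [-> -> ->]]]] := @koszul_syzygies k s F1 F2 F3 (cf 2 0 f) (cf 1 1 f) (cf 0 2 f) s0 h1 h2 h3 noP.
  by rewrite -[RHS]k3; cf_ring.
rewrite !(rmorphD (@in_z k 2), rmorphB (@in_z k 2), rmorphM (@in_z k 2), rmorphN (@in_z k 2)).
suff -> : forall (X Y U V W G1 G2 G3 : {mpoly k[5]}),
   (U * G2 + V * G3) * X ^+ 2 + (W * G3 - U * G1) * (X * Y) + (- V * G1 - W * G2) * Y ^+ 2 + X ^+ 3 * A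
   + X ^+ 2 * Y * B + X * Y ^+ 2 * C + Y ^+ 3 * D =
   - W * (G2 * Y ^+ 2 - G3 * X * Y) + - V * (G1 * Y ^+ 2 - G3 * X ^+ 2) + - U * (G1 * X * Y - G2 * X ^+ 2)
   + A * X ^+ 3 + B * (X ^+ 2 * Y) + C * (X * Y ^+ 2) + D * Y ^+ 3.
  exact: gen_ideal7.
by move=> X Y U V W G1 G2 G3; ring.
Qed.

(** * Linear substitutions *)

Section LinearSubstitution.
Variables (k : fieldType) (N : nat).
Local Notation S := {mpoly k[N]}.

Definition linear_sub (M : 'M[k]_N) : S -> S :=
  comp_mpoly [tuple \sum_(j < N) M i j *: 'X_j | i < N].

HB.instance Definition _ M := GRing.RMorphism.copy (linear_sub M)
  (comp_mpoly [tuple \sum_(j < N) M i j *: 'X_j | i < N]).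

Lemma linear_subX M i : linear_sub M 'X_i = \sum_(j < N) M i j *: 'X_j.
Proof. by rewrite /linear_sub comp_mpolyXU -tnth_nth tnth_mktuple. Qed.

Lemma linear_subC M c : linear_sub M c%:MP = c%:MP.
Proof. exact: comp_mpolyC. Qed.

Lemma linear_subZ M c f : linear_sub M (c *: f) = c *: linear_sub M f.
Proof. exact: comp_mpolyZ. Qed.

Lemma linear_subM M M' f : linear_sub M (linear_sub M' f) = linear_sub (M' *m M) f.
Proof.
pose g : {rmorphism S -> S} := linear_sub M \o linear_sub M'.
apply: (mpoly_rmorph_ext (f := g)) => [c|i] /=; first by rewrite !linear_subC.
rewrite !linear_subX raddf_sum /=.
under eq_bigr => j _ do rewrite linear_subZ linear_subX scaler_sumr.
rewrite exchange_big; apply: eq_bigr => j _ /=.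
by under eq_bigr => l _ do rewrite scalerA; rewrite -scaler_suml mxE.
Qed.

Lemma linear_sub1 f : linear_sub 1%:M f = f.
Proof.
apply: (mpoly_rmorph_ext (f := linear_sub 1%:M) (g := idfun)) => [c|i] /=; first by rewrite linear_subC.
rewrite linear_subX (bigD1 i) //= mxE eqxx scale1r big1 ?addr0 // => j ji.
by rewrite mxE eq_sym (negbTE ji) scale0r.
Qed.

Lemma linear_subK M : M \in unitmx -> cancel (linear_sub M) (linear_sub (invmx M)).
Proof. by move=> uM f; rewrite linear_subM mulmxV // linear_sub1. Qed.

Lemma gen_ideal_morph (phi : {rmorphism S -> S}) s f :
  gen_ideal s f -> gen_ideal (map phi s) (phi f).
Proof.
move=> [c ->]; exists (fun i => phi (c i)); rewrite rmorph_sum size_map.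
by apply: eq_bigr => i _; rewrite rmorphM (nth_map 0).
Qed.

Lemma lin_equiv_refl (I : S -> Prop) : lin_equiv I I.
Proof.
exists 1%:M; first exact: unitmx1.
by move=> f; rewrite -[f \mPo _]/(linear_sub 1%:M f) linear_sub1.
Qed.

Lemma lin_equiv_trans (I I' I'' : S -> Prop) : lin_equiv I I' -> lin_equiv I' I'' -> lin_equiv I I''.
Proof.
move=> [M uM H] [M' uM' H']; exists (M' *m M); first by rewrite unitmx_mul uM' uM.
by move=> f; rewrite H' H; rewrite -[f \mPo _]/(linear_sub _ f) -[_ \mPo _]/(linear_sub _ _) linear_subM.
Qed.

Lemma linear_sub_homog M f d : f \is d.-homog -> linear_sub M f \is d.-homog.
Proof.
move=> /dhomogP fd; rewrite [f]mpolyE raddf_sum big_seq; apply: rpred_sum => m mf.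
rewrite /= linear_subZ; apply: rpredZ; rewrite -(fd m mf) /= mdegE /linear_sub comp_mpolyX.
elim/big_ind2: _ => [|c1 d1 c2 d2|i _]; [exact: dhomog1 | exact: dhomogM |].
have H : \sum_(j < N) M i j *: 'X_j \is 1.-homog for (@mdeg N).
  by apply: rpred_sum => j _; apply: rpredZ; rewrite dhomogX; apply/eqP/mdeg1.
by have := dhomogMn (m i) H; rewrite tnth_mktuple mul1n.
Qed.

Lemma lin_equiv_gens M (s : seq S) : M \in unitmx ->
  lin_equiv (gen_ideal (map (linear_sub M) s)) (gen_ideal s).
Proof.
move=> uM; exists M => // f; split; first exact: gen_ideal_morph.
move/(@gen_ideal_morph (linear_sub (invmx M))); rewrite -map_comp (eq_map (g := id)) ?map_id.
  by rewrite [X in gen_ideal _ X]linear_subK.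
by move=> g; exact: linear_subK.
Qed.

(** The matrix of [phi] is read off from the images of the variables; it is invertible because its
    product with the matrix of [psi] fixes every variable. *)
Lemma linear_sub_morph (L L' : 'I_N -> S) (phi psi : {rmorphism S -> S}) :
  (forall i, L i \is 1.-homog) -> (forall i, L' i \is 1.-homog) ->
  (forall c, phi c%:MP = c%:MP) -> (forall c, psi c%:MP = c%:MP) ->
  (forall i, phi 'X_i = L i) -> (forall i, psi 'X_i = L' i) ->
  (forall i, phi (psi 'X_i) = 'X_i) -> exists2 M, M \in unitmx & phi =1 linear_sub M.
Proof.
move=> hL hL' phiC psiC phiX psiX K.
have lin (f : S) : f \is 1.-homog -> f = \sum_j f@_U_(j) *: 'X_j.
  move=> /dhomogP f1; apply/mpolyP => m; rewrite raddf_sum /=.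
  have [|nm] := boolP (mdeg m == 1%N).
    move=> /mdeg1P[i /eqP ->]; rewrite (bigD1 i) //= mcoeffZ mcoeffX eqxx mulr1 big1 ?addr0 // => j ji.
    by rewrite mcoeffZ mcoeffX eq_mnm1 (negbTE ji) mulr0.
  rewrite memN_msupp_eq0 ?big1 // => [j _|]; last by apply: contra nm => /f1 /= ->.
  rewrite mcoeffZ mcoeffX; case: eqP => [mE|]; last by rewrite mulr0.
  by rewrite -mE mdeg1 in nm.
pose mx (l : 'I_N -> S) : 'M[k]_N := \matrix_(i, j) (l i)@_U_(j).
have phiE : phi =1 linear_sub (mx L).
  apply: mpoly_rmorph_ext => [c|i] /=; first by rewrite phiC linear_subC.
  by rewrite phiX linear_subX {1}(lin _ (hL i)); apply: eq_bigr => j _; rewrite mxE.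
have psiE : psi =1 linear_sub (mx L').
  apply: mpoly_rmorph_ext => [c|i] /=; first by rewrite psiC linear_subC.
  by rewrite psiX linear_subX {1}(lin _ (hL' i)); apply: eq_bigr => j _; rewrite mxE.
exists (mx L) => //.
have E : mx L' *m mx L = 1%:M.
  apply/matrixP => i j; have := K i; rewrite psiE phiE linear_subM linear_subX.
  move/(congr1 (mcoeff U_(j))); rewrite raddf_sum /= (bigD1 j) //= mcoeffZ mcoeffX eqxx mulr1 big1 ?addr0.
    by rewrite mcoeffX eq_mnm1 => ->; rewrite mxE.
  by move=> l lj; rewrite mcoeffZ mcoeffX eq_mnm1 (negbTE lj) mulr0.
by case/mulmx1_unit: E.
Qed.

End LinearSubstitution.

Section CoordinateChange.
Variables (k : fieldType) (n : nat).
Local Notation R := {mpoly k[n.+1]}.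
Local Notation S := {mpoly k[n.+3]}.
Local Notation x := (x k n).
Local Notation y := (y k n).
Local Notation iz := (@in_z k n).

Definition coord_images (g : 'M[k]_n.+1) (x' y' : S) (i : 'I_n.+3) : S :=
  if unlift ord_max i is Some j then
    if unlift ord_max j is Some l then iz (linear_sub g 'X_l) else x'
  else y'.

Definition coord_sub g (x' y' : S) : S -> S :=
  comp_mpoly [tuple coord_images g x' y' i | i < n.+3].

HB.instance Definition _ g x' y' := GRing.RMorphism.copy (coord_sub g x' y')
  (comp_mpoly [tuple coord_images g x' y' i | i < n.+3]).

Lemma coord_subX g x' y' i : coord_sub g x' y' 'X_i = coord_images g x' y' i.
Proof. by rewrite /coord_sub comp_mpolyXU -tnth_nth tnth_mktuple. Qed.

Lemma coord_subC g x' y' c : coord_sub g x' y' c%:MP = c%:MP.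
Proof. exact: comp_mpolyC. Qed.

Lemma widen_lift m (j : 'I_m) : widen_ord (leqnSn m) j = lift ord_max j.
Proof. by apply/val_inj; rewrite /= /bump leqNgt ltn_ord. Qed.

Lemma coord_sub_y g x' y' : coord_sub g x' y' y = y'.
Proof. by rewrite yE coord_subX /coord_images unlift_none. Qed.

Lemma coord_sub_x g x' y' : coord_sub g x' y' x = x'.
Proof. by rewrite xE mwidenXi widen_lift coord_subX /coord_images liftK unlift_none. Qed.

Lemma coord_sub_z g x' y' r : coord_sub g x' y' (iz r) = iz (linear_sub g r).
Proof.
pose f1 : {rmorphism R -> S} := coord_sub g x' y' \o iz.
pose f2 : {rmorphism R -> S} := iz \o linear_sub g.
apply: (mpoly_rmorph_ext (f := f1) (g := f2)) => [c|i] /=.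
  by rewrite linear_subC /in_z !mwidenC coord_subC.
by rewrite {1}/in_z !mwidenXi !widen_lift coord_subX /coord_images !liftK.
Qed.

Definition lin_form (al be : k) : S := iz al%:MP * x + iz be%:MP * y.

Lemma lin_form_homog al be : lin_form al be \is 1.-homog.
Proof.
have H c (v : S) : v \is 1.-homog -> iz c%:MP * v \is 1.-homog.
  by move=> v1; rewrite -[1%N]add0n; apply: dhomogM => //; apply: iz_homog; apply: const_homog.
by apply: rpredD; apply: H; apply: var_homog.
Qed.

Lemma coord_sub_lin g x' y' c d :
  coord_sub g x' y' (lin_form c d) = iz c%:MP * x' + iz d%:MP * y'.
Proof.
rewrite /lin_form (rmorphD (coord_sub g x' y')) !(rmorphM (coord_sub g x' y')) /=.
by rewrite !coord_sub_z !linear_subC coord_sub_x coord_sub_y.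
Qed.

Lemma lin_form10 : lin_form 1 0 = x.
Proof. by rewrite /lin_form mpolyC1 mpolyC0 rmorph1 (rmorph0 iz) mul1r mul0r addr0. Qed.

Lemma lin_form01 : lin_form 0 1 = y.
Proof. by rewrite /lin_form mpolyC1 mpolyC0 rmorph1 (rmorph0 iz) mul1r mul0r add0r. Qed.

Lemma coord_sub_comp g g' u v u' v' f : coord_sub g u' v' (coord_sub g' u v f)
  = coord_sub (g' *m g) (coord_sub g u' v' u) (coord_sub g u' v' v) f.
Proof.
elim/S_ind: f => [t|||f1 f2 H1 H2|f1 f2 H1 H2].
- by rewrite !coord_sub_z linear_subM.
- by rewrite !coord_sub_x.
- by rewrite !coord_sub_y.
- by rewrite !(rmorphD (coord_sub _ _ _)) /= H1 H2.
- by rewrite !(rmorphM (coord_sub _ _ _)) /= H1 H2.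
Qed.

Lemma coord_sub_id f : coord_sub 1%:M x y f = f.
Proof.
elim/S_ind: f => [t|||f1 f2 H1 H2|f1 f2 H1 H2].
- by rewrite coord_sub_z linear_sub1.
- exact: coord_sub_x.
- exact: coord_sub_y.
- by rewrite (rmorphD (coord_sub _ _ _)) /= H1 H2.
- by rewrite (rmorphM (coord_sub _ _ _)) /= H1 H2.
Qed.

(** The inverse substitution in x and y is written down by Cramer's rule with the determinant
    [dl]. *)
Lemma coord_linear_sub g (al be ga de : k) : g \in unitmx -> al * de - be * ga != 0 ->
  exists2 M, M \in unitmx & coord_sub g (lin_form al be) (lin_form ga de) =1 linear_sub M.
Proof.
move=> ug dl0; set dl := _ - _ in dl0.
have izD (c d : k) : iz (c + d)%:MP = iz c%:MP + iz d%:MP by rewrite mpolyCD rmorphD.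
have izM (c d : k) : iz (c * d)%:MP = iz c%:MP * iz d%:MP by rewrite mpolyCM rmorphM.
have comb c d : coord_sub g (lin_form al be) (lin_form ga de) (lin_form c d)
  = lin_form (c * al + d * ga) (c * be + d * de).
  by rewrite coord_sub_lin /lin_form !izD !izM; cf_ring.
have xE := comb (de / dl) (- be / dl); have yE := comb (- ga / dl) (al / dl).
have c1 : de / dl * al + - be / dl * ga = 1 by rewrite -(mulfV dl0) /dl; ring.
have c2 : de / dl * be + - be / dl * de = 0 by ring.
have c3 : - ga / dl * al + al / dl * ga = 0 by ring.
have c4 : - ga / dl * be + al / dl * de = 1 by rewrite -(mulfV dl0) /dl; ring.
rewrite c1 c2 lin_form10 in xE; rewrite c3 c4 lin_form01 in yE.
apply: (@linear_sub_morph _ _ _ _ (coord_sub g _ _)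
  (coord_sub (invmx g) (lin_form (de / dl) (- be / dl)) (lin_form (- ga / dl) (al / dl))) _ _ _ _ (@coord_subX _ _ _) (@coord_subX _ _ _)).
- move=> i; rewrite /coord_images; case: (unlift _ _) => [j|]; last exact: lin_form_homog.
  case: (unlift _ _) => [l|]; last exact: lin_form_homog.
  by apply: iz_homog; apply: linear_sub_homog; apply: var_homog.
- move=> i; rewrite /coord_images; case: (unlift _ _) => [j|]; last exact: lin_form_homog.
  case: (unlift _ _) => [l|]; last exact: lin_form_homog.
  by apply: iz_homog; apply: linear_sub_homog; apply: var_homog.
- exact: coord_subC.
- exact: coord_subC.
move=> i; apply: etrans (coord_sub_comp _ _ _ _ _ _ _) _; apply: etrans (coord_sub_id _).
rewrite mulVmx //; exact: (f_equal2 (fun u v => coord_sub 1%:M u v 'X_i) xE yE).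
Qed.

Lemma coord_lin_equiv g (al be ga de : k) (s : seq S) : g \in unitmx -> al * de - be * ga != 0 ->
  lin_equiv (gen_ideal (map (coord_sub g (lin_form al be) (lin_form ga de)) s)) (gen_ideal s).
Proof.
move=> ug dl0; have [M uM E] := coord_linear_sub ug dl0.
by rewrite (eq_map E); apply: lin_equiv_gens.
Qed.

End CoordinateChange.

Section ListedStructures.
Variables (k : fieldType) (n : nat).
Local Notation R := {mpoly k[n.+1]}.
Local Notation S := {mpoly k[n.+3]}.
Local Notation x := (x k n).
Local Notation y := (y k n).
Local Notation z0 := (z0 k n).
Local Notation iz := (@in_z k n).
Local Notation IX := (@IX k n).

Lemma gen_ideal_eq (s t : seq S) : (forall f, f \in s -> gen_ideal t f) ->
  (forall f, f \in t -> gen_ideal s f) -> gen_ideal s = gen_ideal t.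
Proof.
by move=> st ts; apply: predext => f; split; apply: gen_ideal_sub => //; apply: gen_idealP.
Qed.

Lemma flagB_onto_const (F1 F2 F3 : R) : (exists2 F, F \in [:: F1; F2; F3] & F = 1) ->
  flag_locally_onto 4 (flagB F1 F2 F3).
Proof.
move=> [F FF F1E]; apply: flagB_onto => P [_ P1 _] _ _ _ [PF1 PF2 PF3].
apply: P1; rewrite -(rmorph1 iz) -F1E.
by move: FF; rewrite !inE => /or3P[] /eqP ->.
Qed.

Lemma flagB_onto_nozero (F1 F2 F3 : R) : ~ (exists P, [/\ proj_point P, P F1, P F2 & P F3]) ->
  flag_locally_onto 4 (flagB F1 F2 F3).
Proof.
move=> noP; apply: flagB_onto => P pP hP XP Pj0 [PF1 PF2 PF3]; apply: noP.
exists (trace P); split; [split | exact: PF1 | exact: PF2 | exact: PF3].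
- exact: trace_prime.
- exact: trace_hom.
- exact: Pj0.
Qed.

End ListedStructures.

Lemma listed_type_I (k : fieldType) n (gens : seq {mpoly k[n.+3]}) : listed gens ->
  type_I (gen_ideal gens) /\ multiplicity (gen_ideal gens) 4.
Proof.
have h0 := @dhomog0 n.+1 k mdeg 0; have h1 := @dhomog1 n.+1 k mdeg.
have hN : (- 1 : {mpoly k[n.+1]}) \is 0.-homog by rewrite rpredN.
have t4 : type_I (gen_ideal [:: x k n ^+ 3; x k n * y k n; y k n ^+ 2]) /\
    multiplicity (gen_ideal [:: x k n ^+ 3; x k n * y k n; y k n ^+ 2]) 4.
  apply: (type_I_B h1 h0 h0 _ (@kernel4 k n)); apply: flagB_onto_const.
  by exists 1; rewrite ?inE ?eqxx.
have X1 : ('X_ord0 : {mpoly k[n.+1]}) \is 1.-homog by apply: var_homog.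
have X0 : ('X_ord0 : {mpoly k[n.+1]}) != 0 by rewrite -msize_poly_eq0 msizeX.
case=> [||||s F1 F2 F3 n2 s0 H1 H2 H3 noP|G G2||].
- exact: type_I_1.
- apply: (type_I_B h0 h1 h0 _ (@kernel2 k n)); apply: flagB_onto_const.
  by exists 1; rewrite ?inE ?eqxx ?orbT.
- apply: (type_I_B h1 h0 hN _ (@kernel3 k n)); apply: flagB_onto_const.
  by exists 1; rewrite ?inE ?eqxx.
- exact: t4.
- subst n.
  exact: (type_I_B H1 H2 H3 (flagB_onto_nozero noP) (kernel5 s0 H1 H2 H3 noP)).
(* For G = 0 structure (6) is (4), whose filtration is shorter, with m = 2. *)
- have [->|G0] := eqVneq G 0; last exact: type_I_6.
  by rewrite (rmorph0 (@in_z k n)) mul0r addr0.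
- apply: (type_I_C (a := 0) X1 X0); rewrite -kernelC // -z0E mpolyC0 (rmorph0 (@in_z k n)) mul0r addr0.
  by [].
- apply: (type_I_C (a := 1) X1 X0); rewrite -kernelC // -z0E mpolyC1 rmorph1 mul1r.
  by [].
Qed.

Section LinearEquivalences.
Variables (k : fieldType) (n : nat).
Local Notation R := {mpoly k[n.+1]}.
Local Notation S := {mpoly k[n.+3]}.
Local Notation x := (x k n).
Local Notation y := (y k n).
Local Notation z0 := (z0 k n).
Local Notation iz := (@in_z k n).
Local Notation IX := (@IX k n).

(** Replacing x, y by x + y, x - y turns x y and x^2 + y^2 into x^2 - y^2 and 2 (x^2 + y^2). *)
Lemma lin_equiv23 : 2 \notin [pchar k] ->
  lin_equiv (gen_ideal (gens2 k n)) (gen_ideal (gens3 k n)).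
Proof.
move=> ch; have two0 : (2%:R : k) != 0 by move: ch; rewrite inE.
have E : gen_ideal (gens2 k n) =
    gen_ideal (map (coord_sub 1%:M (lin_form n 1 1) (lin_form n 1 (- 1))) (gens3 k n)).
  rewrite /gens3 /= (rmorphD (coord_sub _ _ _)) !(rmorphXn (coord_sub _ _ _)) (rmorphM (coord_sub _ _ _)) /=.
  rewrite coord_sub_x coord_sub_y /lin_form mpolyCN mpolyC1 (rmorphN iz) !(rmorph1 iz).
  have half : iz (2%:R^-1)%:MP * 2%:R = 1.
    rewrite -(rmorph_nat iz) -(rmorphM iz) -(rmorph_nat (@mpolyC n.+1 k)) -mpolyCM mulVf //.
    by rewrite mpolyC1 rmorph1.
  have combine (X Y h : S) : h * 2%:R = 1 ->
    X ^+ 2 = h * ((1 * X + 1 * Y) * (1 * X + - 1 * Y)) + (h * h) * ((1 * X + 1 * Y) ^+ 2 + (1 * X + - 1 * Y) ^+ 2) /\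
    Y ^+ 2 = - h * ((1 * X + 1 * Y) * (1 * X + - 1 * Y)) + (h * h) * ((1 * X + 1 * Y) ^+ 2 + (1 * X + - 1 * Y) ^+ 2).
    move=> hE; split.
      have -> : X ^+ 2 = (h * 2%:R) * X ^+ 2 by rewrite hE mul1r.
      by rewrite -[LHS]add0r -[0](mul0r (h * (X ^+ 2 + Y ^+ 2))) -(subrr (h * 2%:R)) {2}hE; ring.
    have -> : Y ^+ 2 = (h * 2%:R) * Y ^+ 2 by rewrite hE mul1r.
    by rewrite -[LHS]add0r -[0](mul0r (h * (X ^+ 2 + Y ^+ 2))) -(subrr (h * 2%:R)) {2}hE; ring.
  have [xE yE] := combine x y _ half.
  apply: gen_ideal_eq => f; rewrite !inE => /orP[] /eqP ->.
  - by rewrite [f in gen_ideal _ f]xE; exact: gen_ideal2.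
  - by rewrite [f in gen_ideal _ f]yE; apply: gen_ideal2.
  - have -> : (1 * x + 1 * y) * (1 * x + -1 * y) = 1 * x ^+ 2 + -1 * y ^+ 2 by ring.
    exact: gen_ideal2.
  - have -> : (1 * x + 1 * y) ^+ 2 + (1 * x + -1 * y) ^+ 2 = 2 * x ^+ 2 + 2 * y ^+ 2 by ring.
    exact: gen_ideal2.
rewrite E; apply: coord_lin_equiv; first exact: unitmx1.
by rewrite mul1r mulr1 -opprD oppr_eq0.
Qed.

(** Completing the square: replacing x by x - y / 2 turns x^2 + x y into x^2 - y^2 / 4, and y^2 is
    in the ideal. *)
Lemma lin_equiv78 : 2 \notin [pchar k] ->
  lin_equiv (gen_ideal (gens7 k n)) (gen_ideal (gens8 k n)).
Proof.
move=> ch; have two0 : (2%:R : k) != 0 by move: ch; rewrite inE.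
have E : gen_ideal (gens7 k n) =
    gen_ideal (map (coord_sub 1%:M (lin_form n 1 (- 2%:R^-1)) (lin_form n 0 1)) (gens8 k n)).
  rewrite /gens8 /= !(rmorphD (coord_sub _ _ _)) !(rmorphXn (coord_sub _ _ _)) !(rmorphM (coord_sub _ _ _)) /=.
  rewrite coord_sub_x coord_sub_y z0E coord_sub_z linear_sub1 /gens7 z0E lin_form01 /lin_form mpolyCN mpolyC1.
  rewrite !(rmorphN iz) !(rmorph1 iz).
  have half : iz (2%:R^-1)%:MP * 2%:R = 1.
    rewrite -(rmorph_nat iz) -(rmorphM iz) -(rmorph_nat (@mpolyC n.+1 k)) -mpolyCM mulVf //.
    by rewrite mpolyC1 rmorph1.
  have combine (X Y h z : S) : h * 2%:R = 1 ->
    X ^+ 2 + z * Y = 1 * ((1 * X + - h * Y) ^+ 2 + (1 * X + - h * Y) * Y + z * Y) + h * h * Y ^+ 2 /\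
    (1 * X + - h * Y) ^+ 2 + (1 * X + - h * Y) * Y + z * Y = 1 * (X ^+ 2 + z * Y) + (- (h * h)) * Y ^+ 2.
    move=> hE.
    have H1 : h * Y * X * 2%:R = X * Y by transitivity (h * 2%:R * (X * Y)); [ring | rewrite hE mul1r].
    have H2 : h * h * 2%:R * Y ^+ 2 = h * Y ^+ 2 by transitivity (h * 2%:R * (h * Y ^+ 2)); [ring | rewrite hE mul1r].
    have E2 : (1 * X + - h * Y) ^+ 2 + (1 * X + - h * Y) * Y + z * Y = 1 * (X ^+ 2 + z * Y) + (- (h * h)) * Y ^+ 2.
      apply/eqP; rewrite -subr_eq0; apply/eqP.
      transitivity ((X * Y - h * Y * X * 2%:R) + (h * h * 2%:R * Y ^+ 2 - h * Y ^+ 2)); first by ring.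
      by rewrite H1 H2 !subrr addr0.
    by split=> //; rewrite E2; ring.
  have [E1 E2] := combine x y _ (iz 'X_ord0) half.
  apply: gen_ideal_eq => f; rewrite !inE => /orP[] /eqP ->.
  - by rewrite [f in gen_ideal _ f]E1; apply: gen_ideal2.
  - by apply: gen_ideal_mem; rewrite !inE eqxx orbT.
  - by rewrite [f in gen_ideal _ f]E2; apply: gen_ideal2.
  - by apply: gen_ideal_mem; rewrite !inE eqxx orbT.
rewrite E; apply: coord_lin_equiv; first exact: unitmx1.
by rewrite mulr1 mulr0 subr0 oner_neq0.
Qed.

End LinearEquivalences.

(** * Consequences of the Cohen-Macaulay property *)

Section RegularElements.
Variables (k : fieldType) (N : nat).
Local Notation S := {mpoly k[N]}.
Local Notation hc := (pihomog mdeg).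
Local Notation "f %:F" := (@FracField.tofrac S f).

Definition regular_at (P a : S -> Prop) (u : S) : Prop := forall b, hloc P a (u * b) -> hloc P a b.

Lemma regular_at_exp P a u M : regular_at P a u -> regular_at P a (u ^+ M).
Proof.
move=> ru; elim: M => [|M IH] b; first by rewrite expr0 mul1r.
by rewrite exprSr -mulrA => /IH/ru.
Qed.

Variables (P : S -> Prop).
Hypothesis ptP : proj_point P.
Let pP : prime_ideal (@whole S) P. Proof. by case: ptP. Qed.
Let hP : homogeneous P. Proof. by case: ptP. Qed.
Let iP : ideal (@whole S) P. Proof. by case: pP. Qed.
Let PM f g : ~ P f -> ~ P g -> ~ P (f * g).
Proof. by move=> Pf Pg; have [_ _ pM] := pP; case/pM. Qed.

(** Up to multipliers outside P: if v b is c u^(M+1) modulo [a], then b is c' u modulo [a];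
    cancelling u makes v c' congruent to c u^M, and the induction applies to c'. *)
Lemma regular_adjoin_exp a u v M : ideal (@whole S) a -> regular_at P a u ->
  regular_at P (adjoin (@whole S) a u) v -> regular_at P (adjoin (@whole S) a (u ^+ M)) v.
Proof.
move=> ia ru rv; have [_ a0 aD aM] := ia; elim: M => [|M IH] b.
  have [_ P1 _] := pP; rewrite expr0 => _; exists 1, 0%N; split; [exact: dhomog1 | exact: P1 |].
  by exists 0, b; rewrite mul1r mulr1 add0r.
move=> [s [d [sd Ps [i [c [ai _ E]]]]]].
have /rv[s' [d' [sd' Ps' [i' [c' [ai' _ E']]]]]] : hloc P (adjoin (@whole S) a u) (v * b).
  exists s, d; split=> //; exists i, (c * u ^+ M); split=> //.
  by rewrite E exprSr mulrA.
have /ru[s2 [d2 [sd2 Ps2 a2]]] : hloc P a (u * (s * v * c' - s' * c * u ^+ M)).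
  apply: hloc_incl => //.
  rewrite (_ : _ * _ = s' * i + - (s * v) * i'); first by apply: aD; apply: aM.
  have -> : i = s * (v * b) - c * u ^+ M.+1 by rewrite E addrK.
  have -> : i' = s' * b - c' * u by rewrite E' addrK.
  by rewrite exprS; ring.
have /IH[s3 [d3 [sd3 Ps3 [i3 [c3 [ai3 _ E3]]]]]] : hloc P (adjoin (@whole S) a (u ^+ M)) (v * c').
  exists (s2 * s), (d2 + d)%N; split; [exact: dhomogM | exact: PM |].
  exists (s2 * (s * v * c' - s' * c * u ^+ M)), (s2 * s' * c); split=> //.
  by ring.
exists (s3 * s'), (d3 + d')%N; split; [exact: dhomogM | exact: PM |].
exists (s3 * i' + u * i3), c3; split=> //; first by apply: aD; apply: aM.
rewrite -mulrA E' mulrDr [s3 * (c' * u)]mulrA E3 exprS; ring.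
Qed.

Variables (I : S -> Prop).
Hypotheses (iI : ideal (@whole S) I) (hI : homogeneous I).
Hypothesis CM : CM_local_ring (hlocal P) (hlocal_ideal P I).

Lemma regular_of_frac a f g d : ideal (@whole S) a -> homogeneous a ->
  f \is d.-homog -> g \is d.-homog -> ~ P g ->
  (forall u, hlocal P u -> hlocal_ideal P a (f%:F / g%:F * u) -> hlocal_ideal P a u) -> regular_at P a f.
Proof.
by move=> ia ha fd gd Pg H; have [_ _ [i0 Pi0]] := ptP; apply: (frac_regular_hloc pP Pi0 ia ha fd gd Pg H).
Qed.

(** The prime [p] strictly below [P] makes the dimension positive, hence the depth; the numerator of
    a regular fraction is the element sought. *)
Lemma regular_one p f d : prime_ideal (@whole S) p -> incl I p -> incl p P ->
  f \is d.-homog -> P f -> ~ p f -> exists u e, [/\ u \is e.-homog, P u & regular_at P I u].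
Proof.
move=> pp Ip pP' fd Pf npf; have [_ _ [i0 Pi0]] := ptP.
have IP : incl I P by move=> g /Ip/pP'.
have [|t [le tn tr]] := CM_regular (l := 1) iI CM.
  exists (nth (hlocal_ideal P P) [:: hlocal_ideal P p]); split.
    case=> [|[|//]] _ /=; split; try exact: hlocal_ideal_mono.
    - exact: hlocal_ideal_prime.
    - exact: hlocal_ideal_prime.
  case=> [_|//] /=; split; first exact: hlocal_ideal_mono.
  apply: (hlocal_ideal_proper pP Pi0 _ fd Pf); first by case: pp.
  by move/(hloc_prime pp pP').
case: t le tn tr => [//|u t] _ tn /= [ru _].
have un := tn u (mem_head _ _); have [[e [f0 [g0 [fe ge Pg uE]]]] _] := un.
rewrite uE in un ru; exists f0, e; split=> //; first exact: (nonunit_hlocal pP iI IP fe ge Pg).1 un.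
exact: (regular_of_frac iI hI fe ge Pg ru).
Qed.

Lemma regular_two p q f g d e : prime_ideal (@whole S) p -> prime_ideal (@whole S) q ->
  incl I p -> incl p q -> incl q P ->
  f \is d.-homog -> q f -> ~ p f -> g \is e.-homog -> P g -> ~ q g ->
  exists u v du dv, [/\ u \is du.-homog /\ v \is dv.-homog, P u /\ P v, regular_at P I u &
    regular_at P (adjoin (@whole S) I u) v].
Proof.
move=> pp pq Ip pq' qP fd qf npf ge Pg nqg; have [_ _ [i0 Pi0]] := ptP.
have IP : incl I P by move=> h /Ip/pq'/qP.
have pP' : incl p P by move=> h /pq'/qP.
have [|t [le tn tr]] := CM_regular (l := 2) iI CM.
  exists (nth (hlocal_ideal P P) [:: hlocal_ideal P p; hlocal_ideal P q]); split.
    case=> [|[|[|//]]] _ /=; split; try exact: hlocal_ideal_prime.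
    - exact: hlocal_ideal_mono.
    - by apply: hlocal_ideal_mono => h /Ip/pq'.
    - exact: hlocal_ideal_mono.
  case=> [_|[_|//]] /=; split; try exact: hlocal_ideal_mono.
    apply: (hlocal_ideal_proper pP Pi0 _ fd qf); first by case: pp.
    by move/(hloc_prime pp pP').
  apply: (hlocal_ideal_proper pP Pi0 _ ge Pg); first by case: pq.
  by move/(hloc_prime pq qP).
case: t le tn tr => [//|u [//|v t]] _ tn /= [ru [rv _]].
have un := tn u (mem_head _ _); have [[du [f0 [g0 [fa ga Pg0 uE]]]] _] := un.
have vn : nonunit (hlocal P) (hlocal_ideal P I) v by apply: tn; rewrite !inE eqxx orbT.
have [[dv [f1 [g1 [fb gb Pg1 vE]]]] _] := vn.
rewrite uE in un ru rv; rewrite vE in vn rv.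
exists f0, f1, du, dv; split; [by [] | split | |].
- exact: (nonunit_hlocal pP iI IP fa ga Pg0).1 un.
- exact: (nonunit_hlocal pP iI IP fb gb Pg1).1 vn.
- exact: (regular_of_frac iI hI fa ga Pg0 ru).
- move: rv; rewrite (hlocal_ideal_adjoin pP iI hI fa ga Pg0) => rv.
  apply: (regular_of_frac _ _ fb gb Pg1 rv); first exact: ideal_adjoin_whole.
  exact: (homogeneous_adjoin hI fa iI).
Qed.

End RegularElements.

Lemma saturated_power (k : fieldType) n (a : {mpoly k[n]} -> Prop) t f : saturated a ->
  (forall m : 'X_{1..n}, (t <= mdeg m)%N -> a ('X_[m] * f)) -> a f.
Proof.
move=> sa; elim: t => [|t IH] H.
  by rewrite -[f]mul1r -mpolyX0; apply: H.
apply: IH => m tm; apply: sa => i; rewrite mulrA -mpolyXD; apply: H.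
by rewrite mdegD mdeg1.
Qed.

Section PrimaryIdeals.
Variables (k : fieldType) (n : nat).
Local Notation R := {mpoly k[n.+1]}.
Local Notation S := {mpoly k[n.+3]}.
Local Notation x := (x k n).
Local Notation y := (y k n).
Local Notation iz := (@in_z k n).
Local Notation IX := (@IX k n).
Local Notation hc := (pihomog mdeg).

Lemma IX_ideal : ideal (@whole S) IX. Proof. by case: (@IX_prime k n). Qed.

Lemma IX_sub_cf f : IX (f - iz (cf 0 0 f)).
Proof. by apply/IX_P; rewrite cfB cfz /= subrr. Qed.

Lemma not_IX_cf g : ~ IX g -> cf 0 0 g != 0.
Proof. by move=> Xg; apply/eqP => /IX_P. Qed.

(* Modulo an ideal containing a power of IX, a multiplier outside IX may be replaced by a power of
   its constant coefficient in x and y. *)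
Lemma const_multiplier a N g f : ideal (@whole S) a -> (forall h, IX h -> a (h ^+ N)) ->
  a (g * f) -> a (iz (cf 0 0 g) ^+ N * f).
Proof.
move=> ia XN agf; have [_ _ aD aM] := ia.
have Xh : IX (- (g - iz (cf 0 0 g))).
  by apply: (idealN (@subring_whole S) IX_ideal); apply: IX_sub_cf.
have := subrXX (iz (cf 0 0 g)) (- (g - iz (cf 0 0 g))) N.
rewrite opprK [_ + (g - _)]addrC subrK; set q := \sum_(_ < _) _ => /eqP; rewrite subr_eq => /eqP ->.
rewrite mulrDl; apply: aD; last by rewrite mulrC; apply: aM => //; apply: XN.
by rewrite mulrC mulrA mulrC; apply: aM => //; rewrite mulrC.
Qed.

(** The lowest component of f outside [a] and the lowest nonzero component of r multiply, modulo
    [a], to a component of the product. *)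
Lemma lead_component a r f : ideal (@whole S) a -> r != 0 ->
  (forall c, a (hc c (iz r * f))) ->
  (exists d, ~ a (hc d f)) ->
  exists d e, [/\ ~ a (hc d f), hc e r != 0 & a (iz (hc e r) * hc d f)].
Proof.
move=> ia r0 arf ex; have [_ a0 aD aM] := ia.
have [d nad lt_d] := min_component ex.
have exr : exists e, ~ hc e r = 0.
  by have [e re _] := max_component r0; exists e; apply/eqP.
have [e /eqP re lt_e] := @min_component _ _ (fun u => u = 0) r exr.
exists d, e; split=> //.
have H : a (hc (d + e) (f * iz r) - hc d f * hc e (iz r)).
  apply: pihomogM_lead => // [u v|i ide id]; first exact: aM.
  have [lt|ge] := ltnP i d; first by left; apply: lt_d.
  right; rewrite iz_pihomog lt_e ?(rmorph0 iz) //; lia.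
have aE : a (hc (d + e) (f * iz r)) by rewrite mulrC.
by have := idealB (@subring_whole S) ia aE H; rewrite subKr mulrC iz_pihomog.
Qed.

Lemma primary_component_ideal a : ideal (@whole S) a -> ideal (@whole S) (primary_component IX a).
Proof.
move=> [_ a0 aD aM]; have [_ X1 XM] := @IX_prime k n; split=> //.
- by exists 1; rewrite mul1r.
- move=> u v [g [Xg agu]] [h [Xh ahv]]; exists (g * h); split; first by case/XM.
  rewrite mulrDr; apply: aD; first by rewrite mulrAC mulrC; apply: aM.
  by rewrite -mulrA; apply: aM.
- by move=> u v _ [g [Xg agv]]; exists g; split=> //; rewrite mulrCA; apply: aM.
Qed.

Definition IX_primary (a : S -> Prop) : Prop := forall g f, ~ IX g -> a (g * f) -> a f.

Lemma primary_component_primary a : IX_primary (primary_component IX a).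
Proof.
move=> g f Xg [h [Xh E]]; exists (h * g); split; last by rewrite -mulrA.
by have [_ _ XM] := @IX_prime k n; case/XM.
Qed.

Lemma primary_component_hom a N : ideal (@whole S) a -> homogeneous a ->
  (forall h, IX h -> a (h ^+ N)) -> homogeneous (primary_component IX a).
Proof.
move=> ia ha XN f [g [Xg agf]] c; apply: boolp.contrapT => nc.
have [_ X1 _] := @IX_prime k n.
have H e : primary_component IX a (hc e (iz (cf 0 0 g ^+ N) * f)).
  exists 1; rewrite mul1r; split=> //; apply: ha.
  by rewrite (rmorphXn iz); apply: const_multiplier.
have r0 : cf 0 0 g ^+ N != 0 by rewrite expf_neq0 // not_IX_cf.
have [d [e [nd re Hd]]] :=
  lead_component (primary_component_ideal ia) r0 H (ex_intro _ c nc).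
by apply: nd; apply: primary_component_primary Hd; apply: not_IX_const.
Qed.

(** Absence of embedded components. Otherwise the annihilator of some form F modulo I has a minimal
    prime P containing a nonzero form G of R. As P is strictly above IX, it contains an element u
    regular modulo I, yet a power of u times an element outside P kills F. *)
Lemma CM_primary I N : closed_subscheme I -> incl I IX -> (forall h, IX h -> I (h ^+ N)) ->
  CM_scheme I -> IX_primary I.
Proof.
move=> [iI hI sI] IXI XN CM g f Xg Igf; apply: boolp.contrapT => If.
have [_ I0 ID IM] := iI; have [_ X1 XM] := @IX_prime k n.
have ex : exists d, ~ I (hc d f).
  by apply: boolp.contrapT => /boolp.forallNP H; apply: If; apply: (hom_mem iI) => d; apply: boolp.contrapT.
have [d [e [Ifd re IGf]]] : exists d e, [/\ ~ I (hc d f), hc e (cf 0 0 g ^+ N) != 0 &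
    I (iz (hc e (cf 0 0 g ^+ N)) * hc d f)].
  apply: lead_component => //; first by rewrite expf_neq0 // not_IX_cf.
  by move=> c; apply: hI; rewrite (rmorphXn iz); apply: const_multiplier.
set G := hc e _ in re IGf; set F := hc d f in Ifd IGf.
pose a (s : S) : Prop := I (s * F).
have ia : ideal (@whole S) a.
  split=> //; first by rewrite /a mul0r.
    by move=> u v au av; rewrite /a mulrDl; apply: ID.
  by move=> u v _ av; rewrite /a -mulrA; apply: IM.
have ha : homogeneous a.
  by move=> u au c; rewrite /a -(pihomog_mulr c u (pihomogP mdeg d f)); apply: hI.
(* If every variable were nilpotent modulo the annihilator, saturation would put F into I. *)
have [i Xi] : exists i : 'I_n.+3, forall M, ~ a ('X_i ^+ M).
  apply: boolp.contrapT => /boolp.forallNP H.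
  have {}H i : exists M, a ('X_i ^+ M).
    by apply: boolp.contrapT => nM; apply: (H i) => M aM; apply: nM; exists M.
  have [M aM] := boolp.choice H.
  apply: Ifd; apply: (saturated_power sI (t := (n.+3 * (\max_i M i).+1)%N)) => m tm.
  apply: (large_monomials ia _ tm) => j.
  by rewrite -(subnK (leqW (leq_bigmax j))) exprD; have [_ _ _ aX] := ia; exact: aX.
have [P [pP hP aP Pi uP]] := minimal_hom_prime ia ha (var_homog k i) Xi.
have ptP : proj_point P by split=> //; exists i.
have IP : incl I P by move=> u Iu; apply: aP; rewrite /a mulrC; apply: IM.
have XP : incl IX P.
  move=> h Xh; apply: (primeX (@subring_whole S) pP (r := N)) => //.
  by apply: IP; apply: XN.
have PG : P (iz G) by apply: aP.
have [u [du [ud Pu ru]]] : exists u du, [/\ u \is du.-homog, P u & regular_at P I u].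
  apply: (regular_one ptP iI hI (CM P ptP IP) (@IX_prime k n) IXI XP (iz_homog (pihomogP mdeg e _)) PG).
  exact: not_IX_const.
have [M [w [dw [wd Pw awu]]]] := uP u du ud Pu.
have /(regular_at_exp ru)[s [ds [sd Ps Is]]] : hloc P I (u ^+ M * (w * F)).
  by apply: (hloc_incl pP); rewrite mulrA [_ * w]mulrC.
have : P (s * w) by apply: aP; rewrite /a -mulrA.
by have [_ _ PM] := pP; case/PM.
Qed.

End PrimaryIdeals.

Section LiftedPrimes.
Variables (k : fieldType) (n : nat).
Local Notation R := {mpoly k[n.+1]}.
Local Notation S := {mpoly k[n.+3]}.
Local Notation iz := (@in_z k n).
Local Notation IX := (@IX k n).
Local Notation hc := (pihomog mdeg).

(** The point [p] of X seen in the ambient space: the prime of S that contains IX and contracts to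
    [p]. *)
Definition cf_preimage (p : R -> Prop) : S -> Prop := fun f => p (cf 0 0 f).

Lemma cf_preimage_prime p : prime_ideal (@whole R) p -> prime_ideal (@whole S) (cf_preimage p).
Proof.
move=> [[_ p0 pD pM] p1 pP]; rewrite /cf_preimage; split=> [||f g _ _].
- split; [by move=> ? _ | by rewrite cf0 | |].
    by move=> f g pf pg; rewrite cfD; apply: pD.
  by move=> f g _ pg; rewrite cf00M; apply: pM.
- by rewrite cf1.
- by rewrite cf00M; apply: pP.
Qed.

Lemma cf_preimage_hom p : homogeneous p -> homogeneous (cf_preimage p).
Proof.
move=> hp f pf d; rewrite /cf_preimage -[d]addn0 -[X in (_ + X)%N]/(0 + 0)%N cf_pihomog.
exact: hp.
Qed.

Lemma cf_preimage_iz p r : cf_preimage p (iz r) <-> p r.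
Proof. by rewrite /cf_preimage cfz. Qed.

Lemma IX_cf_preimage p : ideal (@whole R) p -> incl IX (cf_preimage p).
Proof. by move=> [_ p0 _ _] f /IX_P f0; rewrite /cf_preimage f0. Qed.

Lemma divides_prime m (p : {mpoly k[m]}) : prime_elt p -> prime_ideal (@whole {mpoly k[m]}) (divides p).
Proof.
move=> [p0 pU pP]; split=> [||f g _ _]; last exact: pP.
  split=> //; first by exists 0; rewrite mul0r.
    by move=> f g; apply: dividesD.
  by move=> f g _ pg; rewrite mulrC; apply: dividesMr.
by move=> [c cE]; apply: pU; exists c; rewrite mulrC -cE.
Qed.

End LiftedPrimes.

Section NoCommonZero.
Variables (k : fieldType) (n : nat).
Local Notation R := {mpoly k[n.+1]}.
Local Notation S := {mpoly k[n.+3]}.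
Local Notation iz := (@in_z k n).
Local Notation IX := (@IX k n).
Local Notation hc := (pihomog mdeg).

Variables (I1 I2 : S -> Prop) (N r : nat) (h : 'I_r -> S) (F : 'I_r -> R) (d : 'I_r -> nat).
Hypotheses (i1 : ideal (@whole S) I1) (p1 : IX_primary I1).
Hypotheses (i2 : ideal (@whole S) I2) (h2 : homogeneous I2) (CM2 : CM_scheme I2).
Hypotheses (I2X : incl I2 IX) (I21 : incl I2 I1) (XI12 : forall u f, IX u -> I1 f -> I2 (u * f)).
Hypothesis XN : forall u, IX u -> I2 (u ^+ N).
Hypothesis hI1 : forall i, I1 (h i).
Hypothesis h_span : forall f, I1 f -> exists a : 'I_r -> R, I2 (f - \sum_i iz (a i) * h i).
Hypothesis h_rel : forall a : 'I_r -> R, I2 (\sum_i iz (a i) * h i) <-> \sum_i a i * F i = 0.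
Hypothesis Fd : forall i, F i \is (d i).-homog.
Hypothesis Fcop : forall p, prime_elt p -> exists i, ~ divides p (F i).
Hypothesis Fn0 : exists i, F i != 0.

Let X1 : ~ IX 1. Proof. by case: (@IX_prime k n). Qed.

Lemma span_I1 (a : 'I_r -> R) : I1 (\sum_i iz (a i) * h i).
Proof. by have [_ i0 iD iM] := i1; apply: big_ind => // i _; apply: iM. Qed.

Lemma cf_modulo u f : I1 f -> I2 (u * f - iz (cf 0 0 u) * f).
Proof. by move=> If; rewrite -mulrBl; apply: XI12 If; apply: IX_sub_cf. Qed.

Lemma span_scale (b : R) (a : 'I_r -> R) :
  iz b * (\sum_i iz (a i) * h i) = \sum_i iz (b * a i) * h i.
Proof. by rewrite mulr_sumr; apply: eq_bigr => i _; rewrite mulrA (rmorphM iz). Qed.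

Lemma span_sub (a b : 'I_r -> R) :
  (\sum_i iz (a i) * h i) - (\sum_i iz (b i) * h i) = \sum_i iz (a i - b i) * h i.
Proof. by rewrite -sumrB; apply: eq_bigr => i _; rewrite (rmorphB iz) mulrBl. Qed.

Lemma form_scale (b : R) (a : 'I_r -> R) : \sum_i (b * a i) * F i = b * \sum_i a i * F i.
Proof. by rewrite mulr_sumr; apply: eq_bigr => i _; rewrite mulrA. Qed.

Lemma form_sub (a b : 'I_r -> R) : \sum_i (a i - b i) * F i = \sum_i a i * F i - \sum_i b i * F i.
Proof. by rewrite -sumrB; apply: eq_bigr => i _; rewrite mulrBl. Qed.

(* A regular pair u, v at a common zero of the F_i would satisfy w u^M = A.F and w' v^M = B.F with
   constant coefficients in x, y; then w' v^M (A.h) = w u^M (B.h) modulo I2, and cancelling v^M shows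
   that A.h is divisible by u^M, so that the unit s w w' lies in the ideal of the F_i. *)
Lemma no_common_zero : ~ (exists p, proj_point p /\ forall i, p (F i)).
Proof.
move=> [p [[pp hp [j pj]] pF]]; have [[_ p0 pD pM] pn1 pP] := pp.
have ip : ideal (@whole R) p by case: pp.
have fp : incl (forms_ideal F) p.
  by move=> _ [g ->]; apply: big_ind => // i _; apply: pM.
(* Passing to a minimal prime q over the forms: every form in q then has a power that, times an
   element outside q, is a combination of the F_i. *)
have [q [pq hq Fq qj uq]] : exists P, [/\ prime_ideal (@whole R) P, homogeneous P,
    incl (forms_ideal F) P, ~ P 'X_j & forall u e, u \is e.-homog -> P u ->
      exists M w e', [/\ w \is e'.-homog, ~ P w & forms_ideal F (w * u ^+ M)]].
  apply: (minimal_hom_prime (forms_ideal_ideal F) (forms_ideal_hom Fd) (var_homog k j)) => M /fp.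
  by move/(primeX (@subring_whole R) pp) => H; apply: pj; apply: H.
have [[_ q0 qD qM] qn1 qP] := pq.
have iq : ideal (@whole R) q by case: pq.
have qF i : q (F i) by apply: Fq; apply: forms_ideal_mem.
have [i0 Fi0] := Fn0.
(* A prime factor [pi] of F_i0 inside q, together with some F_i that it does not divide, makes IX
   and the preimages of (pi) and q a strict chain of length two. *)
have [pi ppi [qpi pid]] : exists2 pi, prime_elt pi & q pi /\ divides pi (F i0).
  have [s [sP [u [u' uE] FE]]] := factorial_mpoly Fi0.
  have [pi ps qpi] : exists2 pi, pi \in s & q pi.
    apply: boolp.contrapT => H.
    have : ~ q (u * \prod_(t <- s) t).
      case/qP => //; first by move=> qu; apply: qn1; rewrite -uE mulrC; apply: qM.
      rewrite big_seq; elim/big_ind: _ => // [a b qa qb|a as_ qa].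
        by case/qP.
      by apply: H; exists a.
    by rewrite -FE; apply.
  exists pi; first exact: sP.
  split=> //; rewrite FE mulrC; apply: dividesMr.
  by rewrite (big_rem pi) //=; apply: dividesMr; apply: divides_refl.
have [e pie] := divides_homog Fi0 (Fd i0) pid.
have [i1' ndi] := Fcop ppi.
have [P [pPP hPP Pq]] : exists P, [/\ prime_ideal (@whole S) P, homogeneous P & P = cf_preimage q].
  exists (cf_preimage q); split; [exact: cf_preimage_prime | exact: cf_preimage_hom | reflexivity].
have ptP : proj_point P.
  split; [exact: pPP | exact: hPP |].
  have [i iE] := @iz_X k n j; exists i; rewrite -iE Pq => /cf_preimage_iz; exact: qj.
have IP : incl I2 P by move=> f /I2X Xf; rewrite Pq; apply: IX_cf_preimage Xf.
have [u [v [du [dv [[ud vd] [Pu Pv] ru rv]]]]] : exists u v du dv,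
    [/\ u \is du.-homog /\ v \is dv.-homog, P u /\ P v, regular_at P I2 u &
    regular_at P (adjoin (@whole S) I2 u) v].
  apply: (regular_two ptP i2 h2 (CM2 ptP IP) (@IX_prime k n)
    (cf_preimage_prime (divides_prime ppi)) I2X _ _ (iz_homog pie) _ _ (iz_homog (Fd i1')) _ _).
  - by apply: IX_cf_preimage; case: (divides_prime ppi).
  - by move=> f [c cE]; rewrite Pq /cf_preimage cE; apply: qM.
  - by apply/cf_preimage_iz; apply: divides_refl.
  - by apply: not_IX_const; case: ppi.
  - by rewrite Pq; apply/cf_preimage_iz.
  - by move/cf_preimage_iz.
have [_ P1 PM] := pPP.
have Xu : ~ IX u.
  move=> /XN uN; have /(regular_at_exp ru)[s [ds [_ Ps]]] : hloc P I2 (u ^+ N * 1).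
    by rewrite mulr1; apply: hloc_incl.
  by rewrite mulr1 => /IP.
set u0 := cf 0 0 u; set v0 := cf 0 0 v.
have u0n : u0 != 0 by apply: not_IX_cf.
have hom0 (f : S) m : f \is m.-homog -> cf 0 0 f \is m.-homog.
  by move=> fa; have [H _] := cf_homog 0 0 fa; have := H (leq0n _); rewrite subn0.
have [M [w [ew [wd qw [A AE]]]]] := uq u0 du (hom0 _ _ ud) (eq_ind _ (fun Q => Q u) Pu _ Pq).
have [M' [w' [ew' [wd' qw' [B BE]]]]] := uq v0 dv (hom0 _ _ vd) (eq_ind _ (fun Q => Q v) Pv _ Pq).
have span_IA (g : 'I_r -> R) := span_I1 g.
set th := \sum_i iz (A i) * h i; set th' := \sum_i iz (B i) * h i.
have key : I2 (v ^+ M' * (iz w' * th) - u ^+ M * (iz w * th')).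
  have H : I2 (iz (v0 ^+ M') * (iz w' * th) - iz (u0 ^+ M) * (iz w * th')).
    rewrite !mulrA -!(rmorphM iz) /th /th' !span_scale span_sub; apply/h_rel.
    by rewrite form_sub !form_scale -AE -BE; ring.
  have [_ _ iD _] := i2; have [_ _ _ iM] := i1.
  have H1 := cf_modulo (v ^+ M') (iM (iz w') th I (span_I1 A)).
  have H2 := cf_modulo (u ^+ M) (iM (iz w) th' I (span_I1 B)).
  rewrite cf00X -/v0 in H1; rewrite cf00X -/u0 in H2.
  have := iD _ _ (idealB (@subring_whole S) i2 H1 H2) H; congr (I2 _); cf_ring.
have ruM : regular_at P I2 (u ^+ M) by apply: regular_at_exp.
have rvM := regular_at_exp (M := M') (regular_adjoin_exp ptP (M := M) i2 ru rv).
have [s [ds [sd Ps [i [b [Ii _ bE]]]]]] : hloc P (adjoin (@whole S) I2 (u ^+ M)) (iz w' * th).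
  apply: rvM; apply: (hloc_incl pPP); exists (v ^+ M' * (iz w' * th) - u ^+ M * (iz w * th')), (iz w * th').
  by split=> //; ring.
have Ith : I1 (s * (iz w' * th)) by have [_ _ _ iM] := i1; apply: (iM) => //; apply: (iM) => //; apply: span_I1.
(* [u] is outside IX and I1 is primary, so [u ^ M] cancels; thus [b] too is a combination of the h_i
   modulo I2. *)
have Ib : I1 b.
  apply: (p1 (g := u ^+ M)); first by move/(primeX (@subring_whole S) (@IX_prime k n)) => /(_ I).
  have := idealB (@subring_whole S) i1 Ith (I21 Ii); rewrite bE addrC addKr mulrC.
  by [].
have [c cE] := h_span Ib.
have fin : I2 (iz (cf 0 0 s) * (iz w' * th) - iz (u0 ^+ M) * \sum_i iz (c i) * h i).
  have [_ _ iD iM2] := i2; have [_ _ _ iM] := i1.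
  have H1 := cf_modulo s (iM (iz w') th I (span_I1 A)).
  have H2 := cf_modulo (u ^+ M) (span_I1 c).
  rewrite cf00X -/u0 in H2; rewrite bE in H1.
  have H3 := iM2 (u ^+ M) _ I cE.
  have := iD _ _ (idealB (@subring_whole S) i2 H2 H1) (iD _ _ Ii H3).
  congr (I2 _); cf_ring.
move: fin; rewrite mulrA -!(rmorphM iz) /th !span_scale span_sub => /h_rel.
rewrite form_sub !form_scale -AE => /eqP; rewrite subr_eq0 => /eqP E.
have qc : q (\sum_i c i * F i) by apply: big_ind => // l _; apply: qM.
have : q (cf 0 0 s * w' * w).
  rewrite (_ : _ * w = \sum_i c i * F i) //.
  by apply: (mulIf (expf_neq0 M u0n)); rewrite -mulrA E mulrC.
case/qP => //; case/qP => // qs; apply: Ps; rewrite Pq; exact: qs.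
Qed.

End NoCommonZero.

(** * Forms presenting a layer of rank one *)

Section RelationForms.
Variables (k : fieldType) (n : nat).
Local Notation R := {mpoly k[n.+1]}.
Local Notation S := {mpoly k[n.+3]}.
Local Notation iz := (@in_z k n).
Local Notation IX := (@IX k n).
Local Notation hc := (pihomog mdeg).

Lemma homog_relation (K : S -> Prop) (h1 h2 : S) e1 e2 : ideal (@whole S) K -> homogeneous K ->
  h1 \is e1.-homog -> h2 \is e2.-homog ->
  (exists b a, b != 0 /\ K (iz b * h1 - iz a * h2)) ->
  exists b db a da, [/\ b != 0, b \is db.-homog, K (iz b * h1 - iz a * h2), a \is da.-homog
    & a = 0 \/ (db + e1 = da + e2)%N].
Proof.
move=> iK hK h1e h2e [b [a [b0 Kab]]]; have [D bD _] := max_component b0.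
have := hK _ Kab (D + e1)%N; rewrite linearB /= (pihomog_mulr _ _ h1e) iz_pihomog.
have [lt|ge] := ltnP (D + e1) e2.
  rewrite (pihomog_mulr_lt _ h2e lt) subr0 => Kb; exists (hc D b), D, 0, 0%N.
  by rewrite (rmorph0 iz) mul0r subr0 pihomogP dhomog0; split=> //; left.
rewrite -[X in hc X (iz a * _)](subnK ge) (pihomog_mulr _ _ h2e) iz_pihomog => Kb.
exists (hc D b), D, (hc (D + e1 - e2) a), (D + e1 - e2)%N.
by rewrite !pihomogP; split=> //; right; rewrite subnK.
Qed.

Variables (r : nat) (h : 'I_r -> S) (e : 'I_r -> nat) (i0 : 'I_r).
Hypothesis he : forall i, h i \is (e i).-homog.

(** The degrees of the F_i are those of the h_i up to a common shift p - q, possibly negative; forms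
    equal to zero are exempt. *)
Definition graded_forms (F : 'I_r -> R) (d : 'I_r -> nat) p q : Prop :=
  [/\ forall i, F i \is (d i).-homog, forall i, F i = 0 \/ (d i + q = e i + p)%N & F i0 != 0].

(** Generically h_i is a_i / b_i times h_i0. Clearing all denominators at once gives the F_i, and
    their common denominator B cancels because K is primary. *)
Lemma relation_forms (K : S -> Prop) : ideal (@whole S) K -> homogeneous K -> IX_primary K ->
  ~ K (h i0) -> (forall i, exists b a, b != 0 /\ K (iz b * h i - iz a * h i0)) ->
  exists F d p q, graded_forms F d p q /\
    forall c : 'I_r -> R, K (\sum_i iz (c i) * h i) <-> \sum_i c i * F i = 0.
Proof.
move=> iK hK pK Kh0 rel; have [_ K0 KD KM] := iK.
have Kz g f : g != 0 -> K (iz g * f) -> K f by move=> g0; apply: pK; apply: not_IX_const.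
have Kz0 g : K (iz g * h i0) -> g = 0.
  by move=> Kg; apply/eqP; apply: contra_notT Kh0 => g0; apply: Kz Kg.
have H i : exists t : (R * nat) * (R * nat), [/\ t.1.1 != 0, t.1.1 \is (t.1.2).-homog,
    K (iz t.1.1 * h i - iz t.2.1 * h i0), t.2.1 \is (t.2.2).-homog
    & t.2.1 = 0 \/ (t.1.2 + e i = t.2.2 + e i0)%N].
  have [b [db [a [da Hab]]]] := homog_relation iK hK (he i) (he i0) (rel i).
  by exists ((b, db), (a, da)).
have [t tP] := boolp.choice H.
pose b i := (t i).1.1; pose a i := (t i).2.1.
have b0 i : b i != 0 by have [] := tP i.
pose B := \prod_i b i; pose F i := a i * \prod_(l | l != i) b l.
have B0 : B != 0 by apply/prodf_neq0.
have KF i : K (iz B * h i - iz (F i) * h i0).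
  have -> : B = b i * \prod_(l | l != i) b l by rewrite /B (bigD1 i).
  have [_ _ Ki _ _] := tP i; rewrite /F !(rmorphM iz).
  rewrite (_ : _ - _ = iz (\prod_(l | l != i) b l) * (iz (b i) * h i - iz (a i) * h i0)).
    exact: KM.
  by rewrite /=; cf_ring.
have ab0 : a i0 != 0.
  have [_ _ Ki _ _] := tP i0; move: Ki; rewrite -mulrBl -(rmorphB iz) => /Kz0/eqP.
  by rewrite subr_eq0 => /eqP E; rewrite /a -E; apply: b0.
have sdeg i : (\sum_(l | l != i) (t l).1.2 + (t i).1.2 = \sum_l (t l).1.2)%N.
  by rewrite [RHS](bigD1 i) //= addnC.
exists F, (fun i => ((t i).2.2 + \sum_(l | l != i) (t l).1.2)%N), (\sum_l (t l).1.2)%N, (e i0).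
split; first split.
- move=> i; apply: dhomogM; first by have [] := tP i.
  elim/big_ind2: _ => [|c1 d1 c2 d2|l _]; [exact: dhomog1 | exact: dhomogM |].
  by have [] := tP l.
- move=> i; have [_ _ _ _ [a0|E]] := tP i; first by left; rewrite /F /a a0 mul0r.
  by right; rewrite -(sdeg i); lia.
- by rewrite mulf_neq0 //; apply/prodf_neq0.
move=> c; set s := \sum_i c i * F i.
have Ks : K (iz B * (\sum_i iz (c i) * h i) - iz s * h i0).
  rewrite mulr_sumr (rmorph_sum iz) mulr_suml -sumrB; apply: big_ind => // i _.
  rewrite (rmorphM iz) mulrCA -[iz (c i) * _ * _]mulrA -mulrBr; exact: KM.
split=> [Kc|s0].
  apply: Kz0; have := idealB (@subring_whole S) iK (KM (iz B) _ I Kc) Ks.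
  by rewrite subKr.
by apply: (Kz _ _ B0); move: Ks; rewrite s0 (rmorph0 iz) mul0r subr0.
Qed.

(** A prime factor common to all F_i is divided out; this lowers the degree of F_i0 and does not
    change the relations. *)
Lemma coprime_forms F d p q : graded_forms F d p q ->
  exists F' d' p' q', [/\ graded_forms F' d' p' q', forall g, prime_elt g -> exists i, ~ divides g (F' i)
    & forall c : 'I_r -> R, \sum_i c i * F i = 0 <-> \sum_i c i * F' i = 0].
Proof.
move: {2}(d i0) (leqnn (d i0)) => D; elim: D F d p q => [|D IH] F d p q dD FP; have [Fd Fe F0] := FP.
  exists F, d, p, q; split=> // g pg; exists i0 => gF.
  move: dD; rewrite leqn0 => /eqP d0; have [m gm] := divides_homog F0 (Fd i0) gF.
  have [c cE] := gF; have c0 : c != 0 by apply: contraNneq F0 => c0; rewrite cE c0 mul0r.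
  have [m' cm] : exists m', c \is m'.-homog by apply: (homog_factor (g := g) (d := d i0)); rewrite -cE.
  have m0 : (m' + m)%N = 0%N.
    by rewrite -d0; apply: (dhomog_uniq F0); [rewrite cE; apply: dhomogM | apply: Fd].
  by apply: (prime_not_const pg); move: gm m0; case: m => // m _; lia.
have [H|/boolp.existsNP[g /boolp.not_implyP[pg H]]] :=
    boolp.EM (forall g, prime_elt g -> exists i, ~ divides g (F i)).
  by exists F, d, p, q.
have {}H i : exists c, F i = c * g.
  by apply: boolp.contrapT => nd; apply: H; exists i.
have [c cE] := boolp.choice H; have [g0 _ _] := pg.
have [m gm] := divides_homog F0 (Fd i0) (H i0).
have m0 : (0 < m)%N by case: m gm => // g0'; case: (prime_not_const pg).
have cd i : c i != 0 -> exists2 m', c i \is m'.-homog & d i = (m' + m)%N.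
  move=> ci0; have Fi0 : F i != 0 by rewrite cE mulf_neq0.
  have [m' cm] : exists m', c i \is m'.-homog by apply: (homog_factor (g := g) (d := d i)); rewrite -cE.
  exists m' => //; apply: (dhomog_uniq Fi0); [exact: Fd | rewrite cE; exact: dhomogM].
have c0 : c i0 != 0 by apply: contraNneq F0 => c0; rewrite cE c0 mul0r.
have [||F' [d' [p' [q' [FP' cop E]]]]] := IH c (fun i => (d i - m)%N) p (q + m)%N.
- by have [m' _ dE] := cd _ c0; lia.
- split=> // i; have [->|ci0] := eqVneq (c i) 0; [exact: dhomog0 | |by left |].
    by have [m' cm ->] := cd _ ci0; rewrite addnK.
  right; have [m' cm dE] := cd _ ci0; have [/eqP|] := Fe i; last by lia.
  by rewrite cE mulf_eq0 (negbTE ci0) (negbTE g0).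
exists F', d', p', q'; split=> // a; rewrite -E.
have -> : \sum_i a i * F i = (\sum_i a i * c i) * g.
  by rewrite mulr_suml; apply: eq_bigr => i _; rewrite cE mulrA.
split=> [/eqP|->]; last by rewrite mul0r.
by rewrite mulf_eq0 (negbTE g0) orbF => /eqP.
Qed.

(** At most n forms of positive degree in n + 1 variables have a common zero; forms equal to zero
    are given degree one here. *)
Lemma constant_form F d p q : graded_forms F d p q -> (r <= n)%N ->
  ~ (exists P, proj_point P /\ forall i, P (F i)) -> exists i, F i != 0 /\ d i = 0%N.
Proof.
move=> [Fd _ _] rn noP; apply: boolp.contrapT => nc; apply: noP.
apply: (@common_zero k n r F (fun i => if F i == 0 then 1%N else d i)) => // [i|i].
  by case: eqP => [->|_]; [apply: dhomog0 | apply: Fd].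
case: eqP => // /eqP Fi; rewrite lt0n; apply/eqP => d0; apply: nc; by exists i.
Qed.

End RelationForms.

(** * The filtration of a type I structure *)

Section IdealPowers.
Variables (k : fieldType) (n : nat).
Local Notation S := {mpoly k[n.+3]}.
Local Notation IX := (@IX k n).

Lemma ideal_powS j f g : IX f -> ideal_pow IX j g -> ideal_pow IX j.+1 (f * g).
Proof.
move=> Xf Xg; exists [:: (f, g)]; rewrite big_seq1; split=> // w.
by rewrite inE => /eqP ->.
Qed.

Lemma ideal_pow_ind j (Q : S -> Prop) : Q 0 -> (forall f g, Q f -> Q g -> Q (f + g)) ->
  (forall f g, IX f -> ideal_pow IX j g -> Q (f * g)) -> incl (ideal_pow IX j.+1) Q.
Proof.
move=> Q0 QD QM f [s [sP ->]]; rewrite big_seq; apply: big_ind => // w ws.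
by have [Xf Xg] := sP _ ws; apply: QM.
Qed.

Lemma ideal_pow_mul i j f g : ideal_pow IX i f -> ideal_pow IX j g -> ideal_pow IX (i + j) (f * g).
Proof.
elim: i f => [|i IH] f; first by move=> _ Xg; rewrite add0n; apply: iz_mem (ideal_pow_ideal _ _ _) Xg.
move=> Xf Xg; move: f Xf; apply: ideal_pow_ind => [|f f' Hf Hf'|f f' Xf Xf'].
- by rewrite mul0r; have [] := ideal_pow_ideal k n (i.+1 + j).
- by rewrite mulrDl; have [_ _ iD _] := ideal_pow_ideal k n (i.+1 + j); apply: iD.
- by rewrite -mulrA; apply: ideal_powS => //; apply: IH.
Qed.

Lemma ideal_pow_exp j f : IX f -> ideal_pow IX j (f ^+ j).
Proof. by move=> Xf; elim: j => [|j IH] //; rewrite exprS; apply: ideal_powS. Qed.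

Lemma ideal_pow_anti i j : (i <= j)%N -> incl (ideal_pow IX j) (ideal_pow IX i).
Proof. by move=> ij f /ideal_powP o; apply/ideal_powP => a b ab; apply: o; apply: leq_trans ij. Qed.

Lemma ideal_pow_hom j : homogeneous (ideal_pow IX j).
Proof.
move=> f /ideal_powP o d; apply/ideal_powP => a b ab; have [le|lt] := leqP (a + b) d.
  by rewrite -(subnK le) cf_pihomog o // linear0.
by have [_ ->] := cf_homog a b (pihomogP mdeg d f).
Qed.

End IdealPowers.

Section Filtration.
Variables (k : fieldType) (n : nat).
Local Notation R := {mpoly k[n.+1]}.
Local Notation S := {mpoly k[n.+3]}.
Local Notation iz := (@in_z k n).
Local Notation IX := (@IX k n).
Local Notation hc := (pihomog mdeg).

(** What is retained of Cohen-Macaulayness for a layer of rank one. Quantifying over all generating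
    families makes it stable under changes of coordinates and leaves the choice of generators to
    each step. *)
Definition quotient_presented (J K : S -> Prop) : Prop :=
  forall r (h : 'I_r -> S) (e : 'I_r -> nat) i0,
    (forall i, h i \is (e i).-homog) -> (forall i, J (h i)) ->
    (forall f, J f -> exists a : 'I_r -> R, K (f - \sum_i iz (a i) * h i)) ->
    ~ K (h i0) -> (forall i, exists b a, b != 0 /\ K (iz b * h i - iz a * h i0)) ->
    exists F d p q, [/\ graded_forms e i0 F d p q,
      forall c : 'I_r -> R, K (\sum_i iz (c i) * h i) <-> \sum_i c i * F i = 0
      & ~ (exists P, proj_point P /\ forall i, P (F i))].

(** The properties of the S_1-filtration on which the classification rests, in a form that pulls
    back along changes of coordinates. By [ft_gen], J_j is generically generated by IX^(j+1), modulo
    elements common to all terms. *)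
Record type_I_filtration (J : nat -> S -> Prop) (m : nat) : Prop := TypeIFiltration {
  ft_ideal : forall j, ideal (@whole S) (J j);
  ft_primary : forall j, IX_primary (J j);
  ft_first : forall f, J 0%N f <-> IX f;
  ft_anti : forall j, incl (J j.+1) (J j);
  ft_mul : forall i j f g, J i f -> J j g -> J (i + j).+1 (f * g);
  ft_gen : forall j f, J j f ->
    exists g v, [/\ ~ IX g, ideal_pow IX j.+1 v & forall i, J i (g * f - v)];
  ft_strict : forall j, (j < m)%N -> ~ incl (ideal_pow IX j.+1) (J j.+1);
  ft_presented : forall j, (j < m)%N -> quotient_presented (J j) (J j.+1) }.

Lemma filtration_of_type_I I : type_I I -> exists m,
  [/\ type_I_filtration (filtration_ideal I) m, filtration_ideal I m = I,
    forall j, homogeneous (filtration_ideal I j) & forall j, incl I (filtration_ideal I j)].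
Proof.
move=> [[cI radI] CMI [m [powI npowI CMj]]]; have [iI hI sI] := cI.
pose J := filtration_ideal I.
have [_ I0 ID IM] := iI; have [_ X1 XM] := @IX_prime k n.
have IXI : incl I IX by move=> f If; apply/radI; exists 1%N; rewrite expr1.
have XmI h : IX h -> I (h ^+ m.+1) by move=> Xh; apply: powI; apply: ideal_pow_exp.
have pI : IX_primary I := CM_primary cI IXI XmI CMI.
have ij j := ideal_add_ideal iI (ideal_pow_ideal k n j.+1).
have IJ0 j : incl I (ideal_add I (ideal_pow IX j.+1)).
  by apply: ideal_add_l; have [] := ideal_pow_ideal k n j.+1.
have IJ j : incl I (J j) by move=> f If; exists 1; rewrite mul1r; split=> //; apply: IJ0.
have iJ j : ideal (@whole S) (J j) := primary_component_ideal (ij j).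
have pJ j : IX_primary (J j) by apply: primary_component_primary.
have hadd j : homogeneous (ideal_add I (ideal_pow IX j.+1)).
  move=> _ [u [v [Iu Xv ->]]] d; exists (hc d u), (hc d v); rewrite linearD.
  by split=> //; [apply: hI | apply: ideal_pow_hom].
have hJ j : homogeneous (J j).
  by apply: (primary_component_hom (N := m.+1) (ij j) (hadd j)) => h /XmI; apply: IJ0.
have Jpow j : incl (ideal_pow IX j.+1) (J j).
  move=> f Xf; exists 1; rewrite mul1r; split=> //; exists 0, f.
  by rewrite add0r.
have JX j : incl (J j) IX.
  move=> f [g [Xg [u [v [/IXI Xu Xv E]]]]]; case: (XM g f Logic.I Logic.I) => //; rewrite E.
  have [_ _ XD _] := @IX_ideal k n; apply: XD => //.
  by apply/IX_P; move/ideal_powP: Xv; apply.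
have J0 f : J 0%N f <-> IX f.
  split=> [|Xf]; first exact: JX.
  by apply: Jpow; rewrite -[f]expr1; apply: ideal_pow_exp.
have Janti j : incl (J j.+1) (J j).
  move=> f [g [Xg [u [v [Iu Xv E]]]]]; exists g; split=> //; exists u, v; split=> //.
  exact: ideal_pow_anti Xv.
have Jmul i j f g : J i f -> J j g -> J (i + j).+1 (f * g).
  move=> [a [Xa [u [v [Iu Xv E]]]]] [b [Xb [u' [v' [Iu' Xv' E']]]]].
  exists (a * b); split; first by case/XM.
  rewrite mulrACA E E'; exists (u * (u' + v') + v * u'), (v * v'); split.
  - by apply: ID; last exact: IM; rewrite mulrC; apply: IM.
  - by have := ideal_pow_mul Xv Xv'; rewrite addSn addnS.
  - by ring.
have Jgen j f : J j f -> exists g v, [/\ ~ IX g, ideal_pow IX j.+1 v & forall i, J i (g * f - v)].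
  move=> [g [Xg [u [v [Iu Xv E]]]]]; exists g, v; split=> // i.
  by rewrite E addrK; apply: IJ.
have Jm : J m = I.
  apply: predext => f; split; last exact: IJ.
  move=> [g [Xg [u [v [Iu Xv E]]]]]; apply: (pI g) => //; rewrite E; apply: ID => //.
  exact: powI.
exists m; split=> //; split=> // j jm.
- move=> sub; apply: npowI => f Xf; rewrite -Jm.
  (* If IX^(j+1) is in J_(j+1), it is in every later term, because these terms are generically
     generated by powers of IX; then IX^m would be in I. *)
  have H i : incl (ideal_pow IX j.+1) (J (j.+1 + i)%N).
    elim: i => [|i IH]; first by rewrite addn0.
    move=> h Xh; have [g [v [Xg Xv Jgv]]] := Jgen _ _ (IH _ Xh).
    apply: (pJ _ g) => //; have [_ J00 JD _] := iJ (j.+1 + i.+1)%N.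
    rewrite -[g * h](subrK v); apply: (JD) => //; move: v Xv {Jgv}; apply: ideal_pow_ind => // a b Xa Xb.
    by rewrite addnS; apply: (Jmul 0%N (j.+1 + i)%N); [apply/J0 | apply: IH; apply: ideal_pow_anti Xb; rewrite leq_addr].
  by have := H (m - j.+1)%N f; rewrite subnKC //; apply; apply: ideal_pow_anti Xf.
move=> r h e i0 he Jh span Kh0 rels.
have [F [d [p [q [gF relF]]]]] := relation_forms he (iJ j.+1) (hJ j.+1) (pJ j.+1) Kh0 rels.
have [F' [d' [p' [q' [gF' cop relF']]]]] := coprime_forms gF.
exists F', d', p', q'; have rel c : J j.+1 (\sum_i iz (c i) * h i) <-> \sum_i c i * F' i = 0.
  by rewrite relF relF'.
split=> //; have [Fd _ F0] := gF'.
apply: (no_common_zero (iJ j) (pJ j) (iJ j.+1) (hJ j.+1) (CMj j.+1 jm) (JX j.+1) (Janti j) _ (N := m.+1) _ Jh span rel Fd cop).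
- by move=> u f Xu Jf; rewrite -[j.+1]/((0 + j).+1); apply: (Jmul) => //; apply/J0.
- by move=> u /XmI; apply: IJ.
- by exists i0.
Qed.

End Filtration.

(** * Linear changes of x and y *)

Section ChangeOfCoordinates.
Variables (k : fieldType) (n : nat).
Local Notation R := {mpoly k[n.+1]}.
Local Notation S := {mpoly k[n.+3]}.
Local Notation x := (x k n).
Local Notation y := (y k n).
Local Notation iz := (@in_z k n).
Local Notation IX := (@IX k n).
Local Notation hc := (pihomog mdeg).

Record coord_change (phi psi : {rmorphism S -> S}) : Prop := CoordChange {
  cc_z : forall r, phi (iz r) = iz r;
  cc_homog : forall f d, f \is d.-homog -> phi f \is d.-homog;
  cc_cf : forall f, cf 0 0 (phi f) = cf 0 0 f;
  cc_K : cancel phi psi }.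

Lemma lin_form_cf (al be : k) : cf 0 0 (lin_form n al be) = 0.
Proof. by rewrite /lin_form cfD !cfM -[x]mulr1 -[y]mulr1 cfx cfy !mulr0 addr0. Qed.

Lemma coord_sub_K (a b c d p q r s : k) :
  p * a + q * c = 1 -> p * b + q * d = 0 -> r * a + s * c = 0 -> r * b + s * d = 1 ->
  cancel (coord_sub 1%:M (lin_form n p q) (lin_form n r s)) (coord_sub 1%:M (lin_form n a b) (lin_form n c d)).
Proof.
move=> E1 E2 E3 E4 f.
have izD (u v : k) : iz (u + v)%:MP = iz u%:MP + iz v%:MP by rewrite mpolyCD rmorphD.
have izM (u v : k) : iz (u * v)%:MP = iz u%:MP * iz v%:MP by rewrite mpolyCM rmorphM.
have comb u v : coord_sub 1%:M (lin_form n a b) (lin_form n c d) (lin_form n u v)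
  = lin_form n (u * a + v * c) (u * b + v * d).
  by rewrite coord_sub_lin /lin_form !izD !izM; cf_ring.
have xE := comb p q; rewrite E1 E2 lin_form10 in xE.
have yE := comb r s; rewrite E3 E4 lin_form01 in yE.
apply: etrans (coord_sub_comp _ _ _ _ _ _ f) _; rewrite mul1mx; apply: etrans (coord_sub_id f).
exact: (f_equal2 (fun u v => coord_sub 1%:M u v f) xE yE).
Qed.

Lemma coord_sub_homog (a b c d : k) (f : S) e : a * d - b * c != 0 ->
  f \is e.-homog -> coord_sub 1%:M (lin_form n a b) (lin_form n c d) f \is e.-homog.
Proof.
move=> dl0 fe; have [M _ ->] := coord_linear_sub (n:=n) (unitmx1 _ _) dl0.
exact: linear_sub_homog.
Qed.

Lemma coord_sub_cf (a b c d : k) (f : S) :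
  cf 0 0 (coord_sub 1%:M (lin_form n a b) (lin_form n c d) f) = cf 0 0 f.
Proof.
have [f1 [f2 [fE _ _]]] := cf_split f; rewrite {1}fE !(rmorphD (coord_sub _ _ _)) !(rmorphM (coord_sub _ _ _)) /= coord_sub_z linear_sub1.
rewrite coord_sub_x coord_sub_y; set u := coord_sub _ _ _ f1; set v := coord_sub _ _ _ f2.
have xu : cf 0 0 (lin_form n a b * u) = 0 by rewrite cf00M lin_form_cf mul0r.
have yv : cf 0 0 (lin_form n c d * v) = 0 by rewrite cf00M lin_form_cf mul0r.
by rewrite cfD cfD xu yv addr0 addr0 cfz.
Qed.

Lemma coord_change_exists (a b c d : k) : a * d - b * c != 0 -> exists phi psi,
  [/\ coord_change phi psi, coord_change psi phi, phi x = lin_form n a b, phi y = lin_form n c d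
    & exists2 M, M \in unitmx & phi =1 linear_sub M].
Proof.
move=> dl0; set dl := _ - _ in dl0.
exists (coord_sub 1%:M (lin_form n a b) (lin_form n c d)).
exists (coord_sub 1%:M (lin_form n (d / dl) (- b / dl)) (lin_form n (- c / dl) (a / dl))).
have dl0' : d / dl * (a / dl) - - b / dl * (- c / dl) != 0.
  rewrite (_ : _ - _ = dl / dl * dl^-1); last by rewrite /dl; ring.
  by rewrite mulfV // mul1r invr_eq0.
split; [| | exact: coord_sub_x | exact: coord_sub_y | exact: coord_linear_sub (unitmx1 _ _) dl0].
  split=> [r|f e|f|]; first by rewrite /= coord_sub_z linear_sub1.
  - exact: coord_sub_homog.
  - exact: coord_sub_cf.
  by apply: coord_sub_K; rewrite -?(mulfV dl0) /dl; ring.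
split=> [r|f e|f|]; first by rewrite /= coord_sub_z linear_sub1.
- exact: coord_sub_homog.
- exact: coord_sub_cf.
by apply: coord_sub_K; rewrite -?(mulfV dl0) /dl; ring.
Qed.

Variables (phi psi : {rmorphism S -> S}).
Hypotheses (cp : coord_change phi psi) (cs : coord_change psi phi).

Lemma cc_IX (f : S) : IX (phi f) <-> IX f.
Proof. by split=> /IX_P H; apply/IX_P; move: H; rewrite (cc_cf cp). Qed.

Lemma ccV_IX (f : S) : IX (psi f) <-> IX f.
Proof. by split=> /IX_P H; apply/IX_P; move: H; rewrite (cc_cf cs). Qed.

Lemma ccV_pow j (f : S) : ideal_pow IX j f -> ideal_pow IX j (psi f).
Proof.
elim: j f => [//|j IH]; apply: ideal_pow_ind => [|f g Hf Hg|f g Xf Xg].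
- by rewrite rmorph0; have [] := ideal_pow_ideal k n j.+1.
- by rewrite rmorphD; have [_ _ iD _] := ideal_pow_ideal k n j.+1; apply: iD.
- by rewrite rmorphM; apply: ideal_powS; [apply/ccV_IX | apply: IH].
Qed.

Lemma filtration_pullback J m : type_I_filtration J m -> type_I_filtration (fun j f => J j (phi f)) m.
Proof.
move=> fJ; split=> [j|j g f Xg|f|j f|i j f g|j f|j jm sub|j jm r h e i0 he Jh span Kh0 rels].
- have [_ J0 JD JM] := ft_ideal fJ j; split=> //; first by rewrite rmorph0.
    by move=> u v Ju Jv; rewrite rmorphD; apply: JD.
  by move=> u v _ Jv; rewrite rmorphM; apply: JM.
- by rewrite rmorphM; apply: (ft_primary fJ) => /cc_IX.
- by rewrite (ft_first fJ) cc_IX.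
- exact: (ft_anti fJ).
- by rewrite rmorphM; apply: (ft_mul fJ).
- move=> /(ft_gen fJ)[g [v [Xg Xv H]]]; exists (psi g), (psi v); split.
  + by move/ccV_IX.
  + exact: ccV_pow.
  + by move=> i; rewrite rmorphB rmorphM !(cc_K cs).
- apply: (ft_strict fJ jm) => f Xf; rewrite -(cc_K cs f); apply: sub; exact: ccV_pow.
have phiS (c : 'I_r -> R) : phi (\sum_i iz (c i) * h i) = \sum_i iz (c i) * phi (h i).
  by rewrite rmorph_sum; apply: eq_bigr => i _; rewrite rmorphM (cc_z cp).
have [|//|f Jf|//|i|F [d [p [q [gF rel noP]]]]] :=
    ft_presented fJ jm (h := phi \o h) (e := e) (i0 := i0).
- by move=> i; apply: (cc_homog cp).
- have [|a Ka] := span (psi f); first by rewrite (cc_K cs).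
  by exists a; move: Ka; rewrite rmorphB phiS (cc_K cs).
- have [b [a [b0 Kab]]] := rels i; exists b, a; split=> //.
  by move: Kab; rewrite rmorphB !rmorphM !(cc_z cp).
by exists F, d, p, q; split=> // c; rewrite phiS; apply: rel.
Qed.

Lemma flag_pullback r (c : nat -> S -> R) : (0 < r)%N -> is_flag r c -> is_flag r (fun i f => c i (psi f)).
Proof.
move=> r0 fc; have IXx (f : S) : IX f -> forall j g, (j < r)%N -> (forall i, (i < j)%N -> c i (psi g) = 0) ->
    c j (psi (f * g)) = 0.
  move=> Xf j g jr H; rewrite rmorphM; apply: (flag_ker_IX fc jr _ H) => //.
  exact/ccV_IX.
split=> [i f g|i u f|i|f|j f jr H|j f jr H].
- by rewrite rmorphD (flagD fc).
- by rewrite rmorphM (cc_z cs) (flagM fc).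
- have [p [q H]] := flag_homog fc i; exists p, q => f d fd; apply: H.
  exact: (cc_homog cs).
- by rewrite (flag_first fc) (cc_cf cs).
- by apply: IXx => //; apply/IX_P; rewrite -[x]mulr1 cfx.
- by apply: IXx => //; apply/IX_P; rewrite -[y]mulr1 cfy.
Qed.

Lemma onto_pullback r (c : nat -> S -> R) : flag_locally_onto r c ->
  flag_locally_onto r (fun i f => c i (psi f)).
Proof.
move=> oc P pP hP XP Pj j jr; have [e [d [ed ke Pe]]] := oc P pP hP XP Pj j jr.
exists (phi e), d; split; first exact: (cc_homog cp).
  by move=> i ij; rewrite (cc_K cp); apply: ke.
by rewrite (cc_K cp).
Qed.

(** Lengths are unique, so an ideal that is in some coordinates the kernel of a flag of r
    functionals has multiplicity r only. This excludes filtrations that are too short. *)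
Lemma multiplicity_pullback I r (c : nat -> S -> R) mu : (0 < r)%N -> is_flag r c -> flag_locally_onto r c ->
  (forall f, I (phi f) <-> flag_ker c r f) -> multiplicity I mu -> mu = r.
Proof.
move=> r0 fc oc IE [mu1 mu2].
have E : I = flag_ker (fun i f => c i (psi f)) r.
  by apply: predext => f; rewrite -{1}(cc_K cs f) IE.
have [r1 r2] := flag_multiplicity (flag_pullback r0 fc) r0 (onto_pullback oc).
by apply/eqP; rewrite eqn_leq; apply/andP; split; [apply: r2; rewrite -E | apply: mu2; rewrite E].
Qed.

End ChangeOfCoordinates.

Section Length.
Variables (k : fieldType) (n : nat).
Local Notation S := {mpoly k[n.+3]}.
Local Notation iz := (@in_z k n).
Local Notation IX := (@IX k n).

Lemma multiplicity_chain I mu l (b : nat -> S -> Prop) : multiplicity I mu ->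
  (forall i, ideal (@whole S) (b i)) -> incl I (b 0%N) ->
  (forall i, (i < l)%N -> incl (b i) (b i.+1)) ->
  (forall i, (i < l)%N -> exists f d, [/\ f \is d.-homog, b i.+1 f & ~ hloc IX (b i) f]) -> (l <= mu)%N.
Proof.
move=> [_ mu2] ib I0 bS bn; apply: mu2; exists (fun i => hlocal_ideal IX (b i)); split.
  move=> i il; split; first exact: (hlocal_ideal_ideal (@IX_prime k n)).
  apply: hlocal_ideal_mono; elim: i il => [|i IH] il //.
  by move=> f /(IH (ltnW il)); apply: bS.
move=> i il; split; first by apply: hlocal_ideal_mono; apply: bS.
have [f [d [fd bf nbf]]] := bn i il; have [j jE] := @iz_X k n ord0.
have Xj : ~ IX 'X_j by rewrite -jE; apply: X0_notin_IX.
exact: (hlocal_ideal_proper (@IX_prime k n) Xj (ib i) fd bf nbf).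
Qed.

End Length.

(** * Classification *)

Lemma sum_ord2 (V : nmodType) (G : 'I_2 -> V) : \sum_i G i = G ord0 + G ord_max.
Proof. by rewrite big_ord_recl big_ord1; congr (_ + G _); apply/val_inj. Qed.

Section PresentedPair.
Variables (k : fieldType) (n : nat).
Local Notation R := {mpoly k[n.+1]}.
Local Notation S := {mpoly k[n.+3]}.
Local Notation iz := (@in_z k n).

(** As n is at least 2, two forms without common zero cannot both be nonconstant; F1 is nonzero
    because h1 is not in K. *)
Lemma presented_pair (J K : S -> Prop) (h1 h2 : S) e1 e2 : (2 <= n)%N -> quotient_presented J K ->
  h1 \is e1.-homog -> h2 \is e2.-homog -> J h1 -> J h2 ->
  (forall f, J f -> exists a1 a2, K (f - (iz a1 * h1 + iz a2 * h2))) ->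
  K 0 -> ~ K h1 -> (exists b a, b != 0 /\ K (iz b * h2 - iz a * h1)) ->
  exists F1 F2 d1 d2, [/\ [/\ F1 != 0, F1 \is d1.-homog & F2 \is d2.-homog],
    F2 = 0 \/ (d1 + e2 = d2 + e1)%N,
    forall a1 a2, K (iz a1 * h1 + iz a2 * h2) <-> a1 * F1 + a2 * F2 = 0
    & d1 = 0%N \/ F2 != 0 /\ d2 = 0%N].
Proof.
move=> n2 JK h1e h2e J1 J2 span K0 Kh1 rel.
pose h (i : 'I_2) := if i == ord0 then h1 else h2; pose e (i : 'I_2) := if i == ord0 then e1 else e2.
have two (Q : 'I_2 -> Prop) : Q ord0 -> Q ord_max -> forall i, Q i.
  by move=> Q0 Q1 [[|[|//]] p]; [move: Q0 | move: Q1]; congr Q; apply/val_inj.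
have sum2 (a : 'I_2 -> R) : \sum_i iz (a i) * h i = iz (a ord0) * h1 + iz (a ord_max) * h2.
  exact: sum_ord2.
have [||f|//||F [d [p [q [[Fd Fe F0] relF noP]]]]] := JK 2 h e ord0.
- by apply: two.
- by apply: two.
- move=> /span[a1 [a2 Ka]]; exists (fun i => if i == ord0 then a1 else a2).
  by rewrite sum2.
- apply: two => //; exists 1, 1; rewrite oner_neq0 subrr; by split.
have gF : graded_forms e ord0 F d p q by [].
exists (F ord0), (F ord_max), (d ord0), (d ord_max); split.
- by split.
- have [F1|] := Fe ord_max; first by left.
  have [/eqP|] := Fe ord0; first by rewrite (negbTE F0).
  by rewrite /e /= => E1 E2; right; lia.
- move=> a1 a2; have := relF (fun i => if i == ord0 then a1 else a2).
  by rewrite sum2 sum_ord2.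
- have [i [Fi di]] := constant_form gF n2 noP.
  by move: i Fi di; apply: two; [left | right].
Qed.

Lemma homog0_const m (F : {mpoly k[m]}) : F \is 0.-homog -> exists c, F = c%:MP.
Proof. by move=> /homog_msize_le/msize1_polyC FE; exists F@_0. Qed.

End PresentedPair.

Section AdaptedCoordinates.
Variables (k : fieldType) (n : nat).
Local Notation R := {mpoly k[n.+1]}.
Local Notation S := {mpoly k[n.+3]}.
Local Notation x := (x k n).
Local Notation y := (y k n).
Local Notation iz := (@in_z k n).
Local Notation IX := (@IX k n).

Variables (J : nat -> S -> Prop) (m : nat).
Hypotheses (n2 : (2 <= n)%N) (fJ : type_I_filtration J m).

Let iJ j : ideal (@whole S) (J j). Proof. exact: (ft_ideal fJ). Qed.
Let J0 j : J j 0. Proof. by case: (iJ j). Qed.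
Let JD j f g : J j f -> J j g -> J j (f + g). Proof. by case: (iJ j) => _ _ D _; apply: D. Qed.
Let JM j f g : J j g -> J j (f * g). Proof. by case: (iJ j) => _ _ _ M; apply: M. Qed.
Let JMr j f g : J j f -> J j (f * g). Proof. by move=> Jf; rewrite mulrC; apply: JM. Qed.
Let JB j f g : J j f -> J j g -> J j (f - g). Proof. by move=> Jf Jg; apply: (idealB (@subring_whole S) (iJ j)). Qed.
Let Jle i j f : (i <= j)%N -> J j f -> J i f.
Proof.
move=> /subnK <-; elim: (j - i)%N => [//|l IH]; rewrite addSn => /(ft_anti fJ); exact: IH.
Qed.
Let Jz j r f : r != 0 -> J j (iz r * f) -> J j f.
Proof. by move=> r0; apply: (ft_primary fJ); apply: not_IX_const. Qed.
Let Jx : J 0 x. Proof. by apply/(ft_first fJ)/IX_P; rewrite -[x]mulr1 cfx. Qed.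
Let Jy0 : J 0 y. Proof. by apply/(ft_first fJ)/IX_P; rewrite -[y]mulr1 cfy. Qed.

Lemma pow_filtration j : incl (ideal_pow IX j.+1) (J j).
Proof.
elim: j => [|j IH].
  apply: ideal_pow_ind => [|f g|f g Xf _]; [exact: J0 | exact: JD |].
  by apply: JMr; apply/(ft_first fJ).
apply: ideal_pow_ind => [|f g|f g Xf Xg]; [exact: J0 | exact: JD |].
by apply: (ft_mul fJ (i := 0)); [apply/(ft_first fJ) | apply: IH].
Qed.

(** x and y have the same degree, so once one of the forms F1, F2 is constant the other is constant
    or zero, and the relation between x and y has coefficients in k. *)
Lemma adapted_exists : (0 < m)%N -> (exists a b, (a != 0) || (b != 0) /\ J 1 (iz a * x + iz b * y)) ->
  exists al be ga de : k, al * de - be * ga != 0 /\ J 1 (lin_form n ga de).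
Proof.
move=> m0 [a [b [ab Jab]]].
(* Applied with [h1] equal to x or y, whichever is outside J 1. *)
have pivot (h1 h2 : S) : h1 \is 1.-homog -> h2 \is 1.-homog -> J 0 h1 -> J 0 h2 ->
    (forall f, J 0 f -> exists a1 a2, J 1 (f - (iz a1 * h1 + iz a2 * h2))) -> ~ J 1 h1 ->
    (exists b a, b != 0 /\ J 1 (iz b * h2 - iz a * h1)) -> exists c, J 1 (iz c%:MP * h1 + iz 1%:MP * h2).
  move=> h1e h2e J1 J2 span Kh1 rel.
  have [F1 [F2 [d1 [d2 [[F10 Fd1 Fd2] dE relF cst]]]]] :=
    presented_pair n2 (ft_presented fJ m0) h1e h2e J1 J2 span (J0 1) Kh1 rel.
  have d10 : d1 = 0%N by case: cst => [//|[F20 d20]]; case: dE => [/eqP|]; [rewrite (negbTE F20) | lia].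
  rewrite d10 in Fd1; have [c1 F1E] := homog0_const Fd1.
  have c10 : c1 != 0 by apply: contraNneq F10 => c10; rewrite F1E c10 mpolyC0.
  have [c2 F2E] : exists c2, F2 = c2%:MP.
    case: dE => [->|dE]; first by exists 0; rewrite mpolyC0.
    by apply: homog0_const; move: Fd2; rewrite (_ : d2 = 0%N) //; lia.
  exists (- c2 / c1); apply/relF; rewrite F1E F2E -!mpolyCM -mpolyCD divfK // mul1r addNr.
  exact: mpolyC0.
have span0 f : J 0 f -> exists a1 a2, J 1 (f - (iz a1 * x + iz a2 * y)).
  move=> /(ft_first fJ)/IX_P f0; have [f1 [f2 [fE _ _]]] := cf_split f.
  exists (cf 0 0 f1), (cf 0 0 f2); rewrite fE f0 (rmorph0 iz) add0r.
  have -> : x * f1 + y * f2 - (iz (cf 0 0 f1) * x + iz (cf 0 0 f2) * y)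
    = x * (f1 - iz (cf 0 0 f1)) + y * (f2 - iz (cf 0 0 f2)) by cf_ring.
  by apply: JD; apply: (ft_mul fJ (i := 0) (j := 0)) => //; apply/(ft_first fJ); apply: IX_sub_cf.
have [Kx|Kx] := boolp.EM (J 1 x); last first.
  have [|c Kc] := pivot x y (var_homog _ _) (var_homog _ _) Jx Jy0 span0 Kx.
    exists b, (- a); rewrite (rmorphN iz) mulNr opprK addrC; split=> //.
    by apply/eqP => b0; move: ab Jab; rewrite b0 eqxx orbF (rmorph0 iz) mul0r addr0 => a0 /(Jz a0).
  by exists 1, 0, c, 1; split=> //; rewrite mulr1 mul0r subr0 oner_neq0.
have Ky : ~ J 1 y.
  move=> Ky; apply: (ft_strict fJ m0); apply: ideal_pow_ind => [|f g|f g /IX_P f0 _] //; first exact: JD.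
  have [f1 [f2 [-> _ _]]] := cf_split f; rewrite f0 (rmorph0 iz) add0r.
  by apply: JMr; apply: JD; apply: JMr.
have [f||c Kc] := pivot y x (var_homog _ _) (var_homog _ _) Jy0 Jx _ Ky.
- by move=> /span0[a1 [a2 H]]; exists a2, a1; rewrite addrC [iz a2 * _ + _]addrC addrC.
- by exists 1, 0; rewrite oner_neq0 (rmorph0 iz) mul0r subr0 rmorph1 mul1r.
exists 0, 1, 1, c; split; first by rewrite mul0r mulr1 sub0r oppr_eq0 oner_neq0.
by rewrite /lin_form addrC.
Qed.

Hypothesis Jy : J 1 y.

Let Jx2 : J 1 (x ^+ 2). Proof. exact: (ft_mul fJ (i := 0) (j := 0)). Qed.
Let Jx3 : J 2 (x ^+ 3). Proof. by rewrite exprS; apply: (ft_mul fJ (i := 0) (j := 1)). Qed.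
Let Jx4 : J 3 (x ^+ 4). Proof. by rewrite exprS; apply: (ft_mul fJ (i := 0) (j := 2)). Qed.
Let Jxy : J 2 (x * y). Proof. exact: (ft_mul fJ (i := 0) (j := 1)). Qed.
Let Jx2y : J 3 (x ^+ 2 * y). Proof. exact: (ft_mul fJ (i := 1) (j := 1)). Qed.
Let Jy2 : J 3 (y ^+ 2). Proof. exact: (ft_mul fJ (i := 1) (j := 1)). Qed.

(** With y in J 1, multiplicativity of the filtration puts x^4, x^2 y and y^2 into J 3. *)
Lemma adapted_modulo f : J 3 (f - (iz (cf 0 0 f) + iz (cf 1 0 f) * x + iz (cf 2 0 f) * x ^+ 2
  + iz (cf 3 0 f) * x ^+ 3 + iz (cf 0 1 f) * y + iz (cf 1 1 f) * (x * y))).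
Proof.
have [A [B [C [D fE]]]] := cf_expand f.
rewrite (_ : f - _ = A * x ^+ 4 + B * (x ^+ 2 * y) + (iz (cf 0 2 f) + x * C + y * D) * y ^+ 2).
  by apply: JD; [apply: JD|]; apply: JM.
by rewrite {1}fE; cf_ring.
Qed.

(** As y is in J 1, each factor from IX is a multiple of x modulo J 1, and the errors multiply into
    J j. *)
Lemma pow_modulo_x j v : ideal_pow IX j v -> exists a, J j (v - iz a * x ^+ j).
Proof.
elim: j v => [|j IH] v.
  move=> _; exists (cf 0 0 v); rewrite expr0 mulr1; apply/(ft_first fJ); exact: IX_sub_cf.
move: v; apply: ideal_pow_ind => [|f g [a Ha] [b Hb]|f g Xf /IH[a Ha]].
- by exists 0; rewrite (rmorph0 iz) mul0r subr0.
- exists (a + b); have -> : f + g - iz (a + b) * x ^+ j.+1 = (f - iz a * x ^+ j.+1) + (g - iz b * x ^+ j.+1).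
    by rewrite (rmorphD iz) mulrDl opprD addrACA.
  exact: (JD Ha Hb).
have [c Hc] : exists c, J 1 (f - iz c * x).
  move/IX_P: Xf => f0; have [f1 [f2 [fE _ _]]] := cf_split f; exists (cf 0 0 f1).
  rewrite fE f0 (rmorph0 iz) add0r.
  have -> : x * f1 + y * f2 - iz (cf 0 0 f1) * x = x * (f1 - iz (cf 0 0 f1)) + f2 * y by cf_ring.
  apply: JD; last exact: JM.
  by apply: (ft_mul fJ (i := 0) (j := 0)) => //; apply/(ft_first fJ); apply: IX_sub_cf.
exists (c * a); rewrite (rmorphM iz).
have -> : f * g - iz c * iz a * x ^+ j.+1 = f * (g - iz a * x ^+ j) + iz a * ((f - iz c * x) * x ^+ j).
  by rewrite exprS; cf_ring.
apply: JD; first by apply: (ft_mul fJ (i := 0)) => //; apply/(ft_first fJ).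
apply: JM; case: j IH Ha => [|j] _ _; first by rewrite expr0 mulr1.
apply: (ft_mul fJ (i := 1)) => //; apply: pow_filtration; apply: ideal_pow_exp.
exact/(ft_first fJ).
Qed.

Lemma relation_x j f : J j f -> exists b a, b != 0 /\ J j.+1 (iz b * f - iz a * x ^+ j.+1).
Proof.
move=> Jf; have [g [v [Xg Xv Jgv]]] := ft_gen fJ Jf; have [a Ja] := pow_modulo_x Xv.
exists (cf 0 0 g), a; split; first exact: not_IX_cf.
rewrite (_ : _ - _ = (g * f - v) + (v - iz a * x ^+ j.+1) - (g - iz (cf 0 0 g)) * f).
  apply: JB; first exact: JD.
  by apply: (ft_mul fJ (i := 0)) => //; apply/(ft_first fJ); apply: IX_sub_cf.
by cf_ring.
Qed.

Lemma x_notin j : (j < m)%N -> ~ J j.+1 (x ^+ j.+1).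
Proof.
move=> jm Jxj; apply: (ft_strict fJ jm) => v /pow_modulo_x[a Ja].
by rewrite -[v](subrK (iz a * x ^+ j.+1)); apply: JD => //; apply: JM.
Qed.

Lemma adapted1 f : (0 < m)%N -> J 1 f <-> flag_ker (flagA (0 : R) 1) 2 f.
Proof.
move=> m0; have H := @Jle 1 3 _ isT (adapted_modulo f); split=> [Jf|kf].
  have f0 : cf 0 0 f = 0 by apply/IX_P/(ft_first fJ)/(Jle (j := 1)).
  have f1 : J 1 (iz (cf 1 0 f) * x).
    have T : J 1 (iz (cf 2 0 f) * x ^+ 2 + iz (cf 3 0 f) * x ^+ 3 + iz (cf 0 1 f) * y + iz (cf 1 1 f) * (x * y)).
      by apply: JD; [apply: JD; [apply: JD|]|]; apply: JM => //; apply: (Jle (j := 2)).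
    have := JB (JB Jf H) T; rewrite f0 (rmorph0 iz); congr (J 1 _); cf_ring.
  case=> [|[|//]] _ //=; apply/eqP; apply: contra_notT (x_notin m0) => c0.
  by rewrite expr1; apply: Jz f1.
have k0 : cf 0 0 f = 0 := kf 0%N isT; have k1 : cf 1 0 f = 0 := kf 1%N isT.
rewrite k0 k1 (rmorph0 iz) in H; rewrite -[f](subrK (iz (cf 2 0 f) * x ^+ 2
  + iz (cf 3 0 f) * x ^+ 3 + iz (cf 0 1 f) * y + iz (cf 1 1 f) * (x * y))).
apply: JD; first by move: H; congr (J 1 _); cf_ring.
by apply: JD; [apply: JD; [apply: JD|]|]; apply: JM => //; apply: (Jle (j := 2)).
Qed.

Let Jiff j f g : J j (f - g) -> J j f <-> J j g.
Proof.
move=> H; split=> [Jf|Jg]; last by rewrite -(subrK g f); apply: JD.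
by have := JB Jf H; rewrite subKr.
Qed.

Lemma x_homog j : (x ^+ j : S) \is j.-homog.
Proof. by have := dhomogMn j (var_homog k (inord n.+1 : 'I_n.+3)); rewrite mul1n. Qed.

Lemma unit_coefficient (F : R) : F \is 0.-homog -> F != 0 ->
  exists2 u : k, u != 0 & forall g h : R, g * F + h = 0 <-> g + u%:MP * h = 0.
Proof.
move=> /homog0_const[c ->] F0; have c0 : c != 0 by apply: contraNneq F0 => ->; rewrite mpolyC0.
exists c^-1; first by rewrite invr_eq0.
have cC : c%:MP * (c^-1)%:MP = 1 :> R by rewrite -mpolyCM mulfV // mpolyC1.
move=> g h; have -> : g + (c^-1)%:MP * h = (c^-1)%:MP * (g * c%:MP + h).
  by rewrite mulrDr mulrCA [_ * c%:MP]mulrC cC mulr1.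
split=> [->|/eqP]; first by rewrite mulr0.
rewrite mulf_eq0 => /orP[|/eqP //]; rewrite mpolyC_eq0 invr_eq0 (negbTE c0) //.
Qed.

(** J 1 / J 2 is generated by x^2 and y, of degrees two and one. Either F2 = 0 and y is in J 2, or
    F2 is the constant form and F1 has degree one, which gives l = - F1 / F2. *)
Lemma adapted2 : (1 < m)%N ->
  (forall f, J 2 f <-> flag_ker (flagA (0 : R) 1) 3 f) \/
  (exists l : R, [/\ l \is 1.-homog, l != 0 & forall f, J 2 f <-> flag_ker (flagC l 0) 3 f]).
Proof.
move=> m1; have m0 : (0 < m)%N by apply: ltnW.
have mod2 f : flag_ker (flagA (0 : R) 1) 2 f -> J 2 (f - (iz (cf 2 0 f) * x ^+ 2 + iz (cf 0 1 f) * y)).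
  move=> kf; have H := @Jle 2 3 _ isT (adapted_modulo f).
  have k0 : cf 0 0 f = 0 := kf 0%N isT; have k1 : cf 1 0 f = 0 := kf 1%N isT.
  rewrite k0 k1 (rmorph0 iz) in H.
  have T : J 2 (iz (cf 3 0 f) * x ^+ 3 + iz (cf 1 1 f) * (x * y)) by apply: JD; apply: JM.
  have := JD H T; congr (J 2 _); cf_ring.
have span f : J 1 f -> exists a1 a2, J 2 (f - (iz a1 * x ^+ 2 + iz a2 * y)).
  by move=> /(adapted1 _ m0)/mod2 H; exists (cf 2 0 f), (cf 0 1 f).
have [F1 [F2 [d1 [d2 [[F10 Fd1 Fd2] dE relF cst]]]]] :=
  presented_pair n2 (ft_presented fJ m1) (x_homog 2) (var_homog _ _) Jx2 Jy span (J0 2) (x_notin m1) (relation_x Jy).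
have char f : J 2 f <-> flag_ker (flagA (0 : R) 1) 2 f /\ cf 2 0 f * F1 + cf 0 1 f * F2 = 0.
  split=> [Jf|[kf E]].
    have kf : flag_ker (flagA (0 : R) 1) 2 f by apply/adapted1/(ft_anti fJ).
    by split=> //; apply/relF; apply/(Jiff (mod2 _ kf)).
  by apply/(Jiff (mod2 _ kf))/relF.
have [F20|F20] := eqVneq F2 0.
  left=> f; rewrite char F20 mulr0 addr0; split=> [[kf /eqP]|kf].
    rewrite mulf_eq0 (negbTE F10) orbF => /eqP c20 [|[|[|//]]] _ //=.
    - exact: (kf 0%N isT).
    - exact: (kf 1%N isT).
  split; first exact: flag_ker_mono kf.
  by have /= -> := kf 2 isT; rewrite mul0r.
right; have d20 : d2 = 0%N by case: cst => [d10|[]//]; case: dE => [/eqP|]; [rewrite (negbTE F20) | lia].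
have d11 : d1 = 1%N by case: dE => [/eqP|]; [rewrite (negbTE F20) | lia].
rewrite d20 in Fd2; rewrite d11 in Fd1; have [u u0 uE] := unit_coefficient Fd2 F20.
exists (- (u%:MP * F1)); split=> [||f].
- by rewrite rpredN -[1%N]add0n; apply: dhomogM => //; apply: const_homog.
- by rewrite oppr_eq0 mulf_neq0 // mpolyC_eq0.
rewrite char addrC uE; split=> [[kf E]|kf].
  case=> [|[|[|//]]] _ //=; [exact: (kf 0%N isT) | exact: (kf 1%N isT) |].
  by rewrite -[RHS]E mulNr opprK mulrAC mulrA.
split; first by case=> [|[|//]] _; [exact: (kf 0%N isT) | exact: (kf 1%N isT)].
by have /= := kf 2 isT; rewrite mulNr opprK => <-; rewrite mulrAC mulrA.
Qed.

(** If y is in J 2, the generators are x^3 and y: F2 = 0 leads to (1), a constant F2 to a quadratic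
    G. Otherwise they are x y and x^2 + l y, both of degree two, so both forms are constants, and
    their quotient gives [a]. *)
Lemma adapted3 : (2 < m)%N ->
  [\/ forall f, J 3 f <-> flag_ker (flagA (0 : R) 1) 4 f,
      exists2 G : R, G \is 2.-homog & forall f, J 3 f <-> flag_ker (flagA 1 (- G)) 4 f |
      exists (l : R) a, [/\ l \is 1.-homog, l != 0 & forall f, J 3 f <-> flag_ker (flagC l a) 4 f]].
Proof.
move=> m3; have m2 : (1 < m)%N by apply: ltnW.
have [J2|[l [l1 l0 J2]]] := adapted2 m2.
  have Jy2' : J 2 y.
    by apply/J2 => -[|[|[|//]]] _ /=; rewrite cf_y1.
  have Jxy3 : J 3 (x * y) by apply: (ft_mul fJ (i := 0) (j := 2)).
  have mod3 f : J 2 f -> J 3 (f - (iz (cf 3 0 f) * x ^+ 3 + iz (cf 0 1 f) * y)).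
    move=> /J2 kf; have H := adapted_modulo f.
    have k0 : cf 0 0 f = 0 := kf 0%N isT; have k1 : cf 1 0 f = 0 := kf 1%N isT.
    have k2 : cf 2 0 f = 0 := kf 2 isT.
    rewrite k0 k1 k2 (rmorph0 iz) in H.
    have T : J 3 (iz (cf 1 1 f) * (x * y)) by apply: JM.
    have := JD H T; congr (J 3 _); cf_ring.
  have span f : J 2 f -> exists a1 a2, J 3 (f - (iz a1 * x ^+ 3 + iz a2 * y)).
    by move=> /mod3 H; exists (cf 3 0 f), (cf 0 1 f).
  have [F1 [F2 [d1 [d2 [[F10 Fd1 Fd2] dE relF cst]]]]] :=
    presented_pair n2 (ft_presented fJ m3) (x_homog 3) (var_homog _ _) Jx3 Jy2' span (J0 3)
      (x_notin m3) (relation_x Jy2').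
  have char f : J 3 f <-> flag_ker (flagA (0 : R) 1) 3 f /\ cf 3 0 f * F1 + cf 0 1 f * F2 = 0.
    split=> [Jf|[/J2 kf E]].
      have Jf2 : J 2 f by apply: (ft_anti fJ).
      split; first exact/J2.
      by apply/relF; apply/(Jiff (mod3 _ Jf2)).
    by apply/(Jiff (mod3 _ kf))/relF.
  have [F20|F20] := eqVneq F2 0.
    constructor 1 => f; rewrite char F20 mulr0 addr0; split=> [[kf /eqP]|kf].
      rewrite mulf_eq0 (negbTE F10) orbF => /eqP c30 [|[|[|[|//]]]] _ /=.
      - exact: (kf 0%N isT).
      - exact: (kf 1%N isT).
      - exact: (kf 2 isT).
      - by rewrite mul0r add0r mul1r.
    split; first exact: flag_ker_mono kf.
    by have /= := kf 3 isT; rewrite mul0r add0r mul1r => ->; rewrite mul0r.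
  have d20 : d2 = 0%N by case: cst => [d10|[]//]; case: dE => [/eqP|]; [rewrite (negbTE F20) | lia].
  have d12 : d1 = 2 by case: dE => [/eqP|]; [rewrite (negbTE F20) | lia].
  rewrite d20 in Fd2; rewrite d12 in Fd1; have [u u0 uE] := unit_coefficient Fd2 F20.
  constructor 2; exists (- (u%:MP * F1)) => [|f].
    by rewrite rpredN; apply: (@dhomogM _ _ _ 0 _ 2) => //; apply: const_homog.
  rewrite char addrC uE; split=> [[kf E]|kf].
    case=> [|[|[|[|//]]]] _ /=; [exact: (kf 0%N isT) | exact: (kf 1%N isT) | exact: (kf 2 isT) |].
    by rewrite -[RHS]E opprK mul1r mulrAC mulrA.
  split; first by case=> [|[|[|//]]] _; [exact: (kf 0%N isT) | exact: (kf 1%N isT) | exact: (kf 2 isT)].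
  by have /= := kf 3 isT; rewrite opprK mul1r => <-; rewrite mulrAC mulrA.
pose P : S := x ^+ 2 + iz l * y.
have JP : J 2 P.
  by apply/J2 => -[|[|[|//]]] _ /=; rewrite /P; row_simp.
have JxP : J 3 (x * P) by apply: (ft_mul fJ (i := 0) (j := 2)).
have Px2 : P \is 2.-homog.
  rewrite /P; apply: rpredD; first exact: x_homog.
  by apply: (dhomogM (d := 1) (e := 1)); [apply: iz_homog | apply: var_homog].
have mod3 f : J 2 f -> J 3 (f - (iz (cf 1 1 f - l * cf 3 0 f) * (x * y) + iz (cf 2 0 f) * P)).
  move=> /J2 kf; have H := adapted_modulo f.
  have k0 : cf 0 0 f = 0 := kf 0%N isT; have k1 : cf 1 0 f = 0 := kf 1%N isT.
  have /= k2 := kf 2 isT; have {}k2 := subr0_eq k2.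
  rewrite k0 k1 k2 (rmorph0 iz) (rmorphM iz) in H.
  have T := JM (iz (cf 3 0 f)) JxP; rewrite (rmorphB iz) (rmorphM iz).
  have := JD H T; congr (J 3 _); rewrite /P /=; cf_ring.
have span f : J 2 f -> exists a1 a2, J 3 (f - (iz a1 * (x * y) + iz a2 * P)).
  by move=> /mod3 H; exists (cf 1 1 f - l * cf 3 0 f), (cf 2 0 f).
(* x y is the generator that is certainly nonzero in the layer: otherwise x^3 = x P - l x y would be
   in J 3. *)
have Kxy : ~ J 3 (x * y).
  move=> Kxy; apply: (x_notin m3); rewrite (_ : x ^+ 3 = x * P - iz l * (x * y)).
    by apply: JB => //; apply: JM.
  by rewrite /P /=; cf_ring.
have relP : exists b a, b != 0 /\ J 3 (iz b * P - iz a * (x * y)).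
  have [b [a [b0 Kab]]] := relation_x JP; exists b, (- (a * l)); split=> //.
  have := JD Kab (JM (iz a) JxP); congr (J 3 _); rewrite (rmorphN iz) (rmorphM iz) /P /=; cf_ring.
have xyh : x * y \is 2.-homog by apply: (xy_homog k n 1 1).
have [F1 [F2 [d1 [d2 [[F10 Fd1 Fd2] dE relF cst]]]]] :=
  presented_pair n2 (ft_presented fJ m3) xyh Px2 Jxy JP span (J0 3) Kxy relP.
have char f : J 3 f <-> flag_ker (flagC l 0) 3 f /\ (cf 1 1 f - l * cf 3 0 f) * F1 + cf 2 0 f * F2 = 0.
  split=> [Jf|[/J2 kf E]].
    have Jf2 : J 2 f by apply: (ft_anti fJ).
    split; first exact/J2.
    by apply/relF; apply/(Jiff (mod3 _ Jf2)).
  by apply/(Jiff (mod3 _ kf))/relF.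
have d10 : d1 = 0%N by case: cst => [//|[F20 d20]]; case: dE => [/eqP|]; [rewrite (negbTE F20) | lia].
rewrite d10 in Fd1; have [u u0 uE] := unit_coefficient Fd1 F10.
have [c cE] : exists c, F2 = c%:MP.
  case: dE => [->|dE]; first by exists 0; rewrite mpolyC0.
  by apply: homog0_const; move: Fd2; have -> : d2 = 0%N by lia.
constructor 3; exists l, (- (u * c)); split=> // f; rewrite char uE cE.
have rowE : cf 1 1 f - l * cf 3 0 f + u%:MP * (cf 2 0 f * c%:MP)
   = cf 1 1 f - (- (u * c))%:MP * cf 2 0 f - l * cf 3 0 f.
  by rewrite mpolyCN mpolyCM mulNr opprK addrAC; congr (_ + _ + _); rewrite mulrA mulrAC.
split=> [[kf E]|kf].
  case=> [|[|[|[|//]]]] _ /=; [exact: (kf 0%N isT) | exact: (kf 1%N isT) | exact: (kf 2 isT) |].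
  by rewrite -rowE.
split; first by case=> [|[|[|//]]] _; [exact: (kf 0%N isT) | exact: (kf 1%N isT) | exact: (kf 2 isT)].
by rewrite rowE; exact: (kf 3 isT).
Qed.

End AdaptedCoordinates.

Section FiltrationLength.
Variables (k : fieldType) (n : nat).
Local Notation R := {mpoly k[n.+1]}.
Local Notation S := {mpoly k[n.+3]}.
Local Notation x := (x k n).
Local Notation y := (y k n).
Local Notation iz := (@in_z k n).
Local Notation IX := (@IX k n).
Local Notation hc := (pihomog mdeg).

Lemma IX_x : IX x. Proof. by apply/IX_P; rewrite -[x]mulr1 cfx. Qed.
Lemma IX_y : IX y. Proof. by apply/IX_P; rewrite -[y]mulr1 cfy. Qed.

Lemma whole_ideal : ideal (@whole S) (@whole S). Proof. by []. Qed.

Variables (J : nat -> S -> Prop) (m : nat).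
Hypotheses (fJ : type_I_filtration J m).

Let iJ j : ideal (@whole S) (J j). Proof. exact: (ft_ideal fJ). Qed.

Lemma ft_not_hloc j f : ~ J j f -> ~ hloc IX (J j) f.
Proof. by move=> nJ [s [d [_ Xs Js]]]; apply: nJ; apply: (ft_primary fJ Xs). Qed.

Lemma strict_witness j : (j < m)%N ->
  exists f d, [/\ f \is d.-homog, J j f & ~ hloc IX (J j.+1) f].
Proof.
move=> jm; have := ft_strict fJ jm; rewrite /incl => /boolp.existsNP[f /boolp.not_implyP[Xf Jf]].
have [d Jd] : exists d, ~ J j.+1 (hc d f).
  by apply: boolp.contrapT => /boolp.forallNP H; apply: Jf; apply: (hom_mem (iJ _)) => d; apply: boolp.contrapT.
exists (hc d f), d; split; [exact: pihomogP | | exact: ft_not_hloc].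
by apply: (pow_filtration fJ); apply: ideal_pow_hom.
Qed.

Lemma unit_witness : exists f d, [/\ f \is d.-homog, @whole S f & ~ hloc IX (J 0) f].
Proof.
exists 1, 0%N; split=> //; first exact: dhomog1.
by apply: ft_not_hloc => /(ft_first fJ); case: (@IX_prime k n).
Qed.

(** The terms of the filtration and the whole ring form a strict chain of m + 1 steps at the generic
    point. *)
Lemma filtration_length I mu : incl I (J m) -> multiplicity I mu -> (m < mu)%N.
Proof.
move=> IJ mI; apply: (multiplicity_chain (b := fun i => if (i <= m)%N then J (m - i)%N else @whole S) mI).
- by move=> i; case: ifP => _; [apply: iJ | apply: whole_ideal].
- by rewrite subn0.
- move=> i; rewrite ltnS => im; rewrite im; case: (leqP i.+1 m) => [lt|//].
  by rewrite -(subnSK lt); apply: (ft_anti fJ).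
- move=> i; rewrite ltnS => im; rewrite im; case: (leqP i.+1 m) => [lt|gt].
    by rewrite -(subnSK lt); apply: strict_witness; lia.
  have E : (m - i)%N = 0%N by apply/eqP; rewrite subn_eq0 -ltnS.
  by rewrite E; apply: unit_witness.
Qed.

Hypothesis no_relation : forall a b : R, J 1 (iz a * x + iz b * y) -> a = 0 /\ b = 0.

Lemma first_term f : J 1 f <-> ideal_pow IX 2 f.
Proof.
split=> [Jf|]; last exact: (pow_filtration fJ).
have f0 : cf 0 0 f = 0 by apply/IX_P/(ft_first fJ)/(ft_anti fJ).
have [f1 [f2 [fE f1E f2E]]] := cf_split f; rewrite f0 (rmorph0 iz) add0r in fE.
have D2 : ideal_pow IX 2 (x * (f1 - iz (cf 0 0 f1)) + y * (f2 - iz (cf 0 0 f2))).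
  have [_ _ pD _] := ideal_pow_ideal k n 2.
  apply: pD; apply: ideal_powS; rewrite ?IX_x ?IX_y //; try exact: IX_x; try exact: IX_y.
    by rewrite -[X in ideal_pow _ _ X]expr1; apply: ideal_pow_exp; apply: IX_sub_cf.
  by rewrite -[X in ideal_pow _ _ X]expr1; apply: ideal_pow_exp; apply: IX_sub_cf.
have [c1 c2] : cf 0 0 f1 = 0 /\ cf 0 0 f2 = 0.
  apply: no_relation; rewrite (_ : _ + _ = f - (x * (f1 - iz (cf 0 0 f1)) + y * (f2 - iz (cf 0 0 f2)))).
    by apply: (idealB (@subring_whole S) (iJ 1)) => //; apply: (pow_filtration fJ).
  by rewrite {1}fE; cf_ring.
by move: D2; rewrite c1 c2 (rmorph0 iz) !subr0 -fE.
Qed.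

(* Above J 1 there are three more steps: J 1 + (x), IX and the whole ring. *)
Lemma long_chain I mu (b0 b1 : S -> Prop) : multiplicity I mu -> ideal (@whole S) b0 -> ideal (@whole S) b1 ->
  incl I b0 -> incl b0 b1 -> incl b1 (J 1) ->
  (exists f d, [/\ f \is d.-homog, b1 f & ~ hloc IX b0 f]) ->
  (exists f d, [/\ f \is d.-homog, J 1 f & ~ hloc IX b1 f]) -> (5 <= mu)%N.
Proof.
move=> mI i0 i1 Ib0 b01 b1J w0 w1; pose b3 := adjoin (@whole S) (J 1) x.
have Kx : ~ J 1 x.
  move=> Jx; have [] := @no_relation 1 0; last by move/eqP; rewrite oner_eq0.
  by rewrite (rmorph0 iz) mul0r addr0 rmorph1 mul1r.
have Xx : J 0 x by apply/(ft_first fJ)/IX_x.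
have Xy : J 0 y by apply/(ft_first fJ)/IX_y.
have b30 : incl b3 (J 0) by apply: adjoin_sub => //; apply: (ft_anti fJ).
have ib3 : ideal (@whole S) b3 by apply: ideal_adjoin_whole.
apply: (multiplicity_chain (b := fun i => match i with
  | 0 => b0 | 1 => b1 | 2 => J 1 | 3 => b3 | 4 => J 0 | _ => @whole S end) mI) => //.
- by move=> [|[|[|[|[|i]]]]].
- move=> [|[|[|[|[|//]]]]] _ //; exact: (incl_adjoin (@subring_whole S)).
move=> [|[|[|[|[|//]]]]] _ //.
- exists x, 1%N; split; [exact: var_homog | exact: (adjoin_self (@subring_whole S)) | exact: ft_not_hloc].
- exists y, 1%N; split=> //; first exact: var_homog.
  move=> [s [d [_ Xs [u [c [Ju _ E]]]]]].
  have [] := @no_relation (- cf 0 0 c) (cf 0 0 s); last by move=> _; apply/eqP; apply: not_IX_cf.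
  rewrite (_ : _ + _ = u + ((c - iz (cf 0 0 c)) * x - (s - iz (cf 0 0 s)) * y)).
    have [_ _ jD _] := iJ 1; apply: jD => //; apply: (idealB (@subring_whole S) (iJ 1));
      by apply: (ft_mul fJ (i := 0) (j := 0)) => //; apply/(ft_first fJ); apply: IX_sub_cf.
  have uE : u = s * y - c * x by rewrite E addrK.
  rewrite uE (rmorphN iz) /=; cf_ring.
- exact: unit_witness.
Qed.

(** For m at least 3, the terms J 3 and J 2 below J 1 would give a chain of five steps. *)
Lemma length_two I mu : incl I (J m) -> multiplicity I mu -> (mu <= 4)%N -> (m <= 2)%N.
Proof.
move=> IJ mI mu4; rewrite leqNgt; apply/negP => m3.
have J3 : incl (J m) (J 3).
  move: (subnK m3) => <-; elim: (m - 3)%N => [//|l IH] f; rewrite addSn => /(ft_anti fJ); exact: IH.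
have := @long_chain I mu (J 3) (J 2) mI (iJ 3) (iJ 2) _ (@ft_anti _ _ _ _ fJ 2) (@ft_anti _ _ _ _ fJ 1) _ _.
rewrite leqNgt ltnS mu4 => H; suff: false by [].
by apply: H; [move=> f /IJ/J3 | apply: strict_witness | apply: strict_witness; apply: ltnW].
Qed.

(** If h1 and h2 were independent modulo J 2, the ideal J 2 + (h1) would lie strictly between J 2
    and J 1, and the chain would have five steps. *)
Lemma rank_one I mu h1 h2 d1 d2 : incl I (J 2) -> multiplicity I mu -> (mu <= 4)%N ->
  h1 \is d1.-homog -> h2 \is d2.-homog -> J 1 h1 -> J 1 h2 -> ~ J 2 h1 ->
  exists b a, b != 0 /\ J 2 (iz b * h2 - iz a * h1).
Proof.
move=> IJ mI mu4 hh1 hh2 J1 J2 Kh1; apply: boolp.contrapT => norel.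
suff : (5 <= mu)%N by lia.
have cut c h : J 1 h -> J 2 ((c - iz (cf 0 0 c)) * h).
  by move=> Jh; apply: (ft_mul fJ (i := 0) (j := 1)) => //; apply/(ft_first fJ); apply: IX_sub_cf.
apply: (@long_chain I mu (J 2) (adjoin (@whole S) (J 2) h1)) => //.
- exact: ideal_adjoin_whole.
- exact: (incl_adjoin (@subring_whole S)).
- by apply: adjoin_sub => //; apply: (ft_anti fJ).
- exists h1, d1; split=> //; [exact: (adjoin_self (@subring_whole S)) | exact: ft_not_hloc].
exists h2, d2; split=> // -[s [d [_ Xs [u [c [Ju _ E]]]]]]; apply: norel.
exists (cf 0 0 s), (cf 0 0 c); split; first exact: not_IX_cf.
rewrite (_ : _ - _ = u + ((c - iz (cf 0 0 c)) * h1 - (s - iz (cf 0 0 s)) * h2)).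
  by have [_ _ jD _] := iJ 2; apply: jD => //; apply: (idealB (@subring_whole S) (iJ 2)); apply: cut.
have uE : u = s * h2 - c * h1 by rewrite E addrK.
rewrite uE; cf_ring.
Qed.

End FiltrationLength.

Lemma sum_ord3 (V : nmodType) (G : 'I_3 -> V) :
  \sum_i G i = G ord0 + G (inord 1) + G (inord 2).
Proof.
rewrite !big_ord_recr big_ord0 /= add0r; congr (G _ + G _ + G _); apply/val_inj => //=;
  by rewrite inordK.
Qed.

Lemma ord3_ind (Q : 'I_3 -> Prop) : Q ord0 -> Q (inord 1) -> Q (inord 2) -> forall i, Q i.
Proof.
move=> Q0 Q1 Q2 [[|[|[|//]]] p]; [move: Q0 | move: Q1 | move: Q2]; congr Q; apply/val_inj => //=;
  by rewrite inordK.
Qed.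

(** * Functionals on quadrics and binary quadratic forms *)

Section Quadrics.
Variables (k : fieldType) (n : nat).
Local Notation R := {mpoly k[n.+1]}.
Local Notation S := {mpoly k[n.+3]}.
Local Notation x := (x k n).
Local Notation y := (y k n).
Local Notation iz := (@in_z k n).
Local Notation IX := (@IX k n).

Lemma flagB_three (F1 F2 F3 : R) f : flag_ker (flagB F1 F2 F3) 3 f <-> ideal_pow IX 2 f.
Proof.
split=> [kf|/ideal_powP o [|[|[|//]]] _ /=]; try exact: o.
apply/ideal_powP => -[|[|a]] [|[|b]] //= _; [exact: (kf 0%N isT) | exact: (kf 2 isT) | exact: (kf 1%N isT)].
Qed.

Definition quadric_form (F1 F2 F3 : R) (f : S) : R := F1 * cf 2 0 f + F2 * cf 1 1 f + F3 * cf 0 2 f.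

Lemma flagB_four (F1 F2 F3 : R) f : flag_ker (flagB F1 F2 F3) 4 f <->
  ideal_pow IX 2 f /\ quadric_form F1 F2 F3 f = 0.
Proof.
rewrite -(flagB_three F1 F2 F3); split=> [kf|[kf Q] [|[|[|[|//]]]] _].
- split; last exact: (kf 3 isT).
  by move=> i i3; apply: kf; apply: ltnW.
- exact: (kf 0%N isT).
- exact: (kf 1%N isT).
- exact: (kf 2 isT).
- exact: Q.
Qed.

Lemma quadric_modulo f : ideal_pow IX 2 f ->
  ideal_pow IX 3 (f - (iz (cf 2 0 f) * x ^+ 2 + iz (cf 1 1 f) * (x * y) + iz (cf 0 2 f) * y ^+ 2)).
Proof.
move=> /ideal_powP o; have [A [B [C [D fE]]]] := cf_expand f.
have H i j h : (3 <= i + j)%N -> ideal_pow IX 3 (x ^+ i * y ^+ j * h) by apply: pow_mem.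
have [_ _ pD _] := ideal_pow_ideal k n 3.
rewrite (_ : _ - _ = x ^+ 3 * y ^+ 0 * (iz (cf 3 0 f) + x * A) + x ^+ 2 * y ^+ 1 * B
   + x ^+ 1 * y ^+ 2 * C + x ^+ 0 * y ^+ 3 * D).
  by apply: (pD); [apply: (pD); [apply: (pD)|]|]; apply: H.
by rewrite {1}fE (o 0%N 0%N isT) (o 1%N 0%N isT) (o 0%N 1%N isT) (rmorph0 iz) !expr0 !expr1; cf_ring.
Qed.

Lemma quadric_formD F1 F2 F3 f g :
  quadric_form F1 F2 F3 (f + g) = quadric_form F1 F2 F3 f + quadric_form F1 F2 F3 g.
Proof. by rewrite /quadric_form !cfD; cf_ring. Qed.

Lemma quadric_formM F1 F2 F3 r f : quadric_form F1 F2 F3 (iz r * f) = r * quadric_form F1 F2 F3 f.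
Proof. by rewrite /quadric_form !cfM; cf_ring. Qed.

Lemma quadric_form_cubic F1 F2 F3 f : ideal_pow IX 3 f -> quadric_form F1 F2 F3 f = 0.
Proof. by move=> /ideal_powP o; rewrite /quadric_form (o 2 0%N isT) (o 1%N 1%N isT) (o 0%N 2 isT) !mulr0 !addr0. Qed.

Lemma quadric_form_mono F1 F2 F3 : [/\ quadric_form F1 F2 F3 (x ^+ 2) = F1,
  quadric_form F1 F2 F3 (x * y) = F2 & quadric_form F1 F2 F3 (y ^+ 2) = F3].
Proof. by split; rewrite /quadric_form; row_simp. Qed.

Lemma quadric_form_lin F1 F2 F3 (a b c d : k) :
  quadric_form F1 F2 F3 (lin_form n a b * lin_form n c d)
  = (a * c)%:MP * F1 + (a * d + b * c)%:MP * F2 + (b * d)%:MP * F3.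
Proof.
have [q1 q2 q3] := quadric_form_mono F1 F2 F3.
have izD (u v : k) : iz (u + v)%:MP = iz u%:MP + iz v%:MP by rewrite mpolyCD rmorphD.
have izM (u v : k) : iz (u * v)%:MP = iz u%:MP * iz v%:MP by rewrite mpolyCM rmorphM.
have -> : lin_form n a b * lin_form n c d =
    iz (a * c)%:MP * x ^+ 2 + iz (a * d + b * c)%:MP * (x * y) + iz (b * d)%:MP * y ^+ 2.
  by rewrite izD !izM /lin_form; cf_ring.
by rewrite !quadric_formD !quadric_formM q1 q2 q3.
Qed.

Lemma quadric_form_sub F1 F2 F3 (phi psi : {rmorphism S -> S}) f :
  coord_change phi psi -> coord_change psi phi ->
  ideal_pow IX 2 f -> quadric_form F1 F2 F3 (phi f) =
  quadric_form (quadric_form F1 F2 F3 (phi x * phi x)) (quadric_form F1 F2 F3 (phi x * phi y))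
    (quadric_form F1 F2 F3 (phi y * phi y)) f.
Proof.
move=> cp cs /quadric_modulo /(ccV_pow cp) /(quadric_form_cubic F1 F2 F3).
set g := _ + _ + _; rewrite rmorphB /= => E.
have -> : quadric_form F1 F2 F3 (phi f) = quadric_form F1 F2 F3 (phi g).
  have := quadric_formD F1 F2 F3 (phi f - phi g) (phi g); rewrite subrK E add0r.
  by [].
rewrite /g !(rmorphD phi) !(rmorphM phi) /= !(cc_z cp) !quadric_formD !quadric_formM.
rewrite [RHS]/quadric_form; move: (quadric_form _ _ _ _) (quadric_form _ _ _ _) (quadric_form _ _ _ _) => u v w.
by cf_ring.
Qed.

End Quadrics.

Section PresentedTriple.
Variables (k : fieldType) (n : nat).
Local Notation R := {mpoly k[n.+1]}.
Local Notation S := {mpoly k[n.+3]}.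
Local Notation x := (x k n).
Local Notation y := (y k n).
Local Notation iz := (@in_z k n).
Local Notation IX := (@IX k n).

Variables (J : nat -> S -> Prop) (m : nat).
Hypotheses (fJ : type_I_filtration J m) (m1 : (1 < m)%N).
Hypothesis no_relation : forall a b : R, J 1 (iz a * x + iz b * y) -> a = 0 /\ b = 0.
Hypothesis rank1 : forall h1 h2 : S, h1 \is 2.-homog -> h2 \is 2.-homog -> J 1 h1 -> J 1 h2 ->
  ~ J 2 h1 -> exists b a, b != 0 /\ J 2 (iz b * h2 - iz a * h1).

(** The generators x^2, x y, y^2 of J 1 / J 2 have equal degree, hence so do the three forms; for n
    at least 3 one of them is constant, and the common degree is zero. *)
Lemma presented_triple : exists s (F1 F2 F3 : R), [/\ [/\ F1 \is s.-homog, F2 \is s.-homog & F3 \is s.-homog],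
  ~ [/\ F1 = 0, F2 = 0 & F3 = 0], (3 <= n)%N -> s = 0%N,
  forall f, J 2 f <-> flag_ker (flagB F1 F2 F3) 4 f &
  ~ (exists P, [/\ proj_point P, P F1, P F2 & P F3])].
Proof.
have iJ j : ideal (@whole S) (J j) := ft_ideal fJ j.
pose h (i : 'I_3) : S := x ^+ (2 - i) * y ^+ i.
have h0 : h ord0 = x ^+ 2 by rewrite /h subn0 expr0 mulr1.
have h1 : h (inord 1) = x * y by rewrite /h inordK // subn1 !expr1.
have h2 : h (inord 2) = y ^+ 2 by rewrite /h inordK // subnn expr0 mul1r.
have hh i : h i \is 2.-homog.
  have := xy_homog k n (2 - i) i; rewrite subnK //; by case: i => [[|[|[|]]]].
have Jh i : J 1 (h i).
  apply/(first_term fJ no_relation); rewrite -[h i]mulr1; apply: pow_mem.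
  by rewrite subnK //; case: i => [[|[|[|]]]].
have sumh (a : 'I_3 -> R) : \sum_i iz (a i) * h i =
    iz (a ord0) * x ^+ 2 + iz (a (inord 1)) * (x * y) + iz (a (inord 2)) * y ^+ 2.
  by rewrite sum_ord3 h0 h1 h2.
have cubes : incl (ideal_pow IX 3) (J 2) by apply: (pow_filtration fJ).
pose coef f (i : 'I_3) : R := cf (2 - i) i f.
have modh f : J 1 f -> J 2 (f - \sum_i iz (coef f i) * h i).
  move=> /(first_term fJ no_relation)/quadric_modulo H; apply: cubes.
  by rewrite sumh /coef !inordK.
have [i0 Ki0] : exists i0, ~ J 2 (h i0).
  apply: boolp.contrapT => H; apply: (ft_strict fJ m1) => f Xf.
  have {}H i : J 2 (h i) by apply: boolp.contrapT => K; apply: H; exists i.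
  have [_ J0 JD JM] := iJ 2; rewrite -[f](subrK (\sum_i iz (coef f i) * h i)).
  apply: (JD); first by apply: modh; apply/(first_term fJ no_relation).
  by apply: big_ind => // i _; apply: JM.
have [f Jf|i|F [d [p [q [gF relF noP]]]]] := ft_presented fJ m1 hh Jh _ Ki0.
- by exists (coef f); apply: modh.
- exact: rank1.
have [Fd Fe F0] := gF.
have Fs i : F i \is (d i0).-homog.
  have [->|E] := Fe i; first exact: dhomog0.
  have [/eqP|E0] := Fe i0; first by rewrite (negbTE F0).
  by have -> : d i0 = d i by lia.
exists (d i0), (F ord0), (F (inord 1)), (F (inord 2)); split=> //.
- move=> [F00 F1 F2]; move/eqP: F0; apply; move: i0 {Ki0 gF Fe Fs}; exact: ord3_ind.
- move=> n3; have [i [Fi di]] := constant_form gF n3 noP.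
  by have := Fd i; rewrite di => Fi0; apply: (dhomog_uniq Fi (Fs i) Fi0).
- move=> f; rewrite flagB_four.
  have E c : \sum_i coef c i * F i = quadric_form (F ord0) (F (inord 1)) (F (inord 2)) c.
    rewrite sum_ord3 /coef !inordK // /quadric_form.
    by rewrite [cf (2 - _) _ _ * _]mulrC [cf (2 - 1) _ _ * _]mulrC [cf (2 - 2) _ _ * _]mulrC.
  split=> [Jf|[/(first_term fJ no_relation) Jf Q]].
    have Jf1 := ft_anti fJ Jf; split; first exact/(first_term fJ no_relation).
    rewrite -E; apply/relF; have := idealB (@subring_whole S) (iJ 2) Jf (modh _ Jf1).
    by rewrite subKr.
  rewrite -[f](subrK (\sum_i iz (coef f i) * h i)); have [_ _ JD _] := iJ 2.
  by apply: JD; [exact: modh | apply/relF; rewrite E].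
- move=> [P [pP P1 P2 P3]]; apply: noP; exists P; split=> //; exact: ord3_ind.
Qed.

End PresentedTriple.

Section QuadricClassification.
Variables (k : closedFieldType) (n : nat).
Local Notation R := {mpoly k[n.+1]}.
Local Notation S := {mpoly k[n.+3]}.
Local Notation x := (x k n).
Local Notation y := (y k n).
Local Notation iz := (@in_z k n).
Local Notation IX := (@IX k n).

Lemma closed_sqrt (v : k) : exists t, t ^+ 2 = v.
Proof.
have [t tE] := @solve_monicpoly k 2 (fun i => if i == 0%N then v else 0) isT.
by exists t; rewrite tE big_ord_recl big_ord1 /= mul0r addr0 expr0 mulr1.
Qed.

Lemma flagB_scale (u : k) (F1 F2 F3 : R) : u != 0 ->
  flag_ker (flagB (u%:MP * F1) (u%:MP * F2) (u%:MP * F3)) 4 = flag_ker (flagB F1 F2 F3) 4.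
Proof.
move=> u0; apply: predext => f; rewrite !flagB_four /quadric_form -!mulrA -!mulrDr.
split=> -[Xf /eqP H]; split=> //; last by rewrite (eqP H) mulr0.
by move: H; rewrite mulf_eq0 mpolyC_eq0 (negbTE u0) => /eqP.
Qed.

Lemma flagB_pullback (F1 F2 F3 G1 G2 G3 : R) (phi psi : {rmorphism S -> S}) (f : S) :
  coord_change phi psi -> coord_change psi phi -> quadric_form F1 F2 F3 (phi x * phi x) = G1 ->
  quadric_form F1 F2 F3 (phi x * phi y) = G2 -> quadric_form F1 F2 F3 (phi y * phi y) = G3 ->
  flag_ker (flagB G1 G2 G3) 4 f <-> flag_ker (flagB F1 F2 F3) 4 (phi f).
Proof.
move=> cp cs <- <- <-; have pow2 : ideal_pow IX 2 (phi f) <-> ideal_pow IX 2 f.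
  split=> Xf; last exact: (ccV_pow cp Xf).
  by have := ccV_pow cs Xf; rewrite (cc_K cp f).
have Q := @quadric_form_sub k n F1 F2 F3 phi psi f cp cs.
apply: iff_trans (flagB_four _ _ _ _) _; apply: iff_trans (iff_sym (flagB_four _ _ _ _)).
split=> -[Xf H].
  by split; [exact/pow2 | rewrite (Q Xf)].
have {}Xf := pow2.1 Xf; split; [exact: Xf | exact: (etrans (esym (Q Xf)) H)].
Qed.

(** The functional is a symmetric bilinear form on the linear forms in x and y, with a, b, c its
    values on (x, x), (x, y), (y, y); the new entries are its values in the new basis. *)
Lemma quadric_change (a b c al be ga de : k) : al * de - be * ga != 0 ->
  lin_equiv (flag_ker (flagB (a%:MP : R) b%:MP c%:MP) 4)
    (flag_ker (flagB ((al * al * a + (al * be + be * al) * b + be * be * c)%:MP : R)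
      (al * ga * a + (al * de + be * ga) * b + be * de * c)%:MP
      (ga * ga * a + (ga * de + de * ga) * b + de * de * c)%:MP) 4).
Proof.
move=> dl0; have [phi [psi [cp cs xE yE [M uM ME]]]] := coord_change_exists n dl0.
exists M; first exact: uM.
move=> f; have E : f \mPo [tuple \sum_(j < n.+3) M i j *: 'X_j | i < n.+3] = phi f by rewrite ME.
rewrite E; apply: (flagB_pullback f cp cs).
- by rewrite xE; apply: etrans (quadric_form_lin _ _ _ _ _ _ _) _; rewrite !(mpolyCD, mpolyCM).
- by rewrite xE yE; apply: etrans (quadric_form_lin _ _ _ _ _ _ _) _; rewrite !(mpolyCD, mpolyCM).
- by rewrite yE; apply: etrans (quadric_form_lin _ _ _ _ _ _ _) _; rewrite !(mpolyCD, mpolyCM).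
Qed.

(** If x or y has nonzero square e, it is completed by an orthogonal vector of square 0 or, after
    rescaling, of square - e; this gives (4) and (3). If both squares vanish, the functional is a
    multiple of the one for (2). No step divides by two. *)
Lemma quadric_listed (a b c : k) : ~ [/\ a = 0, b = 0 & c = 0] -> exists2 gens : seq S,
  listed gens & lin_equiv (flag_ker (flagB (a%:MP : R) b%:MP c%:MP) 4) (gen_ideal gens).
Proof.
move=> abc.
have normal (al be ga de e : k) : e != 0 -> al * de - be * ga != 0 ->
    al * al * a + (al * be + be * al) * b + be * be * c = e ->
    al * ga * a + (al * de + be * ga) * b + be * de * c = 0 ->
    ga * ga * a + (ga * de + de * ga) * b + de * de * c = 0 \/
    ga * ga * a + (ga * de + de * ga) * b + de * de * c = - e ->
    exists2 gens : seq S, listed gens & lin_equiv (flag_ker (flagB (a%:MP : R) b%:MP c%:MP) 4) (gen_ideal gens).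
  move=> e0 dl0 E1 E2 E3; have := quadric_change a b c dl0; rewrite E1 E2 mpolyC0.
  case: E3 => -> H.
    exists [:: x ^+ 3; x * y; y ^+ 2]; first exact: Listed4.
    by rewrite kernel4 -(flagB_scale 1 0 0 e0) mulr1 mulr0.
  exists (gens3 k n); first exact: Listed3.
  by rewrite /gens3 kernel3 -(flagB_scale 1 0 (- 1) e0) mulr1 mulr0 mulrN1 -mpolyCN.
(* k is algebraically closed: [t] rescales the orthogonal vector, of square D e up to this factor,
   to square - e. *)
have root (D : k) : D != 0 -> exists t, t != 0 /\ t * t * D = - 1.
  move=> D0; have [t tE] := closed_sqrt (- D^-1); exists t; rewrite -expr2 tE mulNr mulVf //.
  split=> //; apply: contraTneq (oner_neq0 k) => t0; move/eqP: tE.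
  by rewrite t0 expr0n eq_sym oppr_eq0 invr_eq0 (negbTE D0).
have [a0|a0] := eqVneq a 0; last first.
  have [D0|D0] := eqVneq (a * c - b * b) 0.
    apply: (normal 1 0 (- b) a a a0); rewrite ?mul1r ?mul0r ?subr0 //; [by ring | by ring |].
    by left; transitivity (a * (a * c - b * b)); [ring | rewrite D0 mulr0].
  have [t [t0 tE]] := root _ D0.
  apply: (normal 1 0 (- (t * b)) (t * a) a a0); [|by ring | by ring |].
    by rewrite mul1r mul0r subr0 mulf_neq0.
  by right; transitivity (t * t * (a * c - b * b) * a); [ring | rewrite tE mulN1r].
have [c0|c0] := eqVneq c 0; last first.
  have [D0|D0] := eqVneq (a * c - b * b) 0.
    apply: (normal 0 1 c (- b) c c0); [|by ring | by ring |].
      by rewrite mul0r mul1r sub0r oppr_eq0.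
    by left; transitivity (c * (a * c - b * b)); [ring | rewrite D0 mulr0].
  have [t [t0 tE]] := root _ D0.
  apply: (normal 0 1 (t * c) (- (t * b)) c c0); [|by ring | by ring |].
    by rewrite mul0r mul1r sub0r oppr_eq0 mulf_neq0.
  by right; transitivity (t * t * (a * c - b * b) * c); [ring | rewrite tE mulN1r].
have b0 : b != 0 by apply/eqP => b0; apply: abc.
exists (gens2 k n); first exact: Listed2.
rewrite /gens2 kernel2 a0 c0 mpolyC0 -(flagB_scale 0 1 0 b0) mulr0 mulr1.
exact: lin_equiv_refl.
Qed.

End QuadricClassification.

Lemma flagB_listed (k : fieldType) n s (F1 F2 F3 : {mpoly k[n.+1]}) : n = 2 -> (0 < s)%N ->
  F1 \is s.-homog -> F2 \is s.-homog -> F3 \is s.-homog ->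
  ~ (exists P, [/\ proj_point P, P F1, P F2 & P F3]) -> exists2 gens : seq {mpoly k[n.+3]},
  listed gens & lin_equiv (flag_ker (flagB F1 F2 F3) 4) (gen_ideal gens).
Proof.
move=> n2; subst n => s0 h1 h2 h3 noP; rewrite -(kernel5 s0 h1 h2 h3 noP).
by eexists; [apply: (Listed5 _ s0 h1 h2 h3 noP) | apply: lin_equiv_refl].
Qed.

Section Classification.
Variables (k : closedFieldType) (n : nat).
Local Notation R := {mpoly k[n.+1]}.
Local Notation S := {mpoly k[n.+3]}.
Local Notation x := (x k n).
Local Notation y := (y k n).
Local Notation iz := (@in_z k n).
Local Notation IX := (@IX k n).

Lemma linear_form_sub (l : R) : l \is 1.-homog -> l != 0 ->
  exists2 g, g \in unitmx & linear_sub g 'X_ord0 = l.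
Proof.
move=> /dhomogP l1 l0; pose c : 'rV[k]_n.+1 := \row_j l@_U_(j).
have lE : l = \sum_j c ord0 j *: 'X_j.
  apply/mpolyP => m; rewrite raddf_sum /=; have [|nm] := boolP (mdeg m == 1%N).
    move=> /mdeg1P[i /eqP ->]; rewrite (bigD1 i) //= mcoeffZ mcoeffX eqxx mulr1 mxE big1 ?addr0 // => j ji.
    by rewrite mcoeffZ mcoeffX eq_mnm1 (negbTE ji) mulr0.
  rewrite memN_msupp_eq0 ?big1 // => [j _|]; last by apply: contra nm => /l1 /= ->.
  rewrite mcoeffZ mcoeffX; case: eqP => [mE|]; last by rewrite mulr0.
  by rewrite -mE mdeg1 in nm.
have c0 : c != 0.
  apply: contraNneq l0 => c0; rewrite lE c0 big1 // => j _.
  by rewrite mxE scale0r.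
pose u : 'rV[k]_n.+1 := delta_mx 0 0; pose f : 'M[k]_n.+1 := \matrix_(i, j) c ord0 j.
have uf : u *m f = c.
  by rewrite -rowE; apply/rowP => j; rewrite !mxE.
have [g ug gE] : {g | g \in unitmx & u *m f = u *m g}.
  by apply: complete_unitmx; rewrite uf !rank_rV c0 (_ : u != 0) //; apply/eqP => /matrixP/(_ 0 0)/eqP; rewrite !mxE oner_eq0.
exists g => //; rewrite linear_subX lE; apply: eq_bigr => j _.
by rewrite -uf gE -rowE mxE.
Qed.

(** The left side is (8) after replacing y by A y and z_0 by B L; it absorbs the coefficient of x
    y. *)
Lemma gen_ideal_scale (X Y L A B : S) : B * A = 1 ->
  gen_ideal [:: X ^+ 2 + X * (A * Y) + B * L * (A * Y); (A * Y) ^+ 2]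
  = gen_ideal [:: X ^+ 2 + A * (X * Y) + L * Y; Y ^+ 2].
Proof.
move=> BA; have -> : X ^+ 2 + X * (A * Y) + B * L * (A * Y) = X ^+ 2 + A * (X * Y) + L * Y.
  by transitivity (X ^+ 2 + A * (X * Y) + B * A * (L * Y)); [ring | rewrite BA mul1r].
have Y2 : Y ^+ 2 = 0 * (X ^+ 2 + A * (X * Y) + L * Y) + B ^+ 2 * (A * Y) ^+ 2.
  by transitivity ((B * A) ^+ 2 * Y ^+ 2); [rewrite BA expr1n mul1r | ring].
have AY2 : (A * Y) ^+ 2 = 0 * (X ^+ 2 + A * (X * Y) + L * Y) + A ^+ 2 * Y ^+ 2 by ring.
apply: gen_ideal_eq => f; rewrite !inE => /orP[] /eqP ->.
- by apply: gen_ideal_mem; rewrite mem_head.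
- by rewrite [f in gen_ideal _ f]AY2; apply: gen_ideal2.
- by apply: gen_ideal_mem; rewrite mem_head.
- by rewrite [f in gen_ideal _ f]Y2; apply: gen_ideal2.
Qed.

Lemma flagC_listed (l : R) (a : k) : l \is 1.-homog -> l != 0 -> exists2 gens : seq S,
  listed gens & lin_equiv (flag_ker (flagC l a) 4) (gen_ideal gens).
Proof.
move=> l1 l0; rewrite -kernelC //; have [->|a0] := eqVneq a 0.
  have [g ug gE] := linear_form_sub l1 l0.
  exists (gens7 k n); first exact: Listed7.
  have det0 : (1 * 1 - 0 * 0 : k) != 0 by rewrite mul1r mul0r subr0 oner_neq0.
  have := coord_lin_equiv (gens7 k n) ug det0; rewrite lin_form10 lin_form01 {1}/gens7 /=.
  rewrite (rmorphD (coord_sub g x y)) !(rmorphXn (coord_sub g x y)) (rmorphM (coord_sub g x y)) /=.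
  by rewrite coord_sub_x coord_sub_y z0E coord_sub_z gE mpolyC0 (rmorph0 iz) mul0r addr0.
have l1' : (a^-1)%:MP * l \is 1.-homog.
  by rewrite -[1%N]add0n; apply: dhomogM => //; apply: const_homog.
have l0' : (a^-1)%:MP * l != 0 by rewrite mulf_neq0 // mpolyC_eq0 invr_eq0.
have [g ug gE] := linear_form_sub l1' l0'.
exists (gens8 k n); first exact: Listed8.
have det0 : 1 * a - 0 * 0 != 0 by rewrite mul1r mul0r subr0.
have := coord_lin_equiv (gens8 k n) ug det0; rewrite lin_form10 {1}/gens8 /=.
rewrite !(rmorphD (coord_sub g x _)) !(rmorphXn (coord_sub g x _)) !(rmorphM (coord_sub g x _)) /=.
rewrite coord_sub_x coord_sub_y z0E coord_sub_z gE.
have yE : lin_form n 0 a = iz a%:MP * y by rewrite /lin_form mpolyC0 (rmorph0 iz) mul0r add0r.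
have aa : iz (a^-1)%:MP * iz a%:MP = 1 by rewrite -(rmorphM iz) -mpolyCM mulVf // mpolyC1 rmorph1.
by rewrite yE (rmorphM iz) (gen_ideal_scale x y (iz l) aa).
Qed.

Lemma listed_of_pullback (I I' : S -> Prop) (M : 'M_n.+3) (phi : S -> S) : M \in unitmx -> phi =1 linear_sub M ->
  (forall f, I (phi f) <-> I' f) ->
  (exists2 gens : seq S, listed gens & lin_equiv I' (gen_ideal gens)) ->
  exists2 gens : seq S, listed gens & lin_equiv I (gen_ideal gens).
Proof.
move=> uM phiE II' [gens lg I'g]; exists gens => //; apply: lin_equiv_trans I'g.
by exists M => // f; rewrite -II' phiE.
Qed.

Lemma type_I_listed (I : S -> Prop) : (2 <= n)%N -> type_I I -> multiplicity I 4 ->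
  exists2 gens : seq S, listed gens & lin_equiv I (gen_ideal gens).
Proof.
move=> n2 tI mI; have [m [fJ Jm hJ IJ]] := filtration_of_type_I tI.
set J := filtration_ideal I in fJ Jm hJ IJ.
have fA : is_flag 4 (flagA (0 : R) 1) by apply: flagA_flag; left.
have oA : flag_locally_onto 4 (flagA (0 : R) 1) by apply: flagA_onto; left.
have m3 : (m < 4)%N := filtration_length fJ (IJ m) mI.
(* m = 0 would give I = IX, of multiplicity one. The identity substitution makes
   [multiplicity_pullback] applicable. *)
have m0 : (0 < m)%N.
  rewrite lt0n; apply/eqP => m0; have det0 : (1 * 1 - 0 * 0 : k) != 0.
    by rewrite mul1r mul0r subr0 oner_neq0.
  have [phi [psi [cp cs _ _ _]]] := coord_change_exists n det0.
  have H f : I (phi f) <-> flag_ker (flagA (0 : R) 1) 1 f.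
    rewrite -Jm m0 (ft_first fJ); apply: iff_trans (cc_IX cp f) _; apply: iff_trans (IX_P f) _.
    by split=> [f0 [|//] _ //|kf]; apply: (kf 0%N isT).
  by have := multiplicity_pullback cp cs (isT : (0 < 1)%N) (is_flag_le (isT : (1 <= 4)%N) fA)
    (onto_le (isT : (1 <= 4)%N) oA) H mI.
have [rel|norel] := boolp.EM (exists a b : R, (a != 0) || (b != 0) /\ J 1 (iz a * x + iz b * y)).
  have [al [be [ga [de [det0 Jy]]]]] := adapted_exists n2 fJ m0 rel.
  have [phi [psi [cp cs _ yE [M uM ME]]]] := coord_change_exists n det0.
  have fJ' := filtration_pullback cp cs fJ; rewrite -yE in Jy.
  (* With y in J 1, m = 1 and m = 2 would give flags of two and three functionals, against
     multiplicity four. *)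
  have low r c : (0 < r < 4)%N -> is_flag r c -> flag_locally_onto r c ->
      (forall f, J m (phi f) <-> flag_ker c r f) -> False.
    move=> /andP[r0 r4] fc oc H; rewrite /= Jm in H.
    by have E := multiplicity_pullback cp cs r0 fc oc H mI; rewrite -E in r4.
  have [m1|m1] := eqVneq m 1%N.
    case: (low 2 (flagA (0 : R) 1)); rewrite ?m1 //; [exact: is_flag_le fA | exact: onto_le oA |].
    by move=> f; exact: (adapted1 fJ' Jy f m0).
  have [m2|m2] := eqVneq m 2.
    have m1' : (1 < m)%N by lia.
    have [H|[l [l1 l0 H]]] := adapted2 n2 fJ' Jy m1'.
      by case: (low 3 (flagA (0 : R) 1)); rewrite ?m2 //; [exact: is_flag_le fA | exact: onto_le oA].
    case: (low 3 (flagC l 0)); rewrite ?m2 //; first exact: is_flag_le (flagC_flag 0 l1).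
    by apply: onto_le (flagC_onto l 0).
  have m3' : m = 3 by lia.
  apply: (listed_of_pullback uM ME (I' := fun f => J 3 (phi f))) => [f|]; first by rewrite -Jm m3'.
  have lt2 : (2 < m)%N by rewrite m3'.
  have ext (c : nat -> S -> R) : (forall f, J 3 (phi f) <-> flag_ker c 4 f) -> (fun f => J 3 (phi f)) = flag_ker c 4.
    by move=> H; apply: predext.
  have [/ext ->|[G G2 /ext ->]|[l [a [l1 l0 /ext ->]]]] := adapted3 n2 fJ' Jy lt2.
  - exists [:: x ^+ 4; y]; first exact: Listed1.
    by rewrite kernel1; apply: lin_equiv_refl.
  - exists [:: x ^+ 3 + iz G * y; x * y; y ^+ 2]; first exact: Listed6.
    by rewrite (kernel6 G2); apply: lin_equiv_refl.
  - exact: flagC_listed.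
have no_relation (a b : R) : J 1 (iz a * x + iz b * y) -> a = 0 /\ b = 0.
  move=> Jab; apply: boolp.contrapT => ab; apply: norel; exists a, b; split=> //.
  by apply/orP; apply: boolp.contrapT => /boolp.not_orP[/negP/negPn/eqP a0 /negP/negPn/eqP b0]; apply: ab.
(* m = 1 would give I = IX^2, the kernel of the first three functionals of a [flagB], of
   multiplicity three. *)
have m1 : (1 < m)%N.
  rewrite ltn_neqAle m0 andbT eq_sym; apply/eqP => m1.
  have h0 := @dhomog0 n.+1 k mdeg 0; have h1 := @dhomog1 n.+1 k mdeg.
  have fB := flagB_flag h1 h0 h0.
  have oB : flag_locally_onto 4 (flagB (1 : R) 0 0) by apply: flagB_onto_const; exists 1; rewrite ?inE ?eqxx.
  have det0 : (1 * 1 - 0 * 0 : k) != 0 by rewrite mul1r mul0r subr0 oner_neq0.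
  have [phi [psi [cp cs _ _ _]]] := coord_change_exists n det0.
  have H f : I (phi f) <-> flag_ker (flagB (1 : R) 0 0) 3 f.
    rewrite -Jm m1; apply: iff_trans (first_term fJ no_relation (phi f)) _.
    apply: iff_trans (iff_sym (flagB_three _ _ _ f)); split=> Xf; last exact: (ccV_pow cp Xf).
    by have := ccV_pow cs Xf; rewrite (cc_K cp f).
  by have := multiplicity_pullback cp cs (isT : (0 < 3)%N)
    (is_flag_le (isT : (3 <= 4)%N) fB) (onto_le (isT : (3 <= 4)%N) oB) H mI.
have m2 : m = 2 by have := length_two fJ no_relation (IJ m) mI (leqnn 4); lia.
have [s [F1 [F2 [F3 [[hF1 hF2 hF3] F0 n3 JE noP]]]]] := presented_triple fJ m1 no_relation
  (fun h1 h2 H1 H2 => rank_one fJ no_relation (IJ 2) mI (leqnn 4) H1 H2).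
have IE : I = flag_ker (flagB F1 F2 F3) 4 by apply: predext => f; rewrite -JE -Jm m2.
have [s0|s0] := posnP s.
  move: hF1 hF2 hF3; rewrite s0 => /homog0_const[a aE] /homog0_const[b bE] /homog0_const[c cE].
  rewrite IE aE bE cE; apply: quadric_listed => -[a0 b0 c0]; apply: F0.
  by rewrite aE bE cE a0 b0 c0 !mpolyC0.
have n_eq2 : n = 2 by apply/eqP; rewrite eqn_leq n2 andbT leqNgt; apply/negP => /n3 s00; rewrite s00 in s0.
rewrite IE; exact: (flagB_listed n_eq2 s0 hF1 hF2 hF3 noP).
Qed.

End Classification.

Theorem theorem3p8 (k : closedFieldType) (n : nat) (hn : (2 <= n)%N) :
  [/\ (forall I : {mpoly k[n.+3]} -> Prop,
         type_I I -> multiplicity I 4 ->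
         exists2 gens : seq {mpoly k[n.+3]},
           listed gens & lin_equiv I (gen_ideal gens)),
      (forall gens : seq {mpoly k[n.+3]}, listed gens ->
         type_I (gen_ideal gens) /\ multiplicity (gen_ideal gens) 4) &
      (2%N \notin [pchar k] ->
         lin_equiv (gen_ideal (gens2 k n)) (gen_ideal (gens3 k n)) /\
         lin_equiv (gen_ideal (gens7 k n)) (gen_ideal (gens8 k n)))].

Proof.
split=> [I tI mI|gens|ch].
- exact: type_I_listed.
- exact: listed_type_I.
- by split; [apply: lin_equiv23 | apply: lin_equiv78].
Qed.
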